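(* For every integer $n \geq 62$, $$\left|\begin{array}{ccc} \Delta\bar{p}(n+2) & \Delta\bar{p}(n+3) & \Delta\bar{p}(n+4)\\ \Delta\bar{p}(n+1) & \Delta\bar{p}(n+2) & \Delta\bar{p}(n+3)\\ \Delta\bar{p}(n) & \Delta\bar{p}(n+1) & \Delta\bar{p}(n+2) \end{array} \right|>0,$$ where $|\cdot|$ denotes the determinant, $\bar{p}(n)$ is the number of overpartitions of $n$ and $\Delta \bar{p}(n)=\bar{p}(n+1)-\bar{p}(n)$.
   Context: A partition of a positive integer $n$ is a non-increasing sequence of positive integers with sum $n$. An overpartition of $n$ is a partition of $n$ in which the first occurrence of each distinct part may (or may not) be overlined; $\bar{p}(n)$ denotes the number of overpartitions of $n$. The first-order forward difference of a sequence $f(n)$ is $\Delta f(n)=f(n+1)-f(n)$. *)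

(* Defs.v *)
From HB Require Import structures.
From mathcomp Require Import all_boot all_order all_algebra.

Set Implicit Arguments.
Unset Strict Implicit.
Unset Printing Implicit Defensive.

Import Order.TTheory GRing.Theory Num.Theory.

(* A pair (k, b) stands for a part of size k, overlined iff b = true. *)
Definition parts (s : seq (nat * bool)) : seq nat := [seq x.1 | x <- s].

Definition is_partition (n : nat) (s : seq nat) : bool :=
  [&& sorted geq s, all (fun k => 0 < k) s & sumn s == n].

(* An overlined entry must be the first occurrence of its part. *)
Definition overlines_first (s : seq (nat * bool)) : bool :=
  all (fun i => (nth (0, false) s i).2 ==>
                ((nth (0, false) s i).1 \notin take i (parts s)))
      (iota 0 (size s)).

Definition is_overpartition (n : nat) (s : seq (nat * bool)) : bool :=
  is_partition n (parts s) && overlines_first s.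

Definition forget_bound (n : nat) (t : n.-bseq ('I_n.+1 * bool)) :
    seq (nat * bool) := [seq (val x.1, x.2) | x <- t].

(* An overpartition of n has at most n parts, each at most n, so the finite type
   n.-bseq ('I_n.+1 * bool) leaves none out: see overpartition_countP. *)
Definition overpartition_count (n : nat) : nat :=
  #|[set t : n.-bseq ('I_n.+1 * bool) | is_overpartition n (forget_bound t)]|.

Lemma forget_bound_inj n : injective (@forget_bound n).
Proof.
move=> t1 t2 e; apply: val_inj; move: e; apply: inj_map.
by case=> [a b] [c d] /= [/val_inj -> ->].
Qed.

Lemma is_partition_bound n s :
  is_partition n s -> (size s <= n) && all (fun k => k <= n) s.
Proof.
case/and3P=> _ + /eqP <-; elim: s => //= k s IHs /andP[k0 /IHs /andP[sz le]].
rewrite leq_addr -add1n leq_add //=.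
by apply: sub_all le => j /leq_trans; apply; rewrite leq_addl.
Qed.

Lemma overpartition_countP (n : nat) :
  exists e : seq (seq (nat * bool)),
    [/\ uniq e, forall s, (s \in e) = is_overpartition n s
      & size e = overpartition_count n].
Proof.
pose A := [set t : n.-bseq ('I_n.+1 * bool) |
             is_overpartition n (forget_bound t)].
exists [seq forget_bound t | t <- enum A]; split.
- by rewrite map_inj_uniq ?enum_uniq //; apply: forget_bound_inj.
- move=> s; apply/mapP/idP => [[t] | ov]; first by rewrite mem_enum inE => + ->.
  have /andP[/is_partition_bound /andP[]] := ov.
  rewrite size_map all_map => sz le _.
  pose u := [seq (inord x.1 : 'I_n.+1, x.2) | x <- s].
  have szu : size u <= n by rewrite size_map.
  have e : s = forget_bound (Bseq szu).
    rewrite /forget_bound /= -map_comp -[LHS]map_id; apply/eq_in_map=> -[k b].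
    by move/(allP le) => /= kn; rewrite inordK.
  by exists (Bseq szu) => //; rewrite mem_enum inE -e.
- by rewrite size_map -cardE.
Qed.

Definition fwd_diff (f : nat -> int) (n : nat) : int := (f n.+1 - f n)%R.

Definition pbar (n : nat) : int := Posz (overpartition_count n).

(* Main.v *)
(* For n >= 1500 the determinant is controlled by a circle method. Let
   P(tau) = prod (1 + q^j) / (1 - q^j) with q = e^(-tau) be the generating function of
   pbar. Its logarithmic derivative is a Lambert series; summing the double series
   sum 1 / ((2k+1) tau + 2 pi i l)^2 in the other order (with an Eisenstein correction)
   shows that this derivative is -(pi^2 / (4 tau^2) - 1 / (2 tau)) up to an exponentially small error, and
   the polar series L(tau) = sum_k f_k tau^(-k) with coefficients
   f_k = pi^(2k+1) k! / (2k+1)! satisfies the same equation up to a tiny forcing term.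
   Integrating along the vertical line Re tau = t gives P = kappa L on the major arc, an elementary
   product estimate makes both small on the minor arc, and by Lipschitz summation L is
   close to the power series in q whose m-th coefficient is the derivative of
   sinh(pi sqrt x) / sqrt x at x = m. Cauchy's estimate then compares pbar(m) / kappa with this
   elementary function.

   The 3 x 3 Toeplitz determinant is unchanged when the k-th diagonal is multiplied by
   e^(-rk). After the tilt r = pi / (2 sqrt x) the differences vary slowly: with second differences
   s1 (step 1), s2 (step 2) and central value c,
     c * det = (w c - s1 u)^2 + (c (s2 - 4 s1) - s1^2) (u^2 - s2 c / 4),
   so positivity follows from s2 < 0 and from a fourth difference s2 - 4 s1 larger than s1^2 / c;
   both are read off the second and fourth derivatives of the tilted main term.

   For n < 1500 the values pbar(n) are computed by Gauss's recurrence
   pbar(n) = 2 sum_(s >= 1) (-1)^(s+1) pbar(n - s^2). *)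
From Stdlib Require Import Reals Lra Lia Psatz ZArith.
From Coquelicot Require Import Coquelicot.

(** * Real series: partial sums, domination and Fubini *)

Open Scope R_scope.

(** The product and the polar series are only used truncated at some K; the arc estimates hold for
    all large K with bounds independent of K. This avoids infinite products, and for K >= n the n-th
    coefficient of the truncated product is already pbar(n). The obstacle is cancellation: with v =
    x^(-1/2), a tilted difference of the main term has size v^3, a second difference v^6, and the
    fourth difference, on which the sign rests, only v^9, so every entry must be known to within a
    small multiple of v^9. The main term is therefore kept exact up to an exponentially small
    relative error instead of being expanded in powers of v; beyond 1500 even crude arc bounds leave
    enough room. The determinant is homogeneous, so kappa need not be evaluated: it is the ratio of
    product and series at the real point t, which makes their difference vanish there, and only a
    positive lower bound for it is used. Complex functions are differentiated along real lines only:
    integration along the vertical line is a mean value inequality, and Cauchy's estimate is a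
    finite average over roots of unity. *)

Fixpoint rsum (a : nat -> R) (n : nat) : R :=
  match n with O => 0 | S m => rsum a m + a m end.

Lemma rsum_sum_n a n : sum_n a n = rsum a (S n).
Proof.
induction n as [|n IH].
- rewrite sum_O. symmetry; apply Rplus_0_l.
- rewrite sum_Sn, IH. reflexivity.
Qed.

Lemma rsum_ext a b n : (forall k, (k < n)%nat -> a k = b k) -> rsum a n = rsum b n.
Proof.
induction n as [|n IH]; intros H; simpl; [easy|].
rewrite IH, H; auto with arith.
Qed.

Lemma rsum_le a b n : (forall k, (k < n)%nat -> a k <= b k) -> rsum a n <= rsum b n.
Proof.
induction n as [|n IH]; intros H; simpl; [lra|].
apply Rplus_le_compat; auto with arith.
Qed.

Lemma rsum_ge0 a n : (forall k, 0 <= a k) -> 0 <= rsum a n.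
Proof. intros H; induction n; simpl; [lra|]. specialize (H n); lra. Qed.

Lemma rsum_mono a m n : (forall k, 0 <= a k) -> (m <= n)%nat -> rsum a m <= rsum a n.
Proof.
intros H Hmn; induction Hmn; [lra|]. simpl. specialize (H m0); lra.
Qed.

Lemma rsum_scal c a n : rsum (fun k => c * a k) n = c * rsum a n.
Proof. induction n; simpl; [ring|]. rewrite IHn; ring. Qed.

Lemma rsum_plus a b n : rsum (fun k => a k + b k) n = rsum a n + rsum b n.
Proof. induction n; simpl; [ring|]. rewrite IHn; ring. Qed.

Lemma rsum_const c n : rsum (fun _ => c) n = INR n * c.
Proof. induction n; [simpl; ring|]. rewrite S_INR; simpl rsum. rewrite IHn; ring. Qed.

Lemma is_series_rsum a l : is_series a l <-> is_lim_seq (rsum a) l.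
Proof.
rewrite (is_lim_seq_incr_1 (rsum a)). unfold is_series. split; intros H.
- apply (is_lim_seq_ext (sum_n a)); [intros; apply rsum_sum_n | exact H].
- assert (H' : is_lim_seq (sum_n a) l).
  { apply (is_lim_seq_ext (fun n => rsum a (S n))); [|exact H].
    intros; symmetry; apply rsum_sum_n. }
  exact H'.
Qed.

Lemma rsum_lim a : ex_series a -> is_lim_seq (rsum a) (Series a).
Proof. intros H. apply is_series_rsum, Series_correct, H. Qed.

Lemma rsum_tail a N : ex_series a -> Series a = rsum a N + Series (fun k => a (N + k)%nat).
Proof.
intros H. destruct N; [simpl; rewrite Rplus_0_l; reflexivity|].
rewrite (Series_incr_n a (S N)) by (auto with arith; lia).
f_equal. rewrite <- sum_n_Reals. apply rsum_sum_n.
Qed.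

Lemma Series_ge0 a : (forall k, 0 <= a k) -> ex_series a -> 0 <= Series a.
Proof.
intros H E. generalize (Series_le (fun _ => 0) a). intros L.
replace 0 with (Series (fun _ => 0)).
- apply L; [intros n; split; [lra|apply H] | exact E].
- apply is_series_unique. apply is_series_rsum.
  apply (is_lim_seq_ext (fun _ => 0)); [|apply is_lim_seq_const].
  intros n; rewrite rsum_const; ring.
Qed.

Lemma rsum_le_Series a N : (forall k, 0 <= a k) -> ex_series a -> rsum a N <= Series a.
Proof.
intros H E. rewrite (rsum_tail a N E).
assert (0 <= Series (fun k => a (N + k)%nat)).
{ apply Series_ge0; [intros; apply H|]. apply ex_series_incr_n, E. }
lra.
Qed.

Lemma term_le_Series a n : (forall k, 0 <= a k) -> ex_series a -> a n <= Series a.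
Proof.
intros H E. apply Rle_trans with (rsum a (S n)); [|apply rsum_le_Series; auto].
simpl. generalize (rsum_ge0 a n H); lra.
Qed.

Lemma bounded_ex_series a M : (forall k, 0 <= a k) -> (forall n, rsum a n <= M) ->
  ex_series a /\ Series a <= M.
Proof.
intros H B.
assert (F : ex_finite_lim_seq (rsum a)).
{ apply ex_finite_lim_seq_incr with M; auto. intros n; simpl. specialize (H n); lra. }
destruct F as [l Hl].
assert (S : is_series a l) by now apply is_series_rsum.
split; [now exists l|].
rewrite (is_series_unique _ _ S).
apply (is_lim_seq_le (rsum a) (fun _ => M) l M B Hl (is_lim_seq_const M)).
Qed.

Lemma ex_series_dom (a b : nat -> R) : (forall n, 0 <= a n <= b n) -> ex_series b -> ex_series a.
Proof.
intros H E. apply (ex_series_le (V := R_CompleteNormedModule) a b); auto.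
intros n. destruct (H n). change (Rabs (a n) <= b n). rewrite Rabs_pos_eq; lra.
Qed.

Lemma ex_series_scalR (c : R) (a : nat -> R) : ex_series a -> ex_series (fun n => c * a n).
Proof. exact (ex_series_scal_l (V := R_NormedModule) c a). Qed.

Lemma ex_series_plusR (a b : nat -> R) : ex_series a -> ex_series b -> ex_series (fun n => a n + b n).
Proof. exact (ex_series_plus (V := R_NormedModule) a b). Qed.

Lemma Series_rsum_swap (a : nat -> nat -> R) J : (forall j, ex_series (fun i => a i j)) ->
  ex_series (fun i => rsum (a i) J) /\
  rsum (fun j => Series (fun i => a i j)) J = Series (fun i => rsum (a i) J).
Proof.
intros H. induction J as [|J [IH1 IH2]]; simpl.
- assert (Z : is_series (fun _ : nat => 0) 0).
  { apply is_series_rsum. apply (is_lim_seq_ext (fun _ => 0)); [|apply is_lim_seq_const].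
    intros; rewrite rsum_const; ring. }
  split; [now exists 0 | symmetry; now apply is_series_unique].
- split; [apply (ex_series_plus _ _ IH1 (H J))|].
  rewrite IH2. symmetry. apply Series_plus; auto.
Qed.

(** Finite sums over j commute with [Series] in i and stay below the full iterated sum; bounded
    partial sums then give convergence. Only an inequality results, but the transposed family gives
    the reverse one. *)
Lemma fubini_pos_aux (a : nat -> nat -> R) : (forall i j, 0 <= a i j) ->
  (forall i, ex_series (a i)) -> ex_series (fun i => Series (a i)) ->
  (forall j, ex_series (fun i => a i j)) /\
  ex_series (fun j => Series (fun i => a i j)) /\
  Series (fun j => Series (fun i => a i j)) <= Series (fun i => Series (a i)).
Proof.
intros P E1 E2.
assert (E3 : forall j, ex_series (fun i => a i j)).
{ intros j. apply (ex_series_dom _ (fun i => Series (a i))); auto.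
  intros n; split; [apply P|]. apply term_le_Series; auto. }
split; [exact E3|].
apply bounded_ex_series.
- intros j. apply Series_ge0; auto.
- intros J. destruct (Series_rsum_swap a J E3) as [E4 ->].
  apply Series_le; auto. intros i; split.
  + apply rsum_ge0; auto.
  + apply rsum_le_Series; auto.
Qed.

Lemma fubini_pos (a : nat -> nat -> R) : (forall i j, 0 <= a i j) ->
  (forall i, ex_series (a i)) -> ex_series (fun i => Series (a i)) ->
  (forall j, ex_series (fun i => a i j)) /\
  ex_series (fun j => Series (fun i => a i j)) /\
  Series (fun j => Series (fun i => a i j)) = Series (fun i => Series (a i)).
Proof.
intros P E1 E2.
destruct (fubini_pos_aux a P E1 E2) as (H1 & H2 & H3).
repeat split; auto.
apply Rle_antisym; auto.
destruct (fubini_pos_aux (fun j i => a i j)) as (_ & _ & K); auto.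
Qed.

(** A signed family is the difference of the nonnegative families [b] and [b - a], and both are
    summable because [b - a] is at most [2 * b]. *)
Lemma fubini_abs (a b : nat -> nat -> R) : (forall i j, Rabs (a i j) <= b i j) ->
  (forall i, ex_series (b i)) -> ex_series (fun i => Series (b i)) ->
  Series (fun j => Series (fun i => a i j)) = Series (fun i => Series (a i)).
Proof.
intros D E1 E2.
pose (u := fun i j => b i j - a i j).
assert (Pb : forall i j, 0 <= b i j) by (intros i j; generalize (D i j) (Rabs_pos (a i j)); lra).
assert (Pu : forall i j, 0 <= u i j <= 2 * b i j).
{ intros i j; unfold u. generalize (D i j); unfold Rabs; destruct Rcase_abs; lra. }
assert (E3 : forall i, ex_series (fun j => 2 * b i j)) by (intros; apply (ex_series_scalR 2); auto).
assert (Eu : forall i, ex_series (u i)) by (intros i; apply (ex_series_dom _ (fun j => 2 * b i j)); auto).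
assert (Eu2 : ex_series (fun i => Series (u i))).
{ apply (ex_series_dom _ (fun i => 2 * Series (b i))); [|apply (ex_series_scalR 2); auto].
  intros i; split; [apply Series_ge0; auto; intros; apply Pu|].
  rewrite <- Series_scal_l. apply Series_le; auto. }
destruct (fubini_pos b Pb E1 E2) as (B1 & B2 & B3).
destruct (fubini_pos u (fun i j => proj1 (Pu i j)) Eu Eu2) as (U1 & U2 & U3).
transitivity (Series (fun j => Series (fun i => b i j) - Series (fun i => u i j))).
- apply Series_ext; intros j. rewrite <- Series_minus; auto.
  apply Series_ext; intros i; unfold u; ring.
- rewrite Series_minus; auto. rewrite B3, U3, <- Series_minus; auto.
  apply Series_ext; intros i. rewrite <- Series_minus; auto.
  apply Series_ext; intros j; unfold u; ring.
Qed.

(** * Absolutely convergent complex series *)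

Open Scope C_scope.

Lemma C_eq (x y : C) : Re x = Re y -> Im x = Im y -> x = y.
Proof. destruct x, y; simpl; intros; subst; reflexivity. Qed.

Lemma Re_plus x y : Re (x + y) = (Re x + Re y)%R. Proof. reflexivity. Qed.
Lemma Im_plus x y : Im (x + y) = (Im x + Im y)%R. Proof. reflexivity. Qed.

Lemma im_le_Cmod (c : C) : (Rabs (Im c) <= Cmod c)%R.
Proof. apply Rle_trans with (2 := Rmax_Cmod c). apply Rmax_r. Qed.

(** Summed componentwise with the total real [Series], whose value says nothing without convergence;
    hence the [cabs] hypotheses in most of the rules below. *)
Definition csum (a : nat -> C) : C :=
  (Series (fun n => Re (a n)), Series (fun n => Im (a n))).
Definition cabs (a : nat -> C) : Prop := ex_series (fun n => Cmod (a n)).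

Lemma cabs_dom (a : nat -> C) (b : nat -> R) :
  (forall n, (Cmod (a n) <= b n)%R) -> ex_series b -> cabs a.
Proof. intros H E. apply (ex_series_dom _ b); auto. intros; split; auto using Cmod_ge_0. Qed.

Lemma cabs_Re a : cabs a -> ex_series (fun n => Re (a n)).
Proof.
intros E. apply (ex_series_le (V := R_CompleteNormedModule) _ (fun n => Cmod (a n))); auto.
intros n. apply re_le_Cmod.
Qed.
Lemma cabs_Im a : cabs a -> ex_series (fun n => Im (a n)).
Proof.
intros E. apply (ex_series_le (V := R_CompleteNormedModule) _ (fun n => Cmod (a n))); auto.
intros n. apply im_le_Cmod.
Qed.

Lemma csum_ext a b : (forall n, a n = b n) -> csum a = csum b.
Proof. intros H; unfold csum; f_equal; apply Series_ext; intros; now rewrite H. Qed.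

Lemma cabs_ext a b : (forall n, a n = b n) -> cabs a -> cabs b.
Proof. intros H; apply ex_series_ext; intros; now rewrite H. Qed.

Lemma cabs_plus a b : cabs a -> cabs b -> cabs (fun n => a n + b n).
Proof.
intros Ea Eb. apply (cabs_dom _ (fun n => Cmod (a n) + Cmod (b n))%R).
- intros; apply Cmod_triangle.
- apply (ex_series_plusR _ _ Ea Eb).
Qed.

Lemma cabs_scal c a : cabs a -> cabs (fun n => c * a n).
Proof.
intros Ea. apply (cabs_dom _ (fun n => Cmod c * Cmod (a n))%R).
- intros; rewrite Cmod_mult; lra.
- apply ex_series_scalR, Ea.
Qed.

Lemma cabs_opp a : cabs a -> cabs (fun n => - a n).
Proof. apply ex_series_ext; intros; now rewrite Cmod_opp. Qed.

Lemma csum_plus a b : cabs a -> cabs b -> csum (fun n => a n + b n) = csum a + csum b.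
Proof.
intros Ea Eb. unfold csum; apply C_eq; simpl; apply Series_plus; auto using cabs_Re, cabs_Im.
Qed.

Lemma csum_opp a : csum (fun n => - a n) = - csum a.
Proof. apply C_eq; simpl; apply Series_opp. Qed.

Lemma csum_minus a b : cabs a -> cabs b -> csum (fun n => a n - b n) = csum a - csum b.
Proof.
intros Ea Eb. unfold Cminus. rewrite csum_plus; auto using cabs_opp. now rewrite csum_opp.
Qed.

Lemma csum_scal c a : cabs a -> csum (fun n => c * a n) = c * csum a.
Proof.
intros Ea. destruct c as [c d]. apply C_eq; simpl.
- rewrite Series_minus, !Series_scal_l; auto; apply ex_series_scalR; auto using cabs_Re, cabs_Im.
- rewrite Series_plus, !Series_scal_l; auto; apply ex_series_scalR; auto using cabs_Re, cabs_Im.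
Qed.


(** Projection on the direction of the sum z: |z|^2 is the series of the real parts of conj(z) a_n,
    each at most |z| |a_n|. Estimating real and imaginary parts separately would lose a constant
    factor. *)
Lemma Cmod_csum a : cabs a -> (Cmod (csum a) <= Series (fun n => Cmod (a n)))%R.
Proof.
intros Ea.
set (z := csum a).
assert (Z0 : (0 <= Series (fun n => Cmod (a n)))%R) by (apply Series_ge0; auto; intros; apply Cmod_ge_0).
destruct (Req_dec (Cmod z) 0) as [Z|Z]; [rewrite Z; auto|].
assert (Zp : (0 < Cmod z)%R) by (generalize (Cmod_ge_0 z); lra).
apply Rmult_le_reg_l with (Cmod z); auto.
assert (E : (Cmod z * Cmod z = Series (fun n => Re (Cconj z * a n)))%R).
{ transitivity (Re (Cconj z * z)).
  - replace (Cmod z * Cmod z)%R with (Cmod z ^ 2)%R by ring. rewrite Cmod2_alt. simpl. ring.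
  - unfold z at 2. rewrite <- csum_scal; auto. }
rewrite E, <- Series_scal_l.
assert (Eb := cabs_scal (Cconj z) a Ea).
apply Rle_trans with (1 := Rle_abs _).
apply Rle_trans with (Series (fun n => Rabs (Re (Cconj z * a n)))).
- apply Series_Rabs. apply (ex_series_dom _ (fun n => Cmod (Cconj z * a n))); auto.
  intros; split; [apply Rabs_pos|apply re_le_Cmod].
- apply Series_le.
  + intros; split; [apply Rabs_pos|]. apply Rle_trans with (1 := re_le_Cmod _).
    rewrite Cmod_mult, Cmod_conj; lra.
  + apply ex_series_scalR; auto.
Qed.

Lemma Cmod_csum_le a b : (forall n, (Cmod (a n) <= b n)%R) -> ex_series b ->
  (Cmod (csum a) <= Series b)%R.
Proof.
intros H E. apply Rle_trans with (1 := Cmod_csum a (cabs_dom _ _ H E)).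
apply Series_le; auto. intros; split; auto using Cmod_ge_0.
Qed.

Fixpoint csumn (a : nat -> C) (n : nat) : C :=
  match n with O => 0 | S m => csumn a m + a m end.

Lemma csumn_Re a n : Re (csumn a n) = rsum (fun k => Re (a k)) n.
Proof. induction n; simpl; [easy|]. now rewrite <- IHn. Qed.
Lemma csumn_Im a n : Im (csumn a n) = rsum (fun k => Im (a k)) n.
Proof. induction n; simpl; [easy|]. now rewrite <- IHn. Qed.

Lemma csumn_ext a b n : (forall k, (k < n)%nat -> a k = b k) -> csumn a n = csumn b n.
Proof.
induction n as [|n IH]; intros H; simpl; [easy|]. rewrite IH, H; auto with arith.
Qed.

Lemma csumn_plus a b n : csumn (fun k => a k + b k) n = csumn a n + csumn b n.
Proof. induction n; simpl; [ring|]. rewrite IHn; ring. Qed.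

Lemma csumn_scal c a n : csumn (fun k => c * a k) n = c * csumn a n.
Proof. induction n; simpl; [ring|]. rewrite IHn; ring. Qed.

Lemma csumn_swap (a : nat -> nat -> C) m n :
  csumn (fun i => csumn (a i) n) m = csumn (fun j => csumn (fun i => a i j) m) n.
Proof.
induction m; simpl.
- induction n; simpl; [easy|]. rewrite <- IHn; ring.
- rewrite IHm, <- csumn_plus. reflexivity.
Qed.

Lemma Cmod_csumn a n : (Cmod (csumn a n) <= rsum (fun k => Cmod (a k)) n)%R.
Proof.
induction n; simpl; [rewrite Cmod_0; lra|].
apply Rle_trans with (1 := Cmod_triangle _ _). lra.
Qed.

Lemma csum_tail a N : cabs a -> csum a = csumn a N + csum (fun k => a (N + k)%nat).
Proof.
intros Ea. apply C_eq.
- rewrite Re_plus, csumn_Re. simpl. apply (rsum_tail (fun n => Re (a n))). auto using cabs_Re.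
- rewrite Im_plus, csumn_Im. simpl. apply (rsum_tail (fun n => Im (a n))). auto using cabs_Im.
Qed.

Lemma cabs_incr a N : cabs a -> cabs (fun k => a (N + k)%nat).
Proof. intros H. apply (ex_series_incr_n (fun n => Cmod (a n)) N), H. Qed.

Definition clim (u : nat -> C) (l : C) : Prop :=
  forall eps, (0 < eps)%R -> exists N, forall n, (N <= n)%nat -> (Cmod (u n - l) < eps)%R.

Lemma clim_unique u l m : clim u l -> clim u m -> l = m.
Proof.
intros H1 H2. destruct (Req_dec (Cmod (l - m)) 0) as [Z|Z].
- apply Cmod_eq_0 in Z. replace l with (l - m + m) by ring. rewrite Z; ring.
- assert (P : (0 < Cmod (l - m) / 2)%R) by (generalize (Cmod_ge_0 (l-m)); lra).
  destruct (H1 _ P) as [N1 K1]. destruct (H2 _ P) as [N2 K2].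
  specialize (K1 (max N1 N2) ltac:(lia)). specialize (K2 (max N1 N2) ltac:(lia)).
  set (x := u (max N1 N2)) in *.
  assert ((Cmod (l - m) <= Cmod (x - l) + Cmod (x - m))%R).
  { replace (l - m) with (- (x - l) + (x - m)) by ring.
    apply Rle_trans with (1 := Cmod_triangle _ _). rewrite Cmod_opp; lra. }
  lra.
Qed.

Lemma Series_tail_small b eps : ex_series b -> (0 < eps)%R ->
  exists N, forall n, (N <= n)%nat -> (Rabs (Series (fun k => b (n + k)%nat)) < eps)%R.
Proof.
intros E He. generalize (rsum_lim b E). intros L.
apply is_lim_seq_spec in L. destruct (L (mkposreal _ He)) as [N HN].
exists N. intros n Hn. specialize (HN n Hn). simpl in HN.
rewrite (rsum_tail b n E) in HN.
rewrite <- Rabs_Ropp. replace (- Series (fun k => b (n + k)%nat))%R with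
  (rsum b n - (rsum b n + Series (fun k => b (n + k)%nat)))%R by ring. exact HN.
Qed.

Lemma csumn_lim a : cabs a -> clim (csumn a) (csum a).
Proof.
intros Ea eps He. destruct (Series_tail_small _ eps Ea He) as [N HN].
exists N; intros n Hn. rewrite (csum_tail a n Ea).
replace (csumn a n - (csumn a n + csum (fun k => a (n + k)%nat))) with
  (- csum (fun k => a (n + k)%nat)) by ring.
rewrite Cmod_opp. eapply Rle_lt_trans; [apply Cmod_csum, cabs_incr, Ea|].
eapply Rle_lt_trans; [apply Rle_abs|]. apply HN; auto.
Qed.

Lemma clim_csumn (f : nat -> nat -> C) F N : (forall k, clim (fun p => f p k) (F k)) ->
  clim (fun p => csumn (f p) N) (csumn F N).
Proof.
intros H. induction N; simpl; intros eps He.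
- exists 0%nat; intros. replace (0 - 0) with (RtoC 0) by ring. rewrite Cmod_0; auto.
- destruct (IHN (eps/2)%R ltac:(lra)) as [N1 K1]. destruct (H N (eps/2)%R ltac:(lra)) as [N2 K2].
  exists (max N1 N2); intros n Hn.
  specialize (K1 n ltac:(lia)). specialize (K2 n ltac:(lia)).
  replace (csumn (f n) N + f n N - (csumn F N + F N)) with
    ((csumn (f n) N - csumn F N) + (f n N - F N)) by ring.
  eapply Rle_lt_trans; [apply Cmod_triangle|]. lra.
Qed.

(** Beyond an index where the tail of [g] is below eps/4 both series are negligible, and the
    remaining finite head converges termwise. This carries finite duplication identities over to
    partial fraction series. *)
Lemma tannery (f : nat -> nat -> C) (F : nat -> C) (g : nat -> R) P :
  ex_series g -> (forall p k, (P <= p)%nat -> (Cmod (f p k) <= g k)%R) ->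
  (forall k, (Cmod (F k) <= g k)%R) ->
  (forall k, clim (fun p => f p k) (F k)) -> clim (fun p => csum (f p)) (csum F).
Proof.
intros Eg Hf HF L eps He.
destruct (Series_tail_small g (eps/4) Eg ltac:(lra)) as [N HN].
specialize (HN N (le_n _)).
destruct (clim_csumn f F N L (eps/4)%R ltac:(lra)) as [M HM].
exists (max P M). intros n Hn. specialize (HM n ltac:(lia)).
assert (Ef : cabs (f n)) by (apply (cabs_dom _ g); auto; intros; apply Hf; lia).
assert (EF : cabs F) by (apply (cabs_dom _ g); auto).
rewrite (csum_tail (f n) N Ef), (csum_tail F N EF).
assert (Eg' : ex_series (fun k => g (N + k)%nat)) by (apply (ex_series_incr_n g N), Eg).
assert (T1 : (Cmod (csum (fun k => f n (N+k)%nat)) <= eps/4)%R).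
{ eapply Rle_trans; [apply (Cmod_csum_le _ (fun k => g (N+k)%nat)); auto; intros; apply Hf; lia|].
  generalize (Rle_abs (Series (fun k => g (N + k)%nat))); lra. }
assert (T2 : (Cmod (csum (fun k => F (N+k)%nat)) <= eps/4)%R).
{ eapply Rle_trans; [apply (Cmod_csum_le _ (fun k => g (N+k)%nat)); auto|].
  generalize (Rle_abs (Series (fun k => g (N + k)%nat))); lra. }
set (A := csum (fun k => f n (N+k)%nat)) in *. set (B := csum (fun k => F (N+k)%nat)) in *.
replace (csumn (f n) N + A - (csumn F N + B)) with ((csumn (f n) N - csumn F N) + (A + - B)) by ring.
eapply Rle_lt_trans; [apply Cmod_triangle|].
generalize (Cmod_triangle A (- B)). rewrite Cmod_opp. lra.
Qed.

Lemma fubini_C (a : nat -> nat -> C) (b : nat -> nat -> R) : (forall i j, (Cmod (a i j) <= b i j)%R) ->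
  (forall i, ex_series (b i)) -> ex_series (fun i => Series (b i)) ->
  csum (fun j => csum (fun i => a i j)) = csum (fun i => csum (a i)).
Proof.
intros D E1 E2. apply C_eq; simpl.
- apply (fubini_abs (fun i j => Re (a i j)) b); auto.
  intros; eapply Rle_trans; [apply re_le_Cmod|auto].
- apply (fubini_abs (fun i j => Im (a i j)) b); auto.
  intros; eapply Rle_trans; [apply im_le_Cmod|auto].
Qed.

Lemma csum_finite (a : nat -> C) N : (forall k, (N <= k)%nat -> a k = 0) -> cabs a /\ csum a = csumn a N.
Proof.
intros H.
assert (Ea : cabs a).
{ apply (ex_series_incr_n (fun n => Cmod (a n)) N).
  apply (ex_series_ext (fun _ => 0%R)); [intros; rewrite H by lia; now rewrite Cmod_0|].
  exists 0%R. apply is_series_rsum. apply (is_lim_seq_ext (fun _ => 0%R)); [|apply is_lim_seq_const].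
  intros; rewrite rsum_const; ring. }
split; auto. rewrite (csum_tail a N Ea).
rewrite (csum_ext _ (fun n => 0 * 0)) by (intros; rewrite H by lia; ring).
rewrite (csum_scal 0 (fun _ => 0)); [ring|].
apply (ex_series_ext (fun _ => 0%R)); [intros; now rewrite Cmod_0|].
exists 0%R. apply is_series_rsum. apply (is_lim_seq_ext (fun _ => 0%R)); [|apply is_lim_seq_const].
intros; rewrite rsum_const; ring.
Qed.


(** * Complex exponential and derivatives along real lines *)

Definition cexp (z : C) : C := ((exp (Re z) * cos (Im z))%R, (exp (Re z) * sin (Im z))%R).

Lemma cexp_plus z w : cexp (z + w) = cexp z * cexp w.
Proof.
destruct z as [a b], w as [c d]. apply C_eq; simpl; rewrite exp_plus.
- rewrite cos_plus; ring.
- rewrite sin_plus; ring.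
Qed.

Lemma cexp_0 : cexp 0 = 1.
Proof. apply C_eq; simpl; rewrite exp_0, ?cos_0, ?sin_0; ring. Qed.

Lemma Cmod_cexp z : Cmod (cexp z) = exp (Re z).
Proof.
unfold Cmod, cexp; simpl.
replace (_ + _)%R with ((exp (Re z))²)%R; [apply sqrt_Rsqr; left; apply exp_pos|].
generalize (sin2_cos2 (Im z)); unfold Rsqr; intros H. simpl in *. nra.
Qed.

Lemma cexp_neq0 z : cexp z <> 0.
Proof. apply Cmod_gt_0. rewrite Cmod_cexp. apply exp_pos. Qed.

Lemma cexp_opp z : cexp (- z) = / cexp z.
Proof.
assert (H : cexp (- z) * cexp z = 1) by (rewrite <- cexp_plus, <- cexp_0; f_equal; ring).
rewrite <- (Cmult_1_l (/ cexp z)), <- H. field. apply cexp_neq0.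
Qed.

Lemma cexp_nat n z : cexp (INR n * z) = cexp z ^ n.
Proof.
induction n.
- simpl. rewrite <- cexp_0; f_equal; ring.
- rewrite S_INR, RtoC_plus. simpl. rewrite <- IHn, <- cexp_plus; f_equal; ring.
Qed.

Lemma cexp_R x : cexp (RtoC x) = RtoC (exp x).
Proof. apply C_eq; simpl; rewrite ?cos_0, ?sin_0; ring. Qed.

Lemma cexp_PI : cexp (PI * Ci) = - (1).
Proof.
apply C_eq; simpl; replace (PI * 0 - 0 * 1)%R with 0%R by ring;
  replace (PI * 1 + 0 * 0)%R with PI by ring; rewrite exp_0.
- rewrite cos_PI; ring.
- rewrite sin_PI; ring.
Qed.

Lemma cexp_2PI : cexp (2 * PI * Ci) = 1.
Proof.
replace (2 * PI * Ci) with (PI * Ci + PI * Ci) by ring.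
rewrite cexp_plus, cexp_PI; ring.
Qed.

Lemma cexp_2PI_nat n : cexp (2 * PI * Ci * INR n) = 1.
Proof.
replace (2 * PI * Ci * INR n) with (INR n * (2 * PI * Ci)) by ring.
rewrite cexp_nat, cexp_2PI. induction n; simpl; [easy|]. rewrite IHn; ring.
Qed.

Lemma cexp_2PI_Z l : cexp (2 * PI * Ci * IZR l) = 1.
Proof.
destruct (Z_le_gt_dec 0 l).
- rewrite <- (Z2Nat.id l) by auto. rewrite <- INR_IZR_INZ. apply cexp_2PI_nat.
- replace l with (- Z.of_nat (Z.to_nat (- l)))%Z by lia.
  rewrite opp_IZR, <- INR_IZR_INZ, RtoC_opp.
  replace (2 * PI * Ci * - INR (Z.to_nat (- l))) with (- (2 * PI * Ci * INR (Z.to_nat (- l)))) by ring.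
  rewrite cexp_opp, cexp_2PI_nat. field.
Qed.

(** Derivative of a complex function of one real variable. Complex functions are differentiated
    along lines [c + s * b] only, so no theory of holomorphic functions is involved. *)
Definition cderive (f : R -> C) (y : R) (l : C) : Prop :=
  is_derive (fun s => Re (f s)) y (Re l) /\ is_derive (fun s => Im (f s)) y (Im l).

Lemma cderive_ext f g y l : (forall s, f s = g s) -> cderive f y l -> cderive g y l.
Proof.
intros H [H1 H2]; split; [eapply is_derive_ext; [|exact H1]|eapply is_derive_ext; [|exact H2]];
 intros; simpl; now rewrite H.
Qed.

Lemma cderive_const c y : cderive (fun _ => c) y 0.
Proof. split; apply (is_derive_const (V := R_NormedModule)). Qed.

Lemma cderive_plus f g y l m : cderive f y l -> cderive g y m -> cderive (fun s => f s + g s) y (l + m).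
Proof.
intros [H1 H2] [K1 K2]; split; simpl.
- apply (is_derive_plus (V := R_NormedModule) (fun s => Re (f s)) (fun s => Re (g s))); auto.
- apply (is_derive_plus (V := R_NormedModule) (fun s => Im (f s)) (fun s => Im (g s))); auto.
Qed.

Lemma is_derive_multR (f g : R -> R) x l m : is_derive f x l -> is_derive g x m ->
  is_derive (fun s => f s * g s)%R x (l * g x + f x * m)%R.
Proof.
intros H1 H2. apply (is_derive_mult f g x l m H1 H2). intros; apply Rmult_comm.
Qed.

Lemma cderive_mult f g y l m : cderive f y l -> cderive g y m ->
  cderive (fun s => f s * g s) y (l * g y + f y * m).
Proof.
intros [H1 H2] [K1 K2]; split; simpl.
- replace (_ + _)%R with ((Re l * Re (g y) + Re (f y) * Re m) - (Im l * Im (g y) + Im (f y) * Im m))%R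
    by (unfold Re, Im; simpl; ring).
  apply (is_derive_minus (V := R_NormedModule) (fun s => Re (f s) * Re (g s))%R
    (fun s => Im (f s) * Im (g s))%R); apply is_derive_multR; auto.
- replace (_ + _)%R with ((Re l * Im (g y) + Re (f y) * Im m) + (Im l * Re (g y) + Im (f y) * Re m))%R
    by (unfold Re, Im; simpl; ring).
  apply (is_derive_plus (V := R_NormedModule) (fun s => Re (f s) * Im (g s))%R
    (fun s => Im (f s) * Re (g s))%R); apply is_derive_multR; auto.
Qed.

Lemma cderive_scal c f y l : cderive f y l -> cderive (fun s => c * f s) y (c * l).
Proof.
intros H. replace (c * l) with (0 * f y + c * l) by ring.
apply cderive_mult; auto using cderive_const.
Qed.

Lemma cderive_minus f g y l m : cderive f y l -> cderive g y m -> cderive (fun s => f s - g s) y (l - m).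
Proof.
intros H K. replace (l - m) with (l + (-(1)) * m) by ring.
apply (cderive_ext (fun s => f s + (-(1)) * g s)); [intros; ring|].
apply cderive_plus; auto. now apply cderive_scal.
Qed.

Lemma cderive_inv (f : R -> C) (y : R) (l : C) : f y <> 0 -> cderive f y l -> cderive (fun s => / f s) y (- l / (f y * f y)).
Proof.
intros N [H1 H2].
assert (P : (Re (f y) ^ 2 + Im (f y) ^ 2 <> 0)%R).
{ rewrite <- Cmod2_alt. apply pow_nonzero. intros Z. apply N. now apply Cmod_eq_0. }
assert (Q : (Re (f y) * Re (f y) + Im (f y) * Im (f y) <> 0)%R).
{ intros Z; apply P; rewrite <- Z; ring. }
assert (D : is_derive (fun s => Re (f s) * Re (f s) + Im (f s) * Im (f s))%R y
   ((Re l * Re (f y) + Re (f y) * Re l) + (Im l * Im (f y) + Im (f y) * Im l))%R).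
{ apply (is_derive_plus (V := R_NormedModule) (fun s => Re (f s) * Re (f s))%R (fun s => Im (f s) * Im (f s))%R);
  apply is_derive_multR; auto. }
assert (DI := is_derive_inv _ _ _ D Q).
assert (E : forall s, / f s = ((Re (f s) * / (Re (f s) * Re (f s) + Im (f s) * Im (f s)))%R,
   (- Im (f s) * / (Re (f s) * Re (f s) + Im (f s) * Im (f s)))%R)).
{ intros s. unfold Cinv, Rdiv, Re, Im. simpl. now rewrite !Rmult_1_r. }
split.
- eapply is_derive_ext; [intros s; rewrite (E s); reflexivity|].
  simpl Re. evar_last; [apply is_derive_multR; [exact H1|exact DI]|].
  unfold Cdiv, Cinv, Cmult, Copp, Re, Im in *. simpl in *. field. split; nra.
- eapply is_derive_ext; [intros s; rewrite (E s); reflexivity|].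
  simpl Im. evar_last; [apply is_derive_multR; [exact (is_derive_opp (V := R_NormedModule) _ _ _ H2)|exact DI]|].
  unfold Cdiv, Cinv, Cmult, Copp, Re, Im, opp in *. simpl in *. field. split; nra.
Qed.

Lemma is_derive_compR (f g : R -> R) x l m : is_derive f (g x) l -> is_derive g x m ->
  is_derive (fun s => f (g s)) x (l * m)%R.
Proof.
intros H K. rewrite Rmult_comm. apply (is_derive_comp (V := R_NormedModule) f g x l m H K).
Qed.

Lemma cderive_cexp f y l : cderive f y l -> cderive (fun s => cexp (f s)) y (l * cexp (f y)).
Proof.
intros [H1 H2].
assert (De : is_derive (fun s => exp (Re (f s))) y (exp (Re (f y)) * Re l)%R)
  by (apply is_derive_compR; auto; apply is_derive_exp).
assert (Dc : is_derive (fun s => cos (Im (f s))) y (- sin (Im (f y)) * Im l)%R)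
  by (apply is_derive_compR; auto; apply is_derive_cos).
assert (Ds : is_derive (fun s => sin (Im (f s))) y (cos (Im (f y)) * Im l)%R)
  by (apply is_derive_compR; auto; apply is_derive_sin).
split; simpl.
- evar_last; [apply is_derive_multR; [exact De|exact Dc]|]. unfold Re, Im; simpl; ring.
- evar_last; [apply is_derive_multR; [exact De|exact Ds]|]. unfold Re, Im; simpl; ring.
Qed.

Lemma cderive_line a b y : cderive (fun s => a + s * b) y b.
Proof.
split; simpl.
- auto_derive; auto; unfold Re; ring.
- auto_derive; auto; unfold Im; ring.
Qed.

Lemma is_derive_bound (f : R -> R) (a b M : R) (f' : R -> R) : (a <= b)%R ->
  (forall s, (a <= s <= b)%R -> is_derive f s (f' s)) ->
  (forall s, (a <= s <= b)%R -> (f' s <= M)%R) -> (f b - f a <= M * (b - a))%R.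
Proof.
intros Hab D B.
destruct (MVT_gen f a b f') as [c [Hc E]].
- intros x Hx. apply D. rewrite Rmin_left, Rmax_right in Hx; lra.
- intros x Hx. rewrite Rmin_left, Rmax_right in Hx by lra.
  apply continuity_pt_filterlim. apply (ex_derive_continuous (V := R_NormedModule) f).
  exists (f' x). apply D; lra.
- rewrite Rmin_left, Rmax_right in Hc by lra. rewrite E.
  apply Rmult_le_compat_r; [lra|]. apply B; lra.
Qed.

Lemma Re_Cconj_mult (z w : C) : Re (Cconj z * w) = (Re z * Re w + Im z * Im w)%R.
Proof. unfold Cconj, Re, Im; simpl; ring. Qed.

Lemma Cmod_sqr z : (Cmod z * Cmod z = Re z * Re z + Im z * Im z)%R.
Proof. generalize (Cmod2_alt z); simpl; rewrite !Rmult_1_r; auto. Qed.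

(** A complex function need not have a mean value point; pairing f with the direction d = f b - f a
    gives a real function whose increment is |d|^2 and whose slope is at most |d| M. *)
Lemma mean_value_C (f f' : R -> C) a b M : (a <= b)%R ->
  (forall s, (a <= s <= b)%R -> cderive f s (f' s)) ->
  (forall s, (a <= s <= b)%R -> (Cmod (f' s) <= M)%R) ->
  (Cmod (f b - f a) <= M * (b - a))%R.
Proof.
intros Hab D B. set (d := f b - f a).
destruct (Req_dec (Cmod d) 0) as [Z|Z].
{ rewrite Z. apply Rmult_le_pos; [|lra].
  apply Rle_trans with (2 := B a ltac:(lra)). apply Cmod_ge_0. }
assert (P : (0 < Cmod d)%R) by (generalize (Cmod_ge_0 d); lra).
apply Rmult_le_reg_l with (Cmod d); auto.
assert (K := is_derive_bound (fun s => Re d * Re (f s) + Im d * Im (f s))%R a b (Cmod d * M)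
  (fun s => Re d * Re (f' s) + Im d * Im (f' s))%R Hab).
rewrite Cmod_sqr.
assert (E : (Re d * Re d + Im d * Im d = (Re d * Re (f b) + Im d * Im (f b)) - (Re d * Re (f a) + Im d * Im (f a)))%R).
{ unfold d at 2 4. unfold Re, Im; simpl; ring. }
rewrite E, <- Rmult_assoc. apply K.
- intros s Hs. destruct (D s Hs) as [D1 D2].
  apply (is_derive_plus (V := R_NormedModule) (fun s => Re d * Re (f s))%R (fun s => Im d * Im (f s))%R).
  + apply (is_derive_scal (fun s => Re (f s))); auto.
  + apply (is_derive_scal (fun s => Im (f s))); auto.
- intros s Hs. rewrite <- Re_Cconj_mult.
  apply Rle_trans with (1 := Rle_abs _). apply Rle_trans with (1 := re_le_Cmod _).
  rewrite Cmod_mult, Cmod_conj. apply Rmult_le_compat_l; auto using Cmod_ge_0.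
Qed.

Lemma Re_le_Cmod z : (Re z <= Cmod z)%R.
Proof. apply Rle_trans with (1 := Rle_abs _); apply re_le_Cmod. Qed.

Lemma cexp_m1_bound u : (Cmod (cexp u - 1) <= Cmod u * exp (Cmod u))%R.
Proof.
assert (H := mean_value_C (fun s => cexp (0 + s * u)) (fun s => u * cexp (0 + s * u)) 0 1 (Cmod u * exp (Cmod u)) ltac:(lra)).
cbv beta in H. replace (0 + RtoC 1 * u) with u in H by ring. replace (0 + RtoC 0 * u) with (RtoC 0) in H by ring.
rewrite cexp_0 in H. replace (Cmod u * exp (Cmod u))%R with (Cmod u * exp (Cmod u) * (1 - 0))%R at 1 by ring.
apply H.
- intros s Hs. apply (cderive_cexp (fun s => 0 + s * u)). apply cderive_line.
- intros s Hs. rewrite Cmod_mult, Cmod_cexp. apply Rmult_le_compat_l; [apply Cmod_ge_0|].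
  assert (Re (0 + s * u) <= Cmod u)%R.
  { apply Rle_trans with (1 := Re_le_Cmod _). rewrite Cplus_0_l, Cmod_mult, Cmod_R, Rabs_pos_eq by lra.
    generalize (Cmod_ge_0 u); nra. }
  destruct H0 as [H0|H0]; [left; apply exp_increasing; auto | rewrite H0; lra].
Qed.

Lemma exp_le_mono x y : (x <= y)%R -> (exp x <= exp y)%R.
Proof. intros [H|H]; [left; apply exp_increasing; auto | rewrite H; lra]. Qed.

Lemma cexp_m2_bound u : (Cmod (cexp u - 1 - u) <= Cmod u * Cmod u * exp (Cmod u))%R.
Proof.
assert (H := mean_value_C (fun s => cexp (0 + s * u) - (0 + s * u)) (fun s => u * cexp (0 + s * u) - u) 0 1
  (Cmod u * Cmod u * exp (Cmod u)) ltac:(lra)).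
cbv beta in H. replace (0 + RtoC 1 * u) with u in H by ring. replace (0 + RtoC 0 * u) with (RtoC 0) in H by ring.
rewrite cexp_0 in H. replace (cexp u - u - (1 - 0)) with (cexp u - 1 - u) in H by ring.
replace (Cmod u * Cmod u * exp (Cmod u))%R with (Cmod u * Cmod u * exp (Cmod u) * (1 - 0))%R at 1 by ring.
apply H.
- intros s Hs. apply cderive_minus; [apply (cderive_cexp (fun s => 0 + s * u))|]; apply cderive_line.
- intros s Hs. replace (u * cexp (0 + s * u) - u) with (u * (cexp (s * u) - 1)) by (rewrite Cplus_0_l; ring).
  rewrite Cmod_mult. rewrite Rmult_assoc. apply Rmult_le_compat_l; [apply Cmod_ge_0|].
  apply Rle_trans with (1 := cexp_m1_bound _).
  assert (Cmod (s * u) <= Cmod u)%R.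
  { rewrite Cmod_mult, Cmod_R, Rabs_pos_eq by lra. generalize (Cmod_ge_0 u); nra. }
  apply Rmult_le_compat; auto using Cmod_ge_0, exp_le_mono. left; apply exp_pos.
Qed.

Lemma sin_ge_third v : (0 <= v <= 2)%R -> (v / 3 <= sin v)%R.
Proof.
intros H. destruct (pre_sin_bound v 0) as [K _]; try lra.
apply Rle_trans with (2 := K). unfold sin_approx, sum_f_R0, sin_term, fact; simpl. nra.
Qed.

Lemma exp_le_3R x : (x <= 1)%R -> (exp x <= 3)%R.
Proof. intros H. apply Rle_trans with (exp 1); [apply exp_le_mono; auto|apply exp_le_3]. Qed.

(** With u = x + iy and E = e^(-x), |1 - e^(-u)|^2 = (1 - E)^2 + 2 E (1 - cos y), and the two parts
    dominate multiples of x^2 and y^2. The box contains no zero other than 0, and its height 4 has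
    room for (1 + 2 pi) / 2, which bounds the imaginary part of the rescaled points in
    [pt_region]. *)
Lemma Cmod_1mexp_lower u : (Rabs (Re u) <= 1)%R -> (Rabs (Im u) <= 4)%R ->
  (Cmod u / 6 <= Cmod (1 - cexp (- u)))%R.
Proof.
intros Hx Hy.
apply Rsqr_incr_0_var; [|apply Cmod_ge_0]. unfold Rsqr.
rewrite (Cmod_sqr (1 - _)).
replace (Cmod u / 6 * (Cmod u / 6))%R with ((Cmod u * Cmod u) / 36)%R by field.
rewrite Cmod_sqr. destruct u as [x y]. simpl in *.
set (E := exp (- x)).
assert (HE : (1/3 <= E)%R).
{ unfold E. rewrite exp_Ropp. generalize (exp_le_3R x ltac:(generalize (Rle_abs x); lra)) (exp_pos x); intros.
  unfold Rdiv; rewrite Rmult_1_l. apply Rinv_le_contravar; auto. }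
assert (HE1 : (x * x / 9 <= (1 - E) * (1 - E))%R).
{ destruct (Rle_lt_dec 0 x) as [Px|Nx].
  - assert (E * (1 + x) <= 1)%R.
    { unfold E. apply Rle_trans with (exp (-x) * exp x)%R.
      - apply Rmult_le_compat_l; [left; apply exp_pos|]. generalize (exp_ineq1_le x); lra.
      - rewrite <- exp_plus, Rplus_opp_l, exp_0; lra. }
    rewrite Rabs_pos_eq in Hx by auto.
    assert (x / 3 <= 1 - E)%R by nra. nra.
  - assert (1 + - x <= E)%R by (unfold E; apply exp_ineq1_le).
    nra. }
assert (HC : (y * y / 18 <= 1 - cos y)%R).
{ replace y with (2 * (y/2))%R at 3 by field. rewrite cos_2a_sin.
  assert (S : (y * y / 36 <= sin (y/2) * sin (y/2))%R); [|nra].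
  destruct (Rle_lt_dec 0 y) as [Py|Ny].
  - rewrite Rabs_pos_eq in Hy by auto. generalize (sin_ge_third (y/2) ltac:(lra)); nra.
  - rewrite Rabs_left in Hy by auto. generalize (sin_ge_third (-(y/2)) ltac:(lra)); rewrite sin_neg; nra. }
rewrite cos_neg, sin_neg.
replace ((1 + - (E * cos y)) * (1 + - (E * cos y)) + (0 + - (E * - sin y)) * (0 + - (E * - sin y)))%R
 with ((1 - E) * (1 - E) + 2 * E * (1 - cos y))%R.
- nra.
- generalize (sin2_cos2 y); unfold Rsqr; intros. nra.
Qed.

(** * Partial fractions of the periodic poles *)

(* Residue-1 simple poles, resp. double poles, at 2 pi i Z. *)
Definition simple_pole (z : C) : C := / (1 - cexp (- z)).
Definition double_pole (z : C) : C := simple_pole z * simple_pole z - simple_pole z.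
Definition regular (z : C) : Prop := cexp (- z) <> 1.

Lemma regular_neq z : regular z -> 1 - cexp (- z) <> 0.
Proof. intros H E. apply H. replace (cexp (-z)) with (1 - (1 - cexp (- z))) by ring. rewrite E; ring. Qed.

Lemma simple_pole_bound (u : C) : u <> 0 -> (Rabs (Re u) <= 1)%R -> (Rabs (Im u) <= 4)%R -> (Cmod (simple_pole u) <= 6 / Cmod u)%R.
Proof.
intros N Hx Hy. assert (P := proj1 (Cmod_gt_0 u) N).
assert (L := Cmod_1mexp_lower u Hx Hy).
unfold simple_pole. rewrite Cmod_inv.
- replace (6 / Cmod u)%R with (/ (Cmod u / 6))%R by (field; lra).
  apply Rinv_le_contravar; lra.
- apply Cmod_gt_0. lra.
Qed.

Lemma regular_small (u : C) : u <> 0 -> (Rabs (Re u) <= 1)%R -> (Rabs (Im u) <= 4)%R -> regular u.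
Proof.
intros N Hx Hy E. assert (P := proj1 (Cmod_gt_0 u) N).
assert (L := Cmod_1mexp_lower u Hx Hy). rewrite E in L.
replace (1 - 1) with (RtoC 0) in L by ring. rewrite Cmod_0 in L. lra.
Qed.

Lemma simple_pole_near0 (u : C) : u <> 0 -> (Cmod u <= 1)%R -> (Cmod (u * simple_pole u - 1) <= 18 * Cmod u)%R.
Proof.
intros N H. assert (P := proj1 (Cmod_gt_0 u) N).
assert (Hx : (Rabs (Re u) <= 1)%R) by (generalize (re_le_Cmod u); lra).
assert (Hy : (Rabs (Im u) <= 4)%R) by (generalize (im_le_Cmod u); lra).
assert (G := regular_neq _ (regular_small u N Hx Hy)).
replace (u * simple_pole u - 1) with (simple_pole u * (cexp (- u) - 1 - - u)) by (unfold simple_pole; field; auto).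
rewrite Cmod_mult. assert (B := simple_pole_bound u N Hx Hy). assert (B2 := cexp_m2_bound (- u)).
rewrite Cmod_opp in B2. assert (E := exp_le_3R _ H).
apply Rle_trans with (6 / Cmod u * (Cmod u * Cmod u * 3))%R.
- apply Rmult_le_compat; auto using Cmod_ge_0. apply Rle_trans with (1 := B2). nra.
- right. field. lra.
Qed.

Lemma double_pole_near0 (u : C) : u <> 0 -> (Cmod u <= 1)%R -> (Cmod (u * u * double_pole u - 1) <= 400 * Cmod u)%R.
Proof.
intros N H. assert (B := simple_pole_near0 u N H). set (w := u * simple_pole u - 1) in *.
replace (u * u * double_pole u - 1) with (w * w + 2 * w - u * w - u) by (unfold w, double_pole; ring).
assert (Cmod (w * w + 2 * w - u * w - u) <= Cmod w * Cmod w + 2 * Cmod w + Cmod u * Cmod w + Cmod u)%R.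
{ unfold Cminus. eapply Rle_trans; [apply Cmod_triangle|]. rewrite Cmod_opp. apply Rplus_le_compat_r.
  eapply Rle_trans; [apply Cmod_triangle|]. rewrite Cmod_opp, Cmod_mult. apply Rplus_le_compat_r.
  eapply Rle_trans; [apply Cmod_triangle|]. rewrite !Cmod_mult, Cmod_R, Rabs_pos_eq; lra. }
generalize (Cmod_ge_0 w) (Cmod_ge_0 u). nra.
Qed.

Lemma double_pole_bound (u : C) : u <> 0 -> (Rabs (Re u) <= 1)%R -> (Rabs (Im u) <= 4)%R -> (Cmod (double_pole u) <= 66 / (Cmod u * Cmod u))%R.
Proof.
intros N Hx Hy. assert (P := proj1 (Cmod_gt_0 u) N).
assert (B := simple_pole_bound u N Hx Hy).
assert (U : (Cmod u <= 5)%R).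
{ replace u with (RtoC (Re u) + Ci * RtoC (Im u)) by (destruct u; apply C_eq; simpl; ring).
  eapply Rle_trans; [apply Cmod_triangle|]. rewrite Cmod_mult, Cmod_Ci, !Cmod_R. lra. }
unfold double_pole, Cminus. eapply Rle_trans; [apply Cmod_triangle|]. rewrite Cmod_opp, Cmod_mult.
apply Rle_trans with (6 / Cmod u * (6 / Cmod u) + 6 / Cmod u)%R.
- apply Rplus_le_compat; auto. apply Rmult_le_compat; auto using Cmod_ge_0.
- apply Rmult_le_reg_r with (Cmod u * Cmod u)%R; [nra|].
  replace ((6 / Cmod u * (6 / Cmod u) + 6 / Cmod u) * (Cmod u * Cmod u))%R with (36 + 6 * Cmod u)%R by (field; lra).
  replace (66 / (Cmod u * Cmod u) * (Cmod u * Cmod u))%R with 66%R by (field; lra). lra.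
Qed.


Definition lattice_pt (z : C) (l : Z) : C := z + 2 * PI * Ci * IZR l.
(* The index l is paired with -l-1, because 2(-l-1)+1 = -(2l+1) for the odd multiples summed later. *)
Definition zsum (a : Z -> C) : C := csum (fun n => a (Z.of_nat n) + a (- Z.of_nat n - 1)%Z).
Definition zabs (a : Z -> C) : Prop := cabs (fun n => a (Z.of_nat n) + a (- Z.of_nat n - 1)%Z).

Lemma csumn_app a m n : csumn a (m + n) = csumn a m + csumn (fun k => a (m + k)%nat) n.
Proof.
induction n; simpl; [rewrite Nat.add_0_r; ring|].
rewrite Nat.add_succ_r; simpl. rewrite IHn; ring.
Qed.

Lemma csumn_Sl a n : csumn a (S n) = a O + csumn (fun k => a (S k)) n.
Proof. change (S n) with (1 + n)%nat. rewrite csumn_app. simpl. ring. Qed.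

Lemma csumn_rev n : forall a, csumn (fun k => a (n - 1 - k)%nat) n = csumn a n.
Proof.
induction n; intros a; [easy|].
rewrite csumn_Sl. simpl csumn at 2. rewrite <- (IHn a).
replace (S n - 1 - 0)%nat with n by lia.
rewrite Cplus_comm. f_equal. apply csumn_ext. intros; f_equal; lia.
Qed.

Lemma csumn_fold a n : csumn a (n + n) = csumn (fun k => a k + a (n + n - 1 - k)%nat) n.
Proof.
rewrite csumn_app, csumn_plus. f_equal.
rewrite <- (csumn_rev n (fun k => a (n + k)%nat)). apply csumn_ext. intros; f_equal; lia.
Qed.

Lemma pow2_neq0 p : (2 ^ p : C) <> 0.
Proof.
intros E. assert (H : Cmod (2 ^ p) = 0%R) by (rewrite E; apply Cmod_0).
rewrite Cmod_pow, Cmod_R, Rabs_pos_eq in H by lra. generalize (pow_lt 2 p); lra.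
Qed.

Lemma RtoC_neq0 (x : R) : x <> 0%R -> RtoC x <> 0.
Proof. intros H E. apply H. now injection E. Qed.

Lemma two_neq0 : RtoC 2 <> 0.
Proof. apply RtoC_neq0; lra. Qed.

Lemma regular_lattice_pt z p l : regular z -> regular (lattice_pt z l / 2 ^ p).
Proof.
intros G E. apply G.
assert (H : cexp (INR (2 ^ p) * (- (lattice_pt z l / 2 ^ p))) = 1).
{ rewrite cexp_nat, E. generalize (2 ^ p)%nat as m. induction m; simpl; [easy|]. rewrite IHm; ring. }
replace (INR (2 ^ p) * (- (lattice_pt z l / 2 ^ p))) with (- z + 2 * PI * Ci * IZR (- l)) in H.
- now rewrite cexp_plus, cexp_2PI_Z, Cmult_1_r in H.
- rewrite pow_INR, RtoC_pow. simpl INR. rewrite opp_IZR, RtoC_opp. unfold lattice_pt.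
  replace (1 + 1)%R with 2%R by ring. field. apply pow2_neq0.
Qed.

(** Iterating the duplication formula p times writes f as a weighted sum over the 2^p preimages of z
    under multiplication by 2^p modulo the period. As p grows, the points near 0 reproduce the
    poles: Herglotz's route to partial fractions, without residues. *)
Lemma doubling (f : C -> C) (lam : C) : (forall u, f (u + 2 * PI * Ci) = f u) ->
  (forall u, regular u -> f u = lam * (f (u / 2) + f (u / 2 + PI * Ci))) ->
  forall p z, regular z -> f z = lam ^ p * csumn (fun l => f (lattice_pt z (Z.of_nat l) / 2 ^ p)) (2 ^ p).
Proof.
intros Hper Hd p z G. induction p as [|p IH].
- simpl. unfold lattice_pt. rewrite ?RtoC_mult. simpl.
  replace ((z + 2 * PI * Ci * 0) / 1) with z by field. ring.
- rewrite IH. replace (2 ^ S p)%nat with (2 ^ p + 2 ^ p)%nat by (simpl; lia).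
  rewrite csumn_app, <- csumn_plus.
  simpl Cpow. replace (lam * lam ^ p) with (lam ^ p * lam) by ring.
  rewrite <- Cmult_assoc. f_equal. rewrite <- csumn_scal. apply csumn_ext. intros k _.
  rewrite (Hd (lattice_pt z (Z.of_nat k) / 2 ^ p)) by now apply regular_lattice_pt.
  f_equal. f_equal; f_equal.
  + field. split; [apply two_neq0|apply pow2_neq0] || (apply pow2_neq0).
  + unfold lattice_pt. rewrite Nat2Z.inj_add, plus_IZR, RtoC_plus, <- !INR_IZR_INZ, pow_INR.
    simpl INR. replace (1 + 1)%R with 2%R by ring. rewrite RtoC_pow.
    field. split; [apply two_neq0|apply pow2_neq0] || (apply pow2_neq0).
Qed.

(** The index 2^(p+1) - 1 - k equals -k - 1 up to a period, so the points can be listed in the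
    pairing that [zsum] uses. *)
Lemma doubling_fold (f : C -> C) (lam : C) : (forall u, f (u + 2 * PI * Ci) = f u) ->
  (forall u, regular u -> f u = lam * (f (u / 2) + f (u / 2 + PI * Ci))) ->
  forall p z, regular z -> f z = lam ^ S p * csumn (fun k => f (lattice_pt z (Z.of_nat k) / 2 ^ S p) +
     f (lattice_pt z (- Z.of_nat k - 1) / 2 ^ S p)) (2 ^ p).
Proof.
intros Hper Hd p z G. rewrite (doubling f lam Hper Hd (S p) z G).
replace (2 ^ S p)%nat with (2 ^ p + 2 ^ p)%nat by (simpl; lia).
rewrite csumn_fold. f_equal. apply csumn_ext. intros k Hk. f_equal.
rewrite <- (Hper (lattice_pt z (- Z.of_nat k - 1) / 2 ^ S p)). f_equal.
unfold lattice_pt. rewrite !Nat2Z.inj_sub by lia. rewrite Nat2Z.inj_add.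
rewrite !minus_IZR, plus_IZR, opp_IZR, <- !INR_IZR_INZ, pow_INR, !RtoC_minus, RtoC_plus, RtoC_opp.
simpl INR. replace (1 + 1)%R with 2%R by ring. rewrite RtoC_pow. simpl Cpow.
field. split; [apply two_neq0|apply pow2_neq0] || (apply pow2_neq0).
Qed.

Lemma ex_series_inv_sq : ex_series (fun k => / ((INR k + 1) * (INR k + 1)))%R /\
  (Series (fun k => / ((INR k + 1) * (INR k + 1))) <= 2)%R.
Proof.
apply bounded_ex_series.
- intros k. left. apply Rinv_0_lt_compat. generalize (pos_INR k); nra.
- assert (B : forall n, (rsum (fun k => / ((INR k + 1) * (INR k + 1))) (S n) <= 2 - / (INR n + 1))%R).
  { induction n as [|n IH]; [simpl; lra|]. remember (S n) as m. simpl rsum. subst m.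
    rewrite S_INR. generalize (pos_INR n); intros P.
    assert (/ ((INR n + 1 + 1) * (INR n + 1 + 1)) <= / (INR n + 1) - / (INR n + 1 + 1))%R; [|lra].
    replace (/ (INR n + 1) - / (INR n + 1 + 1))%R with (/ ((INR n + 1) * (INR n + 1 + 1)))%R by (field; lra).
    apply Rinv_le_contravar; nra. }
  intros [|n]; [simpl; lra|]. apply Rle_trans with (1 := B n).
  assert (0 < / (INR n + 1))%R by (apply Rinv_0_lt_compat; generalize (pos_INR n); lra). lra.
Qed.

Definition inv2 (z : C) (l : Z) : R := (/ (Cmod (lattice_pt z l) * Cmod (lattice_pt z l)))%R.

Lemma lattice_pt_neq0 z l : regular z -> lattice_pt z l <> 0.
Proof.
intros G E. apply G. replace (- z) with (2 * PI * Ci * IZR l).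
- apply cexp_2PI_Z.
- replace (2 * PI * Ci * IZR l) with (lattice_pt z l - z) by (unfold lattice_pt; ring). rewrite E; ring.
Qed.

Lemma inv2_pos z l : regular z -> (0 < inv2 z l)%R.
Proof.
intros G. assert (P := proj1 (Cmod_gt_0 _) (lattice_pt_neq0 z l G)).
apply Rinv_0_lt_compat; nra.
Qed.

Lemma PI_gt_3 : (3 < PI)%R.
Proof. generalize PI2_3_2; lra. Qed.

Lemma Cmod_2PIi l : Cmod (2 * PI * Ci * IZR l) = (2 * PI * Rabs (IZR l))%R.
Proof.
rewrite !Cmod_mult, Cmod_Ci, !Cmod_R, (Rabs_pos_eq 2), (Rabs_pos_eq PI) by (generalize PI_gt_3; lra). ring.
Qed.

Lemma Cmod_sub_le x y : (Cmod x - Cmod y <= Cmod (y + x))%R.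
Proof.
assert (H := Cmod_triangle (y + x) (- y)). rewrite Cmod_opp in H.
replace (y + x + - y) with x in H by ring. lra.
Qed.

Lemma lattice_pt_large z l (k : R) : (Cmod z + 1 <= k)%R -> (k <= Rabs (IZR l))%R -> (k + 1 <= Cmod (lattice_pt z l))%R.
Proof.
intros H H1. assert (B := Cmod_sub_le (2 * PI * Ci * IZR l) z).
rewrite Cmod_2PIi in B. fold (lattice_pt z l) in B. generalize PI_gt_3 (Cmod_ge_0 z). intros. nra.
Qed.

Lemma ex_series_inv2 z : regular z -> ex_series (fun k => inv2 z (Z.of_nat k) + inv2 z (- Z.of_nat k - 1))%R.
Proof.
intros G.
destruct (nfloor_ex (Cmod z + 1)) as [N [_ HN]]; [generalize (Cmod_ge_0 z); lra|].
apply (ex_series_incr_n (fun k => inv2 z (Z.of_nat k) + inv2 z (- Z.of_nat k - 1))%R (S N)).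
apply (ex_series_dom _ (fun k => 2 * / ((INR k + 1) * (INR k + 1)))%R);
  [|apply ex_series_scalR, ex_series_inv_sq].
intros k. split.
- generalize (inv2_pos z (Z.of_nat (S N + k)) G) (inv2_pos z (- Z.of_nat (S N + k) - 1) G); lra.
- set (m := (S N + k)%nat).
  assert (Hm : (INR m = INR N + 1 + INR k)%R) by (unfold m; rewrite plus_INR, S_INR; ring).
  generalize (pos_INR k) (pos_INR N); intros Pk PN.
  assert (K : forall l, (INR m <= Rabs (IZR l))%R -> (inv2 z l <= / ((INR k + 1) * (INR k + 1)))%R).
  { intros l Hl. unfold inv2. assert (A := lattice_pt_large z l (INR m) ltac:(lra) Hl).
    apply Rinv_le_contravar; nra. }
  assert (K1 := K (Z.of_nat m)). assert (K2 := K (- Z.of_nat m - 1)%Z).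
  rewrite <- INR_IZR_INZ in K1. rewrite minus_IZR, opp_IZR, <- INR_IZR_INZ in K2.
  rewrite Rabs_pos_eq in K1 by apply pos_INR.
  rewrite Rabs_left in K2 by (generalize (pos_INR m); lra).
  specialize (K1 ltac:(lra)). specialize (K2 ltac:(lra)). lra.
Qed.


Lemma PI_lt_32 : (PI < 3.2)%R.
Proof.
destruct (Rlt_le_dec PI 3.2) as [H|H]; auto. exfalso.
assert (0 <= cos 1.6)%R by (apply cos_ge_0; lra).
destruct (pre_cos_bound 1.6 0) as [_ K]; try lra.
unfold cos_approx, sum_f_R0, cos_term, fact in K. simpl in K. lra.
Qed.

Lemma pow2_pos p : (0 < 2 ^ p)%R.
Proof. apply pow_lt; lra. Qed.

Lemma Cmod_div_pow2 z p : Cmod (z / 2 ^ p) = (Cmod z / 2 ^ p)%R.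
Proof.
rewrite Cmod_div by apply pow2_neq0. rewrite Cmod_pow, Cmod_R, Rabs_pos_eq by lra. reflexivity.
Qed.

Lemma RtoC_pow2 p : (2 ^ p : C) = RtoC (2 ^ p)%R.
Proof. now rewrite RtoC_pow. Qed.

Lemma Re_div_pow2 z p : Re (z / 2 ^ p) = (Re z / 2 ^ p)%R.
Proof.
rewrite RtoC_pow2. unfold Cdiv. rewrite <- RtoC_inv by (apply pow_nonzero; lra). destruct z; simpl; unfold Rdiv; ring.
Qed.
Lemma Im_div_pow2 z p : Im (z / 2 ^ p) = (Im z / 2 ^ p)%R.
Proof.
rewrite RtoC_pow2. unfold Cdiv. rewrite <- RtoC_inv by (apply pow_nonzero; lra). destruct z; simpl; unfold Rdiv; ring.
Qed.

Lemma Im_lattice_pt z l : Im (lattice_pt z l) = (Im z + 2 * PI * IZR l)%R.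
Proof. unfold lattice_pt; destruct z; simpl. ring. Qed.
Lemma Re_lattice_pt z l : Re (lattice_pt z l) = Re z.
Proof. unfold lattice_pt; destruct z; simpl. ring. Qed.

Lemma pt_region p z l : (Cmod z <= 2 ^ p)%R -> (Rabs (IZR l) <= 2 ^ p)%R ->
  (Rabs (Re (lattice_pt z l / 2 ^ S p)) <= 1)%R /\ (Rabs (Im (lattice_pt z l / 2 ^ S p)) <= 4)%R.
Proof.
intros Hz Hl. generalize (pow2_pos p); intros P.
rewrite Re_div_pow2, Im_div_pow2, Re_lattice_pt, Im_lattice_pt. simpl pow.
unfold Rdiv. rewrite !Rabs_mult, Rabs_inv, (Rabs_pos_eq (2 * 2 ^ p)) by lra.
split.
- apply Rmult_le_reg_r with (2 * 2 ^ p)%R; [lra|]. rewrite Rmult_assoc, Rinv_l, Rmult_1_r by lra.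
  generalize (re_le_Cmod z); lra.
- apply Rmult_le_reg_r with (2 * 2 ^ p)%R; [lra|]. rewrite Rmult_assoc, Rinv_l, Rmult_1_r by lra.
  apply Rle_trans with (Rabs (Im z) + 2 * PI * Rabs (IZR l))%R.
  + eapply Rle_trans; [apply Rabs_triang|]. rewrite !Rabs_mult, (Rabs_pos_eq 2), (Rabs_pos_eq PI) by (generalize PI_gt_3; lra). lra.
  + generalize (im_le_Cmod z) PI_lt_32 PI_gt_3 (Rabs_pos (IZR l)). nra.
Qed.

Lemma pt_neq0 p z l : regular z -> lattice_pt z l / 2 ^ p <> 0.
Proof.
intros G E. apply (lattice_pt_neq0 z l G).
replace (lattice_pt z l) with (lattice_pt z l / 2 ^ p * 2 ^ p) by (field; apply pow2_neq0). rewrite E; ring.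
Qed.

Lemma simple_pole_per u : simple_pole (u + 2 * PI * Ci) = simple_pole u.
Proof.
unfold simple_pole. do 2 f_equal. replace (- (u + 2 * PI * Ci)) with (- u + 2 * PI * Ci * IZR (-1)).
- rewrite cexp_plus, cexp_2PI_Z; ring.
- change (IZR (-1)) with (- (1))%R. rewrite RtoC_opp. ring.
Qed.

Lemma half_exp u : cexp (- u) = cexp (- (u / 2)) * cexp (- (u / 2)).
Proof. rewrite <- cexp_plus; f_equal; field. Qed.

Lemma cexp_mPI u : cexp (- (u + PI * Ci)) = - cexp (- u).
Proof.
replace (- (u + PI * Ci)) with (- u + PI * Ci + 2 * PI * Ci * IZR (-1)).
- rewrite !cexp_plus, cexp_2PI_Z, cexp_PI; ring.
- change (IZR (-1)) with (- (1))%R. rewrite RtoC_opp. ring.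
Qed.

Lemma regular_half u : regular u -> 1 - cexp (- (u / 2)) <> 0 /\ 1 + cexp (- (u / 2)) <> 0.
Proof.
unfold regular; rewrite half_exp. set (x := cexp (- (u / 2))). intros G; split; intros E; apply G.
- replace x with (1 - (1 - x)) by ring. rewrite E; ring.
- replace x with ((1 + x) - 1) by ring. rewrite E; ring.
Qed.

Lemma simple_pole_double u : regular u -> simple_pole u = / 2 * (simple_pole (u / 2) + simple_pole (u / 2 + PI * Ci)).
Proof.
intros G. destruct (regular_half u G) as [A B]. unfold simple_pole. rewrite cexp_mPI, half_exp.
set (x := cexp (- (u / 2))) in *. field. repeat split; auto.
- intros E; apply B; rewrite <- E; ring.
- intros E. apply (regular_neq u G). rewrite half_exp. exact E.
Qed.

Lemma double_pole_per u : double_pole (u + 2 * PI * Ci) = double_pole u.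
Proof. unfold double_pole; now rewrite simple_pole_per. Qed.

Lemma double_pole_double u : regular u -> double_pole u = / 4 * (double_pole (u / 2) + double_pole (u / 2 + PI * Ci)).
Proof.
intros G. destruct (regular_half u G) as [A B]. unfold double_pole, simple_pole. rewrite cexp_mPI, half_exp.
set (x := cexp (- (u / 2))) in *. field. repeat split; auto.
- intros E; apply B; rewrite <- E; ring.
- intros E. apply (regular_neq u G). rewrite half_exp. exact E.
Qed.

Lemma is_lim_pow2 : forall M : R, exists P, forall p, (P <= p)%nat -> (M <= 2 ^ p)%R.
Proof.
intros M. destruct (Pow_x_infinity 2 ltac:(rewrite Rabs_pos_eq; lra) M) as [N HN].
exists N. intros p Hp. specialize (HN p Hp). rewrite Rabs_pos_eq in HN by (generalize (pow2_pos p); lra). lra.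
Qed.

Lemma zfold_triangle (F : Z -> C) (B : Z -> R) k : (forall l, (Cmod (F l) <= B l)%R) ->
  (Cmod (F (Z.of_nat k) + F (- Z.of_nat k - 1)%Z) <= B (Z.of_nat k) + B (- Z.of_nat k - 1)%Z)%R.
Proof. intros H. eapply Rle_trans; [apply Cmod_triangle|]. apply Rplus_le_compat; auto. Qed.

(** The finite sums have growing length 2^p; padded with zeros they become series, to which
    Tannery's theorem applies. The bound on [g p l] is asked for |l| <= 2^p only, which covers every
    index that occurs. *)
Lemma partial_fractions (F : Z -> C) (B : Z -> R) (g : nat -> Z -> C) (val : C) :
  (forall l, (0 <= B l)%R) ->
  ex_series (fun k => B (Z.of_nat k) + B (- Z.of_nat k - 1)%Z)%R ->
  (forall p, val = csumn (fun k => g p (Z.of_nat k) + g p (- Z.of_nat k - 1)%Z) (2 ^ p)) ->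
  (exists P, forall p l, (P <= p)%nat -> (Rabs (IZR l) <= 2 ^ p)%R -> (Cmod (g p l) <= B l)%R) ->
  (forall l, (Cmod (F l) <= B l)%R) ->
  (forall l, clim (fun p => g p l) (F l)) ->
  val = zsum F.
Proof.
intros HB EB Hval [P HP] HF HL.
pose (h := fun p k => if (k <? 2 ^ p)%nat then g p (Z.of_nat k) + g p (- Z.of_nat k - 1)%Z else 0).
assert (Hh : forall p, csum (h p) = val).
{ intros p. destruct (csum_finite (h p) (2 ^ p)) as [_ ->].
  - intros k Hk. unfold h. destruct (Nat.ltb_spec k (2 ^ p)); [lia|easy].
  - rewrite (Hval p). apply csumn_ext. intros k Hk. unfold h. destruct (Nat.ltb_spec k (2 ^ p)); [easy|lia]. }
assert (L : clim (fun p => csum (h p)) (zsum F)).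
{ apply (tannery h _ (fun k => B (Z.of_nat k) + B (- Z.of_nat k - 1)%Z)%R P); auto.
  - intros p k Hp. unfold h.
    destruct (Nat.ltb_spec k (2 ^ p)) as [Hk|_].
    + assert (E : (INR k + 1 <= 2 ^ p)%R).
      { rewrite <- S_INR. apply le_INR in Hk. rewrite pow_INR in Hk. exact Hk. }
      eapply Rle_trans; [apply Cmod_triangle|].
      apply Rplus_le_compat; apply HP; auto.
      * rewrite <- INR_IZR_INZ, Rabs_pos_eq by apply pos_INR. lra.
      * rewrite minus_IZR, opp_IZR, <- INR_IZR_INZ, Rabs_left by (generalize (pos_INR k); lra). lra.
    + rewrite Cmod_0. generalize (HB (Z.of_nat k)) (HB (- Z.of_nat k - 1)%Z). lra.
  - intros k. now apply zfold_triangle.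
  - intros k eps He. destruct (HL (Z.of_nat k) (eps/2)%R ltac:(lra)) as [N1 K1].
    destruct (HL (- Z.of_nat k - 1)%Z (eps/2)%R ltac:(lra)) as [N2 K2].
    destruct (is_lim_pow2 (INR k + 1)) as [N3 K3].
    exists (max N1 (max N2 N3)). intros p Hp.
    specialize (K1 p ltac:(lia)). specialize (K2 p ltac:(lia)). specialize (K3 p ltac:(lia)).
    unfold h. destruct (Nat.ltb_spec k (2 ^ p)) as [Hk|Hk].
    + set (a := g p (Z.of_nat k)) in *. set (b := g p (- Z.of_nat k - 1)%Z) in *.
      replace (a + b - (F (Z.of_nat k) + F (- Z.of_nat k - 1)%Z)) with
        ((a - F (Z.of_nat k)) + (b - F (- Z.of_nat k - 1)%Z)) by ring.
      eapply Rle_lt_trans; [apply Cmod_triangle|]. lra.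
    + exfalso. apply le_INR in Hk. rewrite pow_INR in Hk. simpl INR in Hk.
      replace (1 + 1)%R with 2%R in Hk by ring. lra. }
apply (clim_unique (fun p => csum (h p))); auto.
intros eps He. exists O. intros n _. rewrite Hh.
replace (val - val) with (RtoC 0) by ring. rewrite Cmod_0; auto.
Qed.

Lemma clim_pow2_bound (u : nat -> C) (l : C) (M : R) P :
  (forall p, (P <= p)%nat -> (Cmod (u p - l) <= M / 2 ^ p)%R) -> clim u l.
Proof.
intros H eps He. destruct (is_lim_pow2 ((Rabs M + 1) / eps)) as [N HN].
exists (max P N). intros p Hp. specialize (H p ltac:(lia)). specialize (HN p ltac:(lia)).
apply Rle_lt_trans with (1 := H). generalize (pow2_pos p); intros Q.
apply Rmult_lt_reg_r with (2 ^ p)%R; auto. unfold Rdiv. rewrite Rmult_assoc, Rinv_l, Rmult_1_r by lra.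
assert (Rabs M + 1 <= 2 ^ p * eps)%R.
{ apply Rmult_le_reg_r with (/ eps)%R; [apply Rinv_0_lt_compat; auto|].
  rewrite Rmult_assoc, Rinv_r, Rmult_1_r by lra. exact HN. }
generalize (Rle_abs M); lra.
Qed.

Lemma double_pole_partial_fractions z : regular z -> double_pole z = zsum (fun l => / (lattice_pt z l * lattice_pt z l)).
Proof.
intros G.
apply (partial_fractions _ (fun l => 66 * inv2 z l)%R (fun p l => (/4) ^ S p * double_pole (lattice_pt z l / 2 ^ S p))).
- intros l; generalize (inv2_pos z l G); lra.
- apply (ex_series_ext (fun k => 66 * (inv2 z (Z.of_nat k) + inv2 z (- Z.of_nat k - 1)))%R); [intros; simpl; ring|].
  apply ex_series_scalR, ex_series_inv2, G.
- intros p. rewrite (doubling_fold double_pole (/4) double_pole_per double_pole_double p z G), <- csumn_scal.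
  apply csumn_ext; intros; ring.
- destruct (is_lim_pow2 (Cmod z)) as [P HP]. exists P. intros p l Hp Hl.
  destruct (pt_region p z l (HP p Hp) Hl) as [A B].
  rewrite Cmod_mult. eapply Rle_trans; [apply Rmult_le_compat_l; [apply Cmod_ge_0|apply double_pole_bound; auto; now apply pt_neq0]|].
  rewrite Cmod_div_pow2, Cmod_pow. assert (Z := proj1 (Cmod_gt_0 _) (lattice_pt_neq0 z l G)).
  rewrite <- RtoC_inv by lra. rewrite Cmod_R, Rabs_pos_eq by lra. unfold inv2.
  right. rewrite pow_inv. replace (4 ^ S p)%R with (2 ^ S p * 2 ^ S p)%R by (rewrite <- Rpow_mult_distr; f_equal; lra).
  generalize (pow2_pos (S p)). intros Q. field. lra.
- intros l. assert (Z := proj1 (Cmod_gt_0 _) (lattice_pt_neq0 z l G)).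
  assert (N := lattice_pt_neq0 z l G).
  rewrite Cmod_inv by (apply Cmod_gt_0; rewrite Cmod_mult; nra). rewrite Cmod_mult. fold (inv2 z l).
  generalize (inv2_pos z l G); lra.
- intros l. set (v := lattice_pt z l). assert (N := lattice_pt_neq0 z l G). fold v in N.
  assert (Z := proj1 (Cmod_gt_0 _) N).
  destruct (is_lim_pow2 (Cmod v)) as [P HP].
  apply (clim_pow2_bound _ _ (200 / Cmod v)%R P). intros p Hp. specialize (HP p Hp).
  set (u := v / 2 ^ S p). generalize (pow2_pos p); intros Q.
  assert (U : Cmod u = (Cmod v / (2 * 2 ^ p))%R) by (unfold u; rewrite Cmod_div_pow2; reflexivity).
  assert (U1 : (Cmod u <= 1)%R).
  { rewrite U. apply Rmult_le_reg_r with (2 * 2 ^ p)%R; [lra|]. unfold Rdiv.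
    rewrite Rmult_assoc, Rinv_l, Rmult_1_r, Rmult_1_l by lra. lra. }
  assert (K := double_pole_near0 u (pt_neq0 (S p) z l G) U1).
  replace ((/4) ^ S p * double_pole u - / (v * v)) with (/ (v * v) * (u * u * double_pole u - 1)).
  + rewrite Cmod_mult, Cmod_inv, Cmod_mult by (apply Cmod_gt_0; rewrite Cmod_mult; nra).
    apply Rle_trans with (/ (Cmod v * Cmod v) * (400 * Cmod u))%R.
    * apply Rmult_le_compat_l; auto. left; apply Rinv_0_lt_compat; nra.
    * rewrite U. right. field. lra.
  + replace ((/4) ^ S p) with (/ (2 ^ S p * 2 ^ S p)).
    * unfold u. field. repeat split; auto. apply pow2_neq0.
    * rewrite !RtoC_pow2, <- RtoC_inv by lra. rewrite <- RtoC_pow, <- RtoC_mult, <- RtoC_inv by (generalize (pow2_pos (S p)); intros; nra). f_equal.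
      rewrite <- Rpow_mult_distr, pow_inv. f_equal.
Qed.

Lemma cabs_inv2_double_pole z : regular z -> zabs (fun l => / (lattice_pt z l * lattice_pt z l)).
Proof.
intros G. apply (cabs_dom _ (fun k => inv2 z (Z.of_nat k) + inv2 z (- Z.of_nat k - 1))%R); [|now apply ex_series_inv2].
intros n. eapply Rle_trans; [apply Cmod_triangle|].
assert (K : forall l, Cmod (/ (lattice_pt z l * lattice_pt z l)) = inv2 z l).
{ intros l. assert (N := lattice_pt_neq0 z l G). assert (Z := proj1 (Cmod_gt_0 _) N).
  rewrite Cmod_inv by (apply Cmod_gt_0; rewrite Cmod_mult; nra). now rewrite Cmod_mult. }
rewrite !K. lra.
Qed.


Lemma inv_mult_le a b : (0 < a)%R -> (0 < b)%R -> (/ (a * b) <= / (a * a) + / (b * b))%R.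
Proof.
intros Ha Hb. rewrite !Rinv_mult. generalize (Rinv_0_lt_compat _ Ha) (Rinv_0_lt_compat _ Hb). nra.
Qed.

Lemma simple_pole_diff_bound u v : u <> RtoC 0 -> v <> RtoC 0 ->
  (Rabs (Re u) <= 1)%R -> (Rabs (Im u) <= 4)%R -> (Rabs (Re v) <= 1)%R -> (Rabs (Im v) <= 4)%R ->
  (Cmod (u - v) <= 1)%R -> (Cmod (simple_pole u - simple_pole v) <= 324 * Cmod (u - v) / (Cmod u * Cmod v))%R.
Proof.
intros Nu Nv A1 A2 B1 B2 D.
assert (Gu := regular_neq _ (regular_small u Nu A1 A2)). assert (Gv := regular_neq _ (regular_small v Nv B1 B2)).
replace (simple_pole u - simple_pole v) with (simple_pole u * simple_pole v * (cexp (- v) * (cexp (- (u - v)) - 1))).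
- rewrite !Cmod_mult, Cmod_cexp.
  assert (E1 : (exp (Re (- v)) <= 3)%R).
  { apply exp_le_3R. destruct v; simpl in *. generalize (Rle_abs (-r)). rewrite Rabs_Ropp; lra. }
  assert (E2 := cexp_m1_bound (- (u - v))). rewrite Cmod_opp in E2.
  assert (E3 := exp_le_3R _ D).
  assert (K1 := simple_pole_bound u Nu A1 A2). assert (K2 := simple_pole_bound v Nv B1 B2).
  assert (P1 := proj1 (Cmod_gt_0 u) Nu). assert (P2 := proj1 (Cmod_gt_0 v) Nv).
  replace (324 * Cmod (u - v) / (Cmod u * Cmod v))%R with
   (6 / Cmod u * (6 / Cmod v) * (3 * (Cmod (u - v) * 3)))%R by (field; lra).
  apply Rmult_le_compat.
  + apply Rmult_le_pos; apply Cmod_ge_0.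
  + apply Rmult_le_pos; [left; apply exp_pos|apply Cmod_ge_0].
  + apply Rmult_le_compat; auto using Cmod_ge_0.
  + apply Rmult_le_compat; auto using Cmod_ge_0.
    * left; apply exp_pos.
    * apply Rle_trans with (1 := E2). apply Rmult_le_compat_l; auto using Cmod_ge_0.
- unfold simple_pole. rewrite ?Cmult_minus_distr_l.
  replace (cexp (- v) * (cexp (- (u - v)) - 1)) with (cexp (- u) - cexp (- v)).
  + field. auto.
  + replace (- u) with (- v + - (u - v)) at 1 by ring. rewrite cexp_plus. ring.
Qed.

(** The pole series of a single point converges only conditionally. For the difference at two points
    the terms are of order 1 / l^2, and any additive constant cancels. *)
Lemma simple_pole_partial_fractions z w : regular z -> regular w ->
  simple_pole z - simple_pole w = zsum (fun l => / lattice_pt z l - / lattice_pt w l).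
Proof.
intros Gz Gw.
pose (K := (324 * Cmod (z - w))%R).
assert (HK : (0 <= K)%R) by (unfold K; generalize (Cmod_ge_0 (z - w)); lra).
assert (D : forall p l, lattice_pt z l / 2 ^ S p - lattice_pt w l / 2 ^ S p = (z - w) / 2 ^ S p).
{ intros. unfold lattice_pt. field. apply pow2_neq0. }
apply (partial_fractions _ (fun l => K * (inv2 z l + inv2 w l))%R
  (fun p l => (/2) ^ S p * (simple_pole (lattice_pt z l / 2 ^ S p) - simple_pole (lattice_pt w l / 2 ^ S p)))).
- intros l; generalize (inv2_pos z l Gz) (inv2_pos w l Gw); nra.
- apply (ex_series_ext (fun k => K * ((inv2 z (Z.of_nat k) + inv2 z (- Z.of_nat k - 1)) +
    (inv2 w (Z.of_nat k) + inv2 w (- Z.of_nat k - 1))))%R); [intros; simpl; ring|].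
  apply ex_series_scalR, ex_series_plusR; apply ex_series_inv2; auto.
- intros p. rewrite (doubling_fold simple_pole (/2) simple_pole_per simple_pole_double p z Gz).
  rewrite (doubling_fold simple_pole (/2) simple_pole_per simple_pole_double p w Gw).
  rewrite <- !csumn_scal.
  replace (csumn _ _ - csumn _ _) with (csumn (fun k => (/2) ^ S p * (simple_pole (lattice_pt z (Z.of_nat k) / 2 ^ S p) +
     simple_pole (lattice_pt z (- Z.of_nat k - 1) / 2 ^ S p))) (2 ^ p) + (-(1)) * csumn (fun k => (/2) ^ S p * (simple_pole (lattice_pt w (Z.of_nat k) / 2 ^ S p) +
     simple_pole (lattice_pt w (- Z.of_nat k - 1) / 2 ^ S p))) (2 ^ p)) by ring.
  rewrite <- csumn_scal, <- csumn_plus. apply csumn_ext; intros; ring.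
- destruct (is_lim_pow2 (Cmod z)) as [P1 H1]. destruct (is_lim_pow2 (Cmod w)) as [P2 H2].
  destruct (is_lim_pow2 (Cmod (z - w))) as [P3 H3].
  exists (max P1 (max P2 P3)). intros p l Hp Hl.
  destruct (pt_region p z l (H1 p ltac:(lia)) Hl) as [X1 X2].
  destruct (pt_region p w l (H2 p ltac:(lia)) Hl) as [Y1 Y2].
  specialize (H3 p ltac:(lia)).
  generalize (pow2_pos p); intros Q.
  assert (U1 : (Cmod (lattice_pt z l / 2 ^ S p - lattice_pt w l / 2 ^ S p) <= 1)%R).
  { rewrite D, Cmod_div_pow2. simpl pow. apply Rmult_le_reg_r with (2 * 2 ^ p)%R; [lra|]. unfold Rdiv.
    rewrite Rmult_assoc, Rinv_l, Rmult_1_r, Rmult_1_l by lra. lra. }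
  assert (B := simple_pole_diff_bound _ _ (pt_neq0 (S p) z l Gz) (pt_neq0 (S p) w l Gw) X1 X2 Y1 Y2 U1).
  rewrite Cmod_mult, Cmod_pow. rewrite <- RtoC_inv by lra. rewrite Cmod_R, Rabs_pos_eq by lra.
  eapply Rle_trans; [apply Rmult_le_compat_l; [apply pow_le; lra|exact B]|].
  rewrite D, !Cmod_div_pow2, pow_inv.
  assert (P1' := proj1 (Cmod_gt_0 _) (lattice_pt_neq0 z l Gz)). assert (P2' := proj1 (Cmod_gt_0 _) (lattice_pt_neq0 w l Gw)).
  generalize (pow2_pos (S p)); intros Q'.
  apply Rle_trans with (K * / (Cmod (lattice_pt z l) * Cmod (lattice_pt w l)))%R.
  + right. unfold K. field. lra.
  + apply Rmult_le_compat_l; auto. now apply inv_mult_le.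
- intros l. assert (P1' := proj1 (Cmod_gt_0 _) (lattice_pt_neq0 z l Gz)). assert (P2' := proj1 (Cmod_gt_0 _) (lattice_pt_neq0 w l Gw)).
  assert (N1 := lattice_pt_neq0 z l Gz). assert (N2 := lattice_pt_neq0 w l Gw).
  replace (/ lattice_pt z l - / lattice_pt w l) with (- (z - w) * (/ lattice_pt z l * / lattice_pt w l)).
  + rewrite !Cmod_mult, Cmod_opp, !Cmod_inv, <- Rinv_mult by auto.
    apply Rle_trans with (K * / (Cmod (lattice_pt z l) * Cmod (lattice_pt w l)))%R.
    * apply Rmult_le_compat_r; [left; apply Rinv_0_lt_compat; nra|]. unfold K; generalize (Cmod_ge_0 (z-w)); lra.
    * apply Rmult_le_compat_l; auto. now apply inv_mult_le.
  + transitivity ((lattice_pt w l - lattice_pt z l) * (/ lattice_pt z l * / lattice_pt w l)); [f_equal; unfold lattice_pt; ring|]. field; auto.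
- assert (L1 : forall z, regular z -> forall l, exists P, forall p, (P <= p)%nat ->
    (Cmod ((/2) ^ S p * simple_pole (lattice_pt z l / 2 ^ S p) - / lattice_pt z l) <= 18 / 2 ^ p)%R).
  { clear. intros z G l. set (v := lattice_pt z l). assert (N := lattice_pt_neq0 z l G). fold v in N.
    assert (Z := proj1 (Cmod_gt_0 _) N).
    destruct (is_lim_pow2 (Cmod v)) as [P HP]. exists P. intros p Hp. specialize (HP p Hp).
    set (u := v / 2 ^ S p). generalize (pow2_pos p); intros Q.
    assert (U : Cmod u = (Cmod v / (2 * 2 ^ p))%R) by (unfold u; rewrite Cmod_div_pow2; reflexivity).
    assert (U1 : (Cmod u <= 1)%R).
    { rewrite U. apply Rmult_le_reg_r with (2 * 2 ^ p)%R; [lra|]. unfold Rdiv.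
      rewrite Rmult_assoc, Rinv_l, Rmult_1_r, Rmult_1_l by lra. lra. }
    assert (K := simple_pole_near0 u (pt_neq0 (S p) z l G) U1).
    replace ((/2) ^ S p * simple_pole u - / v) with (/ v * (u * simple_pole u - 1)).
    + rewrite Cmod_mult, Cmod_inv by auto.
      apply Rle_trans with (/ (Cmod v) * (18 * Cmod u))%R.
      * apply Rmult_le_compat_l; auto. left; apply Rinv_0_lt_compat; nra.
      * rewrite U. apply Rle_trans with (9 / 2 ^ p)%R; [right; field; lra|].
        apply Rmult_le_compat_r; [left; apply Rinv_0_lt_compat; lra|lra].
    + replace ((/2) ^ S p) with (/ (2 ^ S p)).
      * unfold u. field. repeat split; auto. apply pow2_neq0.
      * rewrite !RtoC_pow2, <- RtoC_inv by (generalize (pow2_pos (S p)); lra).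
        rewrite <- RtoC_inv by lra. rewrite <- RtoC_pow, pow_inv. reflexivity. }
  intros l. destruct (L1 z Gz l) as [P1 H1]. destruct (L1 w Gw l) as [P2 H2].
  apply (clim_pow2_bound _ _ 36 (max P1 P2)). intros p Hp.
  specialize (H1 p ltac:(lia)). specialize (H2 p ltac:(lia)).
  set (a := (/ 2) ^ S p * simple_pole (lattice_pt z l / 2 ^ S p)) in *.
  set (b := (/ 2) ^ S p * simple_pole (lattice_pt w l / 2 ^ S p)) in *.
  replace (_ - _) with ((a - / lattice_pt z l) + - (b - / lattice_pt w l)) by (unfold a, b; ring).
  eapply Rle_trans; [apply Cmod_triangle|]. rewrite Cmod_opp.
  replace (36 / 2 ^ p)%R with (18 / 2 ^ p + 18 / 2 ^ p)%R by (unfold Rdiv; ring). lra.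
Qed.


Lemma zabs_ext (a b : Z -> C) : (forall l, a l = b l) -> zabs a -> zabs b.
Proof. intros H; apply cabs_ext; intros; now rewrite !H. Qed.

Lemma zsum_ext (a b : Z -> C) : (forall l, a l = b l) -> zsum a = zsum b.
Proof. intros H; apply csum_ext; intros; now rewrite !H. Qed.

Lemma cabs_minus a b : cabs a -> cabs b -> cabs (fun n => a n - b n).
Proof. intros; apply cabs_plus; auto. now apply cabs_opp. Qed.

Lemma zabs_minus a b : zabs a -> zabs b -> zabs (fun l => a l - b l).
Proof.
intros Ha Hb. eapply cabs_ext; [|exact (cabs_minus _ _ Ha Hb)]. intros n; simpl; ring.
Qed.

Lemma zsum_minus a b : zabs a -> zabs b -> zsum (fun l => a l - b l) = zsum a - zsum b.
Proof.
intros Ha Hb. unfold zsum. rewrite <- csum_minus; auto. apply csum_ext; intros; ring.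
Qed.

Lemma zabs_scal c a : zabs a -> zabs (fun l => c * a l).
Proof. intros Ha. eapply cabs_ext; [|exact (cabs_scal c _ Ha)]. intros n; simpl; ring. Qed.

Lemma zsum_scal c a : zabs a -> zsum (fun l => c * a l) = c * zsum a.
Proof.
intros Ha. unfold zsum. rewrite <- csum_scal; auto. apply csum_ext; intros; ring.
Qed.

Lemma zabs_dom (a : Z -> C) (b : nat -> R) : (forall i, (Cmod (a (Z.of_nat i)) <= b i)%R) ->
  (forall i, (Cmod (a (- Z.of_nat i - 1)%Z) <= b i)%R) -> ex_series b -> zabs a.
Proof.
intros H1 H2 E. apply (cabs_dom _ (fun i => 2 * b i)%R); [|now apply ex_series_scalR].
intros i. eapply Rle_trans; [apply Cmod_triangle|]. specialize (H1 i); specialize (H2 i); lra.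
Qed.

Lemma ztelescope (X : Z -> C) A B : zabs (fun k => X k - X (k + 1)%Z) ->
  clim (fun n => X (Z.of_nat n)) A -> clim (fun n => X (- Z.of_nat n)%Z) B ->
  zsum (fun k => X k - X (k + 1)%Z) = B - A.
Proof.
intros H HA HB.
assert (E : forall n, csumn (fun n => X (Z.of_nat n) - X (Z.of_nat n + 1)%Z +
   (X (- Z.of_nat n - 1)%Z - X (- Z.of_nat n - 1 + 1)%Z)) n = X (- Z.of_nat n)%Z - X (Z.of_nat n)).
{ induction n; [simpl; ring|]. simpl csumn. rewrite IHn.
  replace (Z.of_nat n + 1)%Z with (Z.of_nat (S n)) by lia.
  replace (- Z.of_nat n - 1 + 1)%Z with (- Z.of_nat n)%Z by lia.
  replace (- Z.of_nat n - 1)%Z with (- Z.of_nat (S n))%Z by lia. ring. }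
apply (clim_unique _ _ _ (csumn_lim _ H)).
intros eps He. destruct (HA (eps/2)%R ltac:(lra)) as [N1 K1]. destruct (HB (eps/2)%R ltac:(lra)) as [N2 K2].
exists (max N1 N2). intros n Hn. rewrite E.
specialize (K1 n ltac:(lia)). specialize (K2 n ltac:(lia)).
replace (X (- Z.of_nat n)%Z - X (Z.of_nat n) - (B - A)) with
 ((X (- Z.of_nat n)%Z - B) + - (X (Z.of_nat n) - A)) by ring.
eapply Rle_lt_trans; [apply Cmod_triangle|]. rewrite Cmod_opp. lra.
Qed.

(** The double series over pairs of integers is folded to nonnegative indices, each cell collecting
    four terms, so that [fubini_C] applies with majorant [4 * b]. *)
Lemma zfubini (G : Z -> Z -> C) (b : nat -> nat -> R) :
  (forall k l i j, (k = Z.of_nat i \/ k = (- Z.of_nat i - 1)%Z) -> (l = Z.of_nat j \/ l = (- Z.of_nat j - 1)%Z) ->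
     (Cmod (G k l) <= b i j)%R) ->
  (forall i, ex_series (b i)) -> ex_series (fun i => Series (b i)) ->
  (forall k, zabs (G k)) /\ (forall l, zabs (fun k => G k l)) /\ zabs (fun k => zsum (G k)) /\
  zsum (fun l => zsum (fun k => G k l)) = zsum (fun k => zsum (G k)).
Proof.
intros D E1 E2.
assert (P : forall i j, (0 <= b i j)%R).
{ intros i j. eapply Rle_trans; [apply Cmod_ge_0|]. apply (D (Z.of_nat i) (Z.of_nat j)); auto. }
destruct (fubini_pos b P E1 E2) as (F1 & F2 & _).
assert (HI : forall k, exists i, k = Z.of_nat i \/ k = (- Z.of_nat i - 1)%Z).
{ intros k. destruct (Z_le_gt_dec 0 k); [exists (Z.to_nat k); lia|exists (Z.to_nat (- k - 1)); lia]. }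
assert (R1 : forall k, zabs (G k)).
{ intros k. destruct (HI k) as [i Hi]. apply (zabs_dom _ (b i)); auto. }
assert (R2 : forall l, zabs (fun k => G k l)).
{ intros l. destruct (HI l) as [j Hj]. apply (zabs_dom _ (fun i => b i j)); auto. }
assert (R3 : forall k i, (k = Z.of_nat i \/ k = (- Z.of_nat i - 1)%Z) -> (Cmod (zsum (G k)) <= 2 * Series (b i))%R).
{ intros k i Hi. rewrite <- Series_scal_l. apply Cmod_csum_le; [|now apply ex_series_scalR].
  intros j. eapply Rle_trans; [apply Cmod_triangle|].
  generalize (D k (Z.of_nat j) i j Hi (or_introl eq_refl)) (D k (- Z.of_nat j - 1)%Z i j Hi (or_intror eq_refl)). lra. }
split; [exact R1|]. split; [exact R2|]. split.
- apply (zabs_dom _ (fun i => 2 * Series (b i))%R); auto. now apply ex_series_scalR.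
- pose (a := fun i j => (G (Z.of_nat i) (Z.of_nat j) + G (Z.of_nat i) (- Z.of_nat j - 1)%Z) +
    (G (- Z.of_nat i - 1)%Z (Z.of_nat j) + G (- Z.of_nat i - 1)%Z (- Z.of_nat j - 1)%Z)).
  transitivity (csum (fun j => csum (fun i => a i j))).
  + unfold zsum at 1. apply csum_ext. intros j.
    unfold zsum. rewrite <- csum_plus by apply R2. apply csum_ext. intros i; unfold a; ring.
  + rewrite (fubini_C a (fun i j => 4 * b i j)%R).
    * apply csum_ext. intros i. unfold zsum. rewrite <- csum_plus by apply R1. apply csum_ext. intros j; unfold a; ring.
    * intros i j. unfold a. eapply Rle_trans; [apply Cmod_triangle|].
      eapply Rle_trans; [apply Rplus_le_compat; apply Cmod_triangle|].
      generalize (D (Z.of_nat i) (Z.of_nat j) i j (or_introl eq_refl) (or_introl eq_refl))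
        (D (Z.of_nat i) (- Z.of_nat j - 1)%Z i j (or_introl eq_refl) (or_intror eq_refl))
        (D (- Z.of_nat i - 1)%Z (Z.of_nat j) i j (or_intror eq_refl) (or_introl eq_refl))
        (D (- Z.of_nat i - 1)%Z (- Z.of_nat j - 1)%Z i j (or_intror eq_refl) (or_intror eq_refl)). lra.
    * intros i; now apply ex_series_scalR.
    * apply (ex_series_ext (fun i => 4 * Series (b i))%R); [intros; now rewrite <- Series_scal_l|now apply ex_series_scalR].
Qed.

(* A telescoping majorant of 1 / (i + j + 1)^3. *)
Definition cube_bound (i j : nat) : R :=
  (/ ((INR i + INR j + 1) * (INR i + INR j + 2)) - / ((INR i + INR j + 2) * (INR i + INR j + 3)))%R.

Lemma cube_bound_lower i j : (/ ((INR i + INR j + 1) * (INR i + INR j + 1) * (INR i + INR j + 1)) <= 3 * cube_bound i j)%R.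
Proof.
unfold cube_bound. generalize (pos_INR i) (pos_INR j); intros. set (x := (INR i + INR j + 1)%R).
replace (INR i + INR j + 2)%R with (x + 1)%R by (unfold x; ring).
replace (INR i + INR j + 3)%R with (x + 2)%R by (unfold x; ring).
assert (1 <= x)%R by (unfold x; lra).
replace (3 * (/ (x * (x + 1)) - / ((x + 1) * (x + 2))))%R with (/ (x * (x + 1) * (x + 2) / 6))%R by (field; lra).
apply Rinv_le_contravar; [|].
- unfold Rdiv; apply Rmult_lt_0_compat; [|lra]. apply Rmult_lt_0_compat; nra.
- assert (0 <= x * (x - 1) * (5 * x + 2))%R by (apply Rmult_le_pos; [apply Rmult_le_pos|]; lra). nra.
Qed.

Lemma cube_bound_pos i j : (0 <= cube_bound i j)%R.
Proof.
generalize (cube_bound_lower i j) (pos_INR i) (pos_INR j); intros.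
assert (0 < / ((INR i + INR j + 1) * (INR i + INR j + 1) * (INR i + INR j + 1)))%R; [|lra].
apply Rinv_0_lt_compat. apply Rmult_lt_0_compat; [apply Rmult_lt_0_compat|]; lra.
Qed.

Lemma cube_bound_summable : (forall i, ex_series (cube_bound i)) /\ ex_series (fun i => Series (cube_bound i)).
Proof.
assert (B : forall i, ex_series (cube_bound i) /\ (Series (cube_bound i) <= / ((INR i + 1) * (INR i + 1)))%R).
{ intros i. generalize (pos_INR i); intros Pi.
  apply bounded_ex_series; [apply cube_bound_pos|].
  assert (E : forall n, (rsum (cube_bound i) n = / ((INR i + 1) * (INR i + 2)) - / ((INR i + INR n + 1) * (INR i + INR n + 2)))%R).
  { induction n; simpl rsum.
    - simpl INR. replace (INR i + 0)%R with (INR i) by ring. ring.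
    - rewrite IHn. unfold cube_bound. rewrite S_INR. replace (INR i + (INR n + 1) + 1)%R with (INR i + INR n + 2)%R by ring.
      replace (INR i + (INR n + 1) + 2)%R with (INR i + INR n + 3)%R by ring. ring. }
  intros n. rewrite E. generalize (pos_INR n); intros Pn.
  assert (0 < / ((INR i + INR n + 1) * (INR i + INR n + 2)))%R by (apply Rinv_0_lt_compat; nra).
  assert (/ ((INR i + 1) * (INR i + 2)) <= / ((INR i + 1) * (INR i + 1)))%R by (apply Rinv_le_contravar; nra).
  lra. }
split; [intros; apply B|].
apply (ex_series_dom _ (fun i => / ((INR i + 1) * (INR i + 1)))%R); [|apply ex_series_inv_sq].
intros i; split; [|apply B]. apply Series_ge0; [apply cube_bound_pos|apply B].
Qed.

Lemma simple_pole_opp z : regular z -> simple_pole (- z) = 1 - simple_pole z.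
Proof.
intros G. unfold simple_pole. replace (- - z) with z by ring. assert (N := regular_neq z G).
replace (cexp z) with (/ cexp (- z)) by (rewrite <- cexp_opp; f_equal; ring).
assert (N' := cexp_neq0 (- z)). field. repeat split; auto.
intros E. apply N. replace (1 - cexp (- z)) with (- (cexp (- z) - 1)) by ring. rewrite E; ring.
Qed.

Lemma double_pole_opp z : regular z -> double_pole (- z) = double_pole z.
Proof. intros G. unfold double_pole. rewrite simple_pole_opp; auto. ring. Qed.

Lemma regular_Re z : Re z <> 0%R -> regular z.
Proof.
intros N E. assert (H : Cmod (cexp (- z)) = 1%R) by (rewrite E; apply Cmod_1).
rewrite Cmod_cexp in H. destruct z as [x y]; simpl in *.
assert (- x = 0)%R by (apply exp_inv; rewrite exp_0; auto). lra.
Qed.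

Lemma double_pole_exp z : regular z -> double_pole z = cexp (- z) * (simple_pole z * simple_pole z).
Proof. intros G. unfold double_pole, simple_pole. field. now apply regular_neq. Qed.

Lemma Cmod_simple_pole_pos z s : (0 < s)%R -> (s <= Re z)%R -> (Cmod (simple_pole z) <= / (1 - exp (- s)))%R.
Proof.
intros Hs H. assert (G : regular z) by (apply regular_Re; lra).
assert (E : (exp (- s) < 1)%R) by (rewrite <- exp_0; apply exp_increasing; lra).
unfold simple_pole. rewrite Cmod_inv by now apply regular_neq. apply Rinv_le_contravar; [lra|].
assert (T := Cmod_triangle (1 - cexp (-z)) (cexp (- z))).
replace (1 - cexp (- z) + cexp (- z)) with (RtoC 1) in T by ring. rewrite Cmod_1, Cmod_cexp in T.
assert (exp (Re (- z)) <= exp (- s))%R by (apply exp_le_mono; destruct z; simpl in *; lra). lra.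
Qed.

Lemma Cmod_double_pole_pos z s : (0 < s)%R -> (s <= Re z)%R ->
  (Cmod (double_pole z) <= exp (- Re z) * (/ (1 - exp (- s)) * / (1 - exp (- s))))%R.
Proof.
intros Hs H. rewrite double_pole_exp by (apply regular_Re; lra). rewrite !Cmod_mult, Cmod_cexp.
assert (K := Cmod_simple_pole_pos z s Hs H). replace (Re (- z)) with (- Re z)%R by (destruct z; reflexivity).
apply Rmult_le_compat_l; [left; apply exp_pos|]. apply Rmult_le_compat; auto using Cmod_ge_0.
Qed.

Lemma exp_opp_inv_bound x : (0 < x)%R -> (exp (- x) <= / x)%R.
Proof.
intros H. rewrite exp_Ropp. apply Rinv_le_contravar; auto. generalize (exp_ineq1_le x); lra.
Qed.

Lemma clim_inv_bound (u : nat -> C) (l : C) (M : R) :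
  (forall n, (Cmod (u n - l) <= M * / (INR n + 1))%R) -> clim u l.
Proof.
intros H eps He. destruct (nfloor_ex ((Rabs M + 1) / eps)) as [N [_ HN]].
- unfold Rdiv; apply Rmult_le_pos; [generalize (Rabs_pos M); lra|left; now apply Rinv_0_lt_compat].
- exists N. intros n Hn. apply Rle_lt_trans with (1 := H n). apply le_INR in Hn.
  generalize (pos_INR n); intros Pn.
  apply Rmult_lt_reg_r with (INR n + 1)%R; [lra|]. rewrite Rmult_assoc, Rinv_l, Rmult_1_r by lra.
  assert (Rabs M + 1 < (INR N + 1) * eps)%R.
  { apply Rmult_lt_reg_r with (/ eps)%R; [now apply Rinv_0_lt_compat|].
    rewrite Rmult_assoc, Rinv_r, Rmult_1_r by lra. exact HN. }
  generalize (Rle_abs M). nra.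
Qed.

(** * Transformation of the Lambert series *)

Section Eisenstein.
Variable tau : C.
Hypothesis Htau : (0 < Re tau)%R.

Let mt (k : Z) : C := RtoC (2 * IZR k + 1) * tau.

Lemma Re_RtoC_mult x z : Re (RtoC x * z) = (x * Re z)%R.
Proof. destruct z; simpl; ring. Qed.
Lemma odd_abs k i : (k = Z.of_nat i \/ k = (- Z.of_nat i - 1)%Z) -> (Rabs (2 * IZR k + 1) = 2 * INR i + 1)%R.
Proof.
generalize (pos_INR i); intros P.
intros [->| ->]; rewrite ?minus_IZR, ?opp_IZR, <- ?INR_IZR_INZ.
- rewrite Rabs_pos_eq; lra.
- rewrite Rabs_left; lra.
Qed.

Lemma odd_abs_next k i : (k = Z.of_nat i \/ k = (- Z.of_nat i - 1)%Z) ->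
  ((INR i + 1) / 2 <= Rabs (2 * IZR (k + 1) + 1))%R.
Proof.
generalize (pos_INR i); intros P.
intros [->| ->]; rewrite plus_IZR, ?minus_IZR, ?opp_IZR, <- ?INR_IZR_INZ.
- rewrite Rabs_pos_eq; lra.
- destruct i as [|i]; [simpl; rewrite Rabs_pos_eq; lra|]. rewrite S_INR in *.
  generalize (pos_INR i); intros Q. rewrite Rabs_left1; lra.
Qed.

Lemma odd_neq0 k : (2 * IZR k + 1 <> 0)%R.
Proof.
intros E. assert (IZR (2 * k + 1) = 0)%R by (rewrite plus_IZR, mult_IZR; lra).
apply eq_IZR in H. lia.
Qed.

Lemma mt_regular k : regular (mt k).
Proof.
apply regular_Re. unfold mt. rewrite Re_RtoC_mult. generalize (odd_neq0 k). intros N E.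
apply Rmult_integral in E. lra.
Qed.

(** Chosen so that |2k+1| + |l| is at most [kap] times the modulus of the lattice point: its real
    part controls 2k+1, and the triangle inequality then controls l. *)
Let kap : R := (1 / Re tau + (1 + Cmod tau / Re tau))%R.

Lemma kap_pos : (0 < kap)%R.
Proof.
unfold kap. assert (0 < 1 / Re tau)%R by (unfold Rdiv; rewrite Rmult_1_l; now apply Rinv_0_lt_compat).
assert (0 <= Cmod tau / Re tau)%R; [|lra].
apply Rmult_le_pos; [apply Cmod_ge_0|left; now apply Rinv_0_lt_compat].
Qed.

Lemma lattice_lower k l : (Rabs (2 * IZR k + 1) + Rabs (IZR l) <= kap * Cmod (lattice_pt (mt k) l))%R.
Proof.
set (M := Rabs (2 * IZR k + 1)). set (u := lattice_pt (mt k) l).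
assert (H1 : (M * Re tau <= Cmod u)%R).
{ apply Rle_trans with (2 := re_le_Cmod u). unfold u. rewrite Re_lattice_pt. unfold mt.
  rewrite Re_RtoC_mult, Rabs_mult, (Rabs_pos_eq (Re tau)) by lra. fold M. lra. }
assert (H2 : (2 * PI * Rabs (IZR l) <= Cmod u + M * Cmod tau)%R).
{ rewrite <- Cmod_2PIi. replace (2 * PI * Ci * IZR l) with (u + - mt k) by (unfold u, lattice_pt; ring).
  eapply Rle_trans; [apply Cmod_triangle|]. rewrite Cmod_opp. unfold mt. rewrite Cmod_mult, Cmod_R. unfold M; lra. }
assert (Q : (0 <= Cmod tau)%R) by apply Cmod_ge_0.
assert (H3 : (M <= Cmod u * / Re tau)%R).
{ apply Rmult_le_reg_r with (Re tau); auto. rewrite Rmult_assoc, Rinv_l; lra. }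
assert (H4 : (Rabs (IZR l) <= 2 * PI * Rabs (IZR l))%R) by (generalize PI_gt_3 (Rabs_pos (IZR l)); nra).
unfold kap, Rdiv. rewrite Rmult_1_l.
assert (M * Cmod tau <= Cmod u * / Re tau * Cmod tau)%R by (apply Rmult_le_compat_r; auto).
nra.
Qed.

(** The double series of [aa] converges only conditionally, so its two orders of summation may
    differ. Subtracting [bb], which mixes neighbouring rows and telescopes in k, leaves terms of
    cubic decay, for which Fubini holds. *)
Let aa (k l : Z) : C := / (lattice_pt (mt k) l * lattice_pt (mt k) l).
Let bb (k l : Z) : C := / (lattice_pt (mt k) l * lattice_pt (mt (k + 1)) l).

Lemma tau_neq0 : tau <> 0.
Proof. intros E. rewrite E in Htau. simpl in Htau. lra. Qed.

Lemma mt_next k l : lattice_pt (mt (k + 1)) l - lattice_pt (mt k) l = 2 * tau.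
Proof.
unfold lattice_pt, mt. rewrite plus_IZR. replace (2 * (IZR k + 1) + 1)%R with ((2 * IZR k + 1) + 2)%R by ring.
rewrite !RtoC_plus. ring.
Qed.

Lemma bb_diff k l : bb k l = / (2 * tau) * (/ lattice_pt (mt k) l - / lattice_pt (mt (k + 1)) l).
Proof.
assert (N1 := lattice_pt_neq0 _ l (mt_regular k)). assert (N2 := lattice_pt_neq0 _ l (mt_regular (k+1))).
assert (N := tau_neq0).
transitivity (/ (2 * tau) * ((lattice_pt (mt (k + 1)) l - lattice_pt (mt k) l) * (/ lattice_pt (mt k) l * / lattice_pt (mt (k + 1)) l))).
- rewrite mt_next. unfold bb. field. repeat split; auto.
- f_equal. field. auto.
Qed.

Lemma aabb_bound k l i j : (k = Z.of_nat i \/ k = (- Z.of_nat i - 1)%Z) -> (l = Z.of_nat j \/ l = (- Z.of_nat j - 1)%Z) ->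
  (Cmod (aa k l - bb k l) <= (12 * Cmod tau * (kap * kap * kap)) * cube_bound i j)%R.
Proof.
intros Hi Hj.
assert (N1 := lattice_pt_neq0 _ l (mt_regular k)). assert (N2 := lattice_pt_neq0 _ l (mt_regular (k+1))).
assert (B1 := lattice_lower k l). assert (B2 := lattice_lower (k+1) l).
rewrite (odd_abs k i Hi) in B1. assert (B3 := odd_abs_next k i Hi).
assert (Jl : (INR j <= Rabs (IZR l))%R).
{ generalize (pos_INR j); intros. destruct Hj as [->| ->]; rewrite ?minus_IZR, ?opp_IZR, <- ?INR_IZR_INZ.
  - rewrite Rabs_pos_eq; lra.
  - rewrite Rabs_left; lra. }
set (u := lattice_pt (mt k) l) in *. set (v := lattice_pt (mt (k+1)) l) in *.
replace (aa k l - bb k l) with ((v - u) * / (u * u * v)) by (unfold aa, bb; fold u v; field; auto).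
unfold u, v at 1. rewrite mt_next. fold u.
assert (P1 := proj1 (Cmod_gt_0 _) N1). assert (P2 := proj1 (Cmod_gt_0 _) N2).
assert (ND : u * u * v <> 0).
{ apply Cmod_gt_0. rewrite !Cmod_mult. apply Rmult_lt_0_compat; auto. apply Rmult_lt_0_compat; auto. }
rewrite Cmod_mult, Cmod_inv by exact ND. rewrite !Cmod_mult, Cmod_R, Rabs_pos_eq by lra.
generalize (pos_INR i) (pos_INR j) kap_pos (Cmod_ge_0 tau); intros Pi Pj Pk Pt.
set (x := (INR i + INR j + 1)%R).
assert (C1 : (x <= kap * Cmod u)%R) by (unfold x; lra).
assert (C2 : (x <= 2 * (kap * Cmod v))%R) by (unfold x; lra).
assert (X : (1 <= x)%R) by (unfold x; lra).
assert (I : (/ (Cmod u * Cmod u * Cmod v) <= 2 * (kap * kap * kap) * / (x * x * x))%R).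
{ apply Rmult_le_reg_r with (Cmod u * Cmod u * Cmod v)%R.
  - apply Rmult_lt_0_compat; auto; nra.
  - rewrite Rinv_l by (assert (0 < Cmod u * Cmod u)%R by nra; nra).
    apply Rmult_le_reg_r with (x * x * x)%R; [apply Rmult_lt_0_compat; nra|].
    replace (2 * (kap * kap * kap) * / (x * x * x) * (Cmod u * Cmod u * Cmod v) * (x * x * x))%R with
      ((kap * Cmod u) * (kap * Cmod u) * (2 * (kap * Cmod v)))%R by (field; lra).
    rewrite Rmult_1_l. apply Rmult_le_compat; try nra. }
assert (I2 := cube_bound_lower i j). fold x in I2.
apply Rle_trans with (2 * Cmod tau * (2 * (kap * kap * kap) * (3 * cube_bound i j)))%R.
- apply Rmult_le_compat_l; [lra|]. apply Rle_trans with (1 := I). apply Rmult_le_compat_l; auto.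
  assert (0 < kap * kap * kap)%R by (apply Rmult_lt_0_compat; auto; nra). lra.
- right. ring.
Qed.

(** Factoring tau / (pi i) out of the lattice point exchanges the roles of k and l: for fixed l the
    sum over k becomes the pole expansion at [ww l]. *)
Let ww (l : Z) : C := PI * Ci - 2 * (PI * PI) * IZR l * / tau.

Lemma Re_inv_tau : (0 < Re (/ tau))%R.
Proof.
unfold Cinv. simpl. apply Rmult_lt_0_compat; auto. apply Rinv_0_lt_compat.
unfold Re in Htau. nra.
Qed.

Lemma ww_regular l : regular (ww l).
Proof.
destruct (Z.eq_dec l 0) as [->|N].
- unfold regular, ww. replace (- (PI * Ci - 2 * (PI * PI) * 0 * / tau)) with (- (0 + PI * Ci)) by ring.
  rewrite cexp_mPI. replace (- RtoC 0) with (RtoC 0) by ring. rewrite cexp_0. intros E. injection E; lra.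
- apply regular_Re. unfold ww.
  replace (2 * (PI * PI) * IZR l * / tau) with (RtoC (2 * (PI * PI) * IZR l) * / tau) by (rewrite !RtoC_mult; ring).
  unfold Cminus. rewrite Re_plus. replace (Re (PI * Ci)) with 0%R by (simpl; ring).
  replace (Re (- (RtoC (2 * (PI * PI) * IZR l) * / tau))) with (- (2 * (PI * PI) * IZR l * Re (/ tau)))%R
    by (rewrite <- Re_RtoC_mult; reflexivity).
  generalize Re_inv_tau PI_gt_3; intros Q1 Q2 E.
  assert (IZR l <> 0)%R by (apply not_0_IZR; auto).
  assert (K : (2 * (PI * PI) * Re (/ tau) * IZR l <> 0)%R).
  { apply Rmult_integral_contrapositive; split; auto. assert (0 < PI * PI)%R by nra. nra. }
  apply K. lra.
Qed.

Lemma aa_scaled k l : aa k l = - (PI * PI / (tau * tau)) * / (lattice_pt (ww l) k * lattice_pt (ww l) k).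
Proof.
assert (N1 := lattice_pt_neq0 _ l (mt_regular k)). assert (N := tau_neq0).
assert (NP : RtoC PI <> 0) by (apply RtoC_neq0; generalize PI_gt_3; lra).
assert (NI : Ci <> 0) by (intros E; injection E; lra).
assert (E : lattice_pt (ww l) k = PI * Ci / tau * lattice_pt (mt k) l).
{ unfold lattice_pt, ww, mt. rewrite RtoC_plus, RtoC_mult.
  transitivity (PI * Ci + 2 * PI * Ci * IZR k + 2 * (Ci * Ci) * (PI * PI) * IZR l / tau).
  - replace (Ci * Ci) with (- (1)) by (apply C_eq; simpl; ring). field. auto.
  - field. auto. }
rewrite E. unfold aa. set (u := lattice_pt (mt k) l) in *.
replace (PI * Ci / tau * u * (PI * Ci / tau * u)) with ((Ci * Ci) * (PI * PI / (tau * tau)) * (u * u)) by (field; auto).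
replace (Ci * Ci) with (- (1)) by (apply C_eq; simpl; ring).
field. repeat split; auto.
Qed.

Lemma exp_odd_bound n : (exp (- ((2 * INR n + 1) * Re tau)) <= / Re tau * / (INR n + 1))%R.
Proof.
generalize (pos_INR n); intros. eapply Rle_trans; [apply exp_opp_inv_bound; nra|].
rewrite <- Rinv_mult. apply Rinv_le_contravar; nra.
Qed.

Lemma simple_pole_mt_lim : clim (fun n => simple_pole (mt (Z.of_nat n))) 1.
Proof.
set (K := (/ (1 - exp (- Re tau)))%R).
assert (HK : (0 < K)%R).
{ apply Rinv_0_lt_compat. assert (exp (- Re tau) < 1)%R by (rewrite <- exp_0; apply exp_increasing; lra). lra. }
apply (clim_inv_bound _ _ (/ Re tau * K)%R). intros n.
assert (G := mt_regular (Z.of_nat n)).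
replace (simple_pole (mt (Z.of_nat n)) - 1) with (cexp (- mt (Z.of_nat n)) * simple_pole (mt (Z.of_nat n)))
  by (unfold simple_pole; field; now apply regular_neq).
assert (E : Re (mt (Z.of_nat n)) = ((2 * INR n + 1) * Re tau)%R).
{ unfold mt. rewrite Re_RtoC_mult, <- INR_IZR_INZ. reflexivity. }
rewrite Cmod_mult, Cmod_cexp. replace (Re (- mt (Z.of_nat n))) with (- Re (mt (Z.of_nat n)))%R by (destruct (mt (Z.of_nat n)); reflexivity).
rewrite E. apply Rle_trans with (/ Re tau * / (INR n + 1) * K)%R; [|right; ring].
apply Rmult_le_compat; [left; apply exp_pos|apply Cmod_ge_0|apply exp_odd_bound|].
apply Cmod_simple_pole_pos; auto. rewrite E. generalize (pos_INR n); nra.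
Qed.

Lemma mt_opp k : mt (- k - 1) = - mt k.
Proof.
unfold mt. rewrite minus_IZR, opp_IZR. replace (2 * (- IZR k - 1) + 1)%R with (- (2 * IZR k + 1))%R by ring.
rewrite RtoC_opp. ring.
Qed.

Lemma simple_pole_mt_lim_neg : clim (fun n => simple_pole (mt (- Z.of_nat n))) 0.
Proof.
intros eps He. destruct (simple_pole_mt_lim eps He) as [N HN]. exists (S N). intros [|n] Hn; [lia|].
specialize (HN n ltac:(lia)).
replace (- Z.of_nat (S n))%Z with (- Z.of_nat n - 1)%Z by lia. rewrite mt_opp, simple_pole_opp by apply mt_regular.
replace (1 - simple_pole (mt (Z.of_nat n)) - 0) with (- (simple_pole (mt (Z.of_nat n)) - 1)) by ring.
now rewrite Cmod_opp.
Qed.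

Lemma inv_mt_lim l (sg : bool) : clim (fun n => / lattice_pt (mt (if sg then Z.of_nat n else - Z.of_nat n)) l) 0.
Proof.
apply (clim_inv_bound _ _ (2 * kap)%R). intros n.
set (k := if sg then Z.of_nat n else (- Z.of_nat n)%Z).
assert (N1 := lattice_pt_neq0 _ l (mt_regular k)).
replace (/ lattice_pt (mt k) l - 0) with (/ lattice_pt (mt k) l) by ring. rewrite Cmod_inv by auto.
assert (P1 := proj1 (Cmod_gt_0 _) N1).
assert (B := lattice_lower k l). generalize (Rabs_pos (IZR l)) kap_pos (pos_INR n); intros.
assert (A : ((INR n + 1) / 2 <= Rabs (2 * IZR k + 1))%R).
{ unfold k. destruct sg; rewrite ?opp_IZR, <- INR_IZR_INZ.
  - rewrite Rabs_pos_eq; lra.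
  - destruct n as [|n]; [simpl; rewrite Rabs_pos_eq; lra|]. rewrite S_INR in *. generalize (pos_INR n); intros.
    rewrite Rabs_left1; lra. }
apply Rmult_le_reg_r with (Cmod (lattice_pt (mt k) l)); auto. rewrite Rinv_l by lra.
apply Rmult_le_reg_r with (INR n + 1)%R; [lra|].
replace (2 * kap * / (INR n + 1) * Cmod (lattice_pt (mt k) l) * (INR n + 1))%R with (2 * (kap * Cmod (lattice_pt (mt k) l)))%R by (field; lra).
lra.
Qed.

Lemma double_pole_mt_abs : cabs (fun n => double_pole (mt (Z.of_nat n))).
Proof.
set (K := (/ (1 - exp (- Re tau)))%R).
apply (cabs_dom _ (fun n => (K * K) * (exp (- Re tau)) ^ n)%R).
- intros n. assert (E : Re (mt (Z.of_nat n)) = ((2 * INR n + 1) * Re tau)%R).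
  { unfold mt. rewrite Re_RtoC_mult, <- INR_IZR_INZ. reflexivity. }
  eapply Rle_trans; [apply (Cmod_double_pole_pos _ (Re tau)); auto; rewrite E; generalize (pos_INR n); nra|].
  fold K. rewrite E, (Rmult_comm (exp _)). apply Rmult_le_compat_l; [nra|].
  rewrite <- Rpower_pow by apply exp_pos. unfold Rpower. rewrite ln_exp.
  apply exp_le_mono. generalize (pos_INR n); nra.
- apply ex_series_scalR, ex_series_geom. rewrite Rabs_pos_eq by (left; apply exp_pos).
  rewrite <- exp_0. apply exp_increasing; lra.
Qed.

(** Summing over k first gives the left side, because the correction telescopes to 0 for each l.
    Summing over l first gives [double_pole (mt k)] and a difference of consecutive
    [simple_pole (mt k)], whose limits are 1 at plus and 0 at minus infinity; this jump is the extra
    [/ (2 * tau)], the usual anomaly in weight 2. *)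
Theorem eisenstein : zsum (fun l => - (PI * PI / (tau * tau)) * double_pole (ww l)) =
  csum (fun n => 2 * double_pole (RtoC (2 * INR n + 1) * tau)) + / (2 * tau).
Proof.
pose (b := fun i j => ((12 * Cmod tau * (kap * kap * kap)) * cube_bound i j)%R).
destruct cube_bound_summable as [CS1 CS2].
destruct (zfubini (fun k l => aa k l - bb k l) b) as (R1 & R2 & R3 & E).
{ intros; now apply aabb_bound. }
{ intros; unfold b; now apply ex_series_scalR. }
{ unfold b. apply (ex_series_ext (fun i => (12 * Cmod tau * (kap * kap * kap)) * Series (cube_bound i))%R);
  [intros; now rewrite <- Series_scal_l|now apply ex_series_scalR]. }
assert (A1 : forall k, zabs (aa k)) by (intros k; apply (cabs_inv2_double_pole _ (mt_regular k))).
assert (A2 : forall l, zabs (fun k => aa k l)).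
{ intros l. eapply zabs_ext; [intros k; symmetry; apply aa_scaled|]. apply zabs_scal, (cabs_inv2_double_pole _ (ww_regular l)). }
assert (B1 : forall k, zabs (bb k)).
{ intros k. eapply zabs_ext; [|exact (zabs_minus _ _ (A1 k) (R1 k))]. intros l; simpl; ring. }
assert (B2 : forall l, zabs (fun k => bb k l)).
{ intros l. eapply zabs_ext; [|exact (zabs_minus _ _ (A2 l) (R2 l))]. intros k; simpl; ring. }
assert (N : 2 * tau <> 0).
{ intros Z. apply tau_neq0. replace tau with (/ 2 * (2 * tau)) by (field). rewrite Z; ring. }
assert (L : zsum (fun l => zsum (fun k => aa k l - bb k l)) = zsum (fun l => - (PI * PI / (tau * tau)) * double_pole (ww l))).
{ apply zsum_ext. intros l. rewrite zsum_minus by auto.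
  replace (zsum (fun k => bb k l)) with (RtoC 0).
  - rewrite (double_pole_partial_fractions _ (ww_regular l)), <- zsum_scal by apply (cabs_inv2_double_pole _ (ww_regular l)).
    unfold Cminus. replace (- RtoC 0) with (RtoC 0) by ring. rewrite Cplus_0_r. apply zsum_ext. intros k. apply aa_scaled.
  - rewrite (zsum_ext _ (fun k => / (2 * tau) * (/ lattice_pt (mt k) l - / lattice_pt (mt (k + 1)) l))) by (intros; apply bb_diff).
    assert (Z : zabs (fun k => / lattice_pt (mt k) l - / lattice_pt (mt (k + 1)) l)).
    { eapply zabs_ext; [|exact (zabs_scal (2 * tau) _ (B2 l))]. intros k; simpl. rewrite bb_diff.
      rewrite Cmult_assoc, Cinv_r by auto. ring. }
    rewrite zsum_scal by exact Z.
    rewrite (ztelescope (fun k => / lattice_pt (mt k) l) 0 0 Z (inv_mt_lim l true) (inv_mt_lim l false)). ring. }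
assert (Rr : forall k, zsum (fun l => aa k l - bb k l) = double_pole (mt k) - / (2 * tau) * (simple_pole (mt k) - simple_pole (mt (k + 1)))).
{ intros k. rewrite zsum_minus by auto. f_equal; [|f_equal].
  - symmetry. apply (double_pole_partial_fractions _ (mt_regular k)).
  - rewrite (simple_pole_partial_fractions _ _ (mt_regular k) (mt_regular (k+1))).
    rewrite <- zsum_scal.
    + apply zsum_ext. intros l; apply bb_diff.
    + eapply zabs_ext; [|exact (zabs_scal (2 * tau) _ (B1 k))]. intros l; simpl. rewrite bb_diff.
      rewrite Cmult_assoc, Cinv_r by auto. ring. }
assert (C2a : zabs (fun k => double_pole (mt k))).
{ apply (zabs_dom _ (fun n => Cmod (double_pole (mt (Z.of_nat n))))); [intros; lra| |apply double_pole_mt_abs].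
  intros i. rewrite mt_opp, double_pole_opp by apply mt_regular. lra. }
assert (CCa : zabs (fun k => simple_pole (mt k) - simple_pole (mt (k + 1)))).
{ eapply zabs_ext; [|exact (zabs_scal (2 * tau) _ (zabs_minus _ _ C2a R3))]. intros k; simpl. rewrite Rr.
  transitivity (2 * tau * / (2 * tau) * (simple_pole (mt k) - simple_pole (mt (k + 1)))); [ring|]. rewrite Cinv_r by auto. ring. }
rewrite <- L, E. rewrite (zsum_ext _ _ Rr), zsum_minus; auto; [|now apply zabs_scal].
rewrite zsum_scal, (ztelescope (fun k => simple_pole (mt k)) 1 0 CCa simple_pole_mt_lim simple_pole_mt_lim_neg) by auto.
replace (zsum (fun k => double_pole (mt k))) with (csum (fun n => 2 * double_pole (RtoC (2 * INR n + 1) * tau))).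
- ring.
- unfold zsum. apply csum_ext. intros n. rewrite mt_opp, double_pole_opp by apply mt_regular. unfold mt. rewrite <- INR_IZR_INZ. ring.
Qed.

End Eisenstein.


(** * Geometric series and the Lambert series *)

Lemma rsum_geom2 r n : (0 <= r < 1)%R ->
  (rsum (fun k => (INR k + 1) * r ^ k) n <= / ((1 - r) * (1 - r)))%R.
Proof.
intros H.
assert (E : (rsum (fun k => (INR k + 1) * r ^ k) n * ((1 - r) * (1 - r)) = 1 - (INR n + 1) * r ^ n + INR n * r ^ n * r)%R).
{ induction n; [simpl; ring|]. rewrite S_INR. simpl rsum. rewrite Rmult_plus_distr_r, IHn. simpl pow. ring. }
apply Rmult_le_reg_r with ((1 - r) * (1 - r))%R; [nra|]. rewrite E, Rinv_l by nra.
assert (0 <= r ^ n)%R by (apply pow_le; lra). generalize (pos_INR n); intros.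
assert (0 <= INR n * r ^ n)%R by nra. nra.
Qed.

Lemma ex_series_geom2 r : (0 <= r < 1)%R -> ex_series (fun k => (INR k + 1) * r ^ k)%R /\
  (Series (fun k => (INR k + 1) * r ^ k) <= / ((1 - r) * (1 - r)))%R.
Proof.
intros H. apply bounded_ex_series.
- intros k. apply Rmult_le_pos; [generalize (pos_INR k); lra|apply pow_le; lra].
- intros n. now apply rsum_geom2.
Qed.

Lemma ex_series_geomR r : (0 <= r < 1)%R -> ex_series (fun k => r ^ k)%R.
Proof. intros H; apply ex_series_geom. rewrite Rabs_pos_eq; lra. Qed.

Lemma one_minus_neq0 x : (Cmod x < 1)%R -> 1 - x <> 0.
Proof.
intros H E. assert (x = 1) by (replace x with (1 - (1 - x)) by ring; rewrite E; ring).
subst. rewrite Cmod_1 in H; lra.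
Qed.

Lemma csum_geom x : (Cmod x < 1)%R -> cabs (fun k => x ^ k) /\ csum (fun k => x ^ k) = / (1 - x).
Proof.
intros H.
assert (A : cabs (fun k => x ^ k)).
{ apply (cabs_dom _ (fun k => Cmod x ^ k)%R); [intros; rewrite Cmod_pow; lra|].
  apply ex_series_geomR. generalize (Cmod_ge_0 x); lra. }
split; auto.
assert (E := csum_tail _ 1 A). simpl csumn in E. cbv beta in E.
rewrite (csum_ext (fun k => x ^ (1 + k)) (fun k => x * x ^ k)) in E by (intros; reflexivity).
rewrite csum_scal in E by auto. set (S := csum _) in *.
assert (N := one_minus_neq0 x H).
transitivity ((S - x * S) * / (1 - x)); [field; auto|]. rewrite E at 1.
transitivity ((0 + 1 + x * S - x * S) * / (1 - x)); [reflexivity|]. field; auto.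
Qed.

Lemma csum_geom2 x : (Cmod x < 1)%R -> cabs (fun k => (INR k + 1)%R * x ^ k) /\
  csum (fun k => (INR k + 1)%R * x ^ k) = / (1 - x) * / (1 - x).
Proof.
intros H. generalize (Cmod_ge_0 x); intros H0.
assert (A : cabs (fun k => (INR k + 1)%R * x ^ k)).
{ apply (cabs_dom _ (fun k => (INR k + 1) * Cmod x ^ k)%R).
  - intros. rewrite Cmod_mult, Cmod_pow, Cmod_R, Rabs_pos_eq; [lra|generalize (pos_INR n); lra].
  - apply ex_series_geom2; lra. }
split; auto.
destruct (csum_geom x H) as [A1 E1].
assert (E := csum_tail _ 1 A). simpl csumn in E. cbv beta in E.
assert (A' : cabs (fun k => x * ((INR k + 1)%R * x ^ k))) by now apply cabs_scal.
assert (A1' : cabs (fun k => x * x ^ k)) by now apply cabs_scal.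
rewrite (csum_ext (fun k => RtoC (INR (1 + k) + 1) * x ^ (1 + k)) (fun k => x * ((INR k + 1)%R * x ^ k) + x * x ^ k)) in E.
- rewrite (csum_plus _ _ A' A1'), (csum_scal x _ A), (csum_scal x _ A1), E1 in E.
  assert (N := one_minus_neq0 x H). revert E. generalize (csum (fun k => (INR k + 1)%R * x ^ k)). intros y E.
  replace (RtoC (0 + 1)) with (RtoC 1) in E by (f_equal; ring).
  assert (E2 : y * (1 - x) = / (1 - x)).
  { transitivity (y - x * y); [ring|]. rewrite E at 1. field; auto. }
  transitivity (y * (1 - x) * / (1 - x)); [field; auto|]. now rewrite E2.
- intros n. change (1 + n)%nat with (S n). rewrite S_INR, !RtoC_plus. simpl. ring.
Qed.

Definition nome (tau : C) : C := cexp (- tau).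

Lemma Cmod_nome tau : Cmod (nome tau) = exp (- Re tau).
Proof. unfold nome. rewrite Cmod_cexp. destruct tau; reflexivity. Qed.

Lemma exp_neg_lt1 t : (0 < t)%R -> (0 < exp (- t) < 1)%R.
Proof. intros H; split; [apply exp_pos|]. rewrite <- exp_0. apply exp_increasing; lra. Qed.

Lemma nome_nat tau n : cexp (- (INR n * tau)) = nome tau ^ n.
Proof. unfold nome. rewrite <- cexp_nat. f_equal. ring. Qed.

Lemma pow_lt1 r n : (0 <= r < 1)%R -> (0 < n)%nat -> (0 <= r ^ n < 1)%R.
Proof.
intros H Hn. split; [apply pow_le; lra|]. destruct n; [lia|]. simpl.
assert (r ^ n <= 1)%R by (rewrite <- (pow1 n); apply pow_incr; lra).
assert (0 <= r ^ n)%R by (apply pow_le; lra). nra.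
Qed.

(* The j-th term is j / sinh (j tau). *)
Definition lambert_term (tau : C) (j : nat) : C := 2 * INR j * (nome tau ^ j / (1 - nome tau ^ j * nome tau ^ j)).

(** Both sides are orders of summation of the double series of 2 j q^((2i+1) j): for fixed j, 1 / (1
    - q^(2j)) is expanded geometrically; for fixed i, the sum over j is the double pole at (2i+1)
    tau. *)
Lemma lambert tau : (0 < Re tau)%R ->
  csum (fun j => lambert_term tau (S j)) = csum (fun n => 2 * double_pole (RtoC (2 * INR n + 1) * tau)).
Proof.
intros Ht. set (q := nome tau). set (r := exp (- Re tau)).
assert (Hr := exp_neg_lt1 _ Ht : (0 < r < 1)%R).
assert (Hq : Cmod q = r) by apply Cmod_nome.
pose (a := fun i j => 2 * ((INR j + 1)%R * (q ^ (2 * i + 1)) ^ S j)).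
pose (b := fun i j => (2 * r ^ (2 * i + 1) * ((INR j + 1) * (r ^ (2 * i + 1)) ^ j))%R).
assert (Hb : forall i, ex_series (b i) /\ (Series (b i) <= (2 * r * / ((1 - r) * (1 - r))) * r ^ i)%R).
{ intros i. assert (Y := pow_lt1 r (2 * i + 1) ltac:(lra) ltac:(lia)).
  destruct (ex_series_geom2 _ Y) as [G1 G2]. split; [now apply ex_series_scalR|].
  unfold b. rewrite Series_scal_l.
  assert (Y2 : (r ^ (2 * i + 1) <= r)%R).
  { rewrite Nat.add_1_r. simpl pow. assert (0 <= r ^ (i + (i + 0)) <= 1)%R; [|nra].
    split; [apply pow_le; lra|]. rewrite <- (pow1 (i + (i + 0))). apply pow_incr; lra. }
  assert (Y3 : (r ^ (2 * i + 1) <= r * r ^ i)%R).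
  { replace (2 * i + 1)%nat with (S (i + i)) by lia. simpl. rewrite pow_add.
    assert (0 <= r ^ i <= 1)%R by (split; [apply pow_le; lra|]; rewrite <- (pow1 i); apply pow_incr; lra). apply Rmult_le_compat_l; [lra|nra]. }
  assert (/ ((1 - r ^ (2 * i + 1)) * (1 - r ^ (2 * i + 1))) <= / ((1 - r) * (1 - r)))%R
    by (apply Rinv_le_contravar; nra).
  assert (0 < / ((1 - r) * (1 - r)))%R by (apply Rinv_0_lt_compat; nra).
  apply Rle_trans with (2 * r ^ (2 * i + 1) * / ((1 - r) * (1 - r)))%R; [|nra].
  apply Rmult_le_compat_l; nra. }
transitivity (csum (fun j => csum (fun i => a i j))).
- apply csum_ext. intros j. unfold a, lambert_term. fold q.
  assert (Q2 : (Cmod (q ^ S j * q ^ S j) < 1)%R).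
  { rewrite Cmod_mult, !Cmod_pow, Hq. assert (Y := pow_lt1 r (S j) ltac:(lra) ltac:(lia)). nra. }
  destruct (csum_geom _ Q2) as [G1 G2].
  rewrite (csum_ext _ (fun i => 2 * (INR j + 1)%R * q ^ S j * (q ^ S j * q ^ S j) ^ i)).
  + rewrite (csum_scal _ _ G1), G2, S_INR. unfold Cdiv. ring.
  + intros i.
    assert (E : (q ^ (2 * i + 1)) ^ S j = q ^ S j * (q ^ S j * q ^ S j) ^ i).
    { rewrite <- Cpow_mult_r, <- Cpow_add_r, <- Cpow_mult_r, <- Cpow_add_r. f_equal. lia. }
    rewrite E. ring.
- rewrite (fubini_C a b).
  + apply csum_ext. intros i. unfold a.
    assert (Q2 : (Cmod (q ^ (2 * i + 1)) < 1)%R).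
    { rewrite Cmod_pow, Hq. apply pow_lt1; [lra|lia]. }
    destruct (csum_geom2 _ Q2) as [G1 G2].
    rewrite (csum_ext _ (fun j => 2 * q ^ (2 * i + 1) * ((INR j + 1)%R * (q ^ (2 * i + 1)) ^ j))).
    * rewrite (csum_scal _ _ G1), G2. rewrite <- !Cmult_assoc. f_equal.
      assert (E : cexp (- (RtoC (2 * INR i + 1) * tau)) = q ^ (2 * i + 1)).
      { unfold q. rewrite <- nome_nat. do 4 f_equal. rewrite plus_INR, mult_INR. simpl. ring. }
      rewrite double_pole_exp.
      -- unfold simple_pole. rewrite E. reflexivity.
      -- unfold regular. rewrite E. intros Z. rewrite Z, Cmod_1 in Q2. lra.
    * intros j. simpl. ring.
  + intros i j. unfold a, b. rewrite !Cmod_mult, !Cmod_pow, !Cmod_R, Hq, !Rabs_pos_eq by (generalize (pos_INR j); lra).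
    simpl pow. right; ring.
  + intros i; apply Hb.
  + apply (ex_series_dom _ (fun i => (2 * r * / ((1 - r) * (1 - r))) * r ^ i)%R).
    * intros i; split; [|apply Hb]. apply Series_ge0; [|apply Hb]. intros j. unfold b.
      apply Rmult_le_pos; [|apply Rmult_le_pos]; try (apply Rmult_le_pos); try apply pow_le; try apply pow_le; generalize (pos_INR j); lra.
    * apply ex_series_scalR, ex_series_geomR; lra.
Qed.

Lemma PI_sq_lt : (PI * PI < 10.24)%R.
Proof. generalize PI_lt_32 PI_gt_3. nra. Qed.

(** In the Eisenstein identity the term l = 0 is exact: the double pole at pi i is -1/4, which gives
    pi^2 / (4 tau^2). For other l the point [w l] lies at distance s |l| from the imaginary axis, so
    the terms decay like E^|l|. The constant 22 covers 2 pi^2 (100/99)^3. *)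
Lemma D_asymptotic tau : (0 < Re tau)%R -> let E := exp (- (2 * (PI * PI) * Re (/ tau))) in
  (E <= 1 / 100)%R ->
  (Cmod (csum (fun j => lambert_term tau (S j)) - (PI * PI / (4 * (tau * tau)) - / (2 * tau))) <= 22 * E / (Cmod tau * Cmod tau))%R.
Proof.
intros Ht E HE. rewrite lambert by auto.
assert (Eis := eisenstein tau Ht).
assert (N : tau <> 0) by now apply tau_neq0.
assert (PT := proj1 (Cmod_gt_0 _) N).
set (w := fun l : Z => PI * Ci - 2 * (PI * PI) * IZR l * / tau) in *.
set (a := fun l => - (PI * PI / (tau * tau)) * double_pole (w l)).
set (s := (2 * (PI * PI) * Re (/ tau))%R) in *.
assert (Hs : (0 < s)%R) by (generalize (Re_inv_tau tau Ht) PI_gt_3; unfold s; intros; apply Rmult_lt_0_compat; nra).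
assert (HE0 : (0 < E)%R) by apply exp_pos.
set (K := (/ (1 - E) * / (1 - E))%R).
assert (RW : forall l, Re (w l) = (- (s * IZR l))%R).
{ intros l. unfold w. replace (2 * (PI * PI) * IZR l * / tau) with (RtoC (2 * (PI * PI) * IZR l) * / tau) by (rewrite !RtoC_mult; ring).
  unfold Cminus. rewrite Re_plus. replace (Re (PI * Ci)) with 0%R by (simpl; ring).
  replace (Re (- (RtoC (2 * (PI * PI) * IZR l) * / tau))) with (- (2 * (PI * PI) * IZR l * Re (/ tau)))%R
    by (rewrite <- Re_RtoC_mult; reflexivity). unfold s. ring. }
assert (Epow : forall n, exp (- (s * INR n)) = (E ^ n)%R).
{ intros n. unfold E. rewrite <- Rpower_pow by apply exp_pos. unfold Rpower. rewrite ln_exp. f_equal. ring. }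
assert (Cpos : forall n, (Cmod (double_pole (w (- Z.of_nat (S n))%Z)) <= K * E ^ S n)%R).
{ intros n. assert (R : Re (w (- Z.of_nat (S n))%Z) = (s * INR (S n))%R) by (rewrite RW, opp_IZR, <- INR_IZR_INZ; ring).
  eapply Rle_trans; [apply (Cmod_double_pole_pos _ s); auto; rewrite R, S_INR; generalize (pos_INR n); nra|].
  rewrite R, Epow. fold E. fold K. lra. }
assert (Cneg : forall n, (Cmod (double_pole (w (Z.of_nat (S n)))) <= K * E ^ S n)%R).
{ intros n. assert (R : Re (- w (Z.of_nat (S n))) = (s * INR (S n))%R).
  { transitivity (- Re (w (Z.of_nat (S n))))%R; [destruct (w (Z.of_nat (S n))); reflexivity|]. rewrite RW, <- INR_IZR_INZ; ring. }
  replace (double_pole (w (Z.of_nat (S n)))) with (double_pole (- w (Z.of_nat (S n)))) by (apply double_pole_opp, ww_regular; auto).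
  eapply Rle_trans; [apply (Cmod_double_pole_pos _ s); auto; rewrite R, S_INR; generalize (pos_INR n); nra|].
  rewrite R, Epow. fold E. fold K. lra. }
assert (W0 : double_pole (w 0%Z) = - / 4).
{ unfold double_pole, simple_pole, w. replace (- (PI * Ci - 2 * (PI * PI) * 0 * / tau)) with (- (0 + PI * Ci)) by ring.
  rewrite cexp_mPI. replace (- RtoC 0) with (RtoC 0) by ring. rewrite cexp_0.
  apply C_eq; simpl; field. }
assert (A : zabs a).
{ apply zabs_scal. apply (zabs_dom _ (fun n => (match n with O => /4 | S _ => 0 end) + K * E ^ n)%R).
  - intros [|n]; [simpl; rewrite W0, Cmod_opp, Cmod_inv, Cmod_R, Rabs_pos_eq by (try lra; apply RtoC_neq0; lra)|].
    + rewrite Rmult_1_r. assert (0 < K)%R by (unfold K; apply Rmult_lt_0_compat; apply Rinv_0_lt_compat; lra). lra.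
    + rewrite Rplus_0_l; apply Cneg.
  - intros n. replace (- Z.of_nat n - 1)%Z with (- Z.of_nat (S n))%Z by lia.
    eapply Rle_trans; [apply Cpos|]. assert (0 < K)%R by (unfold K; apply Rmult_lt_0_compat; apply Rinv_0_lt_compat; lra).
    assert (0 <= E ^ n)%R by (apply pow_le; lra). simpl pow. assert (K * (E * E ^ n) <= K * E ^ n)%R by (apply Rmult_le_compat_l; nra). assert (0 <= match n with O => /4 | S _ => 0 end)%R by (destruct n; lra). lra.
  - apply ex_series_plusR.
    + apply (ex_series_incr_n (fun n => match n with O => / 4 | S _ => 0 end)%R 1).
      apply (ex_series_ext (fun n => 0 * (1 / 2) ^ n)%R); [intros n; apply Rmult_0_l|]. apply ex_series_scalR, ex_series_geomR; lra.
    + apply ex_series_scalR, ex_series_geomR; lra. }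
assert (Z : csum (fun n => 2 * double_pole (RtoC (2 * INR n + 1) * tau)) - (PI * PI / (4 * (tau * tau)) - / (2 * tau)) =
   a (-1)%Z + csum (fun n => a (Z.of_nat (1 + n)) + a (- Z.of_nat (1 + n) - 1)%Z)).
{ assert (T : zsum a = 0 + (a 0%Z + a (-1)%Z) + csum (fun n => a (Z.of_nat (1 + n)) + a (- Z.of_nat (1 + n) - 1)%Z))
    by exact (csum_tail _ 1 A).
  change (zsum a = csum (fun n => 2 * double_pole (RtoC (2 * INR n + 1) * tau)) + / (2 * tau)) in Eis.
  rewrite T in Eis. replace (csum (fun n => 2 * double_pole (RtoC (2 * INR n + 1) * tau))) with
   (csum (fun n => 2 * double_pole (RtoC (2 * INR n + 1) * tau)) + / (2 * tau) - / (2 * tau)) by ring.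
  rewrite <- Eis. unfold a at 1. rewrite W0. field. auto. }
rewrite Z.
set (M := (PI * PI / (Cmod tau * Cmod tau))%R).
assert (HM : (0 < M)%R) by (unfold M, Rdiv; generalize PI_gt_3; intros; apply Rmult_lt_0_compat; [nra|apply Rinv_0_lt_compat; nra]).
assert (NT2 : tau * tau <> 0) by (apply Cmod_gt_0; rewrite Cmod_mult; nra).
assert (CM : Cmod (- (PI * PI / (tau * tau))) = M).
{ rewrite Cmod_opp, Cmod_div, !Cmod_mult, !Cmod_R by auto. rewrite Rabs_pos_eq by (generalize PI_gt_3; lra). reflexivity. }
assert (HK : (0 < K)%R) by (unfold K; apply Rmult_lt_0_compat; apply Rinv_0_lt_compat; lra).
assert (B1 : (Cmod (a (-1)%Z) <= M * K * E)%R).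
{ unfold a. rewrite Cmod_mult, CM. assert (U := Cpos O). change (- Z.of_nat 1)%Z with (-1)%Z in U. rewrite pow_1 in U. nra. }
assert (B2 : (Cmod (csum (fun n => a (Z.of_nat (1 + n)) + a (- Z.of_nat (1 + n) - 1)%Z)%C) <= M * K * (E + E * E) * / (1 - E))%R).
{ rewrite <- Series_geom by (rewrite Rabs_pos_eq; lra). rewrite <- Series_scal_l.
  apply Cmod_csum_le; [|apply ex_series_scalR, ex_series_geomR; lra].
  intros n. eapply Rle_trans; [apply Cmod_triangle|]. unfold a. rewrite !Cmod_mult, CM.
  replace (- Z.of_nat (1 + n) - 1)%Z with (- Z.of_nat (S (S n)))%Z by lia.
  generalize (Cneg n) (Cpos (S n)). simpl pow. intros U V.
  change (1 + n)%nat with (S n). nra. }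
eapply Rle_trans; [apply Cmod_triangle|]. eapply Rle_trans; [apply Rplus_le_compat; eassumption|].
replace (M * K * E + M * K * (E + E * E) * / (1 - E))%R with ((PI * PI * (2 * K * / (1 - E))) * E / (Cmod tau * Cmod tau))%R by (unfold M; field; lra).
apply Rmult_le_compat_r; [left; apply Rinv_0_lt_compat; nra|]. apply Rmult_le_compat_r; [lra|].
assert (I : (/ (1 - E) <= 100 / 99)%R).
{ replace (100/99)%R with (/ (99/100))%R by field. apply Rinv_le_contravar; lra. }
assert (I0 : (0 < / (1 - E))%R) by (apply Rinv_0_lt_compat; lra).
unfold K. set (x := (/ (1 - E))%R) in *. assert (x * x <= 1.0204)%R by nra. assert (x * x * x <= 1.0308)%R by nra.
generalize PI_sq_lt PI_gt_3; intros. assert (0 < x * x * x)%R by (repeat apply Rmult_lt_0_compat; auto). replace (PI * PI * (2 * (x * x) * x))%R with ((PI * PI) * (2 * (x * x * x)))%R by ring. apply Rle_trans with (10.24 * (2 * (x * x * x)))%R; [apply Rmult_le_compat_r; lra|lra].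
Qed.


(** * The generating product and its principal part *)

(** Generating function of the overpartitions with all parts at most K. *)
Fixpoint overpartition_prod (K : nat) (tau : C) : C :=
  match K with O => 1 | S k => overpartition_prod k tau * ((1 + nome tau ^ S k) / (1 - nome tau ^ S k)) end.

Definition lambert_sum (K : nat) (tau : C) : C := csumn (fun j => lambert_term tau (S j)) K.

Lemma nome_pow_lt1 tau n : (0 < Re tau)%R -> (Cmod (nome tau ^ S n) < 1)%R.
Proof.
intros H. rewrite Cmod_pow, Cmod_nome. apply pow_lt1; [|lia]. generalize (exp_neg_lt1 _ H); lra.
Qed.

Lemma one_plus_neq0 x : (Cmod x < 1)%R -> 1 + x <> 0.
Proof.
intros H. replace (1 + x) with (1 - - x) by ring. apply one_minus_neq0. now rewrite Cmod_opp.
Qed.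

Lemma cderive_nome_pow c b y n : cderive (fun s => nome (c + s * b) ^ n) y (- (INR n * b) * nome (c + y * b) ^ n).
Proof.
apply (cderive_ext (fun s => cexp (- (INR n * (c + s * b))))); [intros; apply nome_nat|].
rewrite <- nome_nat. apply (cderive_cexp (fun s => - (INR n * (c + s * b)))).
apply (cderive_ext (fun s => (- INR n) * (c + s * b))); [intros; ring|].
replace (- (INR n * b)) with ((- INR n) * b) by ring. apply cderive_scal, cderive_line.
Qed.

Lemma cderive_overpartition_prod K (c b : C) (y : R) : (0 < Re (c + RtoC y * b))%R ->
  cderive (fun s => overpartition_prod K (c + s * b)) y (- b * lambert_sum K (c + y * b) * overpartition_prod K (c + y * b)).
Proof.
intros H. induction K as [|K IH].
- simpl. unfold lambert_sum; simpl. replace (- b * 0 * 1) with (RtoC 0) by ring. apply cderive_const.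
- simpl overpartition_prod. set (q := fun s => nome (c + RtoC s * b) ^ S K).
  assert (Q : (Cmod (q y) < 1)%R) by (apply nome_pow_lt1; auto).
  assert (N1 := one_minus_neq0 _ Q). assert (N2 := one_plus_neq0 _ Q).
  assert (Dq : cderive q y (- (INR (S K) * b) * q y)) by (apply (cderive_nome_pow c b y (S K))).
  assert (DF : cderive (fun s => (1 + q s) / (1 - q s)) y (- b * lambert_term (c + y * b) (S K) * ((1 + q y) / (1 - q y)))).
  {
    assert (H1 : cderive (fun s => 1 + q s) y (0 + - (INR (S K) * b) * q y)) by (apply cderive_plus; auto; apply cderive_const).
    assert (H2 : cderive (fun s => 1 - q s) y (0 - - (INR (S K) * b) * q y)) by (apply cderive_minus; auto; apply cderive_const).
    assert (H3 := cderive_mult _ _ _ _ _ H1 (cderive_inv (fun s => 1 - q s) y _ N1 H2)). cbv beta in H3.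
    replace (- b * lambert_term (c + y * b) (S K) * ((1 + q y) / (1 - q y))) with
      ((0 + - (INR (S K) * b) * q y) * / (1 - q y) + (1 + q y) * (- (0 - - (INR (S K) * b) * q y) / ((1 - q y) * (1 - q y)))).
    - exact H3.
    - unfold lambert_term. fold (q y). field. split; auto.
      replace (1 - q y * q y) with ((1 - q y) * (1 + q y)) by ring. intros Z.
      apply (f_equal Cmod) in Z. rewrite Cmod_mult, Cmod_0 in Z. apply Rmult_integral in Z.
      apply Cmod_gt_0 in N1. apply Cmod_gt_0 in N2. lra. }
  assert (HM := cderive_mult _ _ _ _ _ IH DF). cbv beta in HM.
  unfold lambert_sum in *.
  change (cderive (fun s => overpartition_prod K (c + RtoC s * b) * ((1 + q s) / (1 - q s))) y
    (- b * (csumn (fun j => lambert_term (c + y * b) (S j)) K + lambert_term (c + y * b) (S K)) *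
     (overpartition_prod K (c + y * b) * ((1 + q y) / (1 - q y))))).
  replace (- b * (csumn (fun j => lambert_term (c + y * b) (S j)) K + lambert_term (c + y * b) (S K)) *
     (overpartition_prod K (c + y * b) * ((1 + q y) / (1 - q y)))) with
   (- b * csumn (fun j => lambert_term (c + y * b) (S j)) K * overpartition_prod K (c + y * b) * ((1 + q y) / (1 - q y)) +
    overpartition_prod K (c + y * b) * (- b * lambert_term (c + y * b) (S K) * ((1 + q y) / (1 - q y)))) by ring.
  exact HM.
Qed.

(** The ratio of consecutive coefficients is what the differential equation prescribes; the closed
    form with factorials is recovered only when the main coefficients are evaluated. *)
Fixpoint principal_coeff (k : nat) : R :=
  match k with O => PI | S j => (principal_coeff j * (PI * PI / 2) / (2 * INR j + 3))%R end.

Lemma principal_coeff_pos k : (0 < principal_coeff k)%R.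
Proof.
induction k; simpl; [generalize PI_gt_3; lra|]. unfold Rdiv. generalize PI_gt_3 (pos_INR k); intros.
apply Rmult_lt_0_compat; [apply Rmult_lt_0_compat; auto; nra|apply Rinv_0_lt_compat; lra].
Qed.

Lemma principal_coeff_bound k : (principal_coeff k <= PI * ((PI * PI / 4) ^ k * / INR (fact k)))%R.
Proof.
induction k; [simpl; lra|].
change (principal_coeff (S k)) with (principal_coeff k * (PI * PI / 2) / (2 * INR k + 3))%R.
assert (F := INR_fact_lt_0 k). generalize PI_gt_3 (pos_INR k); intros.
rewrite fact_simpl, mult_INR, S_INR. simpl pow.
replace (PI * (PI * PI / 4 * (PI * PI / 4) ^ k * / ((INR k + 1) * INR (fact k))))%R with
  (PI * ((PI * PI / 4) ^ k * / INR (fact k)) * (PI * PI / 4 * / (INR k + 1)))%R by (field; lra).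
replace (principal_coeff k * (PI * PI / 2) / (2 * INR k + 3))%R with (principal_coeff k * (PI * PI / 4 * (2 / (2 * INR k + 3))))%R by (field; lra).
apply Rmult_le_compat; auto.
- left; apply principal_coeff_pos.
- apply Rmult_le_pos; [nra|]. apply Rmult_le_pos; [lra|left; apply Rinv_0_lt_compat; lra].
- apply Rmult_le_compat_l; [nra|]. replace (2 / (2 * INR k + 3))%R with (/ (INR k + 3/2))%R by (field; lra).
  apply Rinv_le_contravar; lra.
Qed.

Lemma exp_series x : ex_series (fun k => x ^ k * / INR (fact k))%R /\ Series (fun k => x ^ k * / INR (fact k))%R = exp x.
Proof.
assert (H := is_exp_Reals x). unfold is_pseries in H.
assert (H' : is_series (fun k => x ^ k * / INR (fact k))%R (exp x)).
{ eapply is_series_ext; [|exact H]. intros n. rewrite pow_n_pow. reflexivity. }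
split; [now exists (exp x)|now apply is_series_unique].
Qed.

Lemma principal_coeff_series x : (0 <= x)%R -> ex_series (fun k => principal_coeff k * x ^ k)%R /\
  (Series (fun k => principal_coeff k * x ^ k) <= PI * exp (PI * PI / 4 * x))%R.
Proof.
intros Hx. destruct (exp_series (PI * PI / 4 * x)) as [E1 E2].
assert (D : forall k, (0 <= principal_coeff k * x ^ k <= PI * ((PI * PI / 4 * x) ^ k * / INR (fact k)))%R).
{ intros k. assert (P := principal_coeff_pos k). assert (X := pow_le x k Hx). split; [nra|].
  rewrite Rpow_mult_distr. generalize (principal_coeff_bound k). intros B.
  replace (PI * ((PI * PI / 4) ^ k * x ^ k * / INR (fact k)))%R with (PI * ((PI * PI / 4) ^ k * / INR (fact k)) * x ^ k)%R by ring.
  apply Rmult_le_compat_r; auto. }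
assert (E3 := ex_series_scalR PI _ E1).
split; [exact (ex_series_dom _ _ D E3)|].
rewrite <- E2, <- Series_scal_l. apply Series_le; auto.
Qed.

Lemma principal_coeff_tail x eps : (0 <= x)%R -> (0 < eps)%R -> exists N, forall K, (N <= K)%nat -> (principal_coeff K * x ^ K < eps)%R.
Proof.
intros Hx He. destruct (principal_coeff_series x Hx) as [E _]. apply ex_series_lim_0 in E.
apply is_lim_seq_spec in E. destruct (E (mkposreal _ He)) as [N HN]. exists N. intros K HK.
specialize (HN K HK). simpl in HN. rewrite Rminus_0_r in HN. generalize (Rle_abs (principal_coeff K * x ^ K)); lra.
Qed.

Definition principal_sum (K : nat) (tau : C) : C := csumn (fun k => principal_coeff k * (/ tau) ^ k) (S K).

Lemma cderive_inv_pow c b y n : c + RtoC y * b <> 0 ->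
  cderive (fun s => (/ (c + RtoC s * b)) ^ n) y (- b * INR n * (/ (c + y * b)) ^ S n).
Proof.
intros N. induction n.
- simpl. replace (- b * 0 * _) with (RtoC 0) by ring. apply cderive_const.
- assert (H := cderive_mult _ _ _ _ _ (cderive_inv _ y _ N (cderive_line c b y)) IHn). cbv beta in H.
  eapply (cderive_ext _ _ y _ (fun s => eq_refl)).
  replace (- b * INR (S n) * (/ (c + y * b)) ^ S (S n)) with
   (- b / ((c + y * b) * (c + y * b)) * (/ (c + y * b)) ^ n + / (c + y * b) * (- b * INR n * (/ (c + y * b)) ^ S n)).
  + exact H.
  + rewrite S_INR, RtoC_plus. simpl. field. auto.
Qed.

(** Coefficientwise this is (2k+1) f_k = (pi^2 / 2) f_(k-1). Two powers of w stay unmatched: the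
    lowest, because f_0 has no predecessor, and the highest, because of the truncation. Together
    they are the forcing term. *)
Lemma principal_sum_ode_identity K w : csumn (fun k => principal_coeff k * (INR k * w ^ S k)) (S K) =
  (PI * PI / 4 * (w * w) - w / 2) * csumn (fun k => principal_coeff k * w ^ k) (S K)
  - PI * PI / 4 * (principal_coeff K * w ^ S (S K)) + PI / 2 * w.
Proof.
induction K as [|K IH].
- simpl. field.
- assert (U : forall f, csumn f (S (S K)) = csumn f (S K) + f (S K)) by reflexivity.
  rewrite !U, IH. clear U.
  set (A := csumn _ (S K)).
  assert (E : RtoC (principal_coeff (S K)) * (2 * INR K + 3)%R = principal_coeff K * (PI * PI / 2)%R).
  { rewrite <- !RtoC_mult. f_equal. simpl principal_coeff. generalize (pos_INR K); intros. field. lra. }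
  rewrite S_INR. rewrite RtoC_plus in *. rewrite !RtoC_mult in E. unfold Rdiv in E. rewrite !RtoC_mult in E.
  rewrite RtoC_inv in E by lra.
  assert (E' : RtoC (principal_coeff K) * (PI * PI / 4) = RtoC (principal_coeff (S K)) * (2 * INR K + 3) / 2).
  { transitivity (principal_coeff K * (PI * PI * / 2) / 2); [field|]. rewrite <- E. field. }
  simpl Cpow.
  transitivity ((PI * PI / 4 * (w * w) - w / 2) * A - (principal_coeff K * (PI * PI / 4)) * (w * (w * w ^ K)) + PI / 2 * w +
    principal_coeff (S K) * ((INR K + 1) * (w * (w * w ^ K)))); [ring|].
  rewrite E'. field.
Qed.

Definition log_slope (tau : C) : C := PI * PI / (4 * (tau * tau)) - / (2 * tau).

Lemma cderive_csumn (f : R -> nat -> C) (f' : nat -> C) y n : (forall k, cderive (fun s => f s k) y (f' k)) ->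
  cderive (fun s => csumn (f s) n) y (csumn f' n).
Proof.
intros H. induction n; simpl; [apply cderive_const|]. apply cderive_plus; auto.
Qed.

Lemma cderive_principal_sum K c b y : c + RtoC y * b <> 0 -> let tau := c + RtoC y * b in
  cderive (fun s => principal_sum K (c + RtoC s * b)) y
   (- b * (log_slope tau * principal_sum K tau + (PI / 2 * / tau - PI * PI / 4 * (principal_coeff K * (/ tau) ^ S (S K))))).
Proof.
intros N tau. unfold principal_sum.
replace (- b * _) with (csumn (fun k => principal_coeff k * (- b * INR k * (/ tau) ^ S k)) (S K)).
- apply (cderive_csumn (fun s k => principal_coeff k * (/ (c + RtoC s * b)) ^ k)). intros k. apply cderive_scal. now apply cderive_inv_pow.
- transitivity (- b * csumn (fun k => principal_coeff k * (INR k * (/ tau) ^ S k)) (S K)).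
  + rewrite <- csumn_scal. apply csumn_ext; intros; ring.
  + rewrite principal_sum_ode_identity. unfold log_slope. f_equal.
    replace (PI * PI / (4 * (tau * tau)) - / (2 * tau)) with (PI * PI / 4 * (/ tau * / tau) - / tau / 2) by (field; auto).
    ring.
Qed.

(** Since Re al <= 0, the modulus of V grows at most at the rate |F|. As |V| need not be
    differentiable at a zero of V, in particular at 0, the proof uses sqrt (|V|^2 + e^2), which
    starts at e, and lets e tend to 0. *)
Lemma growth (V F : R -> C) (al : R -> C) y B : (0 <= y)%R -> V 0%R = 0 ->
  (forall s, (0 <= s <= y)%R -> cderive V s (al s * V s + F s)) ->
  (forall s, (0 <= s <= y)%R -> (Re (al s) <= 0)%R) ->
  (forall s, (0 <= s <= y)%R -> (Cmod (F s) <= B)%R) -> (Cmod (V y) <= B * y)%R.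
Proof.
intros Hy V0 D Ha HF.
apply le_epsilon. intros e He.
pose (g := fun s => sqrt (Re (V s) * Re (V s) + Im (V s) * Im (V s) + e * e)).
assert (Pos : forall s, (0 < Re (V s) * Re (V s) + Im (V s) * Im (V s) + e * e)%R) by (intros; nra).
assert (K := is_derive_bound g 0 y B (fun s => (Re (V s) * Re (al s * V s + F s) + Im (V s) * Im (al s * V s + F s)) / g s)%R Hy).
assert (G0 : g 0%R = e).
{ unfold g. rewrite V0. simpl. replace (0 * 0 + 0 * 0 + e * e)%R with (e * e)%R by ring. apply sqrt_square; lra. }
assert (Gy : (Cmod (V y) <= g y)%R).
{ unfold g, Cmod. apply sqrt_le_1_alt. unfold Re, Im. nra. }
rewrite G0 in K. apply Rle_trans with (1 := Gy).
assert (g y - e <= B * (y - 0))%R; [|lra]. apply K; clear K.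
- intros s Hs. destruct (D s Hs) as [D1 D2]. unfold g.
  set (d1 := Re (al s * V s + F s)) in *. set (d2 := Im (al s * V s + F s)) in *.
  assert (DG : is_derive (fun s => Re (V s) * Re (V s) + Im (V s) * Im (V s) + e * e)%R s
     ((d1 * Re (V s) + Re (V s) * d1) + (d2 * Im (V s) + Im (V s) * d2) + 0)%R).
  { apply (is_derive_plus (V := R_NormedModule) (fun s => Re (V s) * Re (V s) + Im (V s) * Im (V s))%R (fun _ => e * e)%R).
    - apply (is_derive_plus (V := R_NormedModule) (fun s => Re (V s) * Re (V s))%R (fun s => Im (V s) * Im (V s))%R);
      apply is_derive_multR; assumption.
    - apply (is_derive_const (V := R_NormedModule)). }
  assert (S0 : (sqrt (Re (V s) * Re (V s) + Im (V s) * Im (V s) + e * e) <> 0)%R) by (apply Rgt_not_eq, sqrt_lt_R0, Pos).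
  replace ((Re (V s) * d1 + Im (V s) * d2) / sqrt (Re (V s) * Re (V s) + Im (V s) * Im (V s) + e * e))%R with
    (((d1 * Re (V s) + Re (V s) * d1) + (d2 * Im (V s) + Im (V s) * d2) + 0) /
     (2 * sqrt (Re (V s) * Re (V s) + Im (V s) * Im (V s) + e * e)))%R by (field; auto).
  exact (is_derive_sqrt _ s _ DG (Pos s)).
- intros s Hs. assert (Gp : (0 < g s)%R) by (apply sqrt_lt_R0, Pos).
  apply Rmult_le_reg_r with (g s); auto. unfold Rdiv. rewrite Rmult_assoc, Rinv_l, Rmult_1_r by lra.
  assert (E : (Re (V s) * Re (al s * V s + F s) + Im (V s) * Im (al s * V s + F s) =
     Re (al s) * (Cmod (V s) * Cmod (V s)) + Re (Cconj (V s) * F s))%R).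
  { rewrite Cmod_sqr, Re_Cconj_mult. unfold Re, Im; simpl; ring. }
  rewrite E. assert (H1 := Ha s Hs). assert (H2 := HF s Hs).
  assert (H3 : (Re (Cconj (V s) * F s) <= Cmod (V s) * B)%R).
  { apply Rle_trans with (1 := Re_le_Cmod _). rewrite Cmod_mult, Cmod_conj. apply Rmult_le_compat_l; auto using Cmod_ge_0. }
  assert (H4 : (Cmod (V s) <= g s)%R).
  { unfold g, Cmod. apply sqrt_le_1_alt. unfold Re, Im. nra. }
  assert (H5 : (0 <= B)%R) by (apply Rle_trans with (2 := H2); apply Cmod_ge_0).
  assert (0 <= Cmod (V s) * Cmod (V s))%R by (generalize (Cmod_ge_0 (V s)); nra).
  nra.
Qed.

Lemma lambert_term_bound tau j : (0 < Re tau)%R -> let r := exp (- Re tau) in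
  (Cmod (lambert_term tau (S j)) <= 2 * r * / (1 - r) * ((INR j + 1) * r ^ j))%R.
Proof.
intros H r. assert (Hr := exp_neg_lt1 _ H : (0 < r < 1)%R).
unfold lambert_term. set (q := nome tau).
assert (Hq : Cmod q = r) by apply Cmod_nome.
assert (Q : (Cmod (q ^ S j * q ^ S j) <= r)%R).
{ rewrite Cmod_mult, !Cmod_pow, Hq. assert (Y := pow_lt1 r j). simpl pow.
  assert (0 <= r ^ j <= 1)%R by (split; [apply pow_le; lra|]; rewrite <- (pow1 j); apply pow_incr; lra).
  assert (r * r ^ j <= r)%R by nra. assert (0 <= r * r ^ j)%R by nra. nra. }
assert (N : 1 - q ^ S j * q ^ S j <> 0) by (apply one_minus_neq0; lra).
rewrite !Cmod_mult, Cmod_div by auto. rewrite !Cmod_R, S_INR, !Rabs_pos_eq by (generalize (pos_INR j); lra).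
rewrite Cmod_pow, Hq. simpl pow.
assert (T := Cmod_triangle (1 - q ^ S j * q ^ S j) (q ^ S j * q ^ S j)).
replace (1 - q ^ S j * q ^ S j + q ^ S j * q ^ S j) with (RtoC 1) in T by ring. rewrite Cmod_1 in T.
assert (I : (/ Cmod (1 - q ^ S j * q ^ S j) <= / (1 - r))%R) by (apply Rinv_le_contravar; lra).
unfold Rdiv. generalize (pos_INR j) (pow_le r j ltac:(lra)); intros.
replace (2 * r * / (1 - r) * ((INR j + 1) * r ^ j))%R with (2 * (INR j + 1) * (r * r ^ j * / (1 - r)))%R by ring.
apply Rmult_le_compat_l; [lra|]. apply Rmult_le_compat_l; auto. nra.
Qed.

(** One N serves the whole half plane because the majorant of the terms increases with e^(-Re
    tau). *)
Lemma lambert_sum_tail t eps : (0 < t)%R -> (0 < eps)%R -> exists N, forall K, (N <= K)%nat -> forall tau, (t <= Re tau)%R ->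
  (Cmod (lambert_sum K tau - csum (fun j => lambert_term tau (S j))) <= eps)%R.
Proof.
intros Ht He. set (r := exp (- t)). assert (Hr := exp_neg_lt1 _ Ht : (0 < r < 1)%R).
pose (b := fun j => (2 * r * / (1 - r) * ((INR j + 1) * r ^ j))%R).
assert (Eb : ex_series b) by (apply ex_series_scalR, ex_series_geom2; lra).
destruct (Series_tail_small b eps Eb He) as [N HN]. exists N. intros K HK tau Htau.
assert (D : forall j, (Cmod (lambert_term tau (S j)) <= b j)%R).
{ intros j. eapply Rle_trans; [apply lambert_term_bound; lra|]. unfold b. set (r' := exp (- Re tau)).
  assert (Hr' : (r' <= r)%R) by (apply exp_le_mono; lra). assert (0 < r')%R by apply exp_pos.
  apply Rmult_le_compat.
  - apply Rmult_le_pos; [lra|left; apply Rinv_0_lt_compat; lra].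
  - apply Rmult_le_pos; [generalize (pos_INR j); lra|apply pow_le; lra].
  - apply Rmult_le_compat; [lra|left; apply Rinv_0_lt_compat; lra|lra|apply Rinv_le_contravar; lra].
  - apply Rmult_le_compat_l; [generalize (pos_INR j); lra|]. apply pow_incr; lra. }
assert (A : cabs (fun j => lambert_term tau (S j))) by (apply (cabs_dom _ b); auto).
rewrite (csum_tail _ K A). fold (lambert_sum K tau).
replace (lambert_sum K tau - (lambert_sum K tau + csum (fun k => lambert_term tau (S (K + k))))) with (- csum (fun k => lambert_term tau (S (K + k)))) by ring.
rewrite Cmod_opp. eapply Rle_trans; [apply (Cmod_csum_le _ (fun k => b (K + k)%nat)); auto|].
- apply (ex_series_incr_n b K), Eb.
- left. eapply Rle_lt_trans; [apply Rle_abs|]. apply HN; auto.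
Qed.

Open Scope R_scope.

(** * Decay of the product away from the real axis *)

Lemma cos_approx_3 a : cos_approx a 3 = 1 - a * a / 2 + a * a * (a * a) / 24 - a * a * (a * a) * (a * a) / 720.
Proof.
assert (F4 : INR (fact 4) = 24) by (rewrite INR_IZR_INZ; reflexivity).
assert (F6 : INR (fact 6) = 720) by (rewrite INR_IZR_INZ; reflexivity).
unfold cos_approx, sum_f_R0, cos_term.
change (2 * 3)%nat with 6%nat. change (2 * 2)%nat with 4%nat. change (2 * 1)%nat with 2%nat. change (2 * 0)%nat with 0%nat.
rewrite F4, F6. change (INR (fact 2)) with 2. change (INR (fact 0)) with 1. field.
Qed.

(** Half of 3.15 is halved once more, so that a short Taylor polynomial followed by the double angle
    formula decides the sign of the cosine. *)
Lemma PI_lt_315 : PI < 3.15.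
Proof.
destruct (Rlt_le_dec PI 3.15) as [H|H]; auto. exfalso.
assert (A : 0 <= cos (2 * 0.7875)) by (apply cos_ge_0; lra).
destruct (pre_cos_bound 0.7875 0) as [_ K]; try lra.
unfold cos_approx, sum_f_R0, cos_term, fact in K. simpl in K.
assert (0 <= cos 0.7875) by (apply cos_ge_0; lra).
rewrite cos_2a_cos in A. nra.
Qed.

Lemma PI_gt_314 : 3.14 < PI.
Proof.
destruct (Rlt_le_dec 3.14 PI) as [H|H]; auto. exfalso.
assert (A : cos (2 * 0.785) <= 0) by (apply cos_le_0; generalize PI_gt_3; lra).
destruct (pre_cos_bound 0.785 1) as [K _]; try lra.
change (2 * 1 + 1)%nat with 3%nat in K. rewrite cos_approx_3 in K.
rewrite cos_2a_cos in A. nra.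
Qed.

Lemma PI_sq_bounds : 9.85 < PI * PI < 9.9225.
Proof. generalize PI_lt_315 PI_gt_314. nra. Qed.

(* Up to a positive factor, the radial derivative of the gap in factor_log_ineq, with u = rho^2. *)
Lemma factor_poly u c : 0 <= u < 1 -> -1 <= c <= 1 ->
  0 <= (1 + u) * (1 + u) - 4 * u * (c * c) + c * (1 - u) * (u + 3 - 4 * (c * c)).
Proof.
intros Hu Hc.
replace ((1 + u) * (1 + u) - 4 * u * (c * c) + c * (1 - u) * (u + 3 - 4 * (c * c))) with
 ((1 - c) * (4 * (1 - u) * (c * c) + 4 * c + (1 + u) * (1 + u))) by ring.
apply Rmult_le_pos; [lra|].
set (d := c + 1). replace c with (d - 1) by (unfold d; ring).
replace (4 * (1 - u) * ((d - 1) * (d - 1)) + 4 * (d - 1) + (1 + u) * (1 + u)) with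
 ((1 - u) * (1 - u) + d * (8 * u - 4) + 4 * (1 - u) * (d * d)) by ring.
assert (0 <= d <= 2) by (unfold d; lra).
destruct (Rle_lt_dec (1/2) u).
- assert (0 <= d * (8 * u - 4)) by nra. assert (0 <= 4 * (1 - u) * (d * d)) by nra. nra.
(* Multiplying by 1 - u completes the square in d and leaves u (1 - u - u^2), which is nonnegative
   for u <= 1/2. *)
- assert (E : 0 <= (1 - u) * ((1 - u) * (1 - u) + d * (8 * u - 4) + 4 * (1 - u) * (d * d))).
  { replace ((1 - u) * ((1 - u) * (1 - u) + d * (8 * u - 4) + 4 * (1 - u) * (d * d))) with
     ((2 * (1 - u) * d - (1 - 2 * u)) * (2 * (1 - u) * d - (1 - 2 * u)) + u * (1 - u - u * u)) by ring.
    assert (0 <= u * (1 - u - u * u)) by (apply Rmult_le_pos; [lra|]; assert (u * u <= u * (1/2)) by (apply Rmult_le_compat_l; lra); lra). generalize (Rle_0_sqr (2 * (1 - u) * d - (1 - 2 * u))); unfold Rsqr; lra. }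
  apply Rmult_le_reg_l with (1 - u); [lra|]. now rewrite Rmult_0_r.
Qed.

(** The gap between the two sides vanishes at rho = 0 and is monotone in rho for a fixed direction
    c; [factor_poly] gives the sign of its derivative. *)
Lemma factor_log_ineq rho c : 0 <= rho < 1 -> -1 <= c <= 1 ->
  / 2 * ln (1 + rho * rho + 2 * rho * c) - / 2 * ln (1 + rho * rho - 2 * rho * c) <=
  ln (1 + rho) - ln (1 - rho) - 2 * (rho - rho * c).
Proof.
intros Hr Hc.
assert (P : forall x, 0 <= x <= rho -> 0 < 1 + x * x + 2 * x * c /\ 0 < 1 + x * x - 2 * x * c).
{ intros x Hx. assert (0 < (1 - x) * (1 - x)) by nra. split; nra. }
pose (F := fun x => - (ln (1 + x) - ln (1 - x) - 2 * (x - x * c) - / 2 * ln (1 + x * x + 2 * x * c) + / 2 * ln (1 + x * x - 2 * x * c))).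
assert (K := is_derive_bound F 0 rho 0 (fun x => - (/ (1 + x) + / (1 - x) - 2 * (1 - c) - (x + c) / (1 + x * x + 2 * x * c) + (x - c) / (1 + x * x - 2 * x * c)))).
assert (F rho - F 0 <= 0 * (rho - 0)).
{ apply K; [lra|..]; clear K.
  - intros x Hx. destruct (P x Hx) as [P1 P2]. unfold F. auto_derive; [repeat split; lra|]. field. repeat split; lra.
  - intros x Hx. destruct (P x Hx) as [P1 P2].
    assert (Q := factor_poly (x * x) c ltac:(nra) Hc).
    set (A := 1 + x * x + 2 * x * c) in *. set (B := 1 + x * x - 2 * x * c) in *.
    assert (E : / (1 + x) + / (1 - x) - 2 * (1 - c) - (x + c) / A + (x - c) / B =
      2 * (x * x) * ((1 + x * x) * (1 + x * x) - 4 * (x * x) * (c * c) + c * (1 - x * x) * (x * x + 3 - 4 * (c * c))) * (/ (1 - x) * / (1 + x) * / (A * B))).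
    { unfold A, B in *. field. repeat split; lra. }
    rewrite E. apply Ropp_le_cancel. rewrite Ropp_0, Ropp_involutive.
    apply Rmult_le_pos; [apply Rmult_le_pos; auto; nra|].
    left. repeat apply Rmult_lt_0_compat; apply Rinv_0_lt_compat; try lra. now apply Rmult_lt_0_compat. }
unfold F in H. replace (1 + 0) with 1 in H by ring. replace (1 - 0) with 1 in H by ring.
replace (1 + 0 * 0 + 2 * 0 * c) with 1 in H by ring. replace (1 + 0 * 0 - 2 * 0 * c) with 1 in H by ring.
rewrite ln_1 in H. lra.
Qed.

(** Since log ((1+z) / (1-z)) = 2 (z + z^3/3 + ...), turning z away from the positive axis should
    cost about what the linear term 2z loses, and it costs at least that. Keeping this term alone
    makes the loss over all factors a geometric series. *)
Lemma factor_ineq (z : C) : Cmod z < 1 ->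
  Cmod ((1 + z) / (1 - z))%C <= (1 + Cmod z) / (1 - Cmod z) * exp (- (2 * (Cmod z - Re z))).
Proof.
intros H. generalize (Cmod_ge_0 z); intros H0.
assert (N1 := one_minus_neq0 z H). assert (N2 := one_plus_neq0 z H).
assert (P1 := proj1 (Cmod_gt_0 _) N1). assert (P2 := proj1 (Cmod_gt_0 _) N2).
rewrite Cmod_div by auto. set (rho := Cmod z) in *.
destruct (Req_dec rho 0) as [Z|Z].
{ assert (z = RtoC 0) by (apply Cmod_eq_0; auto). rewrite Z, H1. simpl.
  replace (Cplus 1 0) with (RtoC 1) by ring. replace (Cminus 1 0) with (RtoC 1) by ring. rewrite Cmod_1.
  replace (- (2 * (0 - 0))) with 0 by ring. rewrite exp_0. lra. }
set (c := Re z / rho).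
assert (Rz : Re z = rho * c) by (unfold c; field; auto).
assert (Hc : -1 <= c <= 1).
{ assert (A := re_le_Cmod z). fold rho in A. apply Rabs_le_between in A. rewrite Rz in A. nra. }
assert (S : rho * rho = Re z * Re z + Im z * Im z) by apply Cmod_sqr.
assert (E1 : Cmod (1 + z)%C * Cmod (1 + z)%C = 1 + rho * rho + 2 * rho * c).
{ rewrite Cmod_sqr, S. replace (2 * rho * c) with (2 * Re z) by (rewrite Rz; ring). simpl. unfold Re, Im. ring. }
assert (E2 : Cmod (1 - z)%C * Cmod (1 - z)%C = 1 + rho * rho - 2 * rho * c).
{ rewrite Cmod_sqr, S. replace (2 * rho * c) with (2 * Re z) by (rewrite Rz; ring). simpl. unfold Re, Im. ring. }
assert (L := factor_log_ineq rho c ltac:(lra) Hc). rewrite <- E1, <- E2 in L.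
rewrite !ln_mult in L by auto.
assert (A1 : 0 < Cmod (1 + z)%C / Cmod (1 - z)%C) by (apply Rdiv_lt_0_compat; lra).
assert (A2 : 0 < (1 + rho) / (1 - rho)) by (apply Rdiv_lt_0_compat; lra).
apply Rle_trans with (exp (ln (Cmod (1 + z)%C / Cmod (1 - z)%C))); [rewrite exp_ln; auto; lra|].
apply Rle_trans with (exp (ln ((1 + rho) / (1 - rho)) + - (2 * (rho - Re z)))); [|rewrite exp_plus, exp_ln; auto; lra].
apply exp_le_mono. rewrite !ln_div by lra. rewrite Rz. lra.
Qed.

Definition real_prod (K : nat) (s : R) : R := Re (overpartition_prod K (RtoC s)).

Lemma nome_R s : nome (RtoC s) = RtoC (exp (- s)).
Proof. unfold nome. rewrite <- RtoC_opp. apply cexp_R. Qed.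

Lemma real_prod_spec K s : 0 < s -> overpartition_prod K (RtoC s) = RtoC (real_prod K s) /\ 1 <= real_prod K s.
Proof.
intros Hs. assert (Hr := exp_neg_lt1 s Hs).
induction K as [|K [IH1 IH2]].
- unfold real_prod; simpl. split; [easy|lra].
- assert (Y := pow_lt1 (exp (- s)) (S K) ltac:(lra) ltac:(lia)).
  assert (E : overpartition_prod (S K) (RtoC s) = RtoC (real_prod K s * ((1 + exp (- s) ^ S K) / (1 - exp (- s) ^ S K)))).
  { change (overpartition_prod (S K) (RtoC s)) with (overpartition_prod K (RtoC s) * ((1 + nome (RtoC s) ^ S K) / (1 - nome (RtoC s) ^ S K)))%C.
    rewrite IH1, nome_R, <- RtoC_pow, <- RtoC_plus, <- RtoC_minus, <- RtoC_div by lra. now rewrite <- RtoC_mult. }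
  assert (E' : real_prod (S K) s = real_prod K s * ((1 + exp (- s) ^ S K) / (1 - exp (- s) ^ S K))).
  { unfold real_prod at 1. rewrite E. reflexivity. }
  rewrite E'. split; [exact E|].
  assert (1 <= (1 + exp (- s) ^ S K) / (1 - exp (- s) ^ S K)); [|nra].
  apply Rmult_le_reg_r with (1 - exp (- s) ^ S K); [lra|]. unfold Rdiv. rewrite Rmult_assoc, Rinv_l; lra.
Qed.

Lemma real_prod_S K s : 0 < s -> real_prod (S K) s = real_prod K s * ((1 + exp (- s) ^ S K) / (1 - exp (- s) ^ S K)).
Proof.
intros Hs. assert (Hr := exp_neg_lt1 s Hs). assert (Y := pow_lt1 (exp (- s)) (S K) ltac:(lra) ltac:(lia)).
unfold real_prod at 1. change (overpartition_prod (S K) (RtoC s)) with (overpartition_prod K (RtoC s) * ((1 + nome (RtoC s) ^ S K) / (1 - nome (RtoC s) ^ S K)))%C.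
rewrite (proj1 (real_prod_spec K s Hs)), nome_R, <- RtoC_pow, <- RtoC_plus, <- RtoC_minus, <- RtoC_div by lra. now rewrite <- RtoC_mult.
Qed.

Lemma overpartition_prod_minor K tau : 0 < Re tau ->
  Cmod (overpartition_prod K tau) <= real_prod K (Re tau) *
    exp (- (2 * rsum (fun j => exp (- Re tau) ^ S j - Re (nome tau ^ S j)%C) K)).
Proof.
intros Ht. induction K as [|K IH].
- simpl. rewrite Cmod_1, Rmult_0_r, Ropp_0, exp_0. unfold real_prod; simpl. lra.
- rewrite real_prod_S by auto.
  change (rsum (fun j => exp (- Re tau) ^ S j - Re (nome tau ^ S j)%C) (S K)) with
    (rsum (fun j => exp (- Re tau) ^ S j - Re (nome tau ^ S j)%C) K + (exp (- Re tau) ^ S K - Re (nome tau ^ S K)%C)).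
  change (overpartition_prod (S K) tau) with (overpartition_prod K tau * ((1 + nome tau ^ S K) / (1 - nome tau ^ S K)))%C.
  rewrite Cmod_mult.
  assert (Q := nome_pow_lt1 tau K Ht). assert (F := factor_ineq _ Q).
  rewrite Cmod_pow, Cmod_nome in F.
  set (A := rsum _ K) in *. set (B := exp (- Re tau) ^ S K - Re (nome tau ^ S K)%C) in *.
  replace (- (2 * (A + B))) with (- (2 * A) + - (2 * B)) by ring. rewrite exp_plus.
  apply Rle_trans with ((real_prod K (Re tau) * exp (- (2 * A))) * ((1 + exp (- Re tau) ^ S K) / (1 - exp (- Re tau) ^ S K) * exp (- (2 * B)))).
  + apply Rmult_le_compat; auto using Cmod_ge_0.
  + right. ring.
Qed.

Lemma rsum_minus a b n : rsum (fun k => a k - b k) n = rsum a n - rsum b n.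
Proof. induction n; simpl; [ring|]. rewrite IHn; ring. Qed.

Lemma csumn_geom x n : (csumn (fun j => x ^ j) n * (1 - x) = 1 - x ^ n)%C.
Proof. induction n; simpl; [ring|]. rewrite Cmult_plus_distr_r, IHn. ring. Qed.

(** The sum over all j >= 1 of e^(-tj) - Re q^j; twice this is the exponent lost in
    [overpartition_prod_minor] in the limit of large K. *)
Definition Phi (t y : R) : R := exp (- t) / (1 - exp (- t)) - Re (nome (t, y) / (1 - nome (t, y)))%C.

Lemma Phi_partial K t y : 0 < t ->
  Phi t y - 2 * exp (- t) ^ S K / (1 - exp (- t)) <= rsum (fun j => exp (- t) ^ S j - Re (nome (t, y) ^ S j)%C) K.
Proof.
intros Ht. assert (Hr := exp_neg_lt1 t Ht). set (r := exp (- t)) in *. set (q := nome (t, y)).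
assert (Hq : Cmod q = r) by (unfold q; rewrite Cmod_nome; reflexivity).
assert (N := one_minus_neq0 q ltac:(lra)).
assert (E1 : forall x : C, (1 - x <> 0)%C -> csumn (fun j => x ^ S j)%C K = (x / (1 - x) - x ^ S K / (1 - x))%C).
{ intros x Nx. transitivity (x * (csumn (fun j => x ^ j) K * (1 - x)) / (1 - x))%C.
  - transitivity (x * csumn (fun j => x ^ j) K)%C; [rewrite <- csumn_scal; apply csumn_ext; intros; reflexivity|]. field; auto.
  - rewrite csumn_geom. simpl. field; auto. }
assert (N' : (1 - RtoC r <> 0)%C) by (apply one_minus_neq0; rewrite Cmod_R, Rabs_pos_eq; lra).
assert (ER : rsum (fun j => r ^ S j) K = r / (1 - r) - r ^ S K / (1 - r)).
{ assert (E2 := E1 _ N'). apply (f_equal Re) in E2. rewrite csumn_Re in E2.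
  rewrite <- RtoC_pow, <- RtoC_minus, <- !RtoC_div, <- RtoC_minus in E2 by lra.
  change (rsum (fun k => Re (RtoC r ^ S k)%C) K = r / (1 - r) - r ^ S K / (1 - r)) in E2.
  rewrite <- E2. apply rsum_ext. intros k _. rewrite <- RtoC_pow. reflexivity. }
assert (EQ : rsum (fun j => Re (q ^ S j)%C) K = Re (q / (1 - q))%C - Re (q ^ S K / (1 - q))%C).
{ rewrite <- (csumn_Re (fun j => q ^ S j)%C), (E1 q N). reflexivity. }
assert (ES : rsum (fun j => r ^ S j - Re (q ^ S j)%C) K = rsum (fun j => r ^ S j) K - rsum (fun j => Re (q ^ S j)%C) K).
{ apply (rsum_minus (fun j => r ^ S j) (fun j => Re (q ^ S j)%C)). }
rewrite ES, ER, EQ. unfold Phi. fold r q.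
assert (B : - Re (q ^ S K / (1 - q))%C <= r ^ S K / (1 - r)).
{ apply Rle_trans with (Cmod (q ^ S K / (1 - q))%C).
  - rewrite <- Cmod_opp. exact (Re_le_Cmod (- (q ^ S K / (1 - q)))%C).
  - rewrite Cmod_div, Cmod_pow, Hq by auto. apply Rmult_le_compat_l; [apply pow_le; lra|].
    apply Rinv_le_contravar; [lra|]. assert (T := Cmod_triangle (1 - q) q).
    replace (1 - q + q)%C with (RtoC 1) in T by ring. rewrite Cmod_1 in T. lra. }
unfold Rdiv in *. lra.
Qed.

Lemma Phi_eq t y : 0 < t -> let r := exp (- t) in
  Phi t y = r * (1 + r) * (1 - cos y) / ((1 - r) * ((1 - r) * (1 - r) + 2 * r * (1 - cos y))).
Proof.
intros Ht r. assert (Hr := exp_neg_lt1 t Ht : 0 < r < 1). unfold Phi. fold r.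
assert (Q : nome (t, y) = (r * cos y, - (r * sin y))).
{ unfold nome, cexp. apply C_eq; simpl; rewrite ?cos_neg, ?sin_neg; fold r; ring. }
rewrite Q. unfold Cdiv, Cinv. simpl.
generalize (sin2_cos2 y) (COS_bound y); unfold Rsqr; intros S [_ B].
set (h := 1 - cos y). assert (Hh : 0 <= h) by (unfold h; lra).
assert (D : (1 + - (r * cos y)) * ((1 + - (r * cos y)) * 1) + (0 + - - (r * sin y)) * ((0 + - - (r * sin y)) * 1) =
   (1 - r) * (1 - r) + 2 * r * h).
{ unfold h. replace (0 + - - (r * sin y)) with (r * sin y) by ring. nra. }
rewrite D. assert (DP : 0 < (1 - r) * (1 - r) + 2 * r * h) by nra.
replace (r * cos y * ((1 + - (r * cos y)) / ((1 - r) * (1 - r) + 2 * r * h)) -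
   - (r * sin y) * (- (0 + - - (r * sin y)) / ((1 - r) * (1 - r) + 2 * r * h))) with
   ((r * cos y - r * r * (sin y * sin y + cos y * cos y)) / ((1 - r) * (1 - r) + 2 * r * h)) by (field; lra).
rewrite S. replace (cos y) with (1 - h) by (unfold h; ring). field. lra.
Qed.

Lemma coth_ge t : 0 < t -> 2 / t <= (1 + exp (- t)) / (1 - exp (- t)).
Proof.
intros Ht. assert (Hr := exp_neg_lt1 t Ht).
assert (K := is_derive_bound (fun x => - (x * (1 + exp (- x)) - 2 + 2 * exp (- x))) 0 t 0 (fun x => - (1 - exp (- x) * (1 + x)))).
assert (H : - (t * (1 + exp (- t)) - 2 + 2 * exp (- t)) - - (0 * (1 + exp (- 0)) - 2 + 2 * exp (- 0)) <= 0 * (t - 0)).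
{ apply K; [lra|..].
  - intros s Hs. auto_derive; auto. ring.
  - intros s Hs. assert (exp (- s) * (1 + s) <= 1); [|lra].
    apply Rle_trans with (exp (- s) * exp s); [apply Rmult_le_compat_l; [left; apply exp_pos|apply exp_ineq1_le]|].
    rewrite <- exp_plus, Rplus_opp_l, exp_0; lra. }
rewrite Ropp_0, exp_0 in H.
apply Rmult_le_reg_r with (t * (1 - exp (- t))); [nra|].
replace (2 / t * (t * (1 - exp (- t)))) with (2 * (1 - exp (- t))) by (field; lra).
replace ((1 + exp (- t)) / (1 - exp (- t)) * (t * (1 - exp (- t)))) with (t * (1 + exp (- t))) by (field; lra).
lra.
Qed.

(** In the closed form, (1+r) / (1-r) = coth (t/2) >= 2/t, and (1-r)^2 / (2r) <= t^2 / (2 (1-t)) <=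
    0.522 t^2 because t <= 1/24. *)
Lemma Phi_lower t y : 0 < t <= 1/24 ->
  / t * ((1 - cos y) / (0.522 * (t * t) + (1 - cos y))) <= Phi t y.
Proof.
intros Ht. rewrite Phi_eq by lra. assert (Hr := exp_neg_lt1 t ltac:(lra)).
set (r := exp (- t)) in *. generalize (COS_bound y); intros [_ B].
set (h := 1 - cos y). assert (Hh : 0 <= h) by (unfold h; lra).
assert (C1 := coth_ge t ltac:(lra)). fold r in C1.
assert (R1 : 1 - t <= r) by (unfold r; generalize (exp_ineq1_le (- t)); lra).
assert (T2 : 0 < t * t) by nra.
replace (r * (1 + r) * h / ((1 - r) * ((1 - r) * (1 - r) + 2 * r * h))) with
  ((1 + r) / (1 - r) * / 2 * (h / ((1 - r) * (1 - r) / (2 * r) + h))).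
- apply Rmult_le_compat.
  + left; apply Rinv_0_lt_compat; lra.
  + apply Rmult_le_pos; auto. left; apply Rinv_0_lt_compat; lra.
  + replace (/ t) with (2 / t * / 2) by (field; lra). apply Rmult_le_compat_r; lra.
  + apply Rmult_le_compat_l; auto.
    assert (A0 : 0 < (1 - r) * (1 - r) / (2 * r)) by (apply Rdiv_lt_0_compat; nra).
    apply Rinv_le_contravar; [lra|]. apply Rplus_le_compat_r.
    apply Rmult_le_reg_r with (2 * r); [lra|]. unfold Rdiv at 1. rewrite Rmult_assoc, Rinv_l, Rmult_1_r by lra.
    assert ((1 - r) * (1 - r) <= t * t) by nra. nra.
- field. assert (0 < (1 - r) * (1 - r) + 2 * r * h) by nra. assert (0 < 2 * r * h + (1 - r) * (1 - r)) by nra.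
  repeat split; lra.
Qed.

Lemma frac_mono a h1 h2 : 0 < a -> 0 <= h1 <= h2 -> h1 / (a + h1) <= h2 / (a + h2).
Proof.
intros Ha H. apply Rmult_le_reg_r with ((a + h1) * (a + h2)); [nra|].
replace (h1 / (a + h1) * ((a + h1) * (a + h2))) with (h1 * (a + h2)) by (field; lra).
replace (h2 / (a + h2) * ((a + h1) * (a + h2))) with (h2 * (a + h1)) by (field; lra). nra.
Qed.

Lemma one_minus_cos_lower y : 0 <= y <= 1/6 -> 0.4988 * (y * y) <= 1 - cos y.
Proof.
intros H. destruct (pre_cos_bound y 0) as [_ K]; try lra.
unfold cos_approx, sum_f_R0, cos_term, fact in K. simpl in K.
assert (0 <= y * y <= 1/36) by nra. assert (0 <= (y * y) * (y * y) <= (1/36) * (y * y)) by nra. nra.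
Qed.

(** Here y <= 4t <= 1/6, so the Taylor bound for the cosine applies, and 1.05 exceeds 0.522 /
    0.4988. *)
Lemma Phi_major t y : 0 < t <= 1/24 -> 0 <= y <= 4 * t ->
  / t * ((y * y) / (1.05 * (t * t) + y * y)) <= Phi t y.
Proof.
intros Ht Hy. apply Rle_trans with (2 := Phi_lower t y Ht).
apply Rmult_le_compat_l; [left; apply Rinv_0_lt_compat; lra|].
assert (H := one_minus_cos_lower y ltac:(lra)).
assert (0 < t * t) by nra. assert (0 <= y * y) by nra.
apply Rle_trans with (0.4988 * (y * y) / (0.522 * (t * t) + 0.4988 * (y * y))).
- apply Rmult_le_reg_r with ((1.05 * (t * t) + y * y) * (0.522 * (t * t) + 0.4988 * (y * y))); [nra|].
  replace (y * y / (1.05 * (t * t) + y * y) * ((1.05 * (t * t) + y * y) * (0.522 * (t * t) + 0.4988 * (y * y)))) with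
   (y * y * (0.522 * (t * t) + 0.4988 * (y * y))) by (field; lra).
  replace (0.4988 * (y * y) / (0.522 * (t * t) + 0.4988 * (y * y)) * ((1.05 * (t * t) + y * y) * (0.522 * (t * t) + 0.4988 * (y * y)))) with
   (0.4988 * (y * y) * (1.05 * (t * t) + y * y)) by (field; lra). nra.
- apply frac_mono; lra.
Qed.

(** The cosine decreases on [0, pi], so the worst point is y = 4t, where 1 - cos y >= 7.98 t^2; and
    7.98 / (0.522 + 7.98) > 0.938. *)
Lemma Phi_minor t y : 0 < t <= 1/24 -> 4 * t <= y <= PI -> 0.938 * / t <= Phi t y.
Proof.
intros Ht Hy. apply Rle_trans with (2 := Phi_lower t y Ht). rewrite Rmult_comm.
apply Rmult_le_compat_l; [left; apply Rinv_0_lt_compat; lra|].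
assert (H := one_minus_cos_lower (4 * t) ltac:(lra)).
assert (0 < t * t) by nra.
assert (C : cos y <= cos (4 * t)) by (apply cos_decr_1; lra).
apply Rle_trans with (7.98 * (t * t) / (0.522 * (t * t) + 7.98 * (t * t))).
- apply Rmult_le_reg_r with (0.522 * (t * t) + 7.98 * (t * t)); [lra|].
  unfold Rdiv. rewrite Rmult_assoc, Rinv_l by lra. lra.
- apply frac_mono; lra.
Qed.


Ltac change_eq_R := match goal with |- ?a = ?b => change (@eq R a b) end.

Lemma exp_neg_small x n : 0 <= x -> INR n <= x -> exp (- x) <= (1/2) ^ n.
Proof.
intros Hx Hn. apply Rle_trans with (exp (- INR n)); [apply exp_le_mono; lra|].
rewrite exp_Ropp. replace (1/2) with (/ 2) by lra. rewrite pow_inv.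
apply Rinv_le_contravar; [apply pow_lt; lra|].
rewrite <- (Rmult_1_r (INR n)). clear. induction n.
- simpl. rewrite Rmult_0_l, exp_0. lra.
- rewrite S_INR, Rmult_plus_distr_r, exp_plus. simpl pow. rewrite Rmult_comm. apply Rmult_le_compat; try lra.
  + apply pow_le; lra.
  + rewrite Rmult_1_l. generalize (exp_ineq1_le 1); lra.
Qed.

Lemma log_slope_R s : s <> 0 -> log_slope (RtoC s) = RtoC (PI * PI / (4 * (s * s)) - / (2 * s)).
Proof.
intros Hs. unfold log_slope. rewrite RtoC_minus, RtoC_div by nra. rewrite RtoC_inv by lra. rewrite !RtoC_mult. reflexivity.
Qed.

Lemma is_derive_real_prod K s : 0 < s -> is_derive (real_prod K) s (- Re (lambert_sum K (RtoC s)) * real_prod K s).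
Proof.
intros Hs. assert (H := cderive_overpartition_prod K 0%C 1%C s).
replace (RtoC 0 + RtoC s * 1)%C with (RtoC s) in H by ring. specialize (H Hs).
destruct H as [H _].
assert (E : Re (- (1) * lambert_sum K (RtoC s) * overpartition_prod K (RtoC s))%C = - Re (lambert_sum K (RtoC s)) * real_prod K s).
{ rewrite (proj1 (real_prod_spec K s Hs)). destruct (lambert_sum K (RtoC s)); simpl. ring. }
rewrite E in H. eapply is_derive_ext; [|exact H]. intros u. unfold real_prod. f_equal. f_equal. simpl. ring.
Qed.

Lemma Re_inv_RtoC s : s <> 0 -> Re (/ RtoC s)%C = / s.
Proof. intros H. rewrite <- RtoC_inv by auto. reflexivity. Qed.

(** Half of 0.01 pays for the truncation. The other half covers 22 e^(-2 pi^2 / s) / s^2, because 2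
    pi^2 / s >= 16 + 2/s for s <= 1 and e^(-2/s) <= s^2. *)
Lemma lambert_sum_real_bound t : 0 < t <= 1 -> exists N, forall K, (N <= K)%nat -> forall s, t <= s <= 1 ->
  Rabs (Re (lambert_sum K (RtoC s)) - (PI * PI / (4 * (s * s)) - / (2 * s))) <= 0.01.
Proof.
intros Ht. destruct (lambert_sum_tail t 0.005 ltac:(lra) ltac:(lra)) as [N HN].
exists N. intros K HK s Hs.
assert (B1 := HN K HK (RtoC s) ltac:(simpl; lra)).
assert (Hs0 : s <> 0) by lra.
assert (B2 := D_asymptotic (RtoC s) ltac:(simpl; lra)). cbv zeta in B2.
rewrite Re_inv_RtoC in B2 by auto. fold (log_slope (RtoC s)) in B2.
assert (I : 1 <= / s) by (rewrite <- Rinv_1; apply Rinv_le_contravar; lra).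
assert (P2 := PI_sq_bounds).
assert (E1 : exp (- (2 * (PI * PI) * / s)) <= (1/2) ^ 16 * (s * s)).
{ apply Rle_trans with (exp (- 16 + - (/ s + / s))).
  - apply exp_le_mono. nra.
  - rewrite exp_plus. apply Rmult_le_compat; try (left; apply exp_pos).
    + replace (- 16) with (Ropp 16) by ring. apply (exp_neg_small 16 16); [lra|rewrite INR_IZR_INZ; simpl; lra].
    + rewrite exp_Ropp, exp_plus. replace (s * s) with (/ (/ s * / s)) by (field; auto).
      assert (/ s <= exp (/ s)) by (generalize (exp_ineq1_le (/ s)); lra).
      apply Rinv_le_contravar; [nra|]. apply Rmult_le_compat; lra. }
assert (S2 : s * s <= 1) by nra.
assert (E2 : (1/2) ^ 16 = 1 / 65536) by lra. rewrite E2 in E1.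
specialize (B2 ltac:(nra)).
rewrite Cmod_R, Rabs_pos_eq in B2 by lra.
assert (B3 : 22 * exp (- (2 * (PI * PI) * / s)) / (s * s) <= 0.005).
{ apply Rmult_le_reg_r with (s * s); [nra|]. unfold Rdiv. rewrite Rmult_assoc, Rinv_l by nra. nra. }
rewrite log_slope_R in B2 by auto. set (S := csum _) in *.
set (A := PI * PI / (4 * (s * s)) - / (2 * s)) in *.
replace (Re (lambert_sum K (RtoC s)) - A) with (Re ((lambert_sum K (RtoC s) - S) + (S - RtoC A))%C) by (simpl; unfold Re; ring).
apply Rle_trans with (1 := re_le_Cmod _). apply Rle_trans with (1 := Cmod_triangle _ _). lra.
Qed.

Lemma exp_m1_upper : exp (Ropp 1) <= 0.39.
Proof.
rewrite exp_Ropp. replace 0.39 with (/ (1/0.39)) by (field; lra). apply Rinv_le_contravar; [lra|].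
replace 1 with (1/8 + 1/8 + (1/8 + 1/8) + (1/8 + 1/8 + (1/8 + 1/8))) at 2 by field. rewrite !exp_plus.
assert (H : 1.125 <= exp (1/8)) by (generalize (exp_ineq1_le (1/8)); lra).
set (x := exp (1/8)) in *. assert (1.265 <= x * x) by nra. assert (1.6 <= x * x * (x * x)) by nra. nra.
Qed.

(** With x = r^j <= r each factor satisfies (1+x) / (1-x) <= exp (2x / (1-r)). The exponents sum to
    at most 2r / (1-r)^2, which is below 2.25 for r <= 0.39. *)
Lemma real_prod_1_upper K : real_prod K 1 <= exp 2.25.
Proof.
assert (Hr := exp_neg_lt1 1 ltac:(lra)). assert (Hr2 := exp_m1_upper). set (r := exp (Ropp 1)) in *.
assert (B : real_prod K 1 <= exp (2 * / (1 - r) * rsum (fun j => r ^ S j) K)).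
{ induction K as [|K IH].
  - simpl. rewrite Rmult_0_r, exp_0. unfold real_prod; simpl; lra.
  - rewrite real_prod_S by lra. fold r.
    change (rsum (fun j => r ^ S j) (S K)) with (rsum (fun j => r ^ S j) K + r ^ S K).
    rewrite Rmult_plus_distr_l, exp_plus.
    assert (Y := pow_lt1 r (S K) ltac:(lra) ltac:(lia)).
    assert (Y2 : r ^ S K <= r).
    { simpl. assert (0 <= r ^ K <= 1) by (split; [apply pow_le; lra|]; rewrite <- (pow1 K); apply pow_incr; lra). nra. }
    apply Rmult_le_compat; auto.
    + generalize (proj2 (real_prod_spec K 1 ltac:(lra))); lra.
    + left; apply Rdiv_lt_0_compat; lra.
    + apply Rle_trans with (1 + 2 * / (1 - r) * r ^ S K); [|apply exp_ineq1_le].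
      replace ((1 + r ^ S K) / (1 - r ^ S K)) with (1 + 2 * / (1 - r ^ S K) * r ^ S K) by (field; lra).
      apply Rplus_le_compat_l, Rmult_le_compat_r; [lra|]. apply Rmult_le_compat_l; [lra|].
      apply Rinv_le_contravar; lra. }
apply Rle_trans with (1 := B). apply exp_le_mono.
assert (G : rsum (fun j => r ^ S j) K <= r * / (1 - r)).
{ rewrite (rsum_scal r (fun j => r ^ j)). apply Rmult_le_compat_l; [lra|].
  rewrite <- Series_geom by (rewrite Rabs_pos_eq; lra).
  apply rsum_le_Series; [intros; apply pow_le; lra|apply ex_series_geomR; lra]. }
assert (I : 0 < / (1 - r)) by (apply Rinv_0_lt_compat; lra).
apply Rle_trans with (2 * / (1 - r) * (r * / (1 - r))); [apply Rmult_le_compat_l; lra|].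
apply Rmult_le_reg_r with ((1 - r) * (1 - r)); [nra|].
replace (2 * / (1 - r) * (r * / (1 - r)) * ((1 - r) * (1 - r))) with (2 * r) by (field; lra). nra.
Qed.

(** * Normalisation on the real axis *)

(** The subtracted function pi^2 / (4s) + (ln s) / 2 has derivative minus [log_slope]. Hence on
    [t, 1] the gap varies only by the integrated error of the Lambert asymptotics, and its value at
    s = 1 is a matter of numbers. *)
Definition prod_gap (K : nat) (s : R) : R := ln (real_prod K s) - PI * PI / 4 * / s - / 2 * ln s.

Lemma prod_gap_bounds t : 0 < t <= 1 -> exists N, forall K, (N <= K)%nat -> - 2.5 <= prod_gap K t <= 0.
Proof.
intros Ht. destruct (lambert_sum_real_bound t Ht) as [N HN]. exists N. intros K HK.
specialize (HN K HK).
assert (D : forall s, t <= s <= 1 -> is_derive (prod_gap K) s (- (Re (lambert_sum K (RtoC s)) - (PI * PI / (4 * (s * s)) - / (2 * s))))).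
{ intros s Hs. assert (P := proj2 (real_prod_spec K s ltac:(lra))). unfold prod_gap.
  assert (D1 : is_derive (fun s => ln (real_prod K s)) s (/ real_prod K s * (- Re (lambert_sum K (RtoC s)) * real_prod K s))).
  { apply is_derive_compR; [apply is_derive_Reals, derivable_pt_lim_ln; lra|apply is_derive_real_prod; lra]. }
  assert (D2 : is_derive (fun s => PI * PI / 4 * / s + / 2 * ln s) s (- (PI * PI / (4 * (s * s))) + / (2 * s))).
  { auto_derive; [split; lra|]. field. lra. }
  apply (is_derive_ext (fun s => ln (real_prod K s) - (PI * PI / 4 * / s + / 2 * ln s))); [intros; change_eq_R; ring|].
  replace (- (Re (lambert_sum K (RtoC s)) - (PI * PI / (4 * (s * s)) - / (2 * s)))) with
    (/ real_prod K s * (- Re (lambert_sum K (RtoC s)) * real_prod K s) - (- (PI * PI / (4 * (s * s))) + / (2 * s))) by (field; lra).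
  apply (is_derive_minus (V := R_NormedModule) (fun s => ln (real_prod K s)) _ s _ _ D1 D2). }
assert (B1 := is_derive_bound (prod_gap K) t 1 0.01 _ ltac:(lra) D).
assert (B2 := is_derive_bound (fun s => - prod_gap K s) t 1 0.01 (fun s => (Re (lambert_sum K (RtoC s)) - (PI * PI / (4 * (s * s)) - / (2 * s)))) ltac:(lra)).
assert (C1 : prod_gap K 1 - prod_gap K t <= 0.01 * (1 - t)).
{ apply B1. intros s Hs. generalize (HN s Hs). intros A. apply Rabs_le_between in A. lra. }
assert (C2 : - prod_gap K 1 - - prod_gap K t <= 0.01 * (1 - t)).
{ apply B2; intros s Hs.
  - rewrite <- (Ropp_involutive (Re _ - _)). apply (is_derive_opp (V := R_NormedModule)). apply D; auto.
  - generalize (HN s Hs). intros A. apply Rabs_le_between in A. lra. }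
assert (P1 := proj2 (real_prod_spec K 1 ltac:(lra))). assert (P2 := real_prod_1_upper K).
assert (L1 : 0 <= ln (real_prod K 1)) by (rewrite <- ln_1; apply ln_le; lra).
assert (L2 : ln (real_prod K 1) <= 2.25) by (rewrite <- (ln_exp 2.25); apply ln_le; lra).
assert (PS := PI_sq_bounds).
assert (U1 : prod_gap K 1 = ln (real_prod K 1) - PI * PI / 4) by (unfold prod_gap; rewrite Rinv_1, ln_1; ring).
split; lra.
Qed.

Definition real_principal (K : nat) (s : R) : R := Re (principal_sum K (RtoC s)).

Lemma real_principal_rsum K s : s <> 0 -> principal_sum K (RtoC s) = RtoC (rsum (fun k => principal_coeff k * (/ s) ^ k) (S K)).
Proof.
intros Hs. unfold principal_sum. rewrite <- RtoC_inv by auto. generalize (S K) as n. induction n; [easy|].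
simpl. rewrite IHn, RtoC_plus, RtoC_mult, RtoC_pow. reflexivity.
Qed.

Lemma real_principal_spec K s : 0 < s -> principal_sum K (RtoC s) = RtoC (real_principal K s) /\ 0 < real_principal K s /\ real_principal K s <= PI * exp (PI * PI / 4 * / s).
Proof.
intros Hs. assert (E := real_principal_rsum K s ltac:(lra)).
assert (E' : real_principal K s = rsum (fun k => principal_coeff k * (/ s) ^ k) (S K)) by (unfold real_principal; rewrite E; reflexivity).
assert (I : 0 < / s) by (apply Rinv_0_lt_compat; lra).
assert (P : forall k, 0 <= principal_coeff k * (/ s) ^ k) by (intros k; apply Rmult_le_pos; [left; apply principal_coeff_pos|apply pow_le; lra]).
split; [now rewrite E'|]. rewrite E'. split.
- apply Rlt_le_trans with (rsum (fun k => principal_coeff k * (/ s) ^ k) 1).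
  + simpl. generalize PI_gt_3; lra.
  + apply rsum_mono; auto. lia.
- destruct (principal_coeff_series (/ s) ltac:(lra)) as [S1 S2]. apply Rle_trans with (2 := S2). apply rsum_le_Series; auto.
Qed.

Lemma real_principal_lower K s : (1 <= K)%nat -> 0 < s -> PI * (PI * PI / 6) * / s <= real_principal K s.
Proof.
intros HK Hs. assert (E' : real_principal K s = rsum (fun k => principal_coeff k * (/ s) ^ k) (S K)) by (unfold real_principal; rewrite real_principal_rsum by lra; reflexivity).
assert (I : 0 < / s) by (apply Rinv_0_lt_compat; lra). rewrite E'.
apply Rle_trans with (rsum (fun k => principal_coeff k * (/ s) ^ k) 2).
- simpl. generalize PI_gt_3; intros. apply Rle_trans with (PI * (PI * PI / 2) / (2 * 0 + 3) * (/ s * 1)); [right; field; lra|lra].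
- apply rsum_mono; [|lia]. intros k; apply Rmult_le_pos; [left; apply principal_coeff_pos|apply pow_le; lra].
Qed.

Lemma is_derive_real_principal K s : 0 < s -> is_derive (real_principal K) s
  (- ((PI * PI / (4 * (s * s)) - / (2 * s)) * real_principal K s + (PI / 2 * / s - PI * PI / 4 * (principal_coeff K * (/ s) ^ S (S K))))).
Proof.
intros Hs. assert (H := cderive_principal_sum K 0%C 1%C s). cbv zeta in H.
replace (RtoC 0 + RtoC s * 1)%C with (RtoC s) in H by ring. specialize (H ltac:(apply RtoC_neq0; lra)).
destruct H as [H _].
assert (E : Re (- (1) * (log_slope (RtoC s) * principal_sum K (RtoC s) + (PI / 2 * / RtoC s - PI * PI / 4 * (principal_coeff K * (/ RtoC s) ^ S (S K)))))%C =
  - ((PI * PI / (4 * (s * s)) - / (2 * s)) * real_principal K s + (PI / 2 * / s - PI * PI / 4 * (principal_coeff K * (/ s) ^ S (S K))))).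
{ rewrite log_slope_R by lra. rewrite (proj1 (real_principal_spec K s Hs)). rewrite <- RtoC_inv by lra.
  rewrite <- RtoC_pow. unfold Cdiv. rewrite <- !RtoC_inv by lra.
  rewrite <- !RtoC_mult, <- RtoC_minus, <- RtoC_plus, <- RtoC_opp, <- RtoC_mult.
  unfold Re, RtoC, fst, Rdiv. ring. }
rewrite E in H. eapply is_derive_ext; [|exact H]. intros u. unfold real_principal. f_equal. f_equal. simpl. ring.
Qed.

Definition principal_gap (K : nat) (s : R) : R := ln (real_principal K s) - PI * PI / 4 * / s - / 2 * ln s.

(** The derivative of the gap is, up to sign, the forcing term divided by the series. The positive
    forcing pi / (2s) against the single term f_1 / s = pi^3 / (6s) gives 3 / pi^2 <= 1/3. *)
Lemma principal_gap_upper K t : (1 <= K)%nat -> 0 < t <= 1 -> principal_gap K t <= ln PI + 1/3.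
Proof.
intros HK Ht.
pose (tn := fun s => PI / 2 * / s - PI * PI / 4 * (principal_coeff K * (/ s) ^ S (S K))).
assert (D : forall s, t <= s <= 1 -> is_derive (fun s => - principal_gap K s) s (/ real_principal K s * tn s)).
{ intros s Hs. destruct (real_principal_spec K s ltac:(lra)) as (_ & P & _). unfold principal_gap.
  assert (D1 : is_derive (fun s => ln (real_principal K s)) s (/ real_principal K s * (- ((PI * PI / (4 * (s * s)) - / (2 * s)) * real_principal K s + tn s)))).
  { apply is_derive_compR; [apply is_derive_Reals, derivable_pt_lim_ln; lra|apply is_derive_real_principal; lra]. }
  assert (D2 : is_derive (fun s => PI * PI / 4 * / s + / 2 * ln s) s (- (PI * PI / (4 * (s * s))) + / (2 * s))).
  { auto_derive; [split; lra|]. field. lra. }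
  apply (is_derive_ext (fun s => (PI * PI / 4 * / s + / 2 * ln s) - ln (real_principal K s))); [intros; change_eq_R; ring|].
  replace (/ real_principal K s * tn s) with ((- (PI * PI / (4 * (s * s))) + / (2 * s)) - / real_principal K s * (- ((PI * PI / (4 * (s * s)) - / (2 * s)) * real_principal K s + tn s)))
   by (field; lra).
  apply (is_derive_minus (V := R_NormedModule) _ (fun s => ln (real_principal K s)) s _ _ D2 D1). }
assert (B := is_derive_bound (fun s => - principal_gap K s) t 1 (1/3) _ ltac:(lra) D).
assert (C : - principal_gap K 1 - - principal_gap K t <= 1/3 * (1 - t)).
{ apply B. intros s Hs. destruct (real_principal_spec K s ltac:(lra)) as (_ & P & _).
  assert (L := real_principal_lower K s HK ltac:(lra)).
  assert (I : 0 < / s) by (apply Rinv_0_lt_compat; lra).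
  assert (T : tn s <= PI / 2 * / s).
  { unfold tn. assert (0 <= PI * PI / 4 * (principal_coeff K * (/ s) ^ S (S K))); [|lra].
    apply Rmult_le_pos; [generalize PI_gt_3; nra|]. apply Rmult_le_pos; [left; apply principal_coeff_pos|apply pow_le; lra]. }
  apply Rmult_le_reg_l with (real_principal K s); auto. rewrite <- Rmult_assoc, Rinv_r, Rmult_1_l by lra.
  apply Rle_trans with (1 := T). assert (PS := PI_sq_bounds). generalize PI_gt_3; intros.
  assert (PI / 2 * / s <= PI * (PI * PI / 6) * / s * (1/3)); [|lra].
  replace (PI * (PI * PI / 6) * / s * (1 / 3)) with (PI * (PI * PI / 18) * / s) by (field; lra).
  apply Rmult_le_compat_r; [lra|]. apply Rle_trans with (PI * (1/2)); [lra|]. apply Rmult_le_compat_l; lra. }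
destruct (real_principal_spec K 1 ltac:(lra)) as (_ & P & Q).
assert (Y1 : principal_gap K 1 <= ln PI).
{ unfold principal_gap. rewrite Rinv_1, ln_1. rewrite Rinv_1 in Q.
  assert (ln (real_principal K 1) <= ln (PI * exp (PI * PI / 4 * 1))) by (apply ln_le; auto).
  rewrite ln_mult, ln_exp in H by (try apply exp_pos; generalize PI_gt_3; lra). lra. }
lra.
Qed.

Definition kappa (K : nat) (t : R) : R := real_prod K t / real_principal K t.

(** The two gaps differ by at least -2.5 - 1/3 - ln pi, which exceeds -3 - ln pi, and e^(-3) / pi is
    at least 1 / (27 * 3.2). *)
Lemma kappa_lower t : 0 < t <= 1 -> exists N, forall K, (N <= K)%nat ->
  / 100 <= kappa K t /\ real_prod K t <= exp (PI * PI / 4 * / t).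
Proof.
intros Ht. destruct (prod_gap_bounds t Ht) as [N HN]. exists (max N 1). intros K HK.
destruct (HN K ltac:(lia)) as [U1 U2]. assert (Y := principal_gap_upper K t ltac:(lia) Ht).
assert (P := proj2 (real_prod_spec K t ltac:(lra))). destruct (real_principal_spec K t ltac:(lra)) as (_ & Q & _).
unfold prod_gap, principal_gap in *. split.
- unfold kappa. rewrite <- (exp_ln (real_prod K t / real_principal K t)) by (apply Rdiv_lt_0_compat; lra).
  rewrite ln_div by lra.
  apply Rle_trans with (exp (Ropp 3 - ln PI)); [|apply exp_le_mono; lra].
  generalize PI_gt_3 PI_lt_32; intros.
  unfold Rminus. rewrite exp_plus, !exp_Ropp, exp_ln by lra. rewrite <- Rinv_mult.
  assert (E : exp 3 <= 27).
  { replace 3 with (1 + 1 + 1) by ring. rewrite !exp_plus. generalize exp_le_3 (exp_pos 1); intros. nra. }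
  generalize (exp_pos 3); intros. apply Rinv_le_contravar; nra.
- rewrite <- (exp_ln (real_prod K t)) by lra. apply exp_le_mono.
  assert (ln t <= 0) by (rewrite <- ln_1; apply ln_le; lra). lra.
Qed.


(** * Major and minor arcs *)

Lemma Re_inv_pair t y : Re (/ (t, y))%C = t / (t * t + y * y).
Proof. unfold Cinv. simpl. rewrite !Rmult_1_r. reflexivity. Qed.

Lemma Cmod_pair_sq t y : Cmod (t, y) * Cmod (t, y) = t * t + y * y.
Proof. rewrite Cmod_sqr. reflexivity. Qed.

(** In the direction [Ci] the equation has coefficient [- Ci * log_slope], whose real part is this
    imaginary part. For y >= 0 it is nonpositive as long as t^2 + y^2 <= pi^2 t, which holds on the
    major arc, so differences are not amplified there. *)
Lemma Im_log_slope t y : 0 < t -> Im (log_slope (t, y)) = y / (2 * (t * t + y * y) * (t * t + y * y)) * ((t * t + y * y) - PI * PI * t).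
Proof.
intros Ht. assert (N : (t, y) <> RtoC 0) by (intros E; injection E; lra).
replace (log_slope (t, y)) with (RtoC (PI * PI / 4) * (/ (t, y) * / (t, y)) - RtoC (/ 2) * / (t, y))%C.
- unfold Cinv. simpl. field. nra.
- unfold log_slope. rewrite RtoC_div, RtoC_inv by lra. rewrite RtoC_mult. field. auto.
Qed.

(** The three exponents are the size of the product on the real axis, its loss off the axis, and the
    factor E of the Lambert asymptotics. Since their sum is nonpositive, E times the product stays
    bounded although the product itself can be exponentially large. The cut y <= 4t enters through
    t^2 / (t^2 + y^2) >= 1/17. *)
Lemma major_exponent t y : 0 < t -> 0 <= y <= 4 * t ->
  PI * PI / 4 * / t - 2 * (/ t * ((y * y) / (1.05 * (t * t) + y * y))) - 2 * (PI * PI) * (t / (t * t + y * y)) <= 0.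
Proof.
intros Ht Hy. set (s := y * y). set (T := t * t).
assert (HT : 0 < T) by (unfold T; nra). assert (Hs : 0 <= s <= 16 * T) by (unfold s, T; nra).
assert (P := PI_sq_bounds). set (p := PI * PI) in *.
assert (A : 1 / 17 <= T / (T + s)).
{ apply Rmult_le_reg_r with (T + s); [lra|]. unfold Rdiv at 2. rewrite Rmult_assoc, Rinv_l by lra. lra. }
assert (B : 1 - 1.05 * (T / (T + s)) <= s / (1.05 * T + s)).
{ apply Rmult_le_reg_r with ((T + s) * (1.05 * T + s)); [nra|].
  replace ((1 - 1.05 * (T / (T + s))) * ((T + s) * (1.05 * T + s))) with ((s + T - 1.05 * T) * (1.05 * T + s)) by (field; lra).
  replace (s / (1.05 * T + s) * ((T + s) * (1.05 * T + s))) with (s * (T + s)) by (field; lra). nra. }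
set (x := T / (T + s)) in *.
replace (t / (T + s)) with (/ t * x) by (unfold x, T; field; split; fold T; lra).
assert (I : 0 < / t) by (apply Rinv_0_lt_compat; lra).
replace (p / 4 * / t - 2 * (/ t * (s / (1.05 * T + s))) - 2 * p * (/ t * x)) with
  (/ t * (p / 4 - 2 * (s / (1.05 * T + s)) - 2 * p * x)) by (unfold Rdiv; ring).
assert (9.85 * x <= p * x) by (apply Rmult_le_compat_r; lra).
assert (p / 4 - 2 * (s / (1.05 * T + s)) - 2 * p * x <= 0) by lra. nra.
Qed.

Lemma exp_small_ineq x : 0 <= x <= 1/100 -> exp x <= 2.
Proof.
intros H. apply Rle_trans with (exp (/ 100)); [apply exp_le_mono; lra|].
rewrite <- (Ropp_involutive (/ 100)), exp_Ropp. replace 2 with (/ / 2) by field.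
apply Rinv_le_contravar; [lra|]. generalize (exp_ineq1_le (- / 100)); lra.
Qed.

Lemma geom_small r eps : 0 < r < 1 -> 0 < eps -> exists N, forall K, (N <= K)%nat -> 2 * r ^ S K / (1 - r) <= eps.
Proof.
intros Hr He. destruct (pow_lt_1_zero r ltac:(rewrite Rabs_pos_eq; lra) (eps * (1 - r) / 2)) as [N HN].
- apply Rmult_lt_0_compat; [|lra]. apply Rmult_lt_0_compat; lra.
- exists N. intros K HK. specialize (HN (S K) ltac:(lia)). rewrite Rabs_pos_eq in HN by (apply pow_le; lra).
  apply Rmult_le_reg_r with (1 - r); [lra|]. unfold Rdiv. rewrite Rmult_assoc, Rinv_l by lra. lra.
Qed.

(** The difference V = P / kappa - L vanishes at y = 0 and solves V' = -i [log_slope] V + F, where F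
    collects the Lambert error times P / kappa and the forcing of the polar series. [growth] with
    |F| <= 4500 / t^2 on a segment of length at most 4t gives 18000 / t. *)
Lemma major_arc t : 0 < t <= 1/24 -> exists N, forall K, (N <= K)%nat -> forall y, 0 <= y <= 4 * t ->
  Cmod (RtoC (/ kappa K t) * overpartition_prod K (t, y) - principal_sum K (t, y))%C <= 18000 / t.
Proof.
intros Ht.
assert (Hr := exp_neg_lt1 t ltac:(lra)).
destruct (kappa_lower t ltac:(lra)) as [N1 H1].
(* The truncation error of the Lambert series gets multiplied by the product, which can be as large
   as exp (pi^2 / (4t)); hence this tolerance. *)
destruct (lambert_sum_tail t (exp (- (PI * PI / 4 * / t))) ltac:(lra) ltac:(apply exp_pos)) as [N2 H2].
destruct (geom_small (exp (- t)) 0.005 Hr ltac:(lra)) as [N3 H3].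
assert (I : 0 < / t) by (apply Rinv_0_lt_compat; lra).
destruct (principal_coeff_tail (/ t) (/ (PI * PI / 4 * (/ t * / t))) ltac:(lra)) as [N4 H4].
{ apply Rinv_0_lt_compat. generalize PI_sq_bounds; intros. apply Rmult_lt_0_compat; nra. }
exists (max (max N1 N2) (max N3 N4)). intros K HK y Hy.
destruct (H1 K ltac:(lia)) as [Kl Pu]. specialize (H2 K ltac:(lia)). specialize (H3 K ltac:(lia)). specialize (H4 K ltac:(lia)).
set (kp := kappa K t) in *. assert (Kp : 0 < kp) by lra.
assert (Ki : 0 < / kp <= 100).
{ split; [apply Rinv_0_lt_compat; auto|]. rewrite <- (Rinv_inv 100). apply Rinv_le_contravar; lra. }
assert (PS := PI_sq_bounds). assert (P3 := PI_gt_3). assert (P4 := PI_lt_32).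
pose (V := fun s : R => (RtoC (/ kp) * overpartition_prod K (t, s) - principal_sum K (t, s))%C).
pose (tau := fun s : R => (RtoC t + RtoC s * Ci)%C).
assert (Etau : forall s, tau s = (t, s)) by (intros s; unfold tau; apply C_eq; simpl; ring).
pose (F := fun s => (- Ci * ((lambert_sum K (t, s) - log_slope (t, s)) * (RtoC (/ kp) * overpartition_prod K (t, s)) -
     (PI / 2 * / (t, s) - PI * PI / 4 * (principal_coeff K * (/ (t, s)) ^ S (S K)))))%C).
assert (Ntau : forall s, ((t, s) : C) <> RtoC 0) by (intros s E; injection E; lra).
assert (CT : forall s, t <= Cmod (t, s)).
{ intros s. apply Rle_trans with (2 := Re_le_Cmod (t, s)). simpl; lra. }
assert (CI : forall s, Cmod (/ (t, s))%C <= / t).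
{ intros s. rewrite Cmod_inv by apply Ntau. apply Rinv_le_contravar; [lra|apply CT]. }
assert (G := growth V F (fun s => - Ci * log_slope (t, s))%C y (4500 / (t * t)) ltac:(lra)).
assert (GV : Cmod (V y) <= 4500 / (t * t) * y).
{ apply G; clear G.
  - unfold V. replace (t, 0) with (RtoC t) by reflexivity.
    destruct (real_prod_spec K t ltac:(lra)) as [-> _]. destruct (real_principal_spec K t ltac:(lra)) as (-> & L & _).
    rewrite <- RtoC_mult, <- RtoC_minus. f_equal. unfold kp, kappa. 
    assert (1 <= real_prod K t) by (apply real_prod_spec; lra). field. lra.
  - intros s Hs.
    assert (D1 := cderive_overpartition_prod K (RtoC t) Ci s). assert (D2 := cderive_principal_sum K (RtoC t) Ci s). cbv zeta in D2.
    change (RtoC t + RtoC s * Ci)%C with (tau s) in D1, D2. rewrite Etau in D1, D2.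
    specialize (D1 ltac:(simpl; lra)). specialize (D2 (Ntau s)).
    assert (D3 := cderive_minus _ _ _ _ _ (cderive_scal (RtoC (/ kp)) _ _ _ D1) D2).
    apply (cderive_ext (fun s => RtoC (/ kp) * overpartition_prod K (RtoC t + RtoC s * Ci) - principal_sum K (RtoC t + RtoC s * Ci))%C).
    + intros u. unfold V. change (RtoC t + RtoC u * Ci)%C with (tau u). now rewrite Etau.
    + replace (- Ci * log_slope (t, s) * V s + F s)%C with
       (RtoC (/ kp) * (- Ci * lambert_sum K (t, s) * overpartition_prod K (t, s)) - - Ci * (log_slope (t, s) * principal_sum K (t, s) +
        (PI / 2 * / (t, s) - PI * PI / 4 * (principal_coeff K * (/ (t, s)) ^ S (S K)))))%C; [exact D3|].
      unfold V, F. ring.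
  - intros s Hs. replace (Re (- Ci * log_slope (t, s))%C) with (Im (log_slope (t, s))) by (destruct (log_slope (t, s)); simpl; ring).
    rewrite Im_log_slope by lra. set (D := t * t + s * s).
    assert (HD : 0 < D) by (unfold D; nra). assert (HD2 : D <= PI * PI * t) by (unfold D; nra).
    assert (0 <= s / (2 * D * D)) by (apply Rmult_le_pos; [lra|left; apply Rinv_0_lt_compat; nra]). nra.
  - intros s Hs. unfold F. rewrite Cmod_mult, Cmod_opp, Cmod_Ci, Rmult_1_l.
    set (D := t * t + s * s).
    assert (HD : t * t <= D) by (unfold D; nra). assert (T2 : 0 < t * t) by nra.
    assert (As := D_asymptotic (t, s) ltac:(simpl; lra)). cbv zeta in As. rewrite Re_inv_pair in As. fold D in As.
    rewrite Cmod_pair_sq in As. fold D in As. fold (log_slope (t, s)) in As.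
    set (E := exp (- (2 * (PI * PI) * (t / D)))) in *.
    assert (TD : / (17 * t) <= t / D).
    { apply Rmult_le_reg_r with (17 * t * D); [nra|]. replace (/ (17 * t) * (17 * t * D)) with D by (field; lra).
      replace (t / D * (17 * t * D)) with (17 * (t * t)) by (field; lra). unfold D; nra. }
    assert (TT : 24 / 17 <= / (17 * t)).
    { rewrite Rinv_mult. assert (24 <= / t) by (rewrite <- (Rinv_inv 24); apply Rinv_le_contravar; lra). lra. }
    assert (E1 : E <= 1/100).
    { apply Rle_trans with ((1/2) ^ 20); [|lra]. unfold E. apply exp_neg_small; [nra|]. rewrite INR_IZR_INZ. simpl. nra. }
    specialize (As E1).
    assert (PM := overpartition_prod_minor K (t, s) ltac:(simpl; lra)). simpl Re in PM.
    assert (PP := Phi_partial K t s ltac:(lra)).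
    assert (PJ := Phi_major t s Ht ltac:(lra)).
    assert (ME := major_exponent t s ltac:(lra) ltac:(lra)). fold D in ME.
    set (R0 := rsum _ K) in *.
    set (ph := / t * (s * s / (1.05 * (t * t) + s * s))) in *.
    assert (EP : E * Cmod (overpartition_prod K (t, s)) <= 2).
    { apply Rle_trans with (E * (exp (PI * PI / 4 * / t) * exp (- (2 * R0)))).
      - apply Rmult_le_compat_l; [left; apply exp_pos|]. apply Rle_trans with (1 := PM).
        apply Rmult_le_compat_r; [left; apply exp_pos|auto].
      - unfold E. rewrite <- !exp_plus. apply Rle_trans with (exp (1/100)); [apply exp_le_mono; lra|apply exp_small_ineq; lra]. }
    assert (CP : exp (- (PI * PI / 4 * / t)) * Cmod (overpartition_prod K (t, s)) <= 2).
    { apply Rle_trans with (exp (- (PI * PI / 4 * / t)) * (exp (PI * PI / 4 * / t) * exp (- (2 * R0)))).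
      - apply Rmult_le_compat_l; [left; apply exp_pos|]. apply Rle_trans with (1 := PM).
        apply Rmult_le_compat_r; [left; apply exp_pos|auto].
      - rewrite <- !exp_plus. assert (0 <= ph).
        { unfold ph. apply Rmult_le_pos; [lra|]. apply Rmult_le_pos; [nra|left; apply Rinv_0_lt_compat; nra]. }
        apply Rle_trans with (exp (1/100)); [apply exp_le_mono; lra|apply exp_small_ineq; lra]. }
    assert (B2 := H2 (t, s) ltac:(simpl; lra)).
    set (Sm := csum _) in *.
    assert (B3 : Cmod (lambert_sum K (t, s) - log_slope (t, s))%C <= exp (- (PI * PI / 4 * / t)) + 22 * E / (t * t)).
    { replace (lambert_sum K (t, s) - log_slope (t, s))%C with ((lambert_sum K (t, s) - Sm) + (Sm - log_slope (t, s)))%C by ring.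
      eapply Rle_trans; [apply Cmod_triangle|]. apply Rplus_le_compat; [exact B2|].
      apply Rle_trans with (1 := As). apply Rmult_le_compat_l; [generalize (exp_pos (- (2 * (PI * PI) * (t / D)))); fold E; lra|].
      apply Rinv_le_contravar; lra. }
    assert (IT : 1 <= / (t * t)) by (rewrite <- Rinv_1; apply Rinv_le_contravar; nra).
    (* The main part is 100 * 22 * 2 = 4400, with 100 from [/ kp] and 2 from [EP]. The truncation
       part is at most 200 and is absorbed in 60 / t^2 because 1 / t^2 >= 576. *)
    assert (B4 : Cmod ((lambert_sum K (t, s) - log_slope (t, s)) * (RtoC (/ kp) * overpartition_prod K (t, s)))%C <= 4460 * / (t * t)).
    { rewrite !Cmod_mult, Cmod_R, Rabs_pos_eq by lra.
      set (X := Cmod (overpartition_prod K (t, s))) in *. assert (0 <= X) by apply Cmod_ge_0.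
      apply Rle_trans with ((exp (- (PI * PI / 4 * / t)) + 22 * E / (t * t)) * (100 * X)).
      - apply Rmult_le_compat; auto using Cmod_ge_0; nra.
      - replace ((exp (- (PI * PI / 4 * / t)) + 22 * E / (t * t)) * (100 * X)) with
         (100 * (exp (- (PI * PI / 4 * / t)) * X) + 2200 * (E * X) * / (t * t)) by (field; lra).
        assert (2200 * (E * X) * / (t * t) <= 4400 * / (t * t)) by (apply Rmult_le_compat_r; lra).
        assert (24 * 24 <= / (t * t)).
        { replace (24 * 24) with (/ (1/24 * (1/24))) by field. apply Rinv_le_contravar; nra. }
        lra. }
    assert (B5 : Cmod (PI / 2 * / (t, s))%C <= 1.6 * / t).
    { replace (PI / 2)%C with (RtoC (PI / 2)) by (rewrite RtoC_div by lra; reflexivity).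
      rewrite Cmod_mult, Cmod_R, Rabs_pos_eq by lra. apply Rmult_le_compat; auto using Cmod_ge_0; lra. }
    assert (B6 : Cmod (PI * PI / 4 * (principal_coeff K * (/ (t, s)) ^ S (S K)))%C <= 1).
    { replace (PI * PI / 4)%C with (RtoC (PI * PI / 4)) by (rewrite RtoC_div, RtoC_mult by lra; reflexivity).
      rewrite !Cmod_mult, Cmod_pow, !Cmod_R, !Rabs_pos_eq by (try (left; apply principal_coeff_pos); lra).
      simpl pow. set (w := Cmod (/ (t, s))%C) in *. assert (0 <= w) by apply Cmod_ge_0. assert (W := CI s). fold w in W.
      apply Rle_trans with (PI * PI / 4 * (principal_coeff K * (/ t * (/ t * (/ t) ^ K)))).
      - apply Rmult_le_compat_l; [lra|]. apply Rmult_le_compat_l; [left; apply principal_coeff_pos|].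
        apply Rmult_le_compat; auto; [apply Rmult_le_pos; auto; now apply pow_le|].
        apply Rmult_le_compat; auto; [now apply pow_le|]. apply pow_incr; lra.
      - apply Rmult_lt_compat_l with (r := PI * PI / 4 * (/ t * / t)) in H4; [|apply Rmult_lt_0_compat; nra].
        rewrite Rinv_r in H4 by (apply Rgt_not_eq, Rmult_lt_0_compat; nra). lra. }
    assert (T1 : / t <= / (t * t) * (1/24)).
    { rewrite Rinv_mult. assert (24 <= / t) by (rewrite <- (Rinv_inv 24); apply Rinv_le_contravar; lra). nra. }
    unfold Cminus at 1. eapply Rle_trans; [apply Cmod_triangle|]. rewrite Cmod_opp.
    unfold Cminus at 2. eapply Rle_trans; [apply Rplus_le_compat_l, Cmod_triangle|]. rewrite Cmod_opp.
    fold (Cminus (lambert_sum K (t, s)) (log_slope (t, s))).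
    unfold Rdiv. lra. }
apply Rle_trans with (1 := GV).
apply Rle_trans with (4500 / (t * t) * (4 * t)).
- apply Rmult_le_compat_l; [|lra]. apply Rmult_le_pos; [lra|left; apply Rinv_0_lt_compat; nra].
- right. field. lra.
Qed.

(** Both terms are small separately. For y >= 4t the product has exponent pi^2 / 4 - 2 * 0.938 <
    0.605, in units of 1/t, and the series has pi^2 / (4 * 4.12) < 0.605 because |tau| >= 4.12 t;
    the cut at 4t nearly balances the two bounds. The factor is 100 * 2 + 4. *)
Lemma minor_arc t : 0 < t <= 1/24 -> exists N, forall K, (N <= K)%nat -> forall y, 4 * t <= y <= PI ->
  Cmod (RtoC (/ kappa K t) * overpartition_prod K (t, y) - principal_sum K (t, y))%C <= 204 * exp (0.605 * / t).
Proof.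
intros Ht.
assert (Hr := exp_neg_lt1 t ltac:(lra)).
destruct (kappa_lower t ltac:(lra)) as [N1 H1].
destruct (geom_small (exp (- t)) 0.005 Hr ltac:(lra)) as [N3 H3].
assert (I : 0 < / t) by (apply Rinv_0_lt_compat; lra).
exists (max N1 N3). intros K HK y Hy.
destruct (H1 K ltac:(lia)) as [Kl Pu]. specialize (H3 K ltac:(lia)).
set (kp := kappa K t) in *. assert (Kp : 0 < kp) by lra.
assert (Ki : 0 < / kp <= 100).
{ split; [apply Rinv_0_lt_compat; auto|]. rewrite <- (Rinv_inv 100). apply Rinv_le_contravar; lra. }
assert (PS := PI_sq_bounds). assert (P3 := PI_gt_3). assert (P4 := PI_lt_32).
assert (Ntau : ((t, y) : C) <> RtoC 0) by (intros E; injection E; lra).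
assert (PM := overpartition_prod_minor K (t, y) ltac:(simpl; lra)). simpl Re in PM.
assert (PP := Phi_partial K t y ltac:(lra)).
assert (PJ := Phi_minor t y Ht Hy).
set (R0 := rsum _ K) in *.
assert (B1 : Cmod (overpartition_prod K (t, y)) <= 2 * exp (0.605 * / t)).
{ apply Rle_trans with (exp (PI * PI / 4 * / t) * exp (- (2 * R0))).
  - apply Rle_trans with (1 := PM). apply Rmult_le_compat_r; [left; apply exp_pos|auto].
  - rewrite <- exp_plus. apply Rle_trans with (exp (1/100 + 0.605 * / t)).
    + apply exp_le_mono. assert (PI * PI / 4 * / t <= 9.9225 / 4 * / t) by (apply Rmult_le_compat_r; lra). lra.
    + rewrite exp_plus. apply Rmult_le_compat_r; [left; apply exp_pos|apply exp_small_ineq; lra]. }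
assert (CM : 4.12 * t <= Cmod (t, y)).
{ apply Rsqr_incr_0_var; [|apply Cmod_ge_0]. unfold Rsqr. rewrite Cmod_pair_sq. nra. }
assert (B2 : Cmod (principal_sum K (t, y)) <= 4 * exp (0.605 * / t)).
{ unfold principal_sum. eapply Rle_trans; [apply Cmod_csumn|].
  set (w := / (4.12 * t)). assert (W0 : 0 < w) by (apply Rinv_0_lt_compat; lra).
  assert (W : Cmod (/ (t, y))%C <= w) by (rewrite Cmod_inv by auto; apply Rinv_le_contravar; lra).
  destruct (principal_coeff_series w ltac:(lra)) as [F1 F2].
  apply Rle_trans with (rsum (fun k => principal_coeff k * w ^ k) (S K)).
  - apply rsum_le. intros k _. rewrite Cmod_mult, Cmod_pow, Cmod_R, Rabs_pos_eq by (left; apply principal_coeff_pos).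
    apply Rmult_le_compat_l; [left; apply principal_coeff_pos|]. apply pow_incr. split; auto. apply Cmod_ge_0.
  - apply Rle_trans with (Series (fun k => principal_coeff k * w ^ k)).
    + apply rsum_le_Series; auto. intros k. apply Rmult_le_pos; [left; apply principal_coeff_pos|apply pow_le; lra].
    + apply Rle_trans with (1 := F2). apply Rmult_le_compat; [lra|left; apply exp_pos|lra|]. apply exp_le_mono.
      unfold w. rewrite Rinv_mult. assert (PI * PI / 4 * (/ 4.12 * / t) <= 9.9225 / 4 * (/ 4.12 * / t)).
      { apply Rmult_le_compat_r; [|lra]. apply Rmult_le_pos; lra. }
      assert (/ 4.12 * / t <= 0.2428 * / t) by (apply Rmult_le_compat_r; lra). lra. }
unfold Cminus. eapply Rle_trans; [apply Cmod_triangle|]. rewrite Cmod_opp, Cmod_mult, Cmod_R, Rabs_pos_eq by lra.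
set (X := exp (0.605 * / t)) in *. generalize (Cmod_ge_0 (overpartition_prod K (t, y))). intros. nra.
Qed.


(** * Uniqueness of Taylor coefficients and q-expansions *)

Lemma CV_radius_pos (a : nat -> R) d : 0 < d -> ex_series (fun k => Rabs (a k) * d ^ k) -> Rbar_lt 0 (CV_radius a).
Proof.
intros Hd E. apply Rbar_lt_le_trans with (Finite d); [exact Hd|].
apply Rbar_not_lt_le. intros H. apply (CV_disk_outside a d).
- rewrite Rabs_pos_eq by lra. exact H.
- apply is_lim_seq_abs_0. apply (is_lim_seq_ext (fun k => Rabs (a k) * d ^ k)); [|now apply ex_series_lim_0].
  intros n. rewrite Rabs_mult, (Rabs_pos_eq (d ^ n)); [easy|apply pow_le; lra].
Qed.

Lemma powser_unique (a b : nat -> R) d : 0 < d -> ex_series (fun k => Rabs (a k) * d ^ k) ->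
  ex_series (fun k => Rabs (b k) * d ^ k) ->
  (forall s, Rabs s < d -> Series (fun k => a k * s ^ k) = Series (fun k => b k * s ^ k)) -> forall k, a k = b k.
Proof.
intros Hd Ea Eb H k. apply (PSeries_ext_recip a b k); [now apply (CV_radius_pos a d)|now apply (CV_radius_pos b d)|].
exists (mkposreal d Hd). intros s Hs. apply H.
change (Rabs (s + - 0) < d) in Hs. rewrite Ropp_0, Rplus_0_r in Hs. exact Hs.
Qed.

Lemma cpowser_unique (a b : nat -> C) d : 0 < d -> ex_series (fun k => Cmod (a k) * d ^ k) ->
  ex_series (fun k => Cmod (b k) * d ^ k) ->
  (forall s, Rabs s < d -> csum (fun k => a k * RtoC (s ^ k))%C = csum (fun k => b k * RtoC (s ^ k))%C) -> forall k, a k = b k.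
Proof.
intros Hd Ea Eb H k.
assert (Dom : forall (f : C -> R) (c : nat -> C), (forall z, Rabs (f z) <= Cmod z) -> ex_series (fun k => Cmod (c k) * d ^ k) ->
   ex_series (fun k => Rabs (f (c k)) * d ^ k)).
{ intros f c Hf E. apply (ex_series_dom _ (fun k => Cmod (c k) * d ^ k)); auto. intros n.
  assert (0 <= d ^ n) by (apply pow_le; lra). split; [apply Rmult_le_pos; auto; apply Rabs_pos|]. apply Rmult_le_compat_r; auto. }
apply C_eq.
- apply (powser_unique (fun k => Re (a k)) (fun k => Re (b k)) d); auto using re_le_Cmod.
  intros s Hs. specialize (H s Hs). apply (f_equal Re) in H. simpl Re in H.
  rewrite (Series_ext _ (fun n => Re (a n * RtoC (s ^ n))%C)) by (intros; unfold Re, RtoC; simpl; ring).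
  rewrite (Series_ext (fun k => Re (b k) * s ^ k) (fun n => Re (b n * RtoC (s ^ n))%C)) by (intros; unfold Re, RtoC; simpl; ring).
  exact H.
- apply (powser_unique (fun k => Im (a k)) (fun k => Im (b k)) d); auto using im_le_Cmod.
  intros s Hs. specialize (H s Hs). apply (f_equal Im) in H. simpl Im in H.
  rewrite (Series_ext _ (fun n => Im (a n * RtoC (s ^ n))%C)) by (intros; unfold Im, RtoC; simpl; ring).
  rewrite (Series_ext (fun k => Im (b k) * s ^ k) (fun n => Im (b n * RtoC (s ^ n))%C)) by (intros; unfold Im, RtoC; simpl; ring).
  exact H.
Qed.

Lemma pow_fact_exp x k : 0 <= x -> x ^ k * / INR (fact k) <= exp x.
Proof.
intros Hx. destruct (exp_series x) as [E1 E2]. rewrite <- E2.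
apply (term_le_Series (fun k => x ^ k * / INR (fact k))); auto. intros n.
apply Rmult_le_pos; [now apply pow_le|]. left. apply Rinv_0_lt_compat, INR_fact_lt_0.
Qed.

Lemma double_pole_series z : 0 < Re z -> double_pole z = csum (fun m => RtoC (INR m) * nome z ^ m)%C.
Proof.
intros Hz. assert (Q : Cmod (nome z) < 1) by (rewrite Cmod_nome; generalize (exp_neg_lt1 _ Hz); lra).
destruct (csum_geom2 _ Q) as [G1 G2].
assert (A : cabs (fun m => RtoC (INR m) * nome z ^ m)%C).
{ apply (cabs_dom _ (fun m => (INR m + 1) * Cmod (nome z) ^ m)); [|apply ex_series_geom2; split; auto using Cmod_ge_0].
  intros n. rewrite Cmod_mult, Cmod_pow, Cmod_R, Rabs_pos_eq by apply pos_INR.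
  apply Rmult_le_compat_r; [apply pow_le, Cmod_ge_0|lra]. }
rewrite (csum_tail _ 1 A). simpl csumn.
rewrite (csum_ext _ (fun k => nome z * (RtoC (INR k + 1) * nome z ^ k))%C).
- rewrite (csum_scal _ _ G1), G2. rewrite double_pole_exp by (apply regular_Re; lra). unfold simple_pole. fold (nome z). ring.
- intros n. change (1 + n)%nat with (S n). rewrite S_INR. simpl. ring.
Qed.

Lemma exp_pow x n : exp x ^ n = exp (INR n * x).
Proof.
induction n; [simpl; now rewrite Rmult_0_l, exp_0|]. rewrite S_INR, Rmult_plus_distr_r, exp_plus, Rmult_1_l. simpl. rewrite IHn. ring.
Qed.

Lemma nome_shift tau s m : (nome (tau - RtoC s) ^ m = nome tau ^ m * RtoC (exp (INR m * s)))%C.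
Proof.
rewrite <- !nome_nat, <- cexp_R, <- cexp_plus. f_equal. rewrite RtoC_mult. ring.
Qed.

Lemma ex_series_m_exp s : 0 < s -> ex_series (fun m => INR m * exp (- (INR m * s))).
Proof.
intros Hs. assert (Hr := exp_neg_lt1 s Hs).
apply (ex_series_dom _ (fun m => (INR m + 1) * exp (- s) ^ m)); [|apply ex_series_geom2; lra].
intros n. rewrite exp_pow. replace (INR n * - s) with (- (INR n * s)) by ring.
generalize (exp_pos (- (INR n * s))) (pos_INR n); intros. nra.
Qed.

(** * Lipschitz summation and the main term *)

Section Lipschitz.
Variable tau : C.
Hypothesis Ht : 0 < Re tau.
Let t := Re tau.

(** [al] and [be] are the Taylor coefficients of double_pole (tau - s) in s, read off from the
    q-expansion and from the partial fractions. Restricting to |s| <= t/4 leaves half of the decay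
    e^(-mt) to dominate the double series. *)
Let al (j : nat) : C := csum (fun m => RtoC (INR m * (INR m ^ j * / INR (fact j))) * nome tau ^ m)%C.
Let be (j : nat) : C := (RtoC (INR j + 1) * zsum (fun l => / lattice_pt tau l ^ (S (S j))))%C.

Lemma tau_regular : regular tau.
Proof. apply regular_Re. lra. Qed.

Lemma Cmod_nome_pow m : Cmod (nome tau ^ m)%C = exp (- (INR m * t)).
Proof. rewrite Cmod_pow, Cmod_nome, exp_pow. f_equal. unfold t. ring. Qed.

Lemma half_pow_bound m j s : Rabs s <= t / 4 ->
  Rabs (INR m ^ j * / INR (fact j) * s ^ j) <= (1/2) ^ j * exp (INR m * (t / 2)).
Proof.
intros Hs. assert (F := INR_fact_lt_0 j). assert (M := pos_INR m).
rewrite !Rabs_mult, Rabs_inv, (Rabs_pos_eq (INR (fact j))), (Rabs_pos_eq (INR m ^ j)), <- RPow_abs by (try lra; now apply pow_le).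
apply Rle_trans with (INR m ^ j * / INR (fact j) * (t / 4) ^ j).
- apply Rmult_le_compat_l; [apply Rmult_le_pos; [now apply pow_le|left; now apply Rinv_0_lt_compat]|].
  apply pow_incr; split; [apply Rabs_pos|auto].
- assert (P := pow_fact_exp (INR m * (t / 2)) j ltac:(fold t in Ht; nra)).
  replace (t / 4) with (1/2 * (t / 2)) by field. rewrite Rpow_mult_distr in P |- *.
  replace (INR m ^ j * / INR (fact j) * ((1 / 2) ^ j * (t / 2) ^ j)) with ((1/2) ^ j * (INR m ^ j * (t / 2) ^ j * / INR (fact j))) by ring.
  apply Rmult_le_compat_l; [apply pow_le; lra|auto].
Qed.

Lemma al_term_bound m j s : Rabs s <= t / 4 ->
  Cmod (RtoC (INR m * (INR m ^ j * / INR (fact j))) * nome tau ^ m * RtoC (s ^ j))%C <=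
  (INR m * exp (- (INR m * (t / 2)))) * (1/2) ^ j.
Proof.
intros Hs. assert (H := half_pow_bound m j s Hs). assert (M := pos_INR m).
rewrite !Cmod_mult, !Cmod_R, Cmod_nome_pow.
replace (Rabs (INR m * (INR m ^ j * / INR (fact j))) * exp (- (INR m * t)) * Rabs (s ^ j)) with
  (INR m * exp (- (INR m * t)) * Rabs (INR m ^ j * / INR (fact j) * s ^ j)).
- replace (INR m * exp (- (INR m * (t / 2))) * (1 / 2) ^ j) with (INR m * exp (- (INR m * t)) * ((1/2) ^ j * exp (INR m * (t / 2)))).
  + apply Rmult_le_compat_l; auto. apply Rmult_le_pos; [auto|left; apply exp_pos].
  + replace (- (INR m * (t / 2))) with (- (INR m * t) + INR m * (t / 2)) by field. rewrite exp_plus. ring.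
- rewrite !Rabs_mult, (Rabs_pos_eq (INR m)) by auto. ring.
Qed.

Lemma ex_half : ex_series (fun j => (1/2) ^ j).
Proof. apply ex_series_geomR; lra. Qed.

Lemma al_series s : Rabs s <= t / 4 -> csum (fun j => al j * RtoC (s ^ j))%C = double_pole (tau - RtoC s).
Proof.
intros Hs. fold t in Ht.
pose (b := fun m j => (INR m * exp (- (INR m * (t / 2)))) * (1/2) ^ j).
assert (A : forall j, cabs (fun m => RtoC (INR m * (INR m ^ j * / INR (fact j))) * nome tau ^ m)%C).
{ intros j. apply (cabs_dom _ (fun m => (INR m * exp (- (INR m * (t / 2)))) * ((1/2) ^ j * / (t / 4) ^ j))).
  - intros m. assert (B := al_term_bound m j (t/4) ltac:(rewrite Rabs_pos_eq; lra)).
    assert (P : 0 < (t / 4) ^ j) by (apply pow_lt; lra).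
    rewrite Cmod_mult, (Cmod_R ((t / 4) ^ j)), Rabs_pos_eq in B by lra.
    apply Rmult_le_reg_r with ((t / 4) ^ j); auto. apply Rle_trans with (1 := B). right. field. lra.
  - apply (ex_series_ext (fun m => ((1/2) ^ j * / (t / 4) ^ j) * (INR m * exp (- (INR m * (t / 2)))))); [intros; change_eq_R; ring|].
    apply ex_series_scalR, ex_series_m_exp; lra. }
rewrite (csum_ext _ (fun j => csum (fun m => RtoC (INR m * (INR m ^ j * / INR (fact j))) * nome tau ^ m * RtoC (s ^ j)))%C).
- rewrite (fubini_C (fun m j => RtoC (INR m * (INR m ^ j * / INR (fact j))) * nome tau ^ m * RtoC (s ^ j))%C b).
  + rewrite double_pole_series.
    * apply csum_ext. intros m. rewrite nome_shift.
      destruct (exp_series (INR m * s)) as [E1 E2].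
      rewrite (csum_ext _ (fun j => RtoC (INR m) * nome tau ^ m * RtoC ((INR m * s) ^ j * / INR (fact j)))%C).
      -- rewrite csum_scal.
         ++ rewrite <- Cmult_assoc. do 2 f_equal. apply C_eq; simpl.
            ** exact E2.
            ** apply is_series_unique. apply is_series_rsum. apply (is_lim_seq_ext (fun _ => 0)); [|apply is_lim_seq_const].
               intros n. rewrite rsum_const. ring.
         ++ destruct (exp_series (Rabs (INR m * s))) as [E3 _].
            apply (cabs_dom _ (fun k => Rabs (INR m * s) ^ k * / INR (fact k))); auto. intros k.
            rewrite Cmod_R, Rabs_mult, Rabs_inv, <- RPow_abs, (Rabs_pos_eq (INR (fact k))) by apply pos_INR. lra.
      -- intros j. rewrite Rpow_mult_distr, !RtoC_mult. ring.
    * destruct tau as [x y]; simpl in *. unfold t in *. generalize (Rle_abs s); lra.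
  + intros m j. unfold b. now apply al_term_bound.
  + intros m. unfold b. apply ex_series_scalR, ex_half.
  + unfold b. apply (ex_series_ext (fun m => Series (fun j => (1/2) ^ j) * (INR m * exp (- (INR m * (t / 2)))))).
    * intros m. change_eq_R. rewrite Rmult_comm. symmetry. apply (Series_scal_l (INR m * exp (- (INR m * (t / 2)))) (fun j => (1/2) ^ j)).
    * apply ex_series_scalR, ex_series_m_exp; lra.
- intros j. unfold al. rewrite Cmult_comm, <- (csum_scal (RtoC (s ^ j)) _ (A j)). apply csum_ext. intros m. ring.
Qed.

Lemma lattice_pt_ge_t l : t <= Cmod (lattice_pt tau l).
Proof. apply Rle_trans with (2 := Re_le_Cmod _). rewrite Re_lattice_pt. unfold t; lra. Qed.

Lemma be_term_bound l j s : Rabs s <= t / 4 ->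
  Cmod (RtoC (INR j + 1) * / lattice_pt tau l ^ (S (S j)) * RtoC (s ^ j))%C <= inv2 tau l * ((INR j + 1) * (1/2) ^ j).
Proof.
intros Hs. fold t in Ht. assert (N := lattice_pt_neq0 tau l tau_regular). assert (L := lattice_pt_ge_t l). assert (J := pos_INR j).
rewrite !Cmod_mult, !Cmod_R, Rabs_pos_eq by lra. rewrite <- RPow_abs.
rewrite Cmod_inv, Cmod_pow.
- set (u := Cmod (lattice_pt tau l)) in *. unfold inv2. fold u. simpl pow.
  assert (U : 0 < u) by lra. assert (Uj : 0 < u ^ j) by now apply pow_lt.
  assert (K : Rabs s ^ j <= (1/2) ^ j * u ^ j).
  { rewrite <- Rpow_mult_distr. apply pow_incr. split; [apply Rabs_pos|lra]. }
  apply Rle_trans with ((INR j + 1) * / (u * (u * u ^ j)) * ((1/2) ^ j * u ^ j)).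
  + apply Rmult_le_compat_l; auto. apply Rmult_le_pos; [lra|]. left. apply Rinv_0_lt_compat.
    apply Rmult_lt_0_compat; auto. now apply Rmult_lt_0_compat.
  + right. field. lra.
- apply Cmod_gt_0. rewrite Cmod_pow. apply pow_lt. lra.
Qed.

Lemma be_zabs j : zabs (fun l => / lattice_pt tau l ^ (S (S j)))%C.
Proof.
fold t in Ht.
apply (cabs_dom _ (fun k => / t ^ j * (inv2 tau (Z.of_nat k) + inv2 tau (- Z.of_nat k - 1)))); [|apply ex_series_scalR, ex_series_inv2, tau_regular].
intros k. apply Rle_trans with (1 := Cmod_triangle _ _). rewrite Rmult_plus_distr_l.
assert (K : forall l, Cmod (/ lattice_pt tau l ^ (S (S j)))%C <= / t ^ j * inv2 tau l); [|apply Rplus_le_compat; apply K].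
intros l. assert (L := lattice_pt_ge_t l). rewrite Cmod_inv by (apply Cmod_gt_0; rewrite Cmod_pow; apply pow_lt; lra).
rewrite Cmod_pow. unfold inv2. rewrite <- Rinv_mult. apply Rinv_le_contravar.
- apply Rmult_lt_0_compat; [apply pow_lt; lra|apply Rmult_lt_0_compat; lra].
- simpl. assert (t ^ j <= Cmod (lattice_pt tau l) ^ j) by (apply pow_incr; lra). set (u := Cmod (lattice_pt tau l)) in *.
  replace (u * (u * u ^ j)) with (u ^ j * (u * u)) by ring. apply Rmult_le_compat_r; auto. nra.
Qed.

Lemma csum_inv_sq u s : Rabs s < Cmod u -> (csum (fun j => RtoC (INR j + 1) * / u ^ (S (S j)) * RtoC (s ^ j)) = / ((u - RtoC s) * (u - RtoC s)))%C.
Proof.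
intros H. assert (P : 0 < Cmod u) by (generalize (Rabs_pos s); lra). assert (N := proj2 (Cmod_gt_0 u) P).
assert (Q : Cmod (RtoC s / u)%C < 1).
{ rewrite Cmod_div, Cmod_R by auto. apply Rmult_lt_reg_r with (Cmod u); auto. unfold Rdiv. rewrite Rmult_assoc, Rinv_l; lra. }
destruct (csum_geom2 _ Q) as [G1 G2].
assert (N2 : (u - RtoC s <> 0)%C).
{ intros E. assert (u = RtoC s) by (replace u with (u - RtoC s + RtoC s)%C by ring; rewrite E; ring). subst u. rewrite Cmod_R in H. lra. }
rewrite (csum_ext _ (fun j => / (u * u) * (RtoC (INR j + 1) * (RtoC s / u) ^ j))%C).
- rewrite (csum_scal _ _ G1), G2. field. auto.
- intros j. unfold Cdiv. rewrite Cpow_mult_l, RtoC_pow. simpl.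
  assert (Nj : (u ^ j <> 0)%C) by (apply Cmod_gt_0; rewrite Cmod_pow; now apply pow_lt).
  replace ((/ u) ^ j)%C with (/ u ^ j)%C; [field; auto|].
  clear - N Nj. induction j; [simpl; field|]. simpl. simpl in Nj.
  assert (N1 : (u ^ j <> 0)%C) by (intros E; apply Nj; rewrite E; ring). rewrite <- IHj by auto. field; auto.
Qed.

Lemma be_series s : Rabs s <= t / 4 -> csum (fun j => be j * RtoC (s ^ j))%C = double_pole (tau - RtoC s).
Proof.
intros Hs. fold t in Ht.
assert (G : regular (tau - RtoC s)%C).
{ apply regular_Re. destruct tau as [x y]; unfold t in *; simpl in *. generalize (Rle_abs s); lra. }
rewrite (double_pole_partial_fractions _ G). unfold zsum at 1.
pose (g := fun l j => (RtoC (INR j + 1) * / lattice_pt tau l ^ (S (S j)) * RtoC (s ^ j))%C).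
assert (Eg : forall l, csum (g l) = (/ (lattice_pt (tau - RtoC s) l * lattice_pt (tau - RtoC s) l))%C).
{ intros l. replace (lattice_pt (tau - RtoC s) l) with (lattice_pt tau l - RtoC s)%C by (unfold lattice_pt; ring).
  apply csum_inv_sq. generalize (lattice_pt_ge_t l); lra. }
assert (Ag : forall l, cabs (g l)).
{ intros l. apply (cabs_dom _ (fun j => inv2 tau l * ((INR j + 1) * (1/2) ^ j))); [intros; now apply be_term_bound|].
  apply ex_series_scalR, ex_series_geom2; lra. }
rewrite (csum_ext (fun n => / (lattice_pt (tau - RtoC s) (Z.of_nat n) * lattice_pt (tau - RtoC s) (Z.of_nat n)) +
  / (lattice_pt (tau - RtoC s) (- Z.of_nat n - 1) * lattice_pt (tau - RtoC s) (- Z.of_nat n - 1)))%C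
  (fun n => csum (fun j => g (Z.of_nat n) j + g (- Z.of_nat n - 1)%Z j)%C)).
- rewrite <- (fubini_C (fun n j => g (Z.of_nat n) j + g (- Z.of_nat n - 1)%Z j)%C
    (fun n j => (inv2 tau (Z.of_nat n) + inv2 tau (- Z.of_nat n - 1)) * ((INR j + 1) * (1/2) ^ j))).
  + apply csum_ext. intros j. unfold be. 
    rewrite (Cmult_comm (_ * _)), (Cmult_assoc (RtoC (s ^ j))). rewrite <- (zsum_scal _ _ (be_zabs j)). unfold zsum. apply csum_ext. intros n. unfold g. ring.
  + intros n j. rewrite Rmult_plus_distr_r. eapply Rle_trans; [apply Cmod_triangle|]. apply Rplus_le_compat; now apply be_term_bound.
  + intros n. apply ex_series_scalR, ex_series_geom2; lra.
  + apply (ex_series_ext (fun n => Series (fun j => (INR j + 1) * (1/2) ^ j) * (inv2 tau (Z.of_nat n) + inv2 tau (- Z.of_nat n - 1)))).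
    * intros n. change_eq_R. rewrite Rmult_comm. symmetry.
      apply (Series_scal_l (inv2 tau (Z.of_nat n) + inv2 tau (- Z.of_nat n - 1)) (fun j => (INR j + 1) * (1/2) ^ j)).
    * apply ex_series_scalR, ex_series_inv2, tau_regular.
- intros n. rewrite csum_plus by auto. now rewrite !Eg.
Qed.

(** Equality of the two families of Taylor coefficients at j = k - 1, divided by j + 1; this
    replaces Poisson summation. The case k = 0 is excluded because its lattice sum converges only
    conditionally. *)
Theorem lipschitz k : (1 <= k)%nat -> csum (fun m => RtoC (INR m ^ k * / INR (fact k)) * nome tau ^ m)%C = zsum (fun l => / lattice_pt tau l ^ (S k))%C.
Proof.
intros Hk. destruct k as [|j]; [lia|]. clear Hk. fold t in Ht.
assert (E : al j = be j).
{ apply (cpowser_unique al be (t / 4)); [lra|..].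
  - apply (ex_series_dom _ (fun j => Series (fun m => INR m * exp (- (INR m * (t / 2)))) * (1/2) ^ j)); [|apply ex_series_scalR, ex_half].
    intros i. assert (P : 0 < (t/4) ^ i) by (apply pow_lt; lra). split; [apply Rmult_le_pos; [apply Cmod_ge_0|lra]|].
    rewrite <- Series_scal_r.
    apply Rmult_le_reg_r with (/ (t/4) ^ i); [now apply Rinv_0_lt_compat|]. rewrite Rmult_assoc, Rinv_r, Rmult_1_r by lra.
    rewrite <- Series_scal_r. apply Cmod_csum_le.
    + intros m. assert (B := al_term_bound m i (t/4) ltac:(rewrite Rabs_pos_eq; lra)).
      rewrite Cmod_mult, (Cmod_R ((t / 4) ^ i)), Rabs_pos_eq in B by lra.
      apply Rmult_le_reg_r with ((t / 4) ^ i); auto. apply Rle_trans with (1 := B). right. field. lra.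
    + apply (ex_series_ext (fun m => ((1/2) ^ i * / (t / 4) ^ i) * (INR m * exp (- (INR m * (t / 2)))))); [intros; change_eq_R; ring|].
      apply ex_series_scalR, ex_series_m_exp; lra.
  - set (Q := Series (fun k => inv2 tau (Z.of_nat k) + inv2 tau (- Z.of_nat k - 1))).
    apply (ex_series_dom _ (fun j => Q * ((INR j + 1) * (1/2) ^ j))); [|apply ex_series_scalR, ex_series_geom2; lra].
    intros i. assert (P : 0 < (t/4) ^ i) by (apply pow_lt; lra). split; [apply Rmult_le_pos; [apply Cmod_ge_0|lra]|].
    apply Rmult_le_reg_r with (/ (t/4) ^ i); [now apply Rinv_0_lt_compat|]. rewrite Rmult_assoc, Rinv_r, Rmult_1_r by lra.
    rewrite Rmult_assoc. unfold Q. rewrite <- Series_scal_r. unfold be. rewrite <- (zsum_scal _ _ (be_zabs i)). apply Cmod_csum_le.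
    + intros n. apply Rle_trans with (1 := Cmod_triangle _ _). rewrite Rmult_plus_distr_r.
      assert (K : forall l, Cmod (RtoC (INR i + 1) * / lattice_pt tau l ^ S (S i))%C <= inv2 tau l * ((INR i + 1) * (1 / 2) ^ i * / (t / 4) ^ i));
        [|apply Rplus_le_compat; apply K].
      intros l. assert (B := be_term_bound l i (t/4) ltac:(rewrite Rabs_pos_eq; lra)).
      rewrite Cmod_mult, (Cmod_R ((t / 4) ^ i)), Rabs_pos_eq in B by lra.
      apply Rmult_le_reg_r with ((t / 4) ^ i); auto. apply Rle_trans with (1 := B). right. field. lra.
    + apply (ex_series_ext (fun n => ((INR i + 1) * (1 / 2) ^ i * / (t / 4) ^ i) * (inv2 tau (Z.of_nat n) + inv2 tau (- Z.of_nat n - 1)))); [intros; change_eq_R; ring|].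
      apply ex_series_scalR, ex_series_inv2, tau_regular.
  - intros s Hs. now rewrite al_series, be_series by lra. }
unfold al, be in E.
assert (NJ : RtoC (INR j + 1) <> RtoC 0) by (apply RtoC_neq0; generalize (pos_INR j); lra).
transitivity (/ RtoC (INR j + 1) * (RtoC (INR j + 1) * zsum (fun l => / lattice_pt tau l ^ (S (S j)))))%C; [|field; auto].
rewrite <- E. rewrite <- csum_scal.
- apply csum_ext. intros m. rewrite fact_simpl, mult_INR, S_INR.
  assert (F := INR_fact_neq_0 j). simpl pow. rewrite Rinv_mult, !RtoC_mult. rewrite (RtoC_inv (INR j + 1)) by (generalize (pos_INR j); lra). ring.
- apply (cabs_dom _ (fun m => (INR m * exp (- (INR m * (t / 2)))) * ((1/2) ^ j * / (t / 4) ^ j))).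
  + intros m. assert (B := al_term_bound m j (t/4) ltac:(rewrite Rabs_pos_eq; lra)).
    assert (P : 0 < (t / 4) ^ j) by (apply pow_lt; lra).
    rewrite Cmod_mult, (Cmod_R ((t / 4) ^ j)), Rabs_pos_eq in B by lra.
    apply Rmult_le_reg_r with ((t / 4) ^ j); auto. apply Rle_trans with (1 := B). right. field. lra.
  + apply (ex_series_ext (fun m => ((1/2) ^ j * / (t / 4) ^ j) * (INR m * exp (- (INR m * (t / 2)))))); [intros; change_eq_R; ring|].
    apply ex_series_scalR, ex_series_m_exp; lra.
Qed.

End Lipschitz.


(** Replacing every polar term tau^(-(k+1)) of L by the corresponding q-series with coefficients m^k
    / k! turns L, without its constant term, into a power series in q; this is its m-th
    coefficient. *)
Definition main_coeff (m : nat) : R := Series (fun k => principal_coeff (S k) * (INR m ^ k * / INR (fact k))).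
Definition main_genfun (tau : C) : C := csum (fun m => RtoC (main_coeff m) * nome tau ^ m)%C.

Lemma principal_coeff_shift_series x : 0 <= x -> ex_series (fun k => principal_coeff (S k) * x ^ S k) /\
  Series (fun k => principal_coeff (S k) * x ^ S k) <= PI * exp (PI * PI / 4 * x).
Proof.
intros Hx. destruct (principal_coeff_series x Hx) as [E1 E2].
split; [apply (ex_series_incr_1 (fun k => principal_coeff k * x ^ k)), E1|].
apply Rle_trans with (2 := E2). rewrite (Series_incr_1 (fun k => principal_coeff k * x ^ k)) by auto.
generalize (principal_coeff_pos 0). simpl pow. lra.
Qed.

Lemma principal_coeff_shift_ex x : 0 < x -> ex_series (fun k => principal_coeff (S k) * x ^ k).
Proof.
intros Hx. destruct (principal_coeff_shift_series x ltac:(lra)) as [E _].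
apply (ex_series_ext (fun k => / x * (principal_coeff (S k) * x ^ S k))); [|now apply ex_series_scalR].
intros n. change_eq_R. simpl pow. field. lra.
Qed.

Lemma pow_fact_exp_shift m t k : 0 < t -> INR m ^ k * / INR (fact k) <= (2 / t) ^ k * exp (INR m * (t / 2)).
Proof.
intros Ht. assert (M := pos_INR m).
assert (P := pow_fact_exp (INR m * (t / 2)) k ltac:(nra)). rewrite Rpow_mult_distr in P.
assert (Q : 0 < (2 / t) ^ k) by (apply pow_lt; apply Rdiv_lt_0_compat; lra).
apply Rle_trans with ((2 / t) ^ k * (INR m ^ k * (t / 2) ^ k * / INR (fact k))); [|apply Rmult_le_compat_l; lra].
right. replace ((2 / t) ^ k * (INR m ^ k * (t / 2) ^ k * / INR (fact k))) with (((2 / t) ^ k * (t / 2) ^ k) * (INR m ^ k * / INR (fact k))) by ring.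
rewrite <- Rpow_mult_distr. replace (2 / t * (t / 2)) with 1 by (field; lra). rewrite pow1. ring.
Qed.

Lemma main_coeff_term_pos m k : 0 <= principal_coeff (S k) * (INR m ^ k * / INR (fact k)).
Proof.
apply Rmult_le_pos; [left; apply principal_coeff_pos|]. apply Rmult_le_pos; [apply pow_le, pos_INR|].
left. apply Rinv_0_lt_compat, INR_fact_lt_0.
Qed.

Lemma main_coeff_ex m : ex_series (fun k => principal_coeff (S k) * (INR m ^ k * / INR (fact k))).
Proof.
apply (ex_series_dom _ (fun k => exp (INR m * (1 / 2)) * (principal_coeff (S k) * (2 / 1) ^ k))); [|apply ex_series_scalR, principal_coeff_shift_ex; lra].
intros k. split; [apply main_coeff_term_pos|].
replace (exp (INR m * (1 / 2)) * (principal_coeff (S k) * (2 / 1) ^ k)) with (principal_coeff (S k) * ((2 / 1) ^ k * exp (INR m * (1 / 2)))) by ring.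
apply Rmult_le_compat_l; [left; apply principal_coeff_pos|]. apply pow_fact_exp_shift; lra.
Qed.

Lemma main_coeff_bound m t : 0 < t -> 0 <= main_coeff m * exp (- (INR m * t)) <= Series (fun k => principal_coeff (S k) * (2 / t) ^ k) * exp (- (INR m * (t / 2))).
Proof.
intros Ht. assert (S0 : 0 <= main_coeff m) by (apply Series_ge0; [apply main_coeff_term_pos|apply main_coeff_ex]).
split; [apply Rmult_le_pos; [auto|left; apply exp_pos]|].
replace (- (INR m * t)) with (- (INR m * (t / 2)) + - (INR m * (t / 2))) by field. rewrite exp_plus, <- Rmult_assoc.
apply Rmult_le_compat_r; [left; apply exp_pos|].
apply Rmult_le_reg_r with (exp (INR m * (t / 2))); [apply exp_pos|].
rewrite Rmult_assoc, <- exp_plus, Rplus_opp_l, exp_0, Rmult_1_r.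
rewrite <- Series_scal_r. apply Series_le.
- intros k. split; [apply main_coeff_term_pos|]. rewrite Rmult_assoc. apply Rmult_le_compat_l; [left; apply principal_coeff_pos|]. now apply pow_fact_exp_shift.
- apply (ex_series_ext (fun k => exp (INR m * (t / 2)) * (principal_coeff (S k) * (2 / t) ^ k))); [intros; change_eq_R; ring|].
  apply ex_series_scalR, principal_coeff_shift_ex. apply Rdiv_lt_0_compat; lra.
Qed.

Lemma exp_m_summable s : 0 < s -> ex_series (fun m => exp (- (INR m * s))).
Proof.
intros Hs. apply (ex_series_ext (fun m => exp (- s) ^ m)).
- intros n. rewrite exp_pow. change_eq_R. f_equal. ring.
- apply ex_series_geomR. generalize (exp_neg_lt1 s Hs); lra.
Qed.

Lemma main_genfun_abs tau : 0 < Re tau -> cabs (fun m => RtoC (main_coeff m) * nome tau ^ m)%C.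
Proof.
intros Ht. apply (cabs_dom _ (fun m => Series (fun k => principal_coeff (S k) * (2 / Re tau) ^ k) * exp (- (INR m * (Re tau / 2))))).
- intros m. assert (B := main_coeff_bound m (Re tau) Ht). rewrite Cmod_mult, Cmod_nome_pow, Cmod_R, Rabs_pos_eq by
   (apply Series_ge0; [apply main_coeff_term_pos|apply main_coeff_ex]). lra.
- apply ex_series_scalR, exp_m_summable. lra.
Qed.

Lemma main_genfun_swap tau : 0 < Re tau ->
  main_genfun tau = csum (fun k => RtoC (principal_coeff (S k)) * csum (fun m => RtoC (INR m ^ k * / INR (fact k)) * nome tau ^ m))%C.
Proof.
intros Ht. set (t := Re tau) in *.
pose (b := fun m k => (exp (- (INR m * (t / 2)))) * (principal_coeff (S k) * (2 / t) ^ k)).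
assert (E0 : ex_series (fun k => principal_coeff (S k) * (2 / t) ^ k)) by (apply principal_coeff_shift_ex, Rdiv_lt_0_compat; lra).
assert (P0 : 0 < 2 / t) by (apply Rdiv_lt_0_compat; lra).
assert (Bd : forall m k, Cmod (RtoC (INR m ^ k * / INR (fact k)) * nome tau ^ m)%C <= (2 / t) ^ k * exp (- (INR m * (t / 2)))).
{ intros m k. assert (B := pow_fact_exp_shift m t k Ht).
  rewrite Cmod_mult, Cmod_nome_pow, Cmod_R, Rabs_pos_eq.
  - fold t. replace (- (INR m * t)) with (- (INR m * (t / 2)) + - (INR m * (t / 2))) by field. rewrite exp_plus.
    assert (ef : exp (- (INR m * (t / 2))) * exp (INR m * (t / 2)) = 1) by (rewrite <- exp_plus, Rplus_opp_l; apply exp_0).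
    generalize (exp_pos (- (INR m * (t / 2)))); intros e0.
    set (e := exp (- (INR m * (t / 2)))) in *. set (f := exp (INR m * (t / 2))) in *.
    apply Rle_trans with ((2 / t) ^ k * f * (e * e)).
    + apply Rmult_le_compat_r; [nra|exact B].
    + right. replace ((2 / t) ^ k * f * (e * e)) with ((2 / t) ^ k * e * (e * f)) by ring. rewrite ef. ring.
  - apply Rmult_le_pos; [apply pow_le, pos_INR|]. left. apply Rinv_0_lt_compat, INR_fact_lt_0. }
transitivity (csum (fun m => csum (fun k => RtoC (principal_coeff (S k)) * (RtoC (INR m ^ k * / INR (fact k)) * nome tau ^ m)))%C).
- apply csum_ext. intros m. rewrite (csum_ext _ (fun k => nome tau ^ m * RtoC (principal_coeff (S k) * (INR m ^ k * / INR (fact k))))%C) by (intros; rewrite !RtoC_mult; ring).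
  rewrite csum_scal.
  + rewrite Cmult_comm. f_equal. apply C_eq; simpl; [reflexivity|].
    symmetry. apply is_series_unique, is_series_rsum. apply (is_lim_seq_ext (fun _ => 0)); [|apply is_lim_seq_const].
    intros; rewrite rsum_const; ring.
  + apply (cabs_dom _ (fun k => principal_coeff (S k) * (INR m ^ k * / INR (fact k)))); [|apply main_coeff_ex].
    intros k. rewrite Cmod_R, Rabs_pos_eq by apply main_coeff_term_pos. lra.
- rewrite <- (fubini_C (fun m k => RtoC (principal_coeff (S k)) * (RtoC (INR m ^ k * / INR (fact k)) * nome tau ^ m))%C b).
  + apply csum_ext. intros k. apply csum_scal.
    apply (cabs_dom _ (fun m => (2 / t) ^ k * exp (- (INR m * (t / 2))))); auto.
    apply ex_series_scalR, exp_m_summable; lra.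
  + intros m k. unfold b. rewrite Cmod_mult, Cmod_R, Rabs_pos_eq by (left; apply principal_coeff_pos).
    replace (exp (- (INR m * (t / 2))) * (principal_coeff (S k) * (2 / t) ^ k)) with (principal_coeff (S k) * ((2 / t) ^ k * exp (- (INR m * (t / 2))))) by ring.
    apply Rmult_le_compat_l; auto. left; apply principal_coeff_pos.
  + intros m. unfold b. now apply ex_series_scalR.
  + unfold b. apply (ex_series_ext (fun m => Series (fun k => principal_coeff (S k) * (2 / t) ^ k) * exp (- (INR m * (t / 2))))).
    * intros m. change_eq_R. rewrite Rmult_comm. symmetry. apply (Series_scal_l (exp (- (INR m * (t / 2)))) (fun k => principal_coeff (S k) * (2 / t) ^ k)).
    * apply ex_series_scalR, exp_m_summable; lra.
Qed.

(** The imaginary part has modulus at least 2 pi |l| - pi >= pi |l|. *)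
Lemma lattice_pt_far tau l : Rabs (Im tau) <= PI -> l <> 0%Z -> 3 * Rabs (IZR l) <= Cmod (lattice_pt tau l).
Proof.
intros H Hl. apply Rle_trans with (2 := im_le_Cmod _). rewrite Im_lattice_pt.
assert (L1 : 1 <= Rabs (IZR l)).
{ rewrite <- abs_IZR. apply IZR_le. lia. }
assert (T := Rabs_triang_inv (2 * PI * IZR l) (- Im tau)). rewrite Rabs_Ropp in T.
replace (2 * PI * IZR l - - Im tau) with (Im tau + 2 * PI * IZR l) in T by ring.
rewrite !Rabs_mult, (Rabs_pos_eq 2), (Rabs_pos_eq PI) in T by (generalize PI_gt_3; lra).
generalize PI_gt_3; intros. set (x := Rabs (IZR l)) in *.
assert (PI * 1 <= PI * x) by (apply Rmult_le_compat_l; lra).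
assert (3 * x <= PI * x) by (apply Rmult_le_compat_r; lra).
lra.
Qed.

(** The index -1, paired with 0 in [zsum], is counted apart and costs 3^(-k-1). The other pairs cost
    at most 2 * 3^(-k-1) times the sum of 1 / (n+1)^2, which is at most 2; hence 5 = 1 + 4. *)
Lemma lattice_rest tau k : 0 < Re tau -> Rabs (Im tau) <= PI -> (1 <= k)%nat ->
  Cmod (zsum (fun l => / lattice_pt tau l ^ S k)%C - (/ tau) ^ S k)%C <= 5 * (1/3) ^ S k.
Proof.
intros Ht Hi Hk.
assert (G := tau_regular tau Ht).
assert (N := tau_neq0 tau Ht).
assert (A := be_zabs tau Ht (k - 1)). replace (S (S (k - 1))) with (S k) in A by lia.
set (a := fun l => (/ lattice_pt tau l ^ S k)%C) in *.
assert (T : zsum a = (0 + (a 0%Z + a (-1)%Z) + csum (fun n => a (Z.of_nat (1 + n)) + a (- Z.of_nat (1 + n) - 1)%Z))%C)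
  by exact (csum_tail _ 1 A).
assert (A0 : a 0%Z = ((/ tau) ^ S k)%C).
{ unfold a. replace (lattice_pt tau 0) with tau by (unfold lattice_pt; ring). clear - N. generalize (S k) as n. induction n; [simpl; field|].
  simpl. rewrite <- IHn. field. split; auto. apply Cmod_gt_0. rewrite Cmod_pow. apply pow_lt. now apply Cmod_gt_0. }
rewrite T, A0.
match goal with |- Cmod ?z <= _ => replace z with (a (-1)%Z + csum (fun n => a (Z.of_nat (1 + n)) + a (- Z.of_nat (1 + n) - 1)%Z))%C by ring end.
set (c := (1/3) ^ S k).
assert (C0 : 0 < c) by (apply pow_lt; lra).
assert (B : forall l n, Rabs (IZR l) = INR n + 1 -> Cmod (a l) <= c * / ((INR n + 1) * (INR n + 1))).
{ intros l n Hl. assert (Nl : l <> 0%Z) by (intros ->; rewrite Rabs_R0 in Hl; generalize (pos_INR n); lra).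
  assert (F := lattice_pt_far tau l Hi Nl). rewrite Hl in F. generalize (pos_INR n); intros Pn.
  unfold a. assert (PP : 0 < Cmod (lattice_pt tau l)) by lra.
  rewrite Cmod_inv, Cmod_pow by (apply Cmod_gt_0; rewrite Cmod_pow; now apply pow_lt).
  unfold c. replace (1/3) with (/3) by lra. rewrite pow_inv, <- Rinv_mult.
  apply Rinv_le_contravar; [apply Rmult_lt_0_compat; [apply pow_lt; lra|nra]|].
  apply Rle_trans with ((3 * (INR n + 1)) ^ S k); [|apply pow_incr; lra].
  rewrite Rpow_mult_distr. apply Rmult_le_compat_l; [apply pow_le; lra|].
  destruct k as [|k]; [lia|]. simpl. rewrite <- Rmult_assoc.
  rewrite <- (Rmult_1_r ((INR n + 1) * (INR n + 1))) at 1. apply Rmult_le_compat_l; [nra|]. apply pow_R1_Rle; lra. }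
assert (B1 : Cmod (a (-1)%Z) <= c).
{ apply Rle_trans with (1 := B (-1)%Z 0%nat ltac:(simpl; rewrite Rabs_left; lra)). simpl. right. field. }
destruct ex_series_inv_sq as [Q1 Q2].
set (h := fun k => / ((INR k + 1) * (INR k + 1))) in *.
assert (B2 : Cmod (csum (fun n => a (Z.of_nat (1 + n)) + a (- Z.of_nat (1 + n) - 1)%Z)%C) <= 2 * c * 2).
{ apply Rle_trans with (Series (fun n => 2 * c * h n)).
  - apply Cmod_csum_le; [|now apply ex_series_scalR]. intros n. apply Rle_trans with (1 := Cmod_triangle _ _).
    assert (U := B (Z.of_nat (1 + n)) n). assert (V := B (- Z.of_nat (1 + n) - 1)%Z (S n)).
    change (1 + n)%nat with (S n) in *.
    rewrite <- INR_IZR_INZ, S_INR in U. rewrite minus_IZR, opp_IZR, <- INR_IZR_INZ, !S_INR in V.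
    generalize (pos_INR n); intros Pn.
    rewrite Rabs_pos_eq in U by lra. rewrite Rabs_left in V by lra.
    specialize (U ltac:(lra)). specialize (V ltac:(lra)).
    assert (/ ((INR n + 1 + 1) * (INR n + 1 + 1)) <= h n) by (unfold h; apply Rinv_le_contravar; nra).
    fold (h n) in U. nra.
  - rewrite Series_scal_l. apply Rmult_le_compat_l; lra. }
apply Rle_trans with (1 := Cmod_triangle _ _). lra.
Qed.

Lemma principal_coeff_1 : principal_coeff 1 <= 5.3.
Proof.
simpl. assert (P := PI_sq_bounds). assert (PI < 3.15) by apply PI_lt_315. generalize PI_gt_3; intros.
replace (PI * (PI * PI / 2) / (2 * 0 + 3)) with (PI * (PI * PI) / 6) by field. nra.
Qed.

(** For k >= 1 Lipschitz summation leaves only the nonzero lattice points, whose total is bounded.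
    The case k = 0 is the geometric series 1 / (1 - q), compared with 1 / tau crudely up to O(1/t).
    Together with the constant f_0 and the tail of L this stays below 14 / t since 1/t >= 24. *)
Lemma main_genfun_principal_sum t : 0 < t <= 1/24 -> exists N, forall K, (N <= K)%nat -> forall y, 0 <= y <= PI ->
  Cmod (main_genfun (t, y) - principal_sum K (t, y))%C <= 14 / t.
Proof.
intros Ht.
assert (I : 0 < / t) by (apply Rinv_0_lt_compat; lra).
destruct (principal_coeff_shift_series (/ t) ltac:(lra)) as [F1 _].
destruct (Series_tail_small _ 1 F1 ltac:(lra)) as [N HN]. exists N. intros K HK y Hy.
specialize (HN K HK).
set (tau := (t, y) : C). assert (Re0 : 0 < Re tau) by (simpl; lra).
assert (N0 := tau_neq0 tau Re0).
set (X := fun k => csum (fun m => RtoC (INR m ^ k * / INR (fact k)) * nome tau ^ m)%C).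
set (w := (/ tau)%C).
assert (W : Cmod w <= / t).
{ unfold w. rewrite Cmod_inv by auto. apply Rinv_le_contravar; [lra|]. apply Rle_trans with (2 := Re_le_Cmod tau). simpl; lra. }
assert (Hr := exp_neg_lt1 t ltac:(lra)).
assert (X0 : Cmod (X 0%nat - w ^ 1)%C <= 2 * / t + 1).
{ assert (Q : Cmod (nome tau) < 1) by (rewrite Cmod_nome; simpl; lra).
  assert (EX : X 0%nat = (/ (1 - nome tau))%C).
  { destruct (csum_geom _ Q) as [_ <-]. apply csum_ext. intros m. simpl. rewrite Rinv_1, Rmult_1_r. ring. }
  rewrite EX. unfold Cminus. apply Rle_trans with (1 := Cmod_triangle _ _). rewrite Cmod_opp, Cmod_pow, pow_1.
  assert (Cmod (/ (1 - nome tau))%C <= / t + 1).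
  { fold (simple_pole tau). apply Rle_trans with (1 := Cmod_simple_pole_pos tau t ltac:(lra) ltac:(simpl; lra)).
    assert (E : exp (- t) * (1 + t) <= 1).
    { apply Rle_trans with (exp (- t) * exp t); [apply Rmult_le_compat_l; [lra|apply exp_ineq1_le]|].
      rewrite <- exp_plus, Rplus_opp_l, exp_0; lra. }
    replace (/ t + 1) with (/ (t / (1 + t))) by (field; lra). apply Rinv_le_contravar; [apply Rdiv_lt_0_compat; lra|].
    apply Rmult_le_reg_r with (1 + t); [lra|]. unfold Rdiv. rewrite Rmult_assoc, Rinv_l; lra. }
  fold (Cminus 1 (nome tau)). lra. }
assert (Xk : forall k, Cmod (X (S k) - w ^ S (S k))%C <= 5 * (1/3) ^ S (S k)).
{ intros k. unfold X. rewrite lipschitz by (auto; lia). apply lattice_rest; auto; [simpl; rewrite Rabs_pos_eq; lra|lia]. }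
set (D := fun k => (RtoC (principal_coeff (S k)) * (X k - w ^ S k))%C).
set (Wk := fun k => (RtoC (principal_coeff (S k)) * w ^ S k)%C).
destruct (principal_coeff_shift_series (1/3) ltac:(lra)) as [T1 T2].
assert (DS : forall k, Cmod (D (S k)) <= 5 * (principal_coeff (S (S k)) * (1/3) ^ S (S k))).
{ intros k. unfold D. rewrite Cmod_mult, Cmod_R, Rabs_pos_eq by (left; apply principal_coeff_pos).
  generalize (principal_coeff_pos (S (S k))) (Xk k). intros. nra. }
assert (TS : ex_series (fun k => 5 * (principal_coeff (S (S k)) * (1/3) ^ S (S k)))).
{ apply ex_series_scalR. apply (ex_series_incr_1 (fun k => principal_coeff (S k) * (1/3) ^ S k)), T1. }
assert (DA : cabs D).
{ apply (ex_series_incr_1 (fun k => Cmod (D k))). apply (cabs_dom (fun k => D (S k)) _ DS TS). }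
assert (WA : cabs Wk).
{ apply (cabs_dom _ (fun k => principal_coeff (S k) * (/ t) ^ S k)); auto. intros k. unfold Wk.
  rewrite Cmod_mult, Cmod_pow, Cmod_R, Rabs_pos_eq by (left; apply principal_coeff_pos).
  apply Rmult_le_compat_l; [left; apply principal_coeff_pos|]. apply pow_incr. split; auto. apply Cmod_ge_0. }
assert (EG : main_genfun tau = (csum D + csum Wk)%C).
{ rewrite main_genfun_swap by auto. fold X. rewrite <- csum_plus by auto. apply csum_ext. intros k. unfold D, Wk. fold (X k). ring. }
assert (EL : principal_sum K tau = (RtoC PI + csumn Wk K)%C).
{ unfold principal_sum. rewrite csumn_Sl. fold w. simpl. unfold Wk. simpl. ring. }
assert (D1 : csum D = (D 0%nat + csum (fun k => D (S k)))%C).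
{ rewrite (csum_tail D 1 DA). simpl. ring. }
rewrite EG, EL, (csum_tail Wk K WA), D1.
set (Z1 := csum (fun k => D (S k))). set (Z2 := csum (fun k => Wk (K + k)%nat)).
replace (D 0%nat + Z1 + (csumn Wk K + Z2) - (RtoC PI + csumn Wk K))%C with (D 0%nat + (Z1 + (Z2 + - RtoC PI)))%C by ring.
assert (B0 : Cmod (D 0%nat) <= 5.3 * (2 * / t + 1)).
{ unfold D. rewrite Cmod_mult, Cmod_R, Rabs_pos_eq by (left; apply principal_coeff_pos).
  apply Rmult_le_compat; [left; apply principal_coeff_pos|apply Cmod_ge_0|apply principal_coeff_1|exact X0]. }
assert (B1 : Cmod Z1 <= 47.25).
{ apply Rle_trans with (1 := Cmod_csum_le _ _ DS TS). rewrite Series_scal_l.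
  assert (S2 : Series (fun k => principal_coeff (S (S k)) * (1 / 3) ^ S (S k)) <= PI * exp (PI * PI / 4 * (1/3))).
  { apply Rle_trans with (2 := T2). rewrite (Series_incr_1 (fun k => principal_coeff (S k) * (1/3) ^ S k)) by auto.
    generalize (principal_coeff_pos 1). simpl pow. lra. }
  assert (E3 : exp (PI * PI / 4 * (1/3)) <= 3) by (apply exp_le_3R; generalize PI_sq_bounds; lra).
  generalize PI_lt_315 PI_gt_3 (exp_pos (PI * PI / 4 * (1/3))). intros. nra. }
assert (B2 : Cmod Z2 <= 1).
{ apply Rle_trans with (Series (fun k => principal_coeff (S (K + k)) * (/ t) ^ S (K + k))).
  - apply Cmod_csum_le.
    + intros k. unfold Wk. rewrite Cmod_mult, Cmod_pow, Cmod_R, Rabs_pos_eq by (left; apply principal_coeff_pos).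
      apply Rmult_le_compat_l; [left; apply principal_coeff_pos|]. apply pow_incr. split; auto. apply Cmod_ge_0.
    + apply (ex_series_incr_n (fun k => principal_coeff (S k) * (/ t) ^ S k) K), F1.
  - left. apply Rle_lt_trans with (1 := Rle_abs _). exact HN. }
assert (B3 : Cmod (- RtoC PI)%C <= 3.15).
{ rewrite Cmod_opp, Cmod_R, Rabs_pos_eq; generalize PI_gt_3 PI_lt_315; lra. }
assert (24 <= / t) by (rewrite <- (Rinv_inv 24); apply Rinv_le_contravar; lra).
apply Rle_trans with (1 := Cmod_triangle _ _).
apply Rle_trans with (1 := Rplus_le_compat_l _ _ _ (Cmod_triangle _ _)).
generalize (Cmod_triangle Z2 (- RtoC PI)). unfold Rdiv. lra.
Qed.


(** * Coefficient extraction *)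

Lemma nome_polar t y m : (nome (t, y) ^ m = RtoC (exp (- (INR m * t))) * cexp (- (RtoC (INR m * y) * Ci)))%C.
Proof.
rewrite <- nome_nat, <- cexp_R, <- cexp_plus. f_equal. rewrite !RtoC_opp, !RtoC_mult. apply C_eq; simpl; ring.
Qed.

Lemma root_sum_zero N (d : Z) : (Z.abs d < Z.of_nat N)%Z -> d <> 0%Z ->
  csumn (fun s => cexp (RtoC (2 * PI * IZR d / INR N) * Ci) ^ s)%C N = 0%C.
Proof.
intros Hd Nd. set (eta := cexp (RtoC (2 * PI * IZR d / INR N) * Ci)).
assert (HN : 0 < INR N) by (apply lt_0_INR; lia).
assert (E1 : (eta ^ N = 1)%C).
{ unfold eta. rewrite <- cexp_nat. rewrite <- (cexp_2PI_Z d). f_equal.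
  replace (2 * PI * Ci * IZR d)%C with (RtoC (2 * PI * IZR d) * Ci)%C by (rewrite !RtoC_mult; ring).
  rewrite Cmult_assoc, <- RtoC_mult. do 2 f_equal. field. lra. }
assert (N1 : (1 - eta <> 0)%C).
{ intros E. assert (Re eta = 1).
  { apply (f_equal Re) in E. unfold Re in *. simpl in E. simpl. lra. }
  unfold eta, cexp in H. simpl in H.
  replace (2 * PI * IZR d / INR N * 0 - 0 * 1) with 0 in H by ring. rewrite exp_0, Rmult_1_l in H.
  replace (2 * PI * IZR d / INR N * 1 + 0 * 0) with (2 * (PI * IZR d / INR N)) in H by (field; lra).
  rewrite cos_2a_sin in H.
  assert (S0 : sin (PI * IZR d / INR N) = 0) by nra.
  generalize PI_gt_3; intros P3.
  assert (B : forall e, (0 < e < Z.of_nat N)%Z -> 0 < sin (PI * IZR e / INR N)).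
  { intros e He. apply sin_gt_0.
    - apply Rdiv_lt_0_compat; auto. apply Rmult_lt_0_compat; [lra|]. apply IZR_lt; lia.
    - apply Rmult_lt_reg_r with (INR N); auto. unfold Rdiv. rewrite Rmult_assoc, Rinv_l, Rmult_1_r by lra.
      apply Rmult_lt_compat_l; [lra|]. rewrite INR_IZR_INZ. apply IZR_lt; lia. }
  destruct (Z_lt_le_dec 0 d).
  - generalize (B d ltac:(lia)). lra.
  - generalize (B (- d)%Z ltac:(lia)). rewrite opp_IZR.
    replace (PI * - IZR d / INR N) with (- (PI * IZR d / INR N)) by (field; lra). rewrite sin_neg. lra. }
transitivity (csumn (fun s => eta ^ s) N * (1 - eta) * / (1 - eta))%C; [field; auto|].
rewrite csumn_geom, E1. field. auto.
Qed.

Lemma csumn_const c N : (csumn (fun _ => c) N = RtoC (INR N) * c)%C.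
Proof. induction N; [simpl; ring|]. rewrite S_INR, RtoC_plus. simpl csumn. rewrite IHN. ring. Qed.

Lemma csumn_single (a : nat -> C) N n : (n < N)%nat -> (forall m, (m < N)%nat -> m <> n -> a m = 0%C) -> csumn a N = a n.
Proof.
induction N; intros Hn H; [lia|]. simpl. destruct (Nat.eq_dec n N) as [->|D].
- rewrite (csumn_ext a (fun _ => 0%C)), csumn_const; [ring|]. intros k Hk. apply H; lia.
- rewrite IHN by (try lia; intros; apply H; lia). rewrite (H N) by lia. ring.
Qed.

(** The average over N-th roots of unity replaces the integral over the circle: N exceeds n, so that
    the average isolates [a n] in the truncated series, and is large enough for the tail to be below
    eps. Since the coefficients are real, conjugation extends the bound from [0, pi] to the whole
    circle. *)
Lemma cauchy_estimate (a : nat -> R) t B : 0 < t -> ex_series (fun m => Rabs (a m) * exp (- (INR m * t))) ->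
  (forall y, 0 <= y <= PI -> Cmod (csum (fun m => RtoC (a m) * nome (t, y) ^ m))%C <= B) ->
  forall n, Rabs (a n) * exp (- (INR n * t)) <= B.
Proof.
intros Ht Ea HB n.
assert (P3 := PI_gt_3).
assert (Ab : forall y, cabs (fun m => RtoC (a m) * nome (t, y) ^ m)%C).
{ intros y. apply (cabs_dom _ (fun m => Rabs (a m) * exp (- (INR m * t)))); auto. intros m.
  rewrite Cmod_mult, Cmod_R, (Cmod_nome_pow (t, y)). simpl; lra. }
assert (HB2 : forall y, 0 <= y <= 2 * PI -> Cmod (csum (fun m => RtoC (a m) * nome (t, y) ^ m))%C <= B).
{ intros y Hy. destruct (Rle_lt_dec y PI) as [L|L]; [apply HB; lra|].
  apply Rle_trans with (2 := HB (2 * PI - y) ltac:(lra)).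
  right. rewrite <- Cmod_conj. f_equal.
  assert (Q : forall m, (nome (t, y) ^ m = Cconj (nome (t, (2 * PI - y)%R) ^ m))%C).
  { assert (Q1 : nome (t, y) = Cconj (nome (t, 2 * PI - y))).
    { unfold nome, cexp, Cconj. simpl. replace (- (2 * PI - y)) with (y - 2 * PI) by ring.
      rewrite cos_minus, sin_minus, cos_2PI, sin_2PI, cos_neg, sin_neg. f_equal; ring. }
    intros m. rewrite Q1. clear. induction m; [unfold Cconj; simpl; apply C_eq; simpl; ring|].
    simpl. rewrite IHm. unfold Cconj, Cmult. simpl. apply C_eq; simpl; ring. }
  unfold csum, Cconj. simpl. apply C_eq; simpl.
  - apply Series_ext. intros m. rewrite Q. simpl. ring.
  - rewrite <- Series_opp. apply Series_ext. intros m. rewrite Q. simpl. ring. }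
set (b := fun m => Rabs (a m) * exp (- (INR m * t))) in *.
apply le_epsilon. intros eps He.
destruct (Series_tail_small b eps Ea He) as [N0 HN0].
set (N := max N0 (S n)). specialize (HN0 N ltac:(lia)).
assert (HN : 0 < INR N) by (apply lt_0_INR; lia).
pose (y := fun s => 2 * PI * INR s / INR N).
pose (A := fun s => csumn (fun m => RtoC (a m) * nome (t, y s) ^ m)%C N).
pose (rot := fun s => cexp (RtoC (INR n * y s) * Ci)).
assert (BA : forall s, (s < N)%nat -> Cmod (A s) <= B + eps).
{ intros s Hs. assert (Hy : 0 <= y s <= 2 * PI).
  { apply lt_INR in Hs. generalize (pos_INR s); intros. unfold y. split.
    - apply Rmult_le_pos; [nra|left; now apply Rinv_0_lt_compat].
    - apply Rmult_le_reg_r with (INR N); auto. unfold Rdiv. rewrite Rmult_assoc, Rinv_l, Rmult_1_r by lra. nra. }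
  assert (T := csum_tail _ N (Ab (y s))). fold (A s) in T.
  set (R1 := csum (fun k => RtoC (a (N + k)%nat) * nome (t, y s) ^ (N + k))%C) in *.
  replace (A s) with (csum (fun m => RtoC (a m) * nome (t, y s) ^ m)%C + - R1)%C by (rewrite T; ring).
  apply Rle_trans with (1 := Cmod_triangle _ _). rewrite Cmod_opp. apply Rplus_le_compat; [now apply HB2|].
  apply Rle_trans with (Series (fun k => b (N + k)%nat)).
  - apply Cmod_csum_le; [|apply (ex_series_incr_n b N), Ea]. intros m. rewrite Cmod_mult, Cmod_R, (Cmod_nome_pow (t, y s)). unfold b. simpl Re. lra.
  - generalize (Rle_abs (Series (fun k => b (N + k)%nat))). lra. }
assert (E : csumn (fun s => A s * rot s)%C N = (RtoC (INR N) * (RtoC (a n) * RtoC (exp (- (INR n * t)))))%C).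
{ rewrite (csumn_ext _ (fun s => csumn (fun m => RtoC (a m) * RtoC (exp (- (INR m * t))) *
     cexp (RtoC (2 * PI * IZR (Z.of_nat n - Z.of_nat m) / INR N) * Ci) ^ s)%C N)).
  - rewrite csumn_swap. rewrite (csumn_single _ N n) by
     (try lia; intros m Hm Nm; rewrite csumn_scal, root_sum_zero by lia; ring).
    rewrite csumn_scal. rewrite (csumn_ext _ (fun _ => 1%C)), csumn_const; [ring|].
    intros s _. rewrite <- cexp_nat, Z.sub_diag. rewrite <- cexp_0. f_equal. unfold Rdiv. rewrite !Rmult_0_r, Rmult_0_l. ring.
  - intros s _. unfold A. rewrite Cmult_comm, <- csumn_scal. apply csumn_ext. intros m _.
    rewrite nome_polar. unfold rot.
    transitivity (RtoC (a m) * RtoC (exp (- (INR m * t))) * (cexp (RtoC (INR n * y s) * Ci) * cexp (- (RtoC (INR m * y s) * Ci))))%C; [ring|].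
    f_equal. rewrite <- cexp_plus, <- cexp_nat. f_equal.
    rewrite minus_IZR, <- !INR_IZR_INZ. unfold y.
    transitivity (RtoC (INR n * (2 * PI * INR s / INR N) - INR m * (2 * PI * INR s / INR N)) * Ci)%C; [rewrite RtoC_minus; ring|].
    rewrite Cmult_assoc, <- RtoC_mult. do 2 f_equal. field. lra. }
apply Rmult_le_reg_l with (INR N); auto.
apply Rle_trans with (Cmod (csumn (fun s => A s * rot s)%C N)).
- right. rewrite E, !Cmod_mult, !Cmod_R, (Rabs_pos_eq (INR N)), (Rabs_pos_eq (exp _)) by (try lra; left; apply exp_pos). reflexivity.
- apply Rle_trans with (1 := Cmod_csumn _ _). rewrite <- rsum_const. apply rsum_le. intros s Hs.
  rewrite Cmod_mult. unfold rot. rewrite Cmod_cexp.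
  replace (Re (RtoC (INR n * y s) * Ci)%C) with 0 by (simpl; ring). rewrite exp_0, Rmult_1_r. auto.
Qed.

(** * Counts with bounded parts and the coefficient bound *)

Section GeneratingFunction.
Variable c : nat -> nat -> R.
Hypothesis c_pos : forall k n, 0 <= c k n.
Hypothesis c_0 : forall n, c 0%nat n = if (n =? 0)%nat then 1 else 0.
(** This is (1 - q^K) C_K = (1 + q^K) C_(K-1) with K = k + 1. Keeping [c] abstract separates the
    analysis from the way overpartitions are listed. *)
Hypothesis c_S : forall k n, c (S k) n = c k n + (if (n <? S k)%nat then 0 else c k (n - S k)%nat + c (S k) (n - S k)%nat).

Lemma shift_rsum (f : nat -> R) r d M : 
  rsum (fun n => (if (n <? d)%nat then 0 else f (n - d)%nat) * r ^ n) (d + M) = r ^ d * rsum (fun n => f n * r ^ n) M.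
Proof.
induction M.
- rewrite Nat.add_0_r, (rsum_ext _ (fun _ => 0)), rsum_const; [simpl; ring|].
  intros k Hk. destruct (Nat.ltb_spec k d); [ring|lia].
- rewrite Nat.add_succ_r. simpl rsum. rewrite IHM. destruct (Nat.ltb_spec (d + M) d); [lia|].
  replace (d + M - d)%nat with M by lia. rewrite pow_add. ring.
Qed.

Lemma shift_rsum_le (f : nat -> R) r d N : 0 <= r -> (forall n, 0 <= f n) ->
  rsum (fun n => (if (n <? d)%nat then 0 else f (n - d)%nat) * r ^ n) N <= r ^ d * rsum (fun n => f n * r ^ n) N.
Proof.
intros Hr Hf. rewrite <- shift_rsum. apply rsum_mono; [|lia].
intros n. apply Rmult_le_pos; [destruct (Nat.ltb_spec n d); [lra|auto]|now apply pow_le].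
Qed.

(** Summing the recurrence bounds (1 - rho) times a partial sum at level k + 1 by (1 + rho) times
    the series at level k, so convergence passes upwards without any growth estimate for [c]. *)
Lemma genfun_abs k r : 0 <= r < 1 -> ex_series (fun n => c k n * r ^ n).
Proof.
intros Hr. induction k as [|k IH].
- apply (ex_series_incr_n (fun n => c 0%nat n * r ^ n) 1). apply (ex_series_ext (fun n => 0 * r ^ n)).
  + intros n. rewrite c_0. simpl. change_eq_R. ring.
  + apply ex_series_scalR, ex_series_geomR, Hr.
- set (Sk := Series (fun n => c k n * r ^ n)).
  assert (P : forall j n, 0 <= c j n * r ^ n) by (intros; apply Rmult_le_pos; auto; apply pow_le; lra).
  assert (Y := pow_lt1 r (S k) Hr ltac:(lia)). set (rho := r ^ S k) in *.
  apply (bounded_ex_series _ ((1 + rho) * Sk / (1 - rho))); [auto|].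
  intros N. apply Rmult_le_reg_r with (1 - rho); [lra|]. unfold Rdiv. rewrite Rmult_assoc, Rinv_l, Rmult_1_r by lra.
  assert (A : rsum (fun n => c k n * r ^ n) N <= Sk) by (apply rsum_le_Series; auto).
  assert (E : rsum (fun n => c (S k) n * r ^ n) N = rsum (fun n => c k n * r ^ n) N +
    (rsum (fun n => (if (n <? S k)%nat then 0 else c k (n - S k)%nat) * r ^ n) N +
     rsum (fun n => (if (n <? S k)%nat then 0 else c (S k) (n - S k)%nat) * r ^ n) N)).
  { rewrite <- !rsum_plus. apply rsum_ext. intros n _. rewrite c_S at 1. destruct (Nat.ltb_spec n (S k)); ring. }
  assert (B1 := shift_rsum_le (c k) r (S k) N ltac:(lra) (c_pos k)).
  assert (B2 := shift_rsum_le (c (S k)) r (S k) N ltac:(lra) (c_pos (S k))). fold rho in B1, B2.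
  assert (rho * rsum (fun n => c k n * r ^ n) N <= rho * Sk) by (apply Rmult_le_compat_l; lra).
  lra.
Qed.

Lemma genfun_cabs k tau : 0 < Re tau -> cabs (fun n => RtoC (c k n) * nome tau ^ n)%C.
Proof.
intros Ht. apply (cabs_dom _ (fun n => c k n * exp (- Re tau) ^ n)).
- intros n. rewrite Cmod_mult, Cmod_R, Cmod_pow, Cmod_nome, Rabs_pos_eq by auto. lra.
- apply genfun_abs. generalize (exp_neg_lt1 _ Ht); lra.
Qed.

Lemma shift_csum (f : nat -> R) q d : cabs (fun n => RtoC (f n) * q ^ n)%C ->
  cabs (fun n => RtoC (if (n <? d)%nat then 0 else f (n - d)%nat) * q ^ n)%C /\
  csum (fun n => RtoC (if (n <? d)%nat then 0 else f (n - d)%nat) * q ^ n)%C = (q ^ d * csum (fun n => RtoC (f n) * q ^ n))%C.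
Proof.
intros A.
assert (E : forall n, (RtoC (if (d + n <? d)%nat then 0 else f (d + n - d)%nat) * q ^ (d + n) = q ^ d * (RtoC (f n) * q ^ n))%C).
{ intros n. destruct (Nat.ltb_spec (d + n) d); [lia|]. replace (d + n - d)%nat with n by lia. rewrite Cpow_add_r. ring. }
assert (A' : cabs (fun n => RtoC (if (n <? d)%nat then 0 else f (n - d)%nat) * q ^ n)%C).
{ apply (ex_series_incr_n (fun n => Cmod (RtoC (if (n <? d)%nat then 0 else f (n - d)%nat) * q ^ n)%C) d).
  apply (ex_series_ext (fun n => Cmod (q ^ d * (RtoC (f n) * q ^ n))%C)); [intros; now rewrite E|]. now apply (cabs_scal (q ^ d)%C). }
split; auto. rewrite (csum_tail _ d A'). rewrite (csum_ext _ _ E), csum_scal by auto.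
rewrite (csumn_ext _ (fun _ => 0%C)), csumn_const; [ring|]. intros k Hk. destruct (Nat.ltb_spec k d); [ring|lia].
Qed.

Lemma genfun_overpartition_prod k tau : 0 < Re tau -> csum (fun n => RtoC (c k n) * nome tau ^ n)%C = overpartition_prod k tau.
Proof.
intros Ht. induction k as [|k IH].
- rewrite (csum_tail _ 1 (genfun_cabs 0 tau Ht)). simpl csumn. rewrite c_0.
  rewrite (csum_ext _ (fun n => 0 * nome tau ^ n)%C).
  + assert (Q : Cmod (nome tau) < 1) by (rewrite Cmod_nome; generalize (exp_neg_lt1 _ Ht); lra).
    rewrite csum_scal by apply (csum_geom _ Q). simpl. ring.
  + intros n. rewrite c_0. simpl. ring.
- set (q := nome tau) in *. set (X := csum (fun n => RtoC (c (S k) n) * q ^ n)%C).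
  assert (A1 := genfun_cabs k tau Ht). assert (A2 := genfun_cabs (S k) tau Ht). fold q in A1, A2.
  destruct (shift_csum (c k) q (S k) A1) as [S1 S2]. destruct (shift_csum (c (S k)) q (S k) A2) as [S3 S4]. fold X in S4.
  assert (E : X = (overpartition_prod k tau + (q ^ S k * overpartition_prod k tau + q ^ S k * X))%C).
  { rewrite <- IH, <- S2, <- S4, <- !csum_plus by (auto; now apply cabs_plus). apply csum_ext. intros n. rewrite c_S.
    destruct (Nat.ltb_spec n (S k)); rewrite ?RtoC_plus; ring. }
  assert (N := one_minus_neq0 _ (nome_pow_lt1 tau k Ht)). fold q in N.
  change (overpartition_prod (S k) tau) with (overpartition_prod k tau * ((1 + q ^ S k) / (1 - q ^ S k)))%C.
  transitivity ((X - q ^ S k * X) * / (1 - q ^ S k))%C; [field; auto|].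
  rewrite E at 1. field. auto.
Qed.

(** With x = 1/t and 18014 = 18000 + 14, the major arc bound and the error of the main generating
    function together stay below the exponential of the minor arc. *)
Lemma exp_dominates x : 24 <= x -> 18014 * x <= exp (0.605 * x).
Proof.
intros Hx. assert (E : 300000 <= exp 14).
{ replace 14 with (INR 14 * 1) by (rewrite INR_IZR_INZ; simpl; ring). rewrite <- exp_pow.
  apply Rle_trans with ((5/2) ^ 14); [lra|]. apply pow_incr. split; [lra|].
  replace 1 with (1/8 + 1/8 + (1/8 + 1/8) + (1/8 + 1/8 + (1/8 + 1/8))) by field. rewrite !exp_plus.
  assert (H : 1.125 <= exp (1/8)) by (generalize (exp_ineq1_le (1/8)); lra).
  set (z := exp (1/8)) in *. assert (1.265 <= z * z) by nra. assert (1.6 <= z * z * (z * z)) by nra. nra. }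
apply Rle_trans with (exp 14 * (1 + (0.605 * x - 14))).
- nra.
- replace (0.605 * x) with (14 + (0.605 * x - 14)) at 2 by ring. rewrite exp_plus.
  apply Rmult_le_compat_l; [left; apply exp_pos|apply exp_ineq1_le].
Qed.

(** The bound M is free, so that K can exceed every index of interest, and one [kp] serves all n, as
    a homogeneous determinant requires. On the minor arc 205 = 204 + 1, where the 1 absorbs 14 /
    t. *)
Theorem coefficient_bound t M : 0 < t <= 1/24 -> exists K kp, (M <= K)%nat /\ / 100 <= kp /\
  forall n, Rabs (/ kp * c K n - main_coeff n) <= exp (INR n * t) * (205 * exp (0.605 * / t)).
Proof.
intros Ht.
destruct (major_arc t Ht) as [N1 H1]. destruct (minor_arc t Ht) as [N2 H2].
destruct (main_genfun_principal_sum t Ht) as [N3 H3]. destruct (kappa_lower t ltac:(lra)) as [N4 H4].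
pose (K := (M + N1 + N2 + N3 + N4)%nat). exists K, (kappa K t).
destruct (H4 K ltac:(lia)) as [Kl _]. split; [lia|]. split; auto.
specialize (H1 K ltac:(lia)). specialize (H2 K ltac:(lia)). specialize (H3 K ltac:(lia)).
set (kp := kappa K t) in *.
assert (I : 24 <= / t) by (rewrite <- (Rinv_inv 24); apply Rinv_le_contravar; lra).
assert (X := exp_dominates (/ t) I).
assert (A1 : forall y, cabs (fun m => RtoC (/ kp * c K m) * nome (t, y) ^ m)%C).
{ intros y. apply (cabs_ext (fun m => RtoC (/ kp) * (RtoC (c K m) * nome (t, y) ^ m))%C); [intros; rewrite RtoC_mult; ring|].
  apply cabs_scal, genfun_cabs. simpl; lra. }
assert (A2 : forall y, cabs (fun m => RtoC (main_coeff m) * nome (t, y) ^ m)%C) by (intros y; apply main_genfun_abs; simpl; lra).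
assert (Bd := cauchy_estimate (fun m => / kp * c K m - main_coeff m) t (205 * exp (0.605 * / t)) ltac:(lra)).
intros n. apply Rmult_le_reg_r with (exp (- (INR n * t))); [apply exp_pos|].
replace (exp (INR n * t) * (205 * exp (0.605 * / t)) * exp (- (INR n * t))) with
  (205 * exp (0.605 * / t) * exp (INR n * t + - (INR n * t))) by (rewrite exp_plus; ring).
rewrite Rplus_opp_r, exp_0, Rmult_1_r. apply Bd; clear Bd.
- assert (A3 := cabs_minus _ _ (A1 0) (A2 0)). 
  apply (ex_series_ext (fun m => Cmod (RtoC (/ kp * c K m) * nome (t, 0) ^ m - RtoC (main_coeff m) * nome (t, 0) ^ m)%C)); auto.
  intros m. change_eq_R. replace (RtoC (/ kp * c K m) * nome (t, 0) ^ m - RtoC (main_coeff m) * nome (t, 0) ^ m)%C with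
    (RtoC (/ kp * c K m - main_coeff m) * nome (t, 0) ^ m)%C by (rewrite RtoC_minus; ring).
  rewrite Cmod_mult, Cmod_R, (Cmod_nome_pow (t, 0)). reflexivity.
- intros y Hy.
  replace (csum (fun m => RtoC (/ kp * c K m - main_coeff m) * nome (t, y) ^ m)%C) with (RtoC (/ kp) * overpartition_prod K (t, y) - main_genfun (t, y))%C.
  + replace (RtoC (/ kp) * overpartition_prod K (t, y) - main_genfun (t, y))%C with
     ((RtoC (/ kp) * overpartition_prod K (t, y) - principal_sum K (t, y)) + - (main_genfun (t, y) - principal_sum K (t, y)))%C by ring.
    apply Rle_trans with (1 := Cmod_triangle _ _). rewrite Cmod_opp.
    assert (B3 := H3 y Hy). destruct (Rle_lt_dec y (4 * t)) as [L|L].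
    * assert (B1 := H1 y ltac:(lra)). generalize (exp_pos (0.605 * / t)). unfold Rdiv in *. lra.
    * assert (B2 := H2 y ltac:(lra)). unfold Rdiv in *. lra.
  + rewrite <- genfun_overpartition_prod by (simpl; lra). unfold main_genfun.
    rewrite <- csum_scal by (apply genfun_cabs; simpl; lra).
    rewrite <- csum_minus; [|apply cabs_scal, genfun_cabs; simpl; lra|apply A2].
    apply csum_ext. intros m. rewrite RtoC_minus, RtoC_mult. ring.
Qed.

End GeneratingFunction.


(** * Closed form of the main coefficients *)

Lemma Series_even_odd (a : nat -> R) : ex_series (fun k => Rabs (a k)) ->
  ex_series (fun k => a (2 * k)%nat) /\ ex_series (fun k => a (2 * k + 1)%nat) /\
  Series a = Series (fun k => a (2 * k)%nat) + Series (fun k => a (2 * k + 1)%nat).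
Proof.
intros E.
assert (R1 : forall (b : nat -> R) N, rsum b (2 * N) = rsum (fun k => b (2 * k)%nat) N + rsum (fun k => b (2 * k + 1)%nat) N).
{ intros b. induction N; [simpl; ring|]. replace (2 * S N)%nat with (S (S (2 * N))) by lia. cbn [rsum]. rewrite IHN.
  replace (2 * N + 1)%nat with (S (2 * N)) by lia. ring. }
assert (B : forall N, rsum (fun k => Rabs (a (2 * k)%nat)) N + rsum (fun k => Rabs (a (2 * k + 1)%nat)) N <= Series (fun k => Rabs (a k))).
{ intros N. rewrite <- (R1 (fun k => Rabs (a k))). apply rsum_le_Series; auto. intros; apply Rabs_pos. }
assert (E1 : ex_series (fun k => Rabs (a (2 * k)%nat))).
{ apply (bounded_ex_series _ (Series (fun k => Rabs (a k)))); [intros; apply Rabs_pos|]. intros N. specialize (B N).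
  generalize (rsum_ge0 (fun k => Rabs (a (2 * k + 1)%nat)) N (fun k => Rabs_pos _)). lra. }
assert (E2 : ex_series (fun k => Rabs (a (2 * k + 1)%nat))).
{ apply (bounded_ex_series _ (Series (fun k => Rabs (a k)))); [intros; apply Rabs_pos|]. intros N. specialize (B N).
  generalize (rsum_ge0 (fun k => Rabs (a (2 * k)%nat)) N (fun k => Rabs_pos _)). lra. }
apply ex_series_Rabs in E1, E2.
split; [auto|]. split; [auto|].
assert (L1 := rsum_lim _ (ex_series_Rabs _ E)).
assert (L2 : is_lim_seq (fun N => rsum a (2 * N)) (Series (fun k => a (2 * k)%nat) + Series (fun k => a (2 * k + 1)%nat))).
{ apply (is_lim_seq_ext (fun N => rsum (fun k => a (2 * k)%nat) N + rsum (fun k => a (2 * k + 1)%nat) N)); [intros; now rewrite R1|].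
  apply is_lim_seq_plus'; now apply rsum_lim. }
assert (L3 : is_lim_seq (fun N => rsum a (2 * N)) (Series a)).
{ apply (is_lim_seq_subseq (rsum a) (Series a) (fun N => (2 * N)%nat)); auto.
  apply eventually_subseq. intros; lia. }
apply is_lim_seq_unique in L2, L3. rewrite L2 in L3. now injection L3.
Qed.

Lemma exp_series_abs x : ex_series (fun k => Rabs (x ^ k * / INR (fact k))).
Proof.
apply (ex_series_ext (fun k => Rabs x ^ k * / INR (fact k))); [|apply exp_series].
intros k. change_eq_R. rewrite Rabs_mult, Rabs_inv, <- RPow_abs, (Rabs_pos_eq (INR (fact k))) by apply pos_INR. reflexivity.
Qed.

Lemma even_odd_exp x :
  (ex_series (fun k => x ^ (2 * k) * / INR (fact (2 * k))) /\ ex_series (fun k => x ^ (2 * k + 1) * / INR (fact (2 * k + 1)))) /\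
  Series (fun k => x ^ (2 * k) * / INR (fact (2 * k))) = (exp x + exp (- x)) / 2 /\
  Series (fun k => x ^ (2 * k + 1) * / INR (fact (2 * k + 1))) = (exp x - exp (- x)) / 2.
Proof.
destruct (Series_even_odd _ (exp_series_abs x)) as (E1 & E2 & E3).
destruct (Series_even_odd _ (exp_series_abs (- x))) as (F1 & F2 & F3).
rewrite (proj2 (exp_series x)) in E3. rewrite (proj2 (exp_series (- x))) in F3.
rewrite (Series_ext (fun k => (- x) ^ (2 * k) * _) (fun k => x ^ (2 * k) * / INR (fact (2 * k)))) in F3.
- rewrite (Series_ext (fun k => (- x) ^ (2 * k + 1) * _) (fun k => - (x ^ (2 * k + 1) * / INR (fact (2 * k + 1))))), Series_opp in F3.
  + repeat split; auto; lra.
  + intros k. rewrite !pow_add, !pow_mult. replace ((- x) ^ 2) with (x ^ 2) by ring. ring.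
- intros k. rewrite !pow_mult. replace ((- x) ^ 2) with (x ^ 2) by ring. reflexivity.
Qed.

Lemma principal_coeff_closed k : principal_coeff k = PI ^ (2 * k + 1) * INR (fact k) * / INR (fact (2 * k + 1)).
Proof.
induction k.
- simpl. field.
- simpl principal_coeff. rewrite IHk. replace (2 * S k + 1)%nat with (S (S (2 * k + 1))) by lia.
  rewrite !fact_simpl, !mult_INR, !S_INR, plus_INR, mult_INR. simpl (INR 2). simpl (INR 1).
  assert (F := INR_fact_neq_0 (2 * k + 1)). generalize (pos_INR k); intros. simpl pow. field. repeat split; auto; lra.
Qed.

(** The part with the growing exponential of the derivative of sinh (pi sqrt x) / sqrt x, at x =
    s^2. *)
Definition fmain (s : R) : R := exp (PI * s) * (PI / (4 * (s * s)) - 1 / (4 * (s * s * s))).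

Lemma main_coeff_closed m : (1 <= m)%nat -> let s := sqrt (INR m) in
  main_coeff m = fmain s + exp (- (PI * s)) * (PI / (4 * (s * s)) + 1 / (4 * (s * s * s))).
Proof.
intros Hm s.
assert (HM : 0 < INR m) by (apply lt_0_INR; lia).
assert (Hs : 0 < s) by now apply sqrt_lt_R0.
assert (Hss : s * s = INR m) by (apply sqrt_sqrt; lra).
destruct (even_odd_exp (PI * s)) as [[E1 E2] [E3 E4]].
set (ev := fun k => (PI * s) ^ (2 * k) * / INR (fact (2 * k))) in *.
set (od := fun k => (PI * s) ^ (2 * k + 1) * / INR (fact (2 * k + 1))) in *.
set (d := fun k => PI / (2 * (s * s)) * ev k - 1 / (2 * (s * s * s)) * od k).
assert (Ed : ex_series d).
{ apply (ex_series_minus (V := R_NormedModule)); now apply ex_series_scalR. }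
assert (Sd : Series d = PI / (2 * (s * s)) * ((exp (PI * s) + exp (- (PI * s))) / 2) - 1 / (2 * (s * s * s)) * ((exp (PI * s) - exp (- (PI * s))) / 2)).
{ unfold d. rewrite Series_minus, !Series_scal_l, E3, E4 by now apply ex_series_scalR. reflexivity. }
(* The k = 0 terms of the hyperbolic cosine and sine series cancel, so the shift of the index costs
   nothing. *)
assert (D0 : d 0%nat = 0) by (unfold d, ev, od; simpl; field; lra).
unfold main_coeff. rewrite (Series_ext _ (fun k => d (S k))).
- rewrite (Series_incr_1 d Ed), D0, Rplus_0_l in Sd. rewrite Sd. unfold fmain. field. lra.
- intros k. rewrite principal_coeff_closed. unfold d, ev, od.
  replace (2 * S k + 1)%nat with (S (2 * S k)) by lia.
  rewrite (fact_simpl (2 * S k)), (fact_simpl k), !mult_INR, !(S_INR (2 * S k)), mult_INR. simpl (INR 2).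
  rewrite <- Hss. rewrite !Rpow_mult_distr. replace (s ^ k * s ^ k) with (s ^ (2 * k)) by (rewrite <- pow_add; f_equal; lia).
  replace (s ^ S (2 * S k)) with (s * (s * (s * s ^ (2 * k)))) by (replace (S (2 * S k)) with (S (S (S (2 * k)))) by lia; reflexivity).
  replace (s ^ (2 * S k)) with (s * (s * s ^ (2 * k))) by (replace (2 * S k)%nat with (S (S (2 * k))) by lia; reflexivity).
  assert (F := INR_fact_neq_0 (2 * S k)). assert (G := INR_fact_neq_0 k). rewrite S_INR. generalize (pos_INR k); intros.
  change (PI ^ S (2 * S k)) with (PI * PI ^ (2 * S k)). field. repeat split; auto; lra.
Qed.

Lemma main_coeff_fmain m : (1 <= m)%nat -> Rabs (main_coeff m - fmain (sqrt (INR m))) <= 2.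
Proof.
intros Hm. rewrite (main_coeff_closed m Hm). set (s := sqrt (INR m)).
assert (Hs : 1 <= s).
{ unfold s. rewrite <- sqrt_1. apply sqrt_le_1_alt. change 1 with (INR 1). now apply le_INR. }
replace (fmain s + exp (- (PI * s)) * (PI / (4 * (s * s)) + 1 / (4 * (s * s * s))) - fmain s) with
 (exp (- (PI * s)) * (PI / (4 * (s * s)) + 1 / (4 * (s * s * s)))) by ring.
generalize PI_gt_3 PI_lt_32; intros.
assert (E : exp (- (PI * s)) <= 1) by (rewrite <- exp_0; apply exp_le_mono; nra).
assert (I1 : / (4 * (s * s)) <= / 4) by (apply Rinv_le_contravar; nra).
assert (I2 : / (4 * (s * s * s)) <= / 4) by (apply Rinv_le_contravar; [lra|]; assert (1 <= s * s) by nra; nra).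
assert (J1 : 0 < / (4 * (s * s))) by (apply Rinv_0_lt_compat; nra).
assert (J2 : 0 < / (4 * (s * s * s))) by (apply Rinv_0_lt_compat; assert (0 < s * s) by nra; nra).
assert (P : 0 <= PI / (4 * (s * s)) + 1 / (4 * (s * s * s)) <= 2) by (unfold Rdiv; nra).
rewrite Rabs_pos_eq; [|apply Rmult_le_pos; [left; apply exp_pos|lra]].
generalize (exp_pos (- (PI * s))). nra.
Qed.


(** * The determinant of the main term *)

Definition toeplitz3 (a b c d e : R) : R :=
  c * (c * c - d * b) - d * (b * c - d * a) + e * (b * b - c * a).

Lemma toeplitz3_tilt a b c d e l rho : rho <> 0 ->
  toeplitz3 (l * (a / (rho * rho))) (l * (b / rho)) (l * c) (l * (d * rho)) (l * (e * (rho * rho))) = l * l * l * toeplitz3 a b c d e.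
Proof. intros H. unfold toeplitz3. field. auto. Qed.

Lemma toeplitz3_pos a b c d e : let s1 := d - 2 * c + b in let s2 := e - 2 * c + a in
  0 < c -> s2 < 0 -> s1 * s1 < c * (s2 - 4 * s1) -> 0 < toeplitz3 a b c d e.
Proof.
intros s1 s2 Hc H2 H. apply Rmult_lt_reg_l with c; auto. rewrite Rmult_0_r.
(* u and w are the central first and third differences; with c, s1 and s2 they are coordinates in
   place of the five entries. *)
pose (u := (d - b) / 2). pose (w := (e - a) / 2 - 2 * u).
replace (c * toeplitz3 a b c d e) with
 ((w * c - s1 * u) * (w * c - s1 * u) + (c * (s2 - 4 * s1) - s1 * s1) * (u * u - s2 * c / 4))
  by (unfold toeplitz3, w, u, s1, s2; field).
assert (0 < (- s2) * c) by (apply Rmult_lt_0_compat; lra).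
generalize (Rle_0_sqr u) (Rle_0_sqr (w * c - s1 * u)). unfold Rsqr. intros.
assert (0 < (c * (s2 - 4 * s1) - s1 * s1) * (u * u - s2 * c / 4)) by (apply Rmult_lt_0_compat; lra). lra.
Qed.

Lemma is_derive_shift (f f1 : R -> R) c y : is_derive f (y + c) (f1 (y + c)) -> is_derive (fun y => f (y + c)) y (f1 (y + c)).
Proof.
intros F. assert (I : is_derive (fun y => y + c) y 1) by (auto_derive; auto; ring).
assert (C := is_derive_comp (V := R_NormedModule) f (fun y => y + c) y _ _ F I).
match type of C with is_derive _ _ ?l => replace (f1 (y + c)) with l; [exact C|] end.
unfold scal; simpl; unfold mult; simpl. ring.
Qed.

(** The symmetrised function q (x+u) + q (x-u) has derivative q1 (x+u) - q1 (x-u) >= 2 m u, so two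
    mean value inequalities take the place of an integral remainder. *)
Lemma second_difference (q q1 q2 : R -> R) x h m : 0 <= h ->
  (forall y, x - h <= y <= x + h -> is_derive q y (q1 y)) ->
  (forall y, x - h <= y <= x + h -> is_derive q1 y (q2 y)) ->
  (forall y, x - h <= y <= x + h -> m <= q2 y) ->
  m * (h * h) <= q (x + h) - 2 * q x + q (x - h).
Proof.
intros Hh H1 H2 H3.
assert (D : forall u, 0 <= u <= h -> is_derive (fun u => q (x + u) + q (x - u)) u (q1 (x + u) - q1 (x - u))).
{ intros u Hu.
  assert (I : is_derive (fun u => x + u) u 1) by (auto_derive; auto; ring).
  assert (J : is_derive (fun u => x - u) u (Ropp 1)) by (auto_derive; auto; ring).
  assert (A' := is_derive_comp (V := R_NormedModule) q (fun u => x + u) u _ _ (H1 (x + u) ltac:(lra)) I).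
  assert (B' := is_derive_comp (V := R_NormedModule) q (fun u => x - u) u _ _ (H1 (x - u) ltac:(lra)) J).
  assert (C := is_derive_plus (V := R_NormedModule) _ _ _ _ _ A' B').
  match type of C with is_derive _ _ ?l => replace (q1 (x + u) - q1 (x - u)) with l; [exact C|] end.
  unfold plus, scal; simpl; unfold mult; simpl. ring. }
assert (B : forall u, 0 <= u <= h -> m * (2 * u) <= q1 (x + u) - q1 (x - u)).
{ intros u Hu. assert (X := is_derive_bound (fun y => - q1 y) (x - u) (x + u) (- m) (fun y => - q2 y) ltac:(lra)).
  assert (- q1 (x + u) - - q1 (x - u) <= - m * (x + u - (x - u))); [|lra].
  apply X; intros y Hy; [|generalize (H3 y ltac:(lra)); lra].
  apply (is_derive_opp (V := R_NormedModule)), H2; lra. }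
assert (X := is_derive_bound (fun u => m * (u * u) - (q (x + u) + q (x - u))) 0 h 0 (fun u => m * (2 * u) - (q1 (x + u) - q1 (x - u))) Hh).
cbv beta in X. rewrite Rplus_0_r, Rminus_0_r in X.
assert (E : m * (h * h) - (q (x + h) + q (x - h)) - (m * (0 * 0) - (q x + q x)) <= 0 * (h - 0)); [|lra].
apply X; intros u Hu; [|generalize (B u Hu); lra].
apply (is_derive_minus (V := R_NormedModule) (fun u => m * (u * u)) (fun u => q (x + u) + q (x - u))); [|auto].
auto_derive; auto. ring.
Qed.

(** The fourth difference is the second difference of the second difference [dd q], and [dd]
    commutes with differentiation. *)
Lemma fourth_difference (q q1 q2 q3 q4 : R -> R) x m :
  (forall y, x - 2 <= y <= x + 2 -> is_derive q y (q1 y) /\ is_derive q1 y (q2 y) /\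
     is_derive q2 y (q3 y) /\ is_derive q3 y (q4 y) /\ m <= q4 y) ->
  m <= q (x + 2) - 4 * q (x + 1) + 6 * q x - 4 * q (x - 1) + q (x - 2).
Proof.
intros H.
pose (dd := fun (f : R -> R) y => f (y + 1) - 2 * f y + f (y + Ropp 1)).
assert (D : forall f f1 : R -> R, (forall y, x - 2 <= y <= x + 2 -> is_derive f y (f1 y)) ->
  forall y, x - 1 <= y <= x + 1 -> is_derive (dd f) y (dd f1 y)).
{ intros f f1 F y Hy. unfold dd.
  apply (is_derive_plus (V := R_NormedModule) (fun y => f (y + 1) - 2 * f y) (fun y => f (y + Ropp 1)));
   [|apply is_derive_shift, F; lra].
  apply (is_derive_minus (V := R_NormedModule) (fun y => f (y + 1)) (fun y => 2 * f y)); [apply is_derive_shift, F; lra|].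
  apply is_derive_scal, F. lra. }
assert (L : forall y, x - 1 <= y <= x + 1 -> m <= dd q2 y).
{ intros y Hy. unfold dd. assert (X := second_difference q2 q3 q4 y 1 m ltac:(lra)).
  rewrite !Rmult_1_r in X. apply X; intros z Hz; apply (H z ltac:(lra)). }
assert (X := second_difference (dd q) (dd q1) (dd q2) x 1 m ltac:(lra)).
rewrite !Rmult_1_r in X. apply Rle_trans with (1 := X
  ltac:(intros y Hy; apply D; auto; intros; now apply H) ltac:(intros y Hy; apply D; auto; intros; now apply H) L).
unfold dd. right.
replace (x + 1 + 1) with (x + 2) by ring. replace (x + 1 + Ropp 1) with x by ring.
replace (x - 1 + 1) with x by ring. replace (x - 1 + Ropp 1) with (x - 2) by ring. replace (x + Ropp 1) with (x - 1) by ring. ring.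
Qed.

(* Derivatives of the tilted main term in v = 1 / sqrt x and g = v - 1 / sqrt x0: the next polynomial is pi/2 g P - v^3/2 (P_v + P_g). *)
Definition tilt_poly0 (v g : R) : R := PI^2*v^3 - 3*PI*v^4 + 3*v^5.
Definition tilt_poly1 (v g : R) : R := -3/2*PI^2*v^5 + 6*PI*v^6 + 1/2*PI^3*v^3*g - 15/2*v^7 - 3/2*PI^2*v^4*g + 3/2*PI*v^5*g.
Definition tilt_poly2 (v g : R) : R := -1/4*PI^3*v^6 + 9/2*PI^2*v^7 - 75/4*PI*v^8 - 3/2*PI^3*v^5*g + 105/4*v^9 + 6*PI^2*v^6*g
  + 1/4*PI^4*v^3*g^2 - 15/2*PI*v^7*g - 3/4*PI^3*v^4*g^2 + 3/4*PI^2*v^5*g^2.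
Definition tilt_poly3 (v g : R) : R := 3/2*PI^3*v^8 - 75/4*PI^2*v^9 - 3/8*PI^4*v^6*g + 315/4*PI*v^10 + 27/4*PI^3*v^7*g - 945/8*v^11
  - 225/8*PI^2*v^8*g - 9/8*PI^4*v^5*g^2 + 315/8*PI*v^9*g + 9/2*PI^3*v^6*g^2 + 1/8*PI^5*v^3*g^3 - 45/8*PI^2*v^7*g^2
  - 3/8*PI^4*v^4*g^3 + 3/8*PI^3*v^5*g^3.
Definition tilt_poly4 (v g : R) : R := 3/16*PI^4*v^9 - 75/8*PI^3*v^10 + 1575/16*PI^2*v^11 + 3*PI^4*v^8*g - 6615/16*PI*v^12
  - 75/2*PI^3*v^9*g - 3/8*PI^5*v^6*g^2 + 10395/16*v^13 + 315/2*PI^2*v^10*g + 27/4*PI^4*v^7*g^2 - 945/4*PI*v^11*g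
  - 225/8*PI^3*v^8*g^2 - 3/4*PI^5*v^5*g^3 + 315/8*PI^2*v^9*g^2 + 3*PI^4*v^6*g^3 + 1/16*PI^6*v^3*g^4 - 15/4*PI^3*v^7*g^3
  - 3/16*PI^5*v^4*g^4 + 3/16*PI^4*v^5*g^4.

Lemma monomial_bound a b j v z : 0 <= v <= 0.026 -> Rabs z <= 1.6 ->
  Rabs (PI ^ a * v ^ b * z ^ j) <= 3.15 ^ a * 0.026 ^ b * 1.6 ^ j.
Proof.
intros Hv Hz. generalize PI_lt_315 PI_gt_3; intros. rewrite !Rabs_mult, <- !RPow_abs.
rewrite (Rabs_pos_eq PI), (Rabs_pos_eq v) by lra.
repeat apply Rmult_le_compat; try apply pow_incr; try split; try lra; try apply Rabs_pos;
 repeat apply Rmult_le_pos; apply pow_le; try lra; apply Rabs_pos.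
Qed.

Ltac mono a b j v z := let H := fresh in
  assert (H := monomial_bound a b j v z ltac:(assumption) ltac:(assumption)); apply Rabs_le_between in H;
  set (PI ^ a * v ^ b * z ^ j) in *.

Lemma tilt_poly0_lower v g : 0 <= v <= 0.026 -> 9.6 * v ^ 3 <= tilt_poly0 v g.
Proof.
intros Hv. generalize PI_lt_315 PI_gt_314 PI_sq_bounds; intros. unfold tilt_poly0.
replace (PI ^ 2 * v ^ 3 - 3 * PI * v ^ 4 + 3 * v ^ 5) with (v ^ 3 * (PI * PI - 3 * (PI * v) + 3 * (v * v))) by ring.
rewrite Rmult_comm. apply Rmult_le_compat_l; [apply pow_le; lra|]. nra.
Qed.

(** Near x0 the variable g is of order v^3, and g = z v^3 makes every monomial divisible by v^6. The
    leading coefficient is -pi^3 / 4, the term 9/2 pi^2 v is kept with its sign, and the rest is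
    bounded in absolute value. *)
Lemma tilt_poly2_bounds v z : 0 <= v <= 0.026 -> Rabs z <= 1.6 -> -7.94 * v ^ 6 <= tilt_poly2 v (z * v ^ 3) <= -6.4 * v ^ 6.
Proof.
intros Hv Hz. generalize PI_lt_315 PI_gt_314 PI_sq_bounds; intros P1 P2 P3.
assert (E : tilt_poly2 v (z * v ^ 3) = v ^ 6 * (-1/4 * (PI * (PI * PI)) + 9/2 * (PI * PI * v) - 75/4 * (PI ^ 1 * v ^ 2 * z ^ 0) - 3/2 * (PI ^ 3 * v ^ 2 * z ^ 1)
  + 105/4 * (PI ^ 0 * v ^ 3 * z ^ 0) + 6 * (PI ^ 2 * v ^ 3 * z ^ 1) + 1/4 * (PI ^ 4 * v ^ 3 * z ^ 2) - 15/2 * (PI ^ 1 * v ^ 4 * z ^ 1)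
  - 3/4 * (PI ^ 3 * v ^ 4 * z ^ 2) + 3/4 * (PI ^ 2 * v ^ 5 * z ^ 2))) by (unfold tilt_poly2; field).
rewrite E. clear E.
mono 1%nat 2%nat 0%nat v z. mono 3%nat 2%nat 1%nat v z. mono 0%nat 3%nat 0%nat v z. mono 2%nat 3%nat 1%nat v z.
mono 4%nat 3%nat 2%nat v z. mono 1%nat 4%nat 1%nat v z. mono 3%nat 4%nat 2%nat v z. mono 2%nat 5%nat 2%nat v z.
assert (0 <= PI * PI * v <= 9.9225 * 0.026) by nra.
assert (3.14 * 9.85 <= PI * (PI * PI) <= 3.15 * 9.9225) by nra.
assert (0 <= v ^ 6) by (apply pow_le; lra).
rewrite (Rmult_comm (-7.94)), (Rmult_comm (-6.4)).
split; apply Rmult_le_compat_l; auto; lra.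
Qed.

(** Same scaling: the leading coefficient 3 pi^4 / 16 exceeds 18, and the correction -75/8 pi^3 v
    accounts for most of the drop to 10.1. *)
Lemma tilt_poly4_lower v z : 0 <= v <= 0.026 -> Rabs z <= 1.6 -> 10.1 * v ^ 9 <= tilt_poly4 v (z * v ^ 3).
Proof.
intros Hv Hz. generalize PI_lt_315 PI_gt_314 PI_sq_bounds; intros P1 P2 P3.
assert (E : tilt_poly4 v (z * v ^ 3) = v ^ 9 * (3/16 * (PI * PI * (PI * PI)) - 75/8 * (PI ^ 3 * v ^ 1 * z ^ 0)
 + 1575/16 * (PI * PI * (v * v)) + 3 * (PI ^ 4 * v ^ 2 * z ^ 1)
 - 6615/16 * (PI ^ 1 * v ^ 3 * z ^ 0) - 75/2 * (PI ^ 3 * v ^ 3 * z ^ 1) - 3/8 * (PI ^ 5 * v ^ 3 * z ^ 2)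
 + 10395/16 * (PI ^ 0 * v ^ 4 * z ^ 0) + 315/2 * (PI ^ 2 * v ^ 4 * z ^ 1) + 27/4 * (PI ^ 4 * v ^ 4 * z ^ 2)
 - 945/4 * (PI ^ 1 * v ^ 5 * z ^ 1) - 225/8 * (PI ^ 3 * v ^ 5 * z ^ 2) - 3/4 * (PI ^ 5 * v ^ 5 * z ^ 3)
 + 315/8 * (PI ^ 2 * v ^ 6 * z ^ 2) + 3 * (PI ^ 4 * v ^ 6 * z ^ 3) + 1/16 * (PI ^ 6 * v ^ 6 * z ^ 4)
 - 15/4 * (PI ^ 3 * v ^ 7 * z ^ 3) - 3/16 * (PI ^ 5 * v ^ 7 * z ^ 4) + 3/16 * (PI ^ 4 * v ^ 8 * z ^ 4))) by (unfold tilt_poly4; field).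
rewrite E. clear E.
mono 3%nat 1%nat 0%nat v z. mono 4%nat 2%nat 1%nat v z. mono 1%nat 3%nat 0%nat v z. mono 3%nat 3%nat 1%nat v z.
mono 5%nat 3%nat 2%nat v z. mono 0%nat 4%nat 0%nat v z. mono 2%nat 4%nat 1%nat v z. mono 4%nat 4%nat 2%nat v z.
mono 1%nat 5%nat 1%nat v z. mono 3%nat 5%nat 2%nat v z. mono 5%nat 5%nat 3%nat v z. mono 2%nat 6%nat 2%nat v z.
mono 4%nat 6%nat 3%nat v z. mono 6%nat 6%nat 4%nat v z. mono 3%nat 7%nat 3%nat v z. mono 5%nat 7%nat 4%nat v z.
mono 4%nat 8%nat 4%nat v z.
assert (0 <= PI * PI * (v * v)) by nra.
assert (9.85 * 9.85 <= PI * PI * (PI * PI)) by nra.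
assert (0 <= v ^ 9) by (apply pow_le; lra).
rewrite (Rmult_comm 10.1). apply Rmult_le_compat_l; auto; lra.
Qed.


(** * The tilted main term near x0 *)

Section Tilt.

Variable x0 : R.
Hypothesis x0_large : 1502 <= x0.

Let s0 := sqrt x0.
Let v0 := / s0.
(** The slope of pi sqrt x at x0, so that [tilt_exponent] is stationary there: it equals -(pi/2) v0
    (sqrt x - s0)^2. *)
Let r := PI / 2 * v0.

Lemma s0_large : 38.75 <= s0 /\ s0 * s0 = x0.
Proof.
assert (E : s0 * s0 = x0) by (apply sqrt_sqrt; lra). split; auto.
assert (0 <= s0) by apply sqrt_pos. nra.
Qed.

Lemma v0_bounds : 0 < v0 <= 0.0259 /\ v0 * s0 = 1.
Proof.
destruct s0_large. assert (E : v0 * s0 = 1) by (unfold v0; field; lra). split; auto.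
assert (0 < v0) by (apply Rinv_0_lt_compat; lra). split; nra.
Qed.

(** With s = sqrt x, v - v0 = (x0 - x) v^3 s^2 / (s0 (s + s0)), and the quotient s^2 / (s0 (s + s0))
    is close to 1/2, so 3 * 0.52 < 1.6 bounds z. The window holds all points x0 + k + u with |k| <=
    2 and 0 <= u <= 1. *)
Lemma near_v0 x : x0 - 2 <= x <= x0 + 3 -> let v := / sqrt x in
  0.998 * v0 <= v <= 1.001 * v0 /\ 0 <= v <= 0.026 /\ exists z, Rabs z <= 1.6 /\ v - v0 = z * v ^ 3.
Proof.
intros Hx v. destruct s0_large as [S1 S2]. destruct v0_bounds as [[V1 V2] V3].
set (s := sqrt x) in *.
assert (E : s * s = x) by (apply sqrt_sqrt; lra).
assert (Ps : 0 < s) by (apply sqrt_lt_R0; lra).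
assert (Ev : v * s = 1) by (unfold v; field; lra).
assert (Pv : 0 < v) by (apply Rinv_0_lt_compat; lra).
assert (A1 : s0 <= 1.001 * s) by nra.
assert (A2 : 0.998 * s <= s0) by nra.
assert (B1 : v <= 1.001 * v0).
{ apply Rmult_le_reg_r with (s * s0); [nra|]. replace (v * (s * s0)) with (v * s * s0) by ring.
  replace (1.001 * v0 * (s * s0)) with (1.001 * (v0 * s0) * s) by ring. rewrite Ev, V3. lra. }
assert (B2 : 0.998 * v0 <= v).
{ apply Rmult_le_reg_r with (s * s0); [nra|]. replace (v * (s * s0)) with (v * s * s0) by ring.
  replace (0.998 * v0 * (s * s0)) with (0.998 * (v0 * s0) * s) by ring. rewrite Ev, V3. lra. }
split; [lra|]. split; [lra|].
exists ((v - v0) / v ^ 3). split; [|field; lra].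
replace ((v - v0) / v ^ 3) with ((x0 - x) * (s * s * / (s0 * (s + s0)))).
- rewrite Rabs_mult. rewrite (Rabs_pos_eq (s * s * _)).
  + assert (Rabs (x0 - x) <= 3) by (apply Rabs_le; lra). assert (0 <= Rabs (x0 - x)) by apply Rabs_pos.
    assert (s * s * / (s0 * (s + s0)) <= 0.52).
    { apply Rmult_le_reg_r with (s0 * (s + s0)); [nra|]. rewrite Rmult_assoc, Rinv_l by nra.
      nra. }
    assert (0 <= s * s * / (s0 * (s + s0))) by (apply Rmult_le_pos; [nra|left; apply Rinv_0_lt_compat; nra]).
    nra.
  + apply Rmult_le_pos; [nra|left; apply Rinv_0_lt_compat; nra].
- rewrite <- S2, <- E. unfold v, v0. field. lra.
Qed.

Let tilt_exponent x := PI * (sqrt x - s0) - r * (x - x0).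

Lemma exp_tilt_exponent_bounds x : x0 - 2 <= x <= x0 + 3 -> 0.999 <= exp (tilt_exponent x) <= 1.
Proof.
intros Hx. destruct s0_large as [S1 S2]. destruct v0_bounds as [[V1 V2] V3].
set (s := sqrt x) in *.
assert (E : s * s = x) by (apply sqrt_sqrt; lra).
assert (Ps : 0 < s) by (apply sqrt_lt_R0; lra).
assert (T : tilt_exponent x = - (PI / 2 * v0 * ((s - s0) * (s - s0)))).
{ unfold tilt_exponent, r. fold s. rewrite <- E, <- S2. replace (PI * (s - s0)) with (PI * (v0 * s0) * (s - s0)) by (rewrite V3; ring). field. }
assert (D : -0.08 <= s - s0 <= 0.08).
{ assert (38.5 <= s) by nra. split; nra. }
assert (SQ : 0 <= (s - s0) * (s - s0) <= 0.0064).
{ split; [apply Rle_0_sqr|]. assert (0 <= (0.08 - (s - s0)) * (0.08 + (s - s0))) by (apply Rmult_le_pos; lra). lra. }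
generalize PI_lt_315 PI_gt_3; intros.
assert (PV : 0 <= PI / 2 * v0 <= 0.05) by (split; nra).
assert (TB : -0.001 <= tilt_exponent x <= 0) by (rewrite T; split; nra).
split; [|rewrite <- exp_0; apply exp_le_mono; lra].
generalize (exp_ineq1_le (tilt_exponent x)); lra.
Qed.

Let tilt (P : R -> R -> R) x := exp (tilt_exponent x) * P (/ sqrt x) (/ sqrt x - v0).

Lemma tilt_derive (P P' : R -> R -> R) x d : 0 < x -> let v := / sqrt x in
  is_derive (fun v => P v (v - v0)) v d ->
  P' v (v - v0) = PI / 2 * (v - v0) * P v (v - v0) - v ^ 3 / 2 * d ->
  is_derive (tilt P) x (tilt P' x).
Proof.
intros Hx v H E. assert (Ps : 0 < sqrt x) by now apply sqrt_lt_R0.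
assert (D1 : is_derive (fun x => exp (tilt_exponent x)) x (exp (tilt_exponent x) * (PI / 2 * (v - v0)))).
{ unfold tilt_exponent, r. auto_derive; [auto|]. unfold v, Rminus. field. lra. }
assert (D2 : is_derive (fun x => / sqrt x) x (- (v ^ 3 / 2))).
{ auto_derive; [split; lra|]. unfold v. field. lra. }
assert (D3 := is_derive_compR (fun v => P v (v - v0)) (fun x => / sqrt x) x _ _ H D2).
assert (D4 := is_derive_multR _ _ _ _ _ D1 D3).
unfold tilt. fold v. rewrite E.
match type of D4 with is_derive _ _ ?l => match goal with |- is_derive _ _ ?m => replace m with l; [exact D4|] end end.
fold v. ring.
Qed.

Ltac derive_tilt := let H := fresh in intros H; unfold tilt_poly0, tilt_poly1, tilt_poly2, tilt_poly3, tilt_poly4; eapply tilt_derive; [exact H|auto_derive; [auto|reflexivity]|cbv beta; field; apply Rgt_not_eq, sqrt_lt_R0; auto].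

Lemma tilt_derive0 x : 0 < x -> is_derive (tilt tilt_poly0) x (tilt tilt_poly1 x).
Proof. derive_tilt. Qed.
Lemma tilt_derive1 x : 0 < x -> is_derive (tilt tilt_poly1) x (tilt tilt_poly2 x).
Proof. derive_tilt. Qed.
Lemma tilt_derive2 x : 0 < x -> is_derive (tilt tilt_poly2) x (tilt tilt_poly3 x).
Proof. derive_tilt. Qed.
Lemma tilt_derive3 x : 0 < x -> is_derive (tilt tilt_poly3) x (tilt tilt_poly4 x).
Proof. derive_tilt. Qed.

(** [fmain (sqrt x)] multiplied by 8 e^(-pi s0), which clears denominators and normalises the
    exponential at x0. *)
Let scaled_main x := 2 * exp (PI * (sqrt x - s0)) * (PI * (/ sqrt x) ^ 2 - (/ sqrt x) ^ 3).
Let tilt0 := tilt tilt_poly0.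

Lemma scaled_main_derive x : 0 < x -> is_derive scaled_main x (exp (r * (x - x0)) * tilt0 x).
Proof.
intros Hx. assert (Ps : 0 < sqrt x) by now apply sqrt_lt_R0.
unfold tilt0, tilt. rewrite <- Rmult_assoc, <- exp_plus.
replace (r * (x - x0) + tilt_exponent x) with (PI * (sqrt x - s0)) by (unfold tilt_exponent; ring).
unfold scaled_main, tilt_poly0. auto_derive; [repeat split; lra|]. unfold Rminus. field. lra.
Qed.

Definition tilted_difference k := exp (- (r * k)) * (scaled_main (x0 + k + 1) - scaled_main (x0 + k)).
Let H := tilted_difference.

(** A tilted difference is the integral over 0 <= u <= 1 of e^(ru) [tilt0 (x0 + k + u)], so a linear
    functional of the five differences is an average of the same functional of [tilt0]. The mean
    value inequality replaces the integral, and lower bounds follow by negating the coefficients. *)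
Lemma tilted_functional_upper a b c d e M :
  (forall u, 0 <= u <= 1 -> exp (r * u) *
    (a * tilt0 (x0 - 2 + u) + b * tilt0 (x0 - 1 + u) + c * tilt0 (x0 + 0 + u) + d * tilt0 (x0 + 1 + u) + e * tilt0 (x0 + 2 + u)) <= M) ->
  a * H (Ropp 2) + b * H (Ropp 1) + c * H 0 + d * H 1 + e * H 2 <= M.
Proof.
intros B.
pose (g := fun k u => exp (- (r * k)) * scaled_main (u + (x0 + k))).
assert (Dg : forall k u, -2 <= k -> 0 <= u -> is_derive (g k) u (exp (r * u) * tilt0 (x0 + k + u))).
{ intros k u Hk Hu. unfold g.
  replace (exp (r * u) * tilt0 (x0 + k + u)) with (exp (- (r * k)) * (exp (r * (u + (x0 + k) - x0)) * tilt0 (u + (x0 + k)))).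
  - apply is_derive_scal. apply (is_derive_shift scaled_main (fun x => exp (r * (x - x0)) * tilt0 x)).
    apply scaled_main_derive. lra.
  - rewrite <- Rmult_assoc, <- exp_plus. replace (- (r * k) + r * (u + (x0 + k) - x0)) with (r * u) by ring.
    f_equal. f_equal. ring. }
assert (X := is_derive_bound (fun u => a * g (Ropp 2) u + b * g (Ropp 1) u + c * g 0 u + d * g 1 u + e * g 2 u) 0 1 M
 (fun u => a * (exp (r * u) * tilt0 (x0 + Ropp 2 + u)) + b * (exp (r * u) * tilt0 (x0 + Ropp 1 + u)) + c * (exp (r * u) * tilt0 (x0 + 0 + u))
   + d * (exp (r * u) * tilt0 (x0 + 1 + u)) + e * (exp (r * u) * tilt0 (x0 + 2 + u))) ltac:(lra)).
cbv beta in X. rewrite Rminus_0_r, Rmult_1_r in X.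
assert (S : forall k, H k = g k 1 - g k 0).
{ intros k. unfold H, tilted_difference, g. replace (1 + (x0 + k)) with (x0 + k + 1) by ring. rewrite Rplus_0_l. ring. }
rewrite !S.
match type of X with _ -> _ -> ?l <= _ => replace (a * _ + _ + _ + _ + _) with l by ring end.
apply X.
- intros u Hu.
  repeat match goal with |- is_derive (fun u => @?f u + @?h u) _ _ => apply (is_derive_plus (V := R_NormedModule) f h) end;
   apply is_derive_scal; apply Dg; lra.
- intros u Hu. apply Rle_trans with (2 := B u Hu). right. unfold Rminus. ring.
Qed.

Lemma exp_ru_bounds u : 0 <= u <= 1 -> 1 <= exp (r * u) <= 1.045.
Proof.
intros Hu. destruct v0_bounds as [[V1 V2] V3]. generalize PI_lt_315 PI_gt_3; intros.
assert (R1 : 0 <= r <= 0.042) by (unfold r; split; nra).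
assert (R2 : 0 <= r * u <= 0.042) by nra.
split; [rewrite <- exp_0; apply exp_le_mono; lra|].
apply Rle_trans with (/ (1 - 0.042)); [|lra].
rewrite <- (Ropp_involutive (r * u)), exp_Ropp. apply Rinv_le_contravar; [lra|].
generalize (exp_ineq1_le (- (r * u))); lra.
Qed.

Lemma tilt_bounds x : x0 - 2 <= x <= x0 + 3 ->
  9.5 * v0 ^ 3 <= tilt0 x /\ -7.99 * v0 ^ 6 <= tilt tilt_poly2 x <= -6 * v0 ^ 6 /\ 9.9 * v0 ^ 9 <= tilt tilt_poly4 x.
Proof.
intros Hx. destruct v0_bounds as [[V1 V2] V3]. destruct (near_v0 x Hx) as ([W1 W2] & W & z & Hz & Ez).
assert (T := exp_tilt_exponent_bounds x Hx). unfold tilt0, tilt. set (v := / sqrt x) in *. set (E := exp (tilt_exponent x)) in *.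
assert (P0 := tilt_poly0_lower v (v - v0) W). rewrite Ez in *.
assert (P2 := tilt_poly2_bounds v z W Hz). assert (P4 := tilt_poly4_lower v z W Hz).
assert (L : forall n, 0.998 ^ n * v0 ^ n <= v ^ n <= 1.001 ^ n * v0 ^ n).
{ intros n. rewrite <- !Rpow_mult_distr. split; apply pow_incr; lra. }
assert (N : forall n, 0 < v0 ^ n) by (intros; apply pow_lt; lra).
assert (L3 := L 3%nat). assert (L6 := L 6%nat). assert (L9 := L 9%nat).
assert (N3 := N 3%nat). assert (N6 := N 6%nat). assert (N9 := N 9%nat).
assert (C3 : 0.994 * v0 ^ 3 <= v ^ 3).
{ apply Rle_trans with (2 := proj1 L3). apply Rmult_le_compat_r; lra. }
assert (C6 : 0.988 * v0 ^ 6 <= v ^ 6 <= 1.00602 * v0 ^ 6).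
{ split; [apply Rle_trans with (2 := proj1 L6)|apply Rle_trans with (1 := proj2 L6)]; apply Rmult_le_compat_r; lra. }
assert (C9 : 0.9821 * v0 ^ 9 <= v ^ 9).
{ apply Rle_trans with (2 := proj1 L9). apply Rmult_le_compat_r; lra. }
set (y3 := v0 ^ 3) in *. set (y6 := v0 ^ 6) in *. set (y9 := v0 ^ 9) in *.
repeat split.
- assert (9.54 * y3 <= tilt_poly0 v (z * v ^ 3)) by lra. nra.
- assert (-7.99 * y6 <= tilt_poly2 v (z * v ^ 3) <= 0) by lra. nra.
- assert (tilt_poly2 v (z * v ^ 3) <= -6.3 * y6) by lra. nra.
- assert (9.919 * y9 <= tilt_poly4 v (z * v ^ 3)) by lra. nra.
Qed.

Theorem tilted_difference_bounds :
  9.5 * v0 ^ 3 <= H 0 /\ 9.9 * v0 ^ 9 <= H 2 - 4 * H 1 + 6 * H 0 - 4 * H (Ropp 1) + H (Ropp 2) /\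
  Rabs (H 1 - 2 * H 0 + H (Ropp 1)) <= 8.35 * v0 ^ 6 /\ H 2 - 2 * H 0 + H (Ropp 2) <= -20 * v0 ^ 6.
Proof.
destruct v0_bounds as [[V1 V2] V3].
assert (N : forall n, 0 < v0 ^ n) by (intros; apply pow_lt; lra).
assert (N3 := N 3%nat). assert (N6 := N 6%nat). assert (N9 := N 9%nat).
set (q2 := tilt tilt_poly2).
assert (D2 : forall h y m, 0 <= h -> x0 <= y <= x0 + 1 -> h <= 2 -> (forall x, x0 - 2 <= x <= x0 + 3 -> m <= q2 x) ->
  m * (h * h) <= tilt0 (y + h) - 2 * tilt0 y + tilt0 (y - h)).
{ intros h y m Hh Hy H2 B. apply (second_difference tilt0 (tilt tilt_poly1) q2); auto; intros x Hx.
  - apply tilt_derive0; lra.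
  - apply tilt_derive1; lra.
  - apply B. lra. }
assert (D2' : forall h y m, 0 <= h -> x0 <= y <= x0 + 1 -> h <= 2 -> (forall x, x0 - 2 <= x <= x0 + 3 -> q2 x <= m) ->
  tilt0 (y + h) - 2 * tilt0 y + tilt0 (y - h) <= m * (h * h)).
{ intros h y m Hh Hy H2 B.
  assert (X := second_difference (fun x => - tilt0 x) (fun x => - tilt tilt_poly1 x) (fun x => - q2 x) y h (- m) Hh).
  assert (- m * (h * h) <= - tilt0 (y + h) - 2 * - tilt0 y + - tilt0 (y - h)); [|lra].
  apply X; intros x Hx.
  - apply (is_derive_opp (V := R_NormedModule)), tilt_derive0; lra.
  - apply (is_derive_opp (V := R_NormedModule)), tilt_derive1; lra.
  - generalize (B x ltac:(lra)); lra. }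
assert (BQ := fun x Hx => proj1 (proj2 (tilt_bounds x Hx))).
repeat split.
- assert (X := tilted_functional_upper 0 0 (Ropp 1) 0 0 (- (9.5 * v0 ^ 3))).
  assert (Y : 0 * H (Ropp 2) + 0 * H (Ropp 1) + Ropp 1 * H 0 + 0 * H 1 + 0 * H 2 <= - (9.5 * v0 ^ 3)); [apply X|lra].
  intros u Hu. destruct (exp_ru_bounds u Hu). generalize (proj1 (tilt_bounds (x0 + 0 + u) ltac:(lra))). intros. nra.
- assert (X := tilted_functional_upper (Ropp 1) 4 (Ropp 6) 4 (Ropp 1) (- (9.9 * v0 ^ 9))).
  assert (Y : Ropp 1 * H (Ropp 2) + 4 * H (Ropp 1) + Ropp 6 * H 0 + 4 * H 1 + Ropp 1 * H 2 <= - (9.9 * v0 ^ 9)); [apply X|lra].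
  intros u Hu. destruct (exp_ru_bounds u Hu) as [E1 E2].
  assert (Z := fourth_difference tilt0 (tilt tilt_poly1) q2 (tilt tilt_poly3) (tilt tilt_poly4) (x0 + 0 + u) (9.9 * v0 ^ 9)).
  replace (x0 + 0 + u + 2) with (x0 + 2 + u) in Z by ring. replace (x0 + 0 + u + 1) with (x0 + 1 + u) in Z by ring.
  replace (x0 + 0 + u - 2) with (x0 - 2 + u) in Z by ring. replace (x0 + 0 + u - 1) with (x0 - 1 + u) in Z by ring.
  assert (9.9 * v0 ^ 9 <= tilt0 (x0 + 2 + u) - 4 * tilt0 (x0 + 1 + u) + 6 * tilt0 (x0 + 0 + u) - 4 * tilt0 (x0 - 1 + u) + tilt0 (x0 - 2 + u)).
  { apply Z. intros y Hy. assert (Py : 0 < y) by lra. 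
    refine (conj (tilt_derive0 y Py) (conj (tilt_derive1 y Py) (conj (tilt_derive2 y Py) (conj (tilt_derive3 y Py) _)))).
    apply tilt_bounds; lra. }
  nra.
- apply Rabs_le. split.
  + assert (X := tilted_functional_upper 0 (Ropp 1) 2 (Ropp 1) 0 (8.35 * v0 ^ 6)).
    assert (Y : 0 * H (Ropp 2) + Ropp 1 * H (Ropp 1) + 2 * H 0 + Ropp 1 * H 1 + 0 * H 2 <= 8.35 * v0 ^ 6); [apply X|lra].
    intros u Hu. destruct (exp_ru_bounds u Hu) as [E1 E2].
    assert (Z := D2 1 (x0 + u) (-7.99 * v0 ^ 6) ltac:(lra) ltac:(lra) ltac:(lra) (fun x Hx => proj1 (BQ x Hx))).
    replace (x0 + u + 1) with (x0 + 1 + u) in Z by ring. replace (x0 + u - 1) with (x0 - 1 + u) in Z by ring.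
    rewrite Rplus_0_r. nra.
  + assert (X := tilted_functional_upper 0 1 (Ropp 2) 1 0 (8.35 * v0 ^ 6)).
    assert (Y : 0 * H (Ropp 2) + 1 * H (Ropp 1) + Ropp 2 * H 0 + 1 * H 1 + 0 * H 2 <= 8.35 * v0 ^ 6); [apply X|lra].
    intros u Hu. destruct (exp_ru_bounds u Hu) as [E1 E2].
    assert (Z := D2' 1 (x0 + u) (-6 * v0 ^ 6) ltac:(lra) ltac:(lra) ltac:(lra) (fun x Hx => proj2 (BQ x Hx))).
    replace (x0 + u + 1) with (x0 + 1 + u) in Z by ring. replace (x0 + u - 1) with (x0 - 1 + u) in Z by ring.
    rewrite Rplus_0_r. nra.
- assert (X := tilted_functional_upper 1 0 (Ropp 2) 0 1 (-20 * v0 ^ 6)).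
  assert (Y : 1 * H (Ropp 2) + 0 * H (Ropp 1) + Ropp 2 * H 0 + 0 * H 1 + 1 * H 2 <= -20 * v0 ^ 6); [apply X|lra].
  intros u Hu. destruct (exp_ru_bounds u Hu) as [E1 E2].
  assert (Z := D2' 2 (x0 + u) (-6 * v0 ^ 6) ltac:(lra) ltac:(lra) ltac:(lra) (fun x Hx => proj2 (BQ x Hx))).
  replace (x0 + u + 2) with (x0 + 2 + u) in Z by ring. replace (x0 + u - 2) with (x0 - 2 + u) in Z by ring.
  rewrite Rplus_0_r. nra.
Qed.

End Tilt.


(** * Positivity of the determinant for large arguments *)

Lemma exp_dominates_ninth s : 38.75 <= s -> 41500 * s ^ 9 <= exp (1.1846 * s).
Proof.
intros Hs.
(* At s = 38.75 the exponent 1.1846 s exceeds 45, and beyond it s^9 grows more slowly than e^(s -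
   38.75). The factor 41500 is at least 17.5 * 237 / 0.1, as the tolerance in
   [toeplitz3_differences_pos] requires. *)
assert (E1 : 2.69 <= exp 1).
{ replace 1 with (INR 64 * (1/64)) by (rewrite INR_IZR_INZ; simpl; field). rewrite <- (exp_pow (1/64) 64).
  apply Rle_trans with ((65/64) ^ 64); [lra|]. apply pow_incr. generalize (exp_ineq1_le (1/64)). lra. }
assert (E45 : 2.69 ^ 45 <= exp 45).
{ replace 45 with (INR 45 * 1) by (rewrite INR_IZR_INZ; simpl; ring). rewrite <- exp_pow. apply pow_incr; lra. }
set (u := s - 38.75).
assert (S : s ^ 9 <= 38.75 ^ 9 * exp u).
{ replace s with (38.75 * (1 + u / 38.75)) by (unfold u; lra). rewrite Rpow_mult_distr.
  apply Rmult_le_compat_l; [lra|].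
  apply Rle_trans with (exp (u / 38.75) ^ 9).
  - apply pow_incr. split; [unfold u, Rdiv; nra|apply exp_ineq1_le].
  - rewrite exp_pow. apply exp_le_mono. rewrite INR_IZR_INZ; simpl. unfold u. lra. }
apply Rle_trans with (2.69 ^ 45 * exp u).
- apply Rle_trans with (41500 * (38.75 ^ 9 * exp u)); [lra|]. rewrite <- Rmult_assoc. apply Rmult_le_compat_r; [left; apply exp_pos|lra].
- apply Rle_trans with (exp 45 * exp u); [apply Rmult_le_compat_r; [left; apply exp_pos|auto]|].
  rewrite <- exp_plus. apply exp_le_mono. unfold u. lra.
Qed.

(** With y = s0^(-3) the four bounds become powers of y. Errors of 0.1 y^3 in the entries move the
    fourth difference by at most 16 * 0.1 y^3, which leaves 8.3 y^3, and 8.36^2 < 9.49 * 8.3. *)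
Lemma toeplitz3_pos_approx y a b c d e a' b' c' d' e' : 0 < y <= 0.00002 ->
  9.5 * y <= c -> 9.9 * y ^ 3 <= e - 4 * d + 6 * c - 4 * b + a ->
  Rabs (d - 2 * c + b) <= 8.35 * y ^ 2 -> e - 2 * c + a <= -20 * y ^ 2 ->
  Rabs (a' - a) <= 0.1 * y ^ 3 -> Rabs (b' - b) <= 0.1 * y ^ 3 -> Rabs (c' - c) <= 0.1 * y ^ 3 ->
  Rabs (d' - d) <= 0.1 * y ^ 3 -> Rabs (e' - e) <= 0.1 * y ^ 3 -> 0 < toeplitz3 a' b' c' d' e'.
Proof.
intros Hy H1 H2 H3 H4 Ha Hb Hc Hd He.
apply Rabs_le_between in H3, Ha, Hb, Hc, Hd, He.
assert (Y2 : y ^ 2 <= 0.00002 * y) by (simpl; nra).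
assert (P2 : 0 < y ^ 2) by (apply pow_lt; lra).
assert (Y3 : y ^ 3 <= 0.00002 * y ^ 2) by (change (y ^ 3) with (y * y ^ 2); nra).
assert (P3 : 0 < y ^ 3) by (apply pow_lt; lra).
apply toeplitz3_pos; [lra|lra|].
set (s := d' - 2 * c' + b').
assert (B1 : - (8.36 * y ^ 2) <= s <= 8.36 * y ^ 2) by (unfold s; lra).
assert (B2 : 8.3 * y ^ 3 <= e' - 2 * c' + a' - 4 * s) by (unfold s; lra).
assert (B3 : 9.49 * y <= c') by lra.
assert (B4 : s * s <= 8.36 * y ^ 2 * (8.36 * y ^ 2)) by nra.
assert (B5 : 9.49 * y * (8.3 * y ^ 3) <= c' * (e' - 2 * c' + a' - 4 * s)) by (apply Rmult_le_compat; lra).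
apply Rle_lt_trans with (1 := B4). apply Rlt_le_trans with (2 := B5).
replace (8.36 * y ^ 2 * (8.36 * y ^ 2)) with (8.36 * 8.36 * (y * y ^ 3)) by ring.
replace (9.49 * y * (8.3 * y ^ 3)) with (9.49 * 8.3 * (y * y ^ 3)) by ring.
apply Rmult_lt_compat_r; [nra|lra].
Qed.

Section Asymptotics.

Variable c : nat -> nat -> R.
Hypothesis c_pos : forall k n, 0 <= c k n.
Hypothesis c_0 : forall n, c 0 n = if (n =? 0)%nat then 1 else 0.
Hypothesis c_S : forall k n, c (S k) n = c k n + (if (n <? S k)%nat then 0 else c k (n - S k)%nat + c (S k) (n - S k)%nat).

(** t = pi / (2 s0) is the saddle point, where x0 t + pi^2 / (4t) is least. Then e^(mt) uses half of
    the exponent pi s0 and the arcs use 0.605 / t <= 0.605 * 0.637 s0, so 1.57 - 0.3854 leaves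
    1.1846. The factor 237 covers 2 + 205 * 1.145, where 1.145 bounds e^(3/24), the cost of m <= x0
    + 3. *)
Lemma coefficient_fmain n M : (1500 <= n)%nat -> let x0 := INR n + 2 in let s0 := sqrt x0 in
  exists K kp, (M <= K)%nat /\ 0 < kp /\ forall m, (1 <= m <= n + 5)%nat ->
   exp (- (PI * s0)) * Rabs (/ kp * c K m - fmain (sqrt (INR m))) <= 237 * exp (- (1.1846 * s0)).
Proof.
intros Hn x0 s0.
assert (HX : 1502 <= x0).
{ unfold x0. apply le_INR in Hn. replace (INR 1500) with 1500 in Hn by (rewrite INR_IZR_INZ; reflexivity). lra. }
destruct (s0_large x0 HX) as [S1 S2]. destruct (v0_bounds x0 HX) as [[V1 V2] V3]. fold s0 in S1, S2, V1, V2, V3.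
generalize PI_lt_315 PI_gt_314; intros P1 P2.
set (t := PI / 2 * / s0).
assert (Ht : 0 < t <= 1/24) by (unfold t; split; nra).
destruct (coefficient_bound c c_pos c_0 c_S t M Ht) as (K & kp & HK & Hkp & B).
exists K, kp. split; auto. split; [lra|].
intros m Hm. specialize (B m). assert (F := main_coeff_fmain m ltac:(lia)).
assert (T : Rabs (/ kp * c K m - fmain (sqrt (INR m))) <= 2 + exp (INR m * t) * (205 * exp (0.605 * / t))).
{ replace (/ kp * c K m - fmain (sqrt (INR m))) with ((/ kp * c K m - main_coeff m) + (main_coeff m - fmain (sqrt (INR m)))) by ring.
  apply Rle_trans with (1 := Rabs_triang _ _). lra. }
apply Rle_trans with (1 := Rmult_le_compat_l _ _ _ (Rlt_le _ _ (exp_pos _)) T).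
rewrite Rmult_plus_distr_l.
replace (exp (- (PI * s0)) * (exp (INR m * t) * (205 * exp (0.605 * / t)))) with
  (205 * exp (- (PI * s0) + INR m * t + 0.605 * / t)) by (rewrite !exp_plus; ring).
assert (It : / t <= 0.637 * s0).
{ unfold t. rewrite Rinv_mult, Rinv_inv. apply Rmult_le_compat_r; [lra|].
  rewrite Rinv_div. apply Rmult_le_reg_r with PI; [lra|]. unfold Rdiv. rewrite Rmult_assoc, Rinv_l by lra. lra. }
assert (Em : INR m * t <= PI / 2 * s0 + 0.125).
{ assert (M1 : INR m <= x0 + 3).
  { unfold x0. destruct Hm as [_ Hm]. apply le_INR in Hm. rewrite plus_INR in Hm.
    replace (INR 5) with 5 in Hm by (rewrite INR_IZR_INZ; reflexivity). lra. }
  apply Rle_trans with ((x0 + 3) * t); [apply Rmult_le_compat_r; lra|].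
  rewrite <- S2. unfold t at 1. replace ((s0 * s0 + 3) * (PI / 2 * / s0)) with (PI / 2 * s0 * (/ s0 * s0) + 3 * t) by (unfold t; ring).
  rewrite V3. lra. }
assert (X : exp (- (PI * s0) + INR m * t + 0.605 * / t) <= 1.145 * exp (- (1.1846 * s0))).
{ apply Rle_trans with (exp (0.125 + - (1.1846 * s0))).
  - apply exp_le_mono. assert (3.14 * s0 <= PI * s0) by (apply Rmult_le_compat_r; lra). lra.
  - rewrite exp_plus. apply Rmult_le_compat_r; [left; apply exp_pos|].
    rewrite <- (Ropp_involutive 0.125), exp_Ropp. apply Rle_trans with (/ (1 - 0.125)); [|lra].
    apply Rinv_le_contravar; [lra|]. generalize (exp_ineq1_le (Ropp 0.125)). lra. }
assert (Y : exp (- (PI * s0)) <= exp (- (1.1846 * s0))) by (apply exp_le_mono; nra).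
generalize (exp_pos (- (1.1846 * s0))). lra.
Qed.

Theorem toeplitz3_differences_pos n M : (1500 <= n)%nat -> exists K, (M <= K)%nat /\
  let d m := c K (m + 1)%nat - c K m in 0 < toeplitz3 (d n) (d (n + 1)%nat) (d (n + 2)%nat) (d (n + 3)%nat) (d (n + 4)%nat).
Proof.
intros Hn. destruct (coefficient_fmain n M Hn) as (K & kp & HK & Hkp & B).
exists K. split; auto. intros d.
set (x0 := INR n + 2) in *. set (s0 := sqrt x0) in *.
assert (HX : 1502 <= x0).
{ unfold x0. apply le_INR in Hn. replace (INR 1500) with 1500 in Hn by (rewrite INR_IZR_INZ; reflexivity). lra. }
destruct (s0_large x0 HX) as [S1 S2]. destruct (v0_bounds x0 HX) as [[V1 V2] V3]. fold s0 in S1, S2, V1, V2, V3.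
destruct (tilted_difference_bounds x0 HX) as (D0 & D4 & D1 & D2). fold s0 in D0, D4, D1, D2.
generalize PI_lt_315 PI_gt_314; intros P1 P2.
set (t := PI / 2 * / s0) in *.
(* The common scale between differences of counts and differences of [scaled_main]. *)
set (l := kp * exp (PI * s0) / 8).
assert (Pl : 0 < l) by (unfold l; assert (X := Rmult_lt_0_compat _ _ Hkp (exp_pos (PI * s0))); lra).
set (eta := 0.1 * (/ s0 ^ 3) ^ 3).
(* 17.5 covers 8 * 1.09 * 2: the scaling, the tilt e^(-tk) for k >= -2, and two coefficients in each
   difference. *)
assert (Heta : 17.5 * (237 * exp (- (1.1846 * s0))) <= eta).
{ unfold eta. rewrite pow_inv, <- pow_mult. simpl (3 * 3)%nat.
  assert (X := exp_dominates_ninth s0 S1). rewrite exp_Ropp.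
  assert (Y : / exp (1.1846 * s0) <= / (41500 * s0 ^ 9)) by (apply Rinv_le_contravar; auto; generalize (pow_lt s0 9 ltac:(lra)); lra).
  rewrite Rinv_mult in Y. assert (0 < / s0 ^ 9) by (apply Rinv_0_lt_compat, pow_lt; lra). lra. }
assert (A : forall j k, (j <= 4)%nat -> k = INR j - 2 ->
  Rabs (/ l * exp (- (t * k)) * d (n + j)%nat - tilted_difference x0 k) <= eta).
{ intros j k Hj Hk.
  assert (J : 0 <= INR j <= 4).
  { split; [apply pos_INR|]. apply le_INR in Hj. now replace (INR 4) with 4 in Hj by (rewrite INR_IZR_INZ; reflexivity). }
  assert (E1 : INR (n + j) = x0 + k) by (rewrite plus_INR; unfold x0; lra).
  assert (E2 : INR (n + j + 1) = x0 + k + 1) by (rewrite plus_INR, E1; simpl; ring).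
  assert (B1 := B (n + j)%nat ltac:(lia)). assert (B2 := B (n + j + 1)%nat ltac:(lia)).
  rewrite E1 in B1. rewrite E2 in B2.
  replace (/ l * exp (- (t * k)) * d (n + j)%nat - tilted_difference x0 k) with
   (8 * exp (- (t * k)) * (exp (- (PI * s0)) * ((/ kp * c K (n + j + 1)%nat - fmain (sqrt (x0 + k + 1)))
      - (/ kp * c K (n + j)%nat - fmain (sqrt (x0 + k)))))).
  - assert (X : exp (- (t * k)) <= 1.09).
    { assert (T1 : 0 < t <= 0.0408) by (unfold t; split; nra).
      apply Rle_trans with (exp 0.0816); [apply exp_le_mono; assert (0 <= t * (k + 2)) by (apply Rmult_le_pos; lra); lra|].
      rewrite <- (Ropp_involutive 0.0816), exp_Ropp. apply Rle_trans with (/ (1 - 0.0816)); [|lra].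
      apply Rinv_le_contravar; [lra|]. generalize (exp_ineq1_le (Ropp 0.0816)). lra. }
    rewrite !Rabs_mult, (Rabs_pos_eq 8), (Rabs_pos_eq (exp _)), (Rabs_pos_eq (exp (- (PI * s0)))) by (try (left; apply exp_pos); lra).
    apply Rle_trans with (2 := Heta).
    assert (Z : exp (- (PI * s0)) * Rabs ((/ kp * c K (n + j + 1)%nat - fmain (sqrt (x0 + k + 1)))
      - (/ kp * c K (n + j)%nat - fmain (sqrt (x0 + k)))) <= 2 * (237 * exp (- (1.1846 * s0)))).
    { match goal with |- _ * Rabs (?a - ?b) <= _ => set (u1 := a) in *; set (u2 := b) in * end.
      assert (W := Rabs_triang u1 (- u2)). rewrite Rabs_Ropp in W.
      apply Rle_trans with (exp (- (PI * s0)) * (Rabs u1 + Rabs u2)); [|lra].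
      apply Rmult_le_compat_l; [left; apply exp_pos|exact W]. }
    generalize (exp_pos (- (t * k))) (exp_pos (- (1.1846 * s0))); intros.
    apply Rle_trans with (8 * 1.09 * (2 * (237 * exp (- (1.1846 * s0))))); [|lra].
    apply Rmult_le_compat; try lra. apply Rmult_le_pos; [left; apply exp_pos|apply Rabs_pos].
  - assert (F : forall x, x0 - 2 <= x -> 8 * exp (- (PI * s0)) * fmain (sqrt x) = 2 * exp (PI * (sqrt x - s0)) * (PI * (/ sqrt x) ^ 2 - (/ sqrt x) ^ 3)).
    { intros x Hx. assert (0 < sqrt x) by (apply sqrt_lt_R0; lra). unfold fmain.
      replace (PI * (sqrt x - s0)) with (- (PI * s0) + PI * sqrt x) by ring. rewrite exp_plus. field. lra. }
    unfold tilted_difference. fold s0. fold t. rewrite <- !F by lra.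
    unfold d. unfold l. rewrite (exp_Ropp (PI * s0)). generalize (exp_pos (PI * s0)); intros. field. lra. }
set (rho := exp t).
assert (Hr : 0 < rho) by apply exp_pos.
set (h := fun j k => / l * exp (- (t * k)) * d (n + j)%nat) in A.
assert (G : 0 < toeplitz3 (h 0%nat (Ropp 2)) (h 1%nat (Ropp 1)) (h 2%nat 0) (h 3%nat 1) (h 4%nat 2)).
{ assert (Q : forall j, (/ s0) ^ (3 * j) = (/ s0 ^ 3) ^ j) by (intros j; rewrite pow_mult, pow_inv; reflexivity).
  rewrite (Q 1%nat : (/ s0) ^ 3 = _) in D0. rewrite (Q 3%nat : (/ s0) ^ 9 = _) in D4. rewrite (Q 2%nat : (/ s0) ^ 6 = _) in D1, D2.
  rewrite pow_1 in D0.
  apply (toeplitz3_pos_approx (/ s0 ^ 3) (tilted_difference x0 (Ropp 2)) (tilted_difference x0 (Ropp 1))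
    (tilted_difference x0 0) (tilted_difference x0 1) (tilted_difference x0 2)); auto.
  - split; [apply Rinv_0_lt_compat, pow_lt; lra|]. rewrite <- pow_inv.
    apply Rle_trans with (0.0259 ^ 3); [apply pow_incr; lra|lra].
  - apply A; [lia|simpl; ring].
  - apply A; [lia|simpl; ring].
  - apply A; [lia|simpl; ring].
  - apply A; [lia|simpl; ring].
  - apply A; [lia|simpl; ring]. }
assert (R0 : forall j, d (n + j)%nat = l * h j 0).
{ intros j. unfold h. rewrite Rmult_0_r, Ropp_0, exp_0. field. lra. }
assert (Z := toeplitz3_tilt (h 0%nat (Ropp 2)) (h 1%nat (Ropp 1)) (h 2%nat 0) (h 3%nat 1) (h 4%nat 2) l rho ltac:(lra)).
replace (l * (h 0%nat (Ropp 2) / (rho * rho))) with (d n) in Z.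
2:{ unfold h. rewrite Nat.add_0_r. replace (- (t * Ropp 2)) with (t + t) by ring. rewrite exp_plus. fold rho. field. lra. }
replace (l * (h 1%nat (Ropp 1) / rho)) with (d (n + 1)%nat) in Z.
2:{ unfold h. replace (- (t * Ropp 1)) with t by ring. fold rho. field. lra. }
rewrite <- R0 in Z.
replace (l * (h 3%nat 1 * rho)) with (d (n + 3)%nat) in Z.
2:{ unfold h. rewrite Rmult_1_r, exp_Ropp. fold rho. field. lra. }
replace (l * (h 4%nat 2 * (rho * rho))) with (d (n + 4)%nat) in Z.
2:{ unfold h. replace (- (t * 2)) with (- (t + t)) by ring. rewrite exp_Ropp, exp_plus. fold rho. field. lra. }
rewrite Z. clearbody l. repeat apply Rmult_lt_0_compat; auto.
Qed.

End Asymptotics.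

Close Scope C_scope.
Close Scope R_scope.
Open Scope Z_scope.

(** * Gauss's theta recurrence *)

Fixpoint alternating_sum (F : nat -> Z) (n : nat) : Z :=
  match n with O => 0 | S n' => alternating_sum F n' + (if Nat.even n then F n else - F n) end.

Lemma alternating_sum_ext F G n : (forall s, (1 <= s <= n)%nat -> F s = G s) -> alternating_sum F n = alternating_sum G n.
Proof. induction n; intros H; [easy|]. cbn [alternating_sum]. rewrite IHn by (intros; apply H; lia). rewrite (H (S n)) by lia. reflexivity. Qed.

Lemma alternating_sum_plus F G n : alternating_sum (fun s => F s + G s) n = alternating_sum F n + alternating_sum G n.
Proof. induction n; [easy|]. cbn [alternating_sum]. rewrite IHn. destruct (Nat.even _); ring. Qed.

Lemma alternating_sum_minus F G n : alternating_sum (fun s => F s - G s) n = alternating_sum F n - alternating_sum G n.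
Proof. induction n; [easy|]. cbn [alternating_sum]. rewrite IHn. destruct (Nat.even _); ring. Qed.

Lemma alternating_sum_0 F n : (forall s, (1 <= s <= n)%nat -> F s = 0) -> alternating_sum F n = 0.
Proof.
intros H. rewrite (alternating_sum_ext F (fun _ => 0)) by auto. clear.
induction n; [easy|]. cbn [alternating_sum]. rewrite IHn. destruct (Nat.even (S n)); reflexivity.
Qed.

Section Theta.

Variable f : nat -> Z -> Z.
Hypothesis f_neg : forall k i, i < 0 -> f k i = 0.
Hypothesis f_S : forall k i, f (S k) i = f k i + f k (i - Z.of_nat (S k)) + f (S k) (i - Z.of_nat (S k)).

(** Coefficients of q^i, with P_n the generating function of [f n]. [theta_product] belongs to P_n
    times 1 + 2 sum (-1)^s q^(s^2) over s = 1..n; [remainder] belongs to P_0 + sum (-1)^s q^(sx)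
    (P_s + P_(s-1)), and [shifted_remainder] has P_s - P_(s-1) instead. Their equality at x = n + 1
    is a finite form of Gauss's identity. *)
Let theta_product n i := f n i + 2 * alternating_sum (fun s => f n (i - Z.of_nat s * Z.of_nat s)) n.
Let remainder n x i := f 0 i + alternating_sum (fun s => f s (i - Z.of_nat s * x) + f (pred s) (i - Z.of_nat s * x)) n.
Let shifted_remainder n x i := f 0 i + alternating_sum (fun s => f s (i - Z.of_nat s * x) - f (pred s) (i - Z.of_nat s * x)) n.

(** Multiplying by q^s turns P_s + P_(s-1) into P_s - P_(s-1), which is [f_S]. *)
Lemma remainder_shift n x i : remainder n (x + 1) i = shifted_remainder n x i.
Proof.
unfold remainder, shifted_remainder. f_equal. apply alternating_sum_ext. intros s Hs.
destruct s as [|s]; [lia|]. simpl pred. rewrite (f_S s (i - Z.of_nat (S s) * x)).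
replace (i - Z.of_nat (S s) * x - Z.of_nat (S s)) with (i - Z.of_nat (S s) * (x + 1)) by ring. ring.
Qed.

(** In (1 - q^x) times the shifted sum minus (1 + q^x) times the plain one, the s-th summand is -2
    (-1)^s q^(sx) (P_(s-1) + q^x P_s). Consecutive terms cancel and only the last survives. *)
Lemma remainder_telescope n x i : shifted_remainder n x i - shifted_remainder n x (i - x) - remainder n x i - remainder n x (i - x) =
  (if Nat.even n then - 2 else 2) * f n (i - Z.of_nat (S n) * x).
Proof.
unfold shifted_remainder, remainder. induction n as [|n IH].
- simpl alternating_sum. change (Z.of_nat 1) with 1. simpl Nat.even. rewrite Z.mul_1_l. ring.
- cbn [alternating_sum]. simpl pred.
  replace (i - x - Z.of_nat (S n) * x) with (i - Z.of_nat (S (S n)) * x) by (rewrite (Nat2Z.inj_succ (S n)); ring).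
  rewrite Nat.even_succ, <- Nat.negb_even. destruct (Nat.even n); simpl negb; cbv iota; lia.
Qed.

(** Induction on n: with x = n + 1, either side at level n + 1, multiplied by 1 - q^x, is (1 + q^x)
    times level n plus the same term at q^(x^2). Cancelling 1 - q^x is an induction on i, starting
    from zero values at negative i. *)
Lemma theta_product_remainder n i : theta_product n i = remainder n (Z.of_nat (S n)) i.
Proof.
revert i. induction n as [|n IH]; intros i; [unfold theta_product, remainder; simpl; ring|].
set (x := Z.of_nat (S n)) in *. assert (Hx : 1 <= x) by (unfold x; lia).
assert (L : forall i, theta_product (S n) i - theta_product (S n) (i - x) =
  theta_product n i + theta_product n (i - x) + (if Nat.even (S n) then 2 else -2) * (f (S n) (i - x * x) - f (S n) (i - x - x * x))).
{ clear i. intros i. unfold theta_product. cbn [alternating_sum]. fold x.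
  assert (E : alternating_sum (fun s => f (S n) (i - Z.of_nat s * Z.of_nat s)) n -
      alternating_sum (fun s => f (S n) (i - x - Z.of_nat s * Z.of_nat s)) n =
    alternating_sum (fun s => f n (i - Z.of_nat s * Z.of_nat s)) n +
      alternating_sum (fun s => f n (i - x - Z.of_nat s * Z.of_nat s)) n).
  { rewrite <- alternating_sum_minus, <- alternating_sum_plus. apply alternating_sum_ext. intros s _.
    rewrite (f_S n (i - _)). fold x. replace (i - Z.of_nat s * Z.of_nat s - x) with (i - x - Z.of_nat s * Z.of_nat s) by ring. ring. }
  assert (E2 := f_S n i). fold x in E2.
  revert E E2. repeat match goal with |- context [alternating_sum ?F ?m] => generalize (alternating_sum F m) end.
  intros. destruct (Nat.even (S n)); lia. }
assert (R : forall i, remainder (S n) (x + 1) i - remainder (S n) (x + 1) (i - x) =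
  remainder n x i + remainder n x (i - x) + (if Nat.even (S n) then 2 else -2) * (f (S n) (i - x * x) - f (S n) (i - x - x * x))).
{ clear i. intros i. rewrite !remainder_shift. assert (T := remainder_telescope n x i). fold x in T.
  unfold shifted_remainder at 1 2. cbn [alternating_sum]. fold x. simpl pred. unfold shifted_remainder in T.
  assert (E2 := f_S n (i - x * x)). fold x in E2.
  replace (i - x * x - x) with (i - x - x * x) in E2 by ring.
  rewrite Nat.even_succ, <- Nat.negb_even. revert T E2.
  repeat match goal with |- context [alternating_sum ?F ?m] => generalize (alternating_sum F m) end.
  intros. destruct (Nat.even n); simpl negb; cbv iota in *; lia. }
replace (Z.of_nat (S (S n))) with (x + 1) by (unfold x; rewrite (Nat2Z.inj_succ (S n)); ring).
assert (N : forall i, i < 0 -> theta_product (S n) i = 0 /\ remainder (S n) (x + 1) i = 0).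
{ clear i. intros i Hi. unfold theta_product, remainder. rewrite !f_neg by auto.
  split; rewrite alternating_sum_0; auto; intros s Hs; rewrite !f_neg; auto; nia. }
destruct (Z_lt_le_dec i 0) as [Hi|Hi]; [destruct (N i Hi); congruence|].
revert i Hi. apply (Zlt_0_ind (fun i => theta_product (S n) i = remainder (S n) (x + 1) i)).
intros i IHi Hi. specialize (L i). specialize (R i). rewrite !IH in L.
assert (theta_product (S n) (i - x) = remainder (S n) (x + 1) (i - x)); [|lia].
destruct (Z_lt_le_dec (i - x) 0) as [Hx'|Hx']; [destruct (N (i - x) Hx'); congruence|]. apply IHi. lia.
Qed.

(** The correction terms of the remainder carry a factor q^(s (n+1)) with s >= 1, so they cannot
    reach q^n, and P_0 has no coefficient there either. *)
Theorem theta_recurrence n : (forall i, 0 < i -> f 0 i = 0) -> (1 <= n)%nat ->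
  f n (Z.of_nat n) + 2 * alternating_sum (fun s => f n (Z.of_nat n - Z.of_nat s * Z.of_nat s)) n = 0.
Proof.
intros f_0 Hn. assert (E := theta_product_remainder n (Z.of_nat n)). unfold theta_product in E. rewrite E.
unfold remainder. rewrite f_0, alternating_sum_0; [reflexivity| |lia].
intros s Hs. rewrite !f_neg; auto; nia.
Qed.

End Theta.

(** * An integer test for the determinant *)

Definition toeplitzZ (p0 p1 p2 p3 p4 p5 : Z) : Z :=
  let a := p1 - p0 in let b := p2 - p1 in let c := p3 - p2 in let d := p4 - p3 in let e := p5 - p4 in
  c * (c * c - d * b) - d * (b * c - d * a) + e * (b * b - c * a).

(* The leading bits decide the sign: positive terms are rounded down, negative ones up. *)
Definition toeplitz_test (p0 p1 p2 p3 p4 p5 : Z) : bool :=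
  let k := Z.log2 (p3 - p2) - 64 in
  if k <=? 0 then 0 <? toeplitzZ p0 p1 p2 p3 p4 p5 else
  let a := Z.shiftr (p1 - p0) k in let b := Z.shiftr (p2 - p1) k in let c := Z.shiftr (p3 - p2) k in
  let d := Z.shiftr (p4 - p3) k in let e := Z.shiftr (p5 - p4) k in
  (0 <=? a) && (0 <=? b) && (0 <=? c) && (0 <=? d) && (0 <=? e) &&
  ((c + 1) * (2 * ((b + 1) * (d + 1)) + (a + 1) * (e + 1)) <? c * (c * c) + a * (d * d) + e * (b * b)).

(** Sorted by sign the determinant is c^3 + a d^2 + e b^2 - c (2 b d + a e). All products are cubic,
    so the comparison of truncated entries scales back by q^3 with q = 2^k. *)
Lemma toeplitz_testP p0 p1 p2 p3 p4 p5 : toeplitz_test p0 p1 p2 p3 p4 p5 = true -> 0 < toeplitzZ p0 p1 p2 p3 p4 p5.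
Proof.
unfold toeplitz_test. set (k := Z.log2 (p3 - p2) - 64).
destruct (Z.leb_spec k 0) as [Hk|Hk]; [apply Z.ltb_lt|].
unfold toeplitzZ. rewrite !Z.shiftr_div_pow2 by lia.
set (q := 2 ^ k). assert (Hq : 0 < q) by (apply Z.pow_pos_nonneg; lia).
set (a := p1 - p0). set (b := p2 - p1). set (c := p3 - p2). set (d := p4 - p3). set (e := p5 - p4).
assert (F : forall x, q * (x / q) <= x <= q * (x / q + 1)).
{ intros x. generalize (Z.div_mod x q) (Z.mod_pos_bound x q). lia. }
assert (Fa := F a). assert (Fb := F b). assert (Fc := F c). assert (Fd := F d). assert (Fe := F e).
revert Fa Fb Fc Fd Fe. generalize (a / q) (b / q) (c / q) (d / q) (e / q). intros A B C D E Fa Fb Fc Fd Fe T.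
repeat (apply andb_prop in T; destruct T as [T ?]).
rewrite !Z.leb_le in *. rewrite Z.ltb_lt in *.
assert (N : forall X x, 0 <= X -> q * X <= x -> 0 <= x) by (intros; nia).
assert (Na := N A a ltac:(auto) (proj1 Fa)). assert (Nb := N B b ltac:(auto) (proj1 Fb)).
assert (Nc := N C c ltac:(auto) (proj1 Fc)). assert (Nd := N D d ltac:(auto) (proj1 Fd)).
assert (Ne := N E e ltac:(auto) (proj1 Fe)).
assert (M : forall x y X Y, 0 <= X -> 0 <= Y -> X <= x -> Y <= y -> X * Y <= x * y) by (intros; apply Z.mul_le_mono_nonneg; auto).
assert (P : forall X, 0 <= X -> 0 <= q * X) by (intros; apply Z.mul_nonneg_nonneg; lia).
assert (L1 : q * C * (q * C * (q * C)) <= c * (c * c)) by (repeat apply M; auto using Z.mul_nonneg_nonneg; lia).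
assert (L2 : q * A * (q * D * (q * D)) <= a * (d * d)) by (repeat apply M; auto using Z.mul_nonneg_nonneg; lia).
assert (L3 : q * E * (q * B * (q * B)) <= e * (b * b)) by (repeat apply M; auto using Z.mul_nonneg_nonneg; lia).
assert (U1 : c * (b * d) <= q * (C + 1) * (q * (B + 1) * (q * (D + 1)))) by (repeat apply M; auto using Z.mul_nonneg_nonneg; lia).
assert (U2 : c * (a * e) <= q * (C + 1) * (q * (A + 1) * (q * (E + 1)))) by (repeat apply M; auto using Z.mul_nonneg_nonneg; lia).
assert (G : 0 < q * (q * q) * (C * (C * C) + A * (D * D) + E * (B * B) - (C + 1) * (2 * ((B + 1) * (D + 1)) + (A + 1) * (E + 1)))).
{ apply Z.mul_pos_pos; [nia|lia]. }
lia.
Qed.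

Close Scope Z_scope.

Open Scope nat_scope.

Require Import Defs.
From mathcomp Require Import all_boot all_order all_algebra.
From mathcomp Require Import zify.
Set Implicit Arguments.
Unset Strict Implicit.
Unset Printing Implicit Defensive.
Delimit Scope Z_scope with BZ.

(** * Counting overpartitions by largest part *)

Lemma overlines_first_cons a b s :
  overlines_first ((a, b) :: s) = overlines_first s && all (fun x => x.2 ==> (x.1 != a)) s.
Proof.
rewrite /overlines_first /= implybT /= -[1]addn0 iotaDl all_map.
have -> : all (fun x => x.2 ==> (x.1 != a)) s =
    all (fun i => (nth (0, false) s i).2 ==> ((nth (0, false) s i).1 != a)) (iota 0 (size s)).
  by rewrite -{1}[s](mkseq_nth (0, false)) all_map.
rewrite -all_predI.
apply: eq_all => i /=; rewrite inE negb_or.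
by case: (nth _ s i) => x []; rewrite //= andbC.
Qed.

Lemma is_overpartition_nil n : is_overpartition n [::] = (n == 0).
Proof. by rewrite /is_overpartition /is_partition /overlines_first /= !andbT eq_sym. Qed.

(** After a head a, an overlined a further on is not a first occurrence, whether or not the head is
    overlined. *)
Lemma is_overpartition_cons n a b s :
  is_overpartition n ((a, b) :: s) =
  [&& 0 < a, a <= n, is_overpartition (n - a) s, all (fun x => x.1 <= a) s & (a, true) \notin s].
Proof.
rewrite /is_overpartition overlines_first_cons /is_partition /=.
have -> : path geq a (parts s) = sorted geq (parts s) && all (fun x => x.1 <= a) s.
  rewrite path_sortedE; last by move=> x y z /= h1 h2; apply: leq_trans h2 h1.
  by rewrite andbC /parts all_map.
have -> : (a + sumn (parts s) == n) = (a <= n) && (sumn (parts s) == n - a).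
  by apply/eqP/andP => [<-|[h /eqP ->]]; rewrite ?leq_addr ?addKn // subnKC.
have -> : all (fun x => x.2 ==> (x.1 != a)) s = ((a, true) \notin s).
  apply/allP/idP => [h|h [x []] //= xs].
    by apply/negP => /h /=; rewrite eqxx.
  by apply: contra h => /eqP <-.
by case: (sorted _ _); case: (all _ s); case: (0 < a); case: (a <= n);
   case: (all _ (parts s)); case: (sumn _ == _); case: (overlines_first s); case: (_ \notin s).
Qed.

(** With [u] set this describes what may follow a leading part k: another k is allowed, but not
    overlined. *)
Definition bounded_overpartition k u n (s : seq (nat * bool)) :=
  [&& is_overpartition n s, all (fun x => x.1 <= k) s & u ==> ((k, true) \notin s)].

(** Puts any number of plain copies of K in front of the lists from [e]. The argument [f] is fuel;
    for K > 0 it suffices that n <= f. *)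
Fixpoint prepend_parts (K : nat) (e : nat -> seq (seq (nat * bool))) (f n : nat) :=
  e n ++ if f is f'.+1 then
           if K <= n then [seq (K, false) :: s | s <- prepend_parts K e f' (n - K)] else [::]
         else [::].

(** An enumeration that recurses on the largest part, which the finite set behind
    [overpartition_count] does not offer. The leading k is plain or overlined, and the same tails
    follow in both cases; hence the factor 2 in the counts. *)
Fixpoint overpartitions_upto (k n : nat) : seq (seq (nat * bool)) :=
  if k is k'.+1 then
    let e := overpartitions_upto k' in
    e n ++ if k <= n then let p := prepend_parts k e n (n - k) in
             [seq (k, false) :: s | s <- p] ++ [seq (k, true) :: s | s <- p]
           else [::]
  else if n == 0 then [:: [::]] else [::].

Lemma bounded_cons k u n a b s : bounded_overpartition k.+1 u n ((a, b) :: s) =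
  bounded_overpartition k false n ((a, b) :: s) ||
  [&& a == k.+1, u ==> ~~ b, k.+1 <= n & bounded_overpartition k.+1 true (n - k.+1) s].
Proof.
rewrite /bounded_overpartition is_overpartition_cons /= !andbT !inE negb_or.
have [->|ne] := eqVneq a k.+1.
  rewrite !ltnn !andbF /= leqnn /= xpair_eqE eqxx /= -/(is_true _).
  by case: (k < n); case: (is_overpartition _ s); case: (all _ s); case: (_ \notin s); case: u; case: b.
rewrite /= orbF xpair_eqE eq_sym (negbTE ne) /=.
have [ak|ka] := leqP a k; last first.
  rewrite !andbF /= ; have -> : (a <= k.+1) = false by apply/negbTE; rewrite -ltnNge ltn_neqAle eq_sym ne.
  by rewrite !andbF.
rewrite (leq_trans ak (leqnSn k)) /=.
case E: [&& 0 < a, _, _, _ & _] => //=.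
case/and5P: E => _ _ _ /allP sa _.
have h1 : all (fun x => x.1 <= k) s by apply/allP => x /sa h; apply: leq_trans h ak.
have h2 : all (fun x => x.1 <= k.+1) s by apply/allP => x /sa h; apply: leq_trans h (leqW ak).
rewrite h1 h2 /=; case: u => //=; apply/negP => /sa /=.
by rewrite leqNgt ltnS ak.
Qed.

Lemma prepend_partsP k e f n : (forall n s, (s \in e n) = bounded_overpartition k false n s) -> n <= f ->
  forall s, (s \in prepend_parts k.+1 e f n) = bounded_overpartition k.+1 true n s.
Proof.
move=> He; elim: f n => [|f IH] n nf s.
  rewrite /= cats0 He; move: nf; rewrite leqn0 => /eqP ->.
  by case: s => [|[a b] s]; rewrite ?bounded_cons /= ?andbF ?orbF // /bounded_overpartition /= !andbT.
rewrite /= mem_cat He; case: s => [|[a b] s].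
  rewrite /bounded_overpartition /= !andbT; case: ifP => _; rewrite ?orbF //.
  by case: mapP => [[? _]|] //; rewrite orbF.
rewrite bounded_cons; congr (_ || _); case: ifP => kn; last by rewrite /= !andbF.
apply/mapP/and3P => [[s' h [-> -> ->]]|[/eqP -> hb h]].
  by rewrite eqxx -IH //; rewrite leq_subLR (leq_trans nf) // addSn ltnS leq_addl.
exists s; last by rewrite (negbTE hb).
by rewrite IH // leq_subLR (leq_trans nf) // addSn ltnS leq_addl.
Qed.

Lemma overpartitions_uptoP k n s : (s \in overpartitions_upto k n) = bounded_overpartition k false n s.
Proof.
elim: k n s => [|k IH] n s.
  case: s => [|[a b] s]; rewrite /bounded_overpartition.
    by rewrite is_overpartition_nil /=; case: eqP.
  rewrite is_overpartition_cons /= leqn0; case: a => [|a] /=; last by rewrite andbF; case: eqP.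
  by case: eqP.
have P := prepend_partsP IH (leq_subr k.+1 n).
rewrite /= mem_cat IH; case: s => [|[a b] s].
  rewrite /bounded_overpartition /= !andbT; case: ifP => _; rewrite ?orbF // mem_cat.
  by case: mapP => [[? _]|_] //; case: mapP => [[? _]|_] //; rewrite !orbF.
rewrite bounded_cons; congr (_ || _); case: ifP => kn; last by rewrite /= !andbF.
rewrite mem_cat /= -P; apply/orP/andP => [[]/mapP [s' h [-> _ ->]]|[/eqP -> h]]; rewrite ?eqxx //.
by case: b; [right|left]; apply/mapP; exists s.
Qed.

Lemma not_mem_bounded k n b s s' : s' = (k.+1, b) :: s -> s' \in overpartitions_upto k n = false.
Proof. by move=> ->; rewrite overpartitions_uptoP /bounded_overpartition /= ltnn /= andbF. Qed.

Lemma uniq_prepend_parts k f n : (forall n, uniq (overpartitions_upto k n)) ->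
  uniq (prepend_parts k.+1 (overpartitions_upto k) f n).
Proof.
move=> U; elim: f n => [|f IH] n /=; first by rewrite cats0.
rewrite cat_uniq U /=; case: ifP => // kn; rewrite map_inj_uniq ?IH ?andbT; last by move=> ? ? [].
by apply/hasPn => s' /mapP [s _ /not_mem_bounded ->].
Qed.

Lemma uniq_overpartitions_upto k n : uniq (overpartitions_upto k n).
Proof.
elim: k n => [|k IH] n /=; first by case: eqP.
rewrite cat_uniq IH /=; case: ifP => // kn.
rewrite cat_uniq !map_inj_uniq ?uniq_prepend_parts //; try by move=> ? ? [].
rewrite !andbT /=; apply/andP; split; apply/hasPn => s'.
  by rewrite mem_cat => /orP[] /mapP [s _ /not_mem_bounded ->].
by case/mapP => s _ ->; apply/mapP => -[].
Qed.

Definition count_upto k n := size (overpartitions_upto k n).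

(** Parts of an overpartition of n never exceed n, and two duplicate-free lists with the same
    members have equal length. *)
Lemma count_upto_pbar k n : n <= k -> count_upto k n = overpartition_count n.
Proof.
move=> nk; have [e [ue me <-]] := overpartition_countP n.
apply/perm_size/uniq_perm => //; first exact: uniq_overpartitions_upto.
move=> s; rewrite overpartitions_uptoP me /bounded_overpartition andbT.
case E: (is_overpartition n s) => //=.
case/andP: E => /is_partition_bound /andP[_]; rewrite /parts all_map => /allP h _.
by apply/allP => x /h /= hx; apply: leq_trans hx nk.
Qed.

Lemma size_prepend_parts K e f g n : 0 < K -> n <= f -> n <= g ->
  size (prepend_parts K e f n) = size (prepend_parts K e g n).
Proof.
move=> K0; elim: f g n => [|f IH] [|g] n //; rewrite ?leqn0.
- by move=> /eqP -> _ /=; rewrite leqNgt K0.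
- by move=> _ /eqP -> /=; rewrite leqNgt K0.
move=> nf ng /=; rewrite !size_cat; case: ifP => // Kn; rewrite !size_map; congr (_ + _).
by apply: IH; rewrite leq_subLR; [apply: leq_trans nf _|apply: leq_trans ng _]; rewrite -add1n leq_add2r.
Qed.

Lemma count_upto0 n : count_upto 0 n = (n == 0).
Proof. by rewrite /count_upto /=; case: eqP. Qed.

(** With K = k + 1, p has generating function P_k / (1 - q^K). The enumeration gives P_K = P_k + 2
    q^K p, and [D] is the companion relation 2 p = P_k + P_K; eliminating p leaves the
    recurrence. *)
Lemma count_uptoS k n : count_upto k.+1 n =
  count_upto k n + if n < k.+1 then 0 else count_upto k (n - k.+1) + count_upto k.+1 (n - k.+1).
Proof.
pose p f m := size (prepend_parts k.+1 (overpartitions_upto k) f m).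
have E m : count_upto k.+1 m = count_upto k m + if k.+1 <= m then (p m (m - k.+1)).*2 else 0.
  rewrite {1}/count_upto /= size_cat; case: ifP => // _.
  by rewrite size_cat !size_map -addnn.
have D m : (p m m).*2 = count_upto k m + count_upto k.+1 m.
  rewrite E addnA addnn; case: m => [|m]; first by rewrite /p /= cats0 addn0.
  rewrite {1}/p /= size_cat doubleD; congr (_ + _); case: ifP => // km.
  rewrite size_map; congr double; apply: size_prepend_parts => //; first by rewrite subSS leq_subr.
  exact: leq_subr.
rewrite {1}E; have [kn|nk] := ltnP k n; last by rewrite ltnS nk.
rewrite ltnNge kn; congr (_ + _); rewrite -D; congr double.
by apply: size_prepend_parts => //; apply: leq_subr.
Qed.

(** * The finite range *)

(** Zero at negative arguments, so that the recurrence in k holds at every integer without case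
    distinction. *)
Definition count_ext k i := if (i <? 0)%BZ then 0%BZ else Z.of_nat (count_upto k (Z.to_nat i)).

Lemma count_ext_nat k n : count_ext k (Z.of_nat n) = Z.of_nat (count_upto k n).
Proof. by rewrite /count_ext Nat2Z.id; case: Z.ltb_spec; lia. Qed.

Lemma count_extS k i : (count_ext k.+1 i =
  count_ext k i + count_ext k (i - Z.of_nat k.+1) + count_ext k.+1 (i - Z.of_nat k.+1))%BZ.
Proof.
have [i0|i0] := Z_lt_le_dec i 0.
  by rewrite /count_ext; do ! case: Z.ltb_spec => *; lia.
rewrite -(Z2Nat.id i i0) !count_ext_nat count_uptoS; case: ltnP => ki.
  by rewrite /count_ext; do ! case: Z.ltb_spec => *; lia.
have -> : (Z.of_nat (Z.to_nat i) - Z.of_nat k.+1)%BZ = Z.of_nat (Z.to_nat i - k.+1) by lia.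
by rewrite !count_ext_nat; lia.
Qed.

Definition square_term (p : nat -> Z) n s := if s * s <= n then p (n - s * s) else 0%BZ.

(** All arguments n - s^2 are at most n, so counts with parts at most n agree with the overpartition
    numbers in every term. *)
Lemma pbar_theta n : 0 < n -> let p m := Z.of_nat (overpartition_count m) in
  p n = (- (2 * alternating_sum (square_term p n) n))%BZ.
Proof.
move=> n0 p.
have N k i : (i < 0)%BZ -> count_ext k i = 0%BZ by rewrite /count_ext; case: Z.ltb_spec; lia.
have Z0 i : (0 < i)%BZ -> count_ext 0 i = 0%BZ.
  by move=> i0; rewrite /count_ext count_upto0; case: Z.ltb_spec => // _; case: eqP => //; lia.
have := theta_recurrence _ N count_extS n Z0 (elimT leP n0).
rewrite count_ext_nat count_upto_pbar // (@alternating_sum_ext _ (square_term p n)); first by rewrite /p; lia.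
move=> s _; rewrite /square_term; case: leqP => ns; last by rewrite N //; lia.
have -> : (Z.of_nat n - Z.of_nat s * Z.of_nat s)%BZ = Z.of_nat (n - s * s) by lia.
by rewrite count_ext_nat count_upto_pbar // leq_subr.
Qed.

(** Nested subtraction produces the alternating signs without parity tests, in the shape that the
    table computes. *)
Fixpoint square_sum (q : nat -> Z) k s := if k is k'.+1 then (q s - square_sum q k' s.+1)%BZ else 0%BZ.

Lemma alternating_square_sum q k s : alternating_sum q (s + k) =
  (alternating_sum q s + if Nat.even s.+1 then square_sum q k s.+1 else - square_sum q k s.+1)%BZ.
Proof.
elim: k s => [|k IH] s; first by rewrite addn0 /square_sum; case: (Nat.even _); lia.
rewrite addnS -addSn IH; cbn [alternating_sum square_sum]; rewrite (Nat.even_succ s.+1) -Nat.negb_even.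
by case: (Nat.even s.+1) => /=; lia.
Qed.

(* Along the list [p (n-1), ..., p 0] the entries [p (n - s^2)] sit at the positions [s^2 - 1]. *)
Fixpoint skip_sum (fuel : nat) (l : seq Z) (gap : nat) : Z :=
  if fuel is k.+1 then if l is x :: _ then (x - skip_sum k (drop gap l) gap.+2)%BZ else 0%BZ else 0%BZ.

(** Newest value first, so that the recurrence only walks forward through the history. The initial
    gap 3 is 2^2 - 1^2. *)
Fixpoint pbar_history (n : nat) : seq Z :=
  if n is n'.+1 then let h := pbar_history n' in (2 * skip_sum n h 3)%BZ :: h else [:: 1%BZ].

(** s (s + 2) = (s + 1)^2 - 1 is the position belonging to the square (s + 1)^2, and 2s + 3 is the
    distance to the next square. Once the list is exhausted both sides are 0. *)
Lemma skip_sumE p n k s : skip_sum k (drop (s * s.+2) (rev [seq p i | i <- iota 0 n])) (s + s).+3 =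
  square_sum (square_term p n) k s.+1.
Proof.
elim: k s => //= k IH s; set l := rev _.
have sl : size l = n by rewrite size_rev size_map size_iota.
have sq : s.+1 * s.+1 = (s * s.+2).+1 by lia.
have [ns|ns] := leqP n (s * s.+2).
  rewrite drop_oversize ?sl // /square_term sq leqNgt ltnS ns /=.
  suff Q m t : n <= t * t -> square_sum (square_term p n) m t.+1 = 0%BZ by rewrite Q //; lia.
  elim: m t => //= m IHm t h; rewrite IHm; last by lia.
  by rewrite /square_term leqNgt (_ : n < _) //; lia.
rewrite (drop_nth 0%BZ) ?sl //; congr (_ - _)%BZ.
  rewrite /square_term sq ns /l nth_rev ?size_map ?size_iota // (nth_map 0) ?size_iota; last by lia.
  by rewrite nth_iota //; lia.
have -> : (s + s).+3.+2 = (s.+1 + s.+1).+3 by lia.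
rewrite -IH; congr skip_sum.
by rewrite -(drop_nth 0%BZ) ?sl // drop_drop; congr drop; lia.
Qed.

Lemma pbar_historyE n : pbar_history n = rev [seq Z.of_nat (overpartition_count i) | i <- iota 0 n.+1].
Proof.
elim: n => [|n IH].
  by rewrite /= -(@count_upto_pbar 0) // count_upto0.
rewrite -[n.+2]addn1 iotaD map_cat rev_cat -IH.
congr (_ :: _); rewrite [RHS]pbar_theta //.
have := skip_sumE (fun i => Z.of_nat (overpartition_count i)) n.+1 n.+1 0; rewrite mul0n drop0 addn0 -IH => ->.
have := alternating_square_sum (square_term (fun i => Z.of_nat (overpartition_count i)) n.+1) n.+1 0; rewrite add0n => ->.
by rewrite [Nat.even 1]/= [alternating_sum _ 0]/=; lia.
Qed.

Fixpoint all_toeplitz_pos (l : seq Z) : bool :=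
  if l is p0 :: l' then
    if l' is [:: p1, p2, p3, p4, p5 & _] then toeplitz_test p0 p1 p2 p3 p4 p5 && all_toeplitz_pos l'
    else true
  else true.

(** The last case n = 1499 uses six values up to n + 5 = 1504. The evaluation is left to the virtual
    machine when the proof is checked. *)
Lemma table_check : all_toeplitz_pos (drop 62 (rev (pbar_history 1504))).
Proof. by vm_cast_no_check (erefl true). Qed.

Lemma all_toeplitz_posP (f : nat -> Z) n m : all_toeplitz_pos [seq f i | i <- iota n (m + 6)] ->
  (0 < toeplitzZ (f n) (f n.+1) (f n.+2) (f n.+3) (f n.+4) (f n.+4.+1))%BZ.
Proof. by rewrite addnC /= => /andP[/toeplitz_testP]. Qed.


(** * Joining the two ranges *)

Lemma det_toeplitz (n : nat) :
  (0 < toeplitzZ (Z.of_nat (overpartition_count n)) (Z.of_nat (overpartition_count n.+1))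
    (Z.of_nat (overpartition_count n.+2)) (Z.of_nat (overpartition_count n.+3))
    (Z.of_nat (overpartition_count n.+4)) (Z.of_nat (overpartition_count n.+4.+1)))%BZ ->
  (0 < \det (\matrix_(i < 3, j < 3) fwd_diff pbar (n + 2 + j - i)%N))%R.
Proof.
move=> H.
rewrite (expand_det_row _ ord0) !big_ord_recl big_ord0 /cofactor.
rewrite !(expand_det_row _ (@ord0 1)) !big_ord_recl !big_ord0 /cofactor !det_mx11 !mxE /= /bump /=.
(* The natural subtraction in the index never truncates because i <= 2. *)
rewrite ?addn0 ?subn0 ?addn1 ?addn2 ?addnS ?subSS ?subn0 ?addn0.
rewrite /fwd_diff /pbar; move: H; rewrite /toeplitzZ; lia.
Qed.

Lemma all_toeplitz_pos_drop m l : all_toeplitz_pos l -> all_toeplitz_pos (drop m l).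
Proof.
elim: m l => [|m IH] l; first by rewrite drop0.
case: l => [|p0 l] //= H; apply: IH.
by case: l H => [|p1 [|p2 [|p3 [|p4 [|p5 l]]]]] // /andP[].
Qed.

Lemma toeplitzZ_table N m n : all_toeplitz_pos (drop m (rev (pbar_history N))) -> m <= n -> n + 5 <= N ->
  let p m := Z.of_nat (overpartition_count m) in
  (0 < toeplitzZ (p n) (p n.+1) (p n.+2) (p n.+3) (p n.+4) (p n.+4.+1))%BZ.
Proof.
move=> H mn nN p; move: (all_toeplitz_pos_drop (n - m) H).
rewrite drop_drop subnK // pbar_historyE revK -map_drop drop_iota add0n.
have -> : N.+1 - n = (N - 5 - n) + 6 by lia.
exact: all_toeplitz_posP.
Qed.

Lemma toeplitzZ_large n : 1500 <= n -> let p m := Z.of_nat (overpartition_count m) in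
  (0 < toeplitzZ (p n) (p n.+1) (p n.+2) (p n.+3) (p n.+4) (p n.+4.+1))%BZ.
Proof.
move=> hn p.
(* K is requested to be at least n + 5, so that counts with parts at most K are the overpartition
   numbers at all six arguments. *)
have [||k m|K [/leP HK]] := @toeplitz3_differences_pos (fun k m => INR (count_upto k m)) _ _ _ n (n + 5) (elimT leP hn).
- by move=> *; apply: pos_INR.
- by move=> m; rewrite count_upto0; case: m.
- rewrite count_uptoS plus_INR; congr Rplus.
  by case: Nat.ltb_spec => [/ltP ->|/leP km] //; rewrite ltnS leqNgt km /= plus_INR.
cbv beta zeta; rewrite plusE !count_upto_pbar; try lia.
move=> H; apply: lt_IZR.
suff -> : IZR (toeplitzZ (p n) (p n.+1) (p n.+2) (p n.+3) (p n.+4) (p n.+4.+1)) = toeplitz3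
  (INR (overpartition_count n.+1) - INR (overpartition_count n))
  (INR (overpartition_count n.+2) - INR (overpartition_count n.+1))
  (INR (overpartition_count n.+3) - INR (overpartition_count n.+2))
  (INR (overpartition_count n.+4) - INR (overpartition_count n.+3))
  (INR (overpartition_count n.+4.+1) - INR (overpartition_count n.+4)).
  by move: H; rewrite !addnS !addn0.
rewrite /toeplitzZ /toeplitz3 /p.
by rewrite !(mult_IZR, plus_IZR, minus_IZR) -!INR_IZR_INZ.
Qed.

Theorem theorem4p2 (n : nat) (hn : (62 <= n)%N) :
  (0 < \det (\matrix_(i < 3, j < 3) fwd_diff pbar (n + 2 + j - i)%N))%R.
Proof.
apply: det_toeplitz; have [hs|hl] := ltnP n 1500.
  by apply: toeplitzZ_table table_check hn _; rewrite -[1504]/(1499 + 5) leq_add2r.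
exact: toeplitzZ_large.
Qed.
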